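(* Let $(\nu^N)_{N\ge1}$ be a sequence of probability measures on $\mathcal Q$ and let $\psi_0\in X_R$ be such that for every $\delta>0$ and every $f\in C_0(\mathbb R_+^\circ)$, $$\lim_{N\to\infty}\nu^N\Big[\Big|\int_0^\infty f(u)\tilde\psi^N_q(u)\,du-\int_0^\infty f(u)\psi_0(u)\,du\Big|>\delta\Big]=0 .$$ Then the problem $$\partial_t\psi=\partial_u^2\psi+\beta\,\partial_u\psi\,(1+\partial_u\psi),\qquad \psi(0,\cdot)=\psi_0,\qquad \psi(t,\cdot)\in X_R\ (t\ge0),$$ with $\beta=\pi/\sqrt{12}$, has a unique classical solution $\psi(t,u)$, and for every $t>0$, $\delta>0$ and $f\in C_0(\mathbb R_+^\circ)$, $$\lim_{N\to\infty}\mathbb Q^N_{\nu^N}\Big[\Big|\int_0^\infty f(u)\tilde\psi^N_{q_t}(u)\,du-\int_0^\infty f(u)\psi(t,u)\,du\Big|>\delta\Big]=0 .$$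
   Context: Notation: $\mathbb N=\{1,2,\dots\}$, $\mathbb Z_+=\{0,1,2,\dots\}$, $\mathbb R_+=[0,\infty)$, $\mathbb R_+^\circ=(0,\infty)$; $C_0(\mathbb R_+^\circ)$ is the set of continuous functions with compact support in $(0,\infty)$. $\mathcal Q$ is the set of sequences $q=(q_i)_{i\in\mathbb N}$ with $q_i\in\mathbb Z_+$, $q_1\ge q_2\ge\cdots$, $n(q):=\sum_iq_i<\infty$, and $q_i>q_{i+1}$ whenever $q_i>0$ (partitions into distinct parts). The height function is $\psi_q(u)=\sum_{i\in\mathbb N}1_{\{u<q_i\}}$, $u\ge0$, and $\tilde\psi^N_q(u)=\frac1N\psi_q(Nu)$. For $0<\varepsilon<1$, $\mu^\varepsilon_R(q)=\varepsilon^{n(q)}/Z_R(\varepsilon)$ with $Z_R(\varepsilon)=\prod_{k\ge1}(1+\varepsilon^k)$. For $N\ge1$, $\varepsilon(N)\in(0,1)$ is the unique number with $E_{\mu_R^{\varepsilon(N)}}[n(q)]=N^2$. For $f:\mathcal Q\to\mathbb R$, $L_{\varepsilon,R}f(q)=\sum_{i\in\mathbb N}\big[\varepsilon1_{\{q_{i-1}>q_i+1\}}(f(q^{i,+})-f(q))+1_{\{q_i>q_{i+1}+1\text{ or }q_i=1\}}(f(q^{i,-})-f(q))\big]$, where $q_0:=\infty$ and $q^{i,\pm}$ is obtained from $q$ by replacing $q_i$ with $q_i\pm1$. For a probability measure $\nu$ on $\mathcal Q$, $\mathbb Q^N_\nu$ is the law on $D(\mathbb R_+,\mathcal Q)$ of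 the Markov process $q_t=q^N_t$ with generator $N^2L_{\varepsilon(N),R}$ and initial law $\nu$. $X_R$ is the set of $C^1$ functions $\psi:[0,\infty)\to[0,\infty)$ with $-1\le\psi'\le0$, $\psi'(0)=-1/2$, $\lim_{u\uparrow\infty}\psi(u)=0$. *)

(* Defs.v *)
From Stdlib Require Import Reals.
From Coquelicot Require Import Coquelicot.
From mathcomp Require Import ssreflect ssrfun ssrbool eqtype ssrnat seq path choice.

Local Open Scope R_scope.

(* A sequence q = (q_i)_{i>=1} of Q is represented by the finite list of its
   nonzero entries [q_1; q_2; ...; q_k] (all later q_i are 0).  Such lists are
   exactly the strictly decreasing lists of positive naturals. *)
Definition isQ (q : seq nat) : bool :=
  sorted (fun a b => (b < a)%N) q && all (fun k => (0 < k)%N) q.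

Definition nq (q : seq nat) : nat := sumn q.

Definition sumR (l : seq R) : R := foldr Rplus 0 l.

(* height function psi_q(u) = sum_i 1_{u < q_i}  (u >= 0; zero entries contribute 0) *)
Definition psi_q (q : seq nat) (u : R) : R :=
  sumR [seq (if Rlt_dec u (INR k) then 1 else 0) | k <- q].

Definition psiN (N : nat) (q : seq nat) (u : R) : R := / INR N * psi_q q (INR N * u).

(* seq nat is a countType; pickle_inv enumerates every list exactly once. *)
Definition enumQ (g : seq nat -> R) (k : nat) : R :=
  match @pickle_inv (seq nat) k with Some x => g x | None => 0 end.
Definition sumQ (g : seq nat -> R) : R := Series (enumQ g).

Definition isProbQ (nu : seq nat -> R) : Prop :=
  (forall q, 0 <= nu q) /\ (forall q, ~~ isQ q -> nu q = 0) /\ is_series (enumQ nu) 1.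

Fixpoint prodZ (eps : R) (m : nat) : R :=
  match m with O => 1 | S m' => prodZ eps m' * (1 + eps ^ (S m')) end.
Definition ZR (eps : R) : R := real (Lim_seq (prodZ eps)).
Definition muR (eps : R) (q : seq nat) : R :=
  if isQ q then eps ^ (nq q) / ZR eps else 0.
Definition ExpN (eps : R) : R := sumQ (fun q => INR (nq q) * muR eps q).

(* 0-based index j corresponds to i = j+1; q_0 = infinity. *)
Definition up_cond (q : seq nat) (j : nat) : bool :=
  match j with O => true | S j' => (nth 0%N q j' > nth 0%N q j + 1)%N end.
Definition down_cond (q : seq nat) (j : nat) : bool :=
  (nth 0%N q j > nth 0%N q j.+1 + 1)%N || (nth 0%N q j == 1%N).
Definition qmod (q : seq nat) (j v : nat) : seq nat :=
  filter (fun k => (0 < k)%N) (set_nth 0%N q j v).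
(* List of (rate, target) of L_{eps,R} at q.  For i > size q + 1 both indicators
   in L vanish (q_{i-1} = q_i = 0), so only j <= size q contributes. *)
Definition moves (eps : R) (q : seq nat) : seq (R * seq nat) :=
  flatten [seq (if up_cond q j then [:: (eps, qmod q j (nth 0%N q j).+1)] else [::])
               ++ (if down_cond q j then [:: (1, qmod q j (nth 0%N q j).-1)] else [::])
          | j <- iota 0 (size q).+1].
Definition ratesN (N : nat) (eps : R) (q : seq nat) : seq (R * seq nat) :=
  [seq (INR N ^ 2 * p.1, p.2) | p <- moves eps q].

Definition lam (rs : seq (R * seq nat)) : R := sumR (map fst rs).

(* pjump rt n x y t = P_x[ q_t = y and exactly n jumps in [0,t] ] *)
Fixpoint pjump (rt : seq nat -> seq (R * seq nat)) (n : nat) (x y : seq nat) (t : R)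
  {struct n} : R :=
  match n with
  | O => if x == y then exp (- lam (rt x) * t) else 0
  | S n' => RInt (fun s => exp (- lam (rt x) * s) *
                     sumR [seq p.1 * pjump rt n' p.2 y (t - s) | p <- rt x]) 0 t
  end.
Definition trans (rt : seq nat -> seq (R * seq nat)) (t : R) (x y : seq nat) : R :=
  Series (fun n => pjump rt n x y t).

Definition probT (rt : seq nat -> seq (R * seq nat)) (nu : seq nat -> R) (t : R)
  (g : seq nat -> R) : R :=
  sumQ (fun x => nu x * sumQ (fun y => trans rt t x y * g y)).
Definition probQ (nu : seq nat -> R) (g : seq nat -> R) : R := sumQ (fun x => nu x * g x).

Definition ind_gt (delta a : R) : R := if Rlt_dec delta (Rabs a) then 1 else 0.

Definition Int0inf (h : R -> R) : R := RInt_gen h (at_point 0) (Rbar_locally p_infty).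

(* f in C_0(R_+^o) (extended by 0 outside (0,oo)) *)
Definition C0pos (f : R -> R) : Prop :=
  (forall u, continuous f u) /\
  exists a b, 0 < a /\ a <= b /\ forall u, f u <> 0 -> a <= u <= b.

Definition in_XR (p : R -> R) : Prop :=
  exists d : R -> R,
    (forall u, 0 <= u -> 0 <= p u) /\
    (forall u, 0 < u -> is_derive p u (d u)) /\
    filterlim (fun h => (p h - p 0) / h) (at_right 0) (locally (d 0)) /\
    (forall u, 0 < u -> continuous d u) /\
    filterlim d (at_right 0) (locally (d 0)) /\
    (forall u, 0 <= u -> -1 <= d u <= 0) /\
    d 0 = - (1 / 2) /\
    is_lim p p_infty 0.

Definition dt (psi : R -> R -> R) (t u : R) : R := Derive (fun s => psi s u) t.
Definition du (psi : R -> R -> R) (t u : R) : R := Derive (fun v => psi t v) u.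
Definition duu (psi : R -> R -> R) (t u : R) : R := Derive (fun v => du psi t v) u.

Definition classical_sol (psi0 : R -> R) (beta : R) (psi : R -> R -> R) : Prop :=
  (forall u, 0 <= u -> psi 0 u = psi0 u) /\
  (forall t, 0 <= t -> in_XR (psi t)) /\
  (forall t u, 0 <= t -> 0 <= u ->
     filterlim (fun p : R * R => psi (fst p) (snd p))
       (within (fun p : R * R => 0 <= fst p /\ 0 <= snd p) (locally (t, u)))
       (locally (psi t u))) /\
  (forall t u, 0 < t -> 0 < u ->
     ex_derive (fun s => psi s u) t /\
     ex_derive (fun v => psi t v) u /\
     ex_derive (fun v => du psi t v) u /\
     continuous (fun p : R * R => dt psi (fst p) (snd p)) (t, u) /\
     continuous (fun p : R * R => du psi (fst p) (snd p)) (t, u) /\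
     continuous (fun p : R * R => duu psi (fst p) (snd p)) (t, u) /\
     dt psi t u = duu psi t u + beta * du psi t u * (1 + du psi t u)).

(* Main.v *)
Require Import Defs.
From Stdlib Require Import Reals Lra Lia ClassicalEpsilon.
From Coquelicot Require Import Coquelicot.
From mathcomp Require Import ssreflect ssrfun ssrbool eqtype ssrnat seq path choice.
From mathcomp Require Import zify.

(* Hopf-Cole transform.  With b = - ln eps and h the height function, the quantities
   V_j = exp (b (h j + j / 2)) satisfy an exact, closed, linear equation under the generator:
     L V_j = N^2 (sqrt eps (V_(j-1) + V_(j+1)) - (1 + eps) V_j),   V_(-1) = V_1.
   As N b tends to beta, its continuum counterpart is that theta = exp (beta (psi + u / 2)) solves
   theta_t = theta_uu - beta^2 theta / 4 with a Neumann condition at 0, which is solved by Gaussian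
   averages of the even extension of theta_0; uniqueness for psi is a maximum principle with an
   exponential barrier.  The normalised partial sums U_k of V are compared with the primitive of
   theta in an exponentially weighted l^2 norm E: the jump noise in U_k is only O(1/N), so
   exp (C (T - s)) (E + kappa (T - s) (1 + H)), with H a mean of V_j^2, is a supermartingale of the
   process for some kappa -> 0.  That N b tends to pi / sqrt 12 follows from
   E[n] = sum_m (-1)^(m-1) eps^m / (1 - eps^m)^2 and sum_m (-1)^(m-1) / m^2 = pi^2 / 12. *)

Local Open Scope R_scope.

(** The noise decides the choice of unknown: at speed N^2 a single V_j keeps quadratic variation of
    order one per unit time, so an l^2 estimate on V itself would not close, whereas a jump changes
    one summand of U_k only. The initial profile is merely C^1, so the second space derivative of
    exp (beta (psi + u / 2)) may be singular at time 0. Its primitive has two space derivatives that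
    are continuous up to time 0, and consistency is proved for that primitive with a modulus of
    continuity. The initial laws carry no moment bound. The supermartingale is therefore started
    from one state at a time; states at which one of finitely many test integrals is off are removed
    by a union bound. On the remaining ones the height is uniformly close to psi_0 on a compact
    interval, because heights are Lipschitz up to 1/N, and this bounds both E and H. [trans] is a
    series over the number of jumps, so the supermartingale inequality is proved by induction on
    that number, without path space or non-explosion. *)

(** * Sums over finite partitions *)

Definition lsum {T : Type} (g : T -> R) (l : seq T) : R := sumR [seq g x | x <- l].

Lemma lsum_cons {T : Type} (g : T -> R) a l : lsum g (a :: l) = g a + lsum g l.
Proof. by []. Qed.

Lemma lsum_cat {T : Type} (g : T -> R) l1 l2 : lsum g (l1 ++ l2) = lsum g l1 + lsum g l2.
Proof. elim: l1 => [|a l IH] /=; rewrite ?lsum_cons ?IH /lsum /=; lra. Qed.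

Lemma lsum_map {S T : Type} (f : S -> T) (g : T -> R) l :
  lsum g (map f l) = lsum (fun x => g (f x)) l.
Proof. by rewrite /lsum -map_comp. Qed.

Lemma lsum_flatten {T : Type} (g : T -> R) ll : lsum g (flatten ll) = lsum (lsum g) ll.
Proof. elim: ll => [|a l IH] //=. by rewrite lsum_cat IH lsum_cons. Qed.

Lemma lsum_ext_in {T : eqType} (f g : T -> R) (l : seq T) :
  (forall x, x \in l -> f x = g x) -> lsum f l = lsum g l.
Proof.
elim: l => [|a l IH] H //; rewrite !lsum_cons H ?mem_head // IH // => x Hx.
by apply: H; rewrite inE Hx orbT.
Qed.

Lemma lsum_ext {T : Type} (f g : T -> R) l : (forall x, f x = g x) -> lsum f l = lsum g l.
Proof. by move=> H; elim: l => [|a l IH] //; rewrite !lsum_cons H IH. Qed.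

Lemma lsum_le {T : Type} (f g : T -> R) l : (forall x, f x <= g x) -> lsum f l <= lsum g l.
Proof.
by move=> H; elim: l => [|a l IH]; [exact: Rle_refl|rewrite !lsum_cons; apply: Rplus_le_compat].
Qed.

Lemma lsum_plus {T : Type} (f g : T -> R) l :
  lsum (fun x => f x + g x) l = lsum f l + lsum g l.
Proof. elim: l => [|a l IH]; rewrite ?lsum_cons ?IH /lsum /=; lra. Qed.

Lemma lsum_scal {T : Type} c (f : T -> R) l : lsum (fun x => c * f x) l = c * lsum f l.
Proof. elim: l => [|a l IH]; rewrite ?lsum_cons ?IH /lsum /=; lra. Qed.

Lemma lsum_ge0 {T : Type} (f : T -> R) l : (forall x, 0 <= f x) -> 0 <= lsum f l.
Proof. move=> H; elim: l => [|a l IH]; rewrite ?lsum_cons /lsum /=; [lra|]. move: (H a); rewrite /lsum in IH; lra. Qed.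

Lemma lsum0 {T : eqType} (f : T -> R) (l : seq T) :
  (forall x, x \in l -> f x = 0) -> lsum f l = 0.
Proof.
move=> H; rewrite (lsum_ext_in _ (fun=> 0)) //.
elim: l {H} => [|a l IH]; rewrite ?lsum_cons ?IH /lsum /=; lra.
Qed.

Lemma lsum_exchange {S T : Type} (f : S -> T -> R) l1 l2 :
  lsum (fun x => lsum (f x) l2) l1 = lsum (fun y => lsum (fun x => f x y) l1) l2.
Proof.
elim: l1 => [|a l IH].
  by elim: l2 => [|b l2 IH2] //; rewrite lsum_cons -IH2 /lsum /=; lra.
rewrite lsum_cons IH -lsum_plus; apply: lsum_ext => y; by rewrite lsum_cons.
Qed.

Lemma lsum_rem {T : eqType} (g : T -> R) a (l : seq T) :
  a \in l -> lsum g l = g a + lsum g (rem a l).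
Proof.
elim: l => // b l IH; rewrite inE /=; case: eqVneq => [->|Hab] //= Hal.
rewrite !lsum_cons IH //; lra.
Qed.

Lemma lsum_sub {T : eqType} (g : T -> R) (l l' : seq T) :
  (forall x, 0 <= g x) -> uniq l -> {subset l <= l'} -> lsum g l <= lsum g l'.
Proof.
move=> Hg; elim: l l' => [|a l IH] l' /=; first by move=> _ _; apply: lsum_ge0.
case/andP=> Hal Hu Hs; rewrite lsum_cons (lsum_rem g a l'); last by apply: Hs; rewrite mem_head.
apply: Rplus_le_compat_l; apply: IH => // x Hx.
have Hxl' : x \in l' by apply: Hs; rewrite inE Hx orbT.
have Hxa : x != a by apply: contraNneq Hal => <-.
have := perm_to_rem (Hs a (mem_head _ _)) => /perm_mem /(_ x).
by rewrite Hxl' inE (negbTE Hxa).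
Qed.

(** Series over Q run along pickle codes, an order without meaning for partitions. Their partial
    sums are sums over these duplicate-free lists, so a bound uniform over all finite duplicate-free
    lists controls the series. *)
Definition enum_upto (n : nat) : seq (seq nat) :=
  pmap (@pickle_inv (seq nat)) (iota 0%N n.+1).

Lemma sum_n_enumQ g n : sum_n (enumQ g) n = lsum g (enum_upto n).
Proof.
have E k : lsum g (pmap (@pickle_inv (seq nat)) [:: k]) = enumQ g k.
  rewrite /enumQ /pmap; case: (pickle_inv k) => [x|] //=.
  by rewrite /lsum /=; lra.
elim: n => [|n IH]; first by rewrite sum_O -E.
rewrite sum_Sn IH /enum_upto.
have -> : iota 0%N n.+2 = iota 0%N n.+1 ++ [:: n.+1] by rewrite -[n.+2]addn1 iotaD.
by rewrite pmap_cat lsum_cat E.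
Qed.

Lemma mem_enum_upto (x : seq nat) n : (pickle x <= n)%N -> x \in enum_upto n.
Proof.
move=> H; rewrite /enum_upto mem_pmap; apply/mapP; exists (pickle x).
  by rewrite mem_iota add0n ltnS.
by rewrite pickleK_inv.
Qed.

Lemma uniq_enum_upto n : uniq (enum_upto n).
Proof. by apply: (@pmap_uniq _ _ _ (@pickle (seq nat))); [exact: pickle_invK|exact: iota_uniq]. Qed.

Lemma finite_in_enum (l : seq (seq nat)) : exists n, {subset l <= enum_upto n}.
Proof.
elim: l => [|a l [n IH]]; first by exists 0%N.
exists (maxn (pickle a) n) => x; rewrite inE => /orP [/eqP ->|Hx].
  by apply: mem_enum_upto; rewrite leq_maxl.
move: (IH x Hx); rewrite !mem_pmap => /mapP [m Hm E]; apply/mapP; exists m => //.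
by move: Hm; rewrite !mem_iota !add0n /= !ltnS => /leq_trans; apply; rewrite leq_maxr.
Qed.

Lemma enumQ_ge0 g : (forall x, 0 <= g x) -> forall n, 0 <= enumQ g n.
Proof. by move=> H n; rewrite /enumQ; case: (pickle_inv n) => //; lra. Qed.

Lemma is_series_nonneg_bounded (a : nat -> R) B :
  (forall n, 0 <= a n) -> (forall n, sum_n a n <= B) -> ex_series a /\ Series a <= B.
Proof.
move=> Ha HB.
have [l Hl] : ex_finite_lim_seq (sum_n a).
  apply: (ex_finite_lim_seq_incr _ B) => // n; rewrite sum_Sn /plus /=.
  by move: (Ha n.+1); lra.
have Hs : is_series a l by apply: Hl.
split; first by exists l.
rewrite (is_series_unique _ _ Hs).
by apply: (is_lim_seq_le (sum_n a) (fun=> B) l B) => //; exact: is_lim_seq_const.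
Qed.

Lemma sum_n_le_Series (a : nat -> R) n :
  (forall n, 0 <= a n) -> ex_series a -> sum_n a n <= Series a.
Proof.
move=> Ha Hex; apply: (is_lim_seq_incr_compare (sum_n a) (Series a)).
  by apply: Series_correct.
by move=> k; rewrite sum_Sn /plus /=; move: (Ha k.+1); lra.
Qed.

Lemma sumQ_le g B :
  (forall x, 0 <= g x) -> (forall l, uniq l -> lsum g l <= B) ->
  ex_series (enumQ g) /\ sumQ g <= B.
Proof.
move=> Hg HB; apply: is_series_nonneg_bounded; first exact: enumQ_ge0.
by move=> n; rewrite sum_n_enumQ; apply: HB; apply: uniq_enum_upto.
Qed.

Lemma lsum_le_sumQ g l :
  (forall x, 0 <= g x) -> ex_series (enumQ g) -> uniq l -> lsum g l <= sumQ g.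
Proof.
move=> Hg Hex Hu; have [n Hn] := finite_in_enum l.
apply: (Rle_trans _ (lsum g (enum_upto n))); first exact: lsum_sub.
by rewrite -sum_n_enumQ; apply: sum_n_le_Series => //; apply: enumQ_ge0.
Qed.

(** [Series] is the real part of the total function [Lim_seq]; an infinite limit becomes 0, so the
    inequality survives divergence. *)
Lemma sumQ_ge0 g : (forall x, 0 <= g x) -> 0 <= sumQ g.
Proof.
move=> Hg; rewrite /sumQ /Series.
have H : Rbar_le (Lim_seq (fun=> 0)) (Lim_seq (sum_n (enumQ g))).
  apply: Lim_seq_le_loc; exists 0%N => n _; rewrite sum_n_enumQ; exact: lsum_ge0.
move: H; rewrite Lim_seq_const; case: (Lim_seq _) => [r|?|[]] //=; lra.
Qed.

Lemma sumQ_ext f g : (forall x, f x = g x) -> sumQ f = sumQ g.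
Proof. by move=> H; apply: Series_ext => n; rewrite /enumQ; case: (pickle_inv n). Qed.

Lemma ex_sumQ_dom f g :
  (forall x, 0 <= f x <= g x) -> ex_series (enumQ g) -> ex_series (enumQ f) /\ sumQ f <= sumQ g.
Proof.
move=> H Hg.
have Hg0 x : 0 <= g x by move: (H x); lra.
apply: sumQ_le => [x|l Hu]; first by move: (H x); lra.
apply: (Rle_trans _ (lsum g l)); first by apply: lsum_le => x; move: (H x); lra.
exact: lsum_le_sumQ.
Qed.

(** Trades the pickle order for a convenient one: a nonnegative series may be summed along any
    increasing chain of finite sets that eventually catches each point of the support. It serves for
    the partitions with parts at most m. *)
Lemma sumQ_exhaust (g : seq nat -> R) (P : nat -> seq (seq nat)) (S : R) :
  (forall x, 0 <= g x) -> (forall m, uniq (P m)) ->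
  (forall m, {subset P m <= P m.+1}) ->
  (forall x, g x <> 0 -> exists m, x \in P m) ->
  is_lim_seq (fun m => lsum g (P m)) S -> sumQ g = S.
Proof.
move=> Hg HU Hi Hx HS.
have Hmono m k : (m <= k)%N -> {subset P m <= P k}.
  elim: k => [|k IH]; first by rewrite leqn0 => /eqP ->.
  rewrite leq_eqVlt => /orP [/eqP -> //|]; rewrite ltnS => Hm x Hxm.
  by apply: Hi; apply: IH.
have HPS m : lsum g (P m) <= S.
  apply: (is_lim_seq_incr_compare (fun m => lsum g (P m)) S) => [|k]; first by [].
  by apply: lsum_sub.
have [Hex Hle] : ex_series (enumQ g) /\ sumQ g <= S.
  apply: sumQ_le => // l Hu.
  have [m Hm] : exists m, forall x, x \in l -> g x <> 0 -> x \in P m.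
    elim: l {Hu} => [|a l [m IH]]; first by exists 0%N.
    have [k Hk] : exists k, g a <> 0 -> a \in P k.
      have [E|E] := Req_dec (g a) 0; first by exists 0%N.
      by have [k Hk] := Hx a E; exists k.
    exists (maxn m k) => x; rewrite inE => /orP [/eqP -> Ha|Hxl Hgx].
      by apply: (Hmono k); [rewrite leq_maxr|exact: Hk].
    by apply: (Hmono m); [rewrite leq_maxl|exact: IH].
  apply: Rle_trans (HPS m).
  have [E|] : lsum g l = lsum g [seq x <- l | x \in P m] \/ False.
    left; elim: l Hm {Hu} => [|a l IH] Hm //; rewrite lsum_cons IH; last first.
      by move=> x Hxl; apply: Hm; rewrite inE Hxl orbT.
    rewrite /=; case: ifP => Ha; first by rewrite lsum_cons.
    have -> : g a = 0; last lra.
    have [E|E] := Req_dec (g a) 0; first by [].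
    by move: (Hm a (mem_head _ _) E); rewrite Ha.
  - rewrite E; apply: lsum_sub => //; first exact: filter_uniq.
    by move=> x; rewrite mem_filter => /andP [].
  - by [].
apply: Rle_antisym => //.
apply: (is_lim_seq_le (fun m => lsum g (P m)) (fun=> sumQ g) S (sumQ g)) => //.
  by move=> m; apply: lsum_le_sumQ.
exact: is_lim_seq_const.
Qed.

(** * The Basel sum *)

Lemma exp_le x y : x <= y -> exp x <= exp y.
Proof. by case=> [/exp_increasing|->]; lra. Qed.

Lemma exp_ge0 x : 0 <= exp x.
Proof. by apply: Rlt_le; exact: exp_pos. Qed.

Lemma Rabs_exp x : Rabs (exp x) = exp x.
Proof. by apply: Rabs_right; apply: Rle_ge; exact: exp_ge0. Qed.

Fixpoint bsum (n : nat) (f : nat -> R) : R :=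
  match n with O => 0 | S m => bsum m f + f m end.

Lemma bsumS n f : bsum n.+1 f = bsum n f + f n.
Proof. by []. Qed.

Lemma bsum_ext n f g : (forall k, (k < n)%N -> f k = g k) -> bsum n f = bsum n g.
Proof.
elim: n => [|n IH] H //=; rewrite IH ?H // => k Hk; apply: H; lia.
Qed.

Lemma bsum_le n f g : (forall k, (k < n)%N -> f k <= g k) -> bsum n f <= bsum n g.
Proof.
elim: n => [|n IH] H /=; first lra.
apply: Rplus_le_compat; last by apply: H.
by apply: IH => k Hk; apply: H; lia.
Qed.

Lemma bsum_plus n f g : bsum n (fun k => f k + g k) = bsum n f + bsum n g.
Proof. elim: n => [|n IH] /=; rewrite ?IH; lra. Qed.

Lemma bsum_scal n c f : bsum n (fun k => c * f k) = c * bsum n f.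
Proof. elim: n => [|n IH] /=; rewrite ?IH; lra. Qed.

Lemma bsum_ge0 n f : (forall k, (k < n)%N -> 0 <= f k) -> 0 <= bsum n f.
Proof.
move=> H; elim: n H => [|n IH] H /=; first lra.
move: (H n (leqnn _)); have := IH (fun k Hk => H k (ltnW Hk)); lra.
Qed.

Lemma bsum_const n c : bsum n (fun=> c) = INR n * c.
Proof. elim: n => [|n IH]; rewrite ?S_INR /= ?IH ?S_INR; lra. Qed.

Lemma bsum_cat m n f : bsum (m + n) f = bsum m f + bsum n (fun k => f (m + k)%N).
Proof. elim: n => [|n IH]; rewrite ?addn0 ?addnS /= ?IH; lra. Qed.

Lemma bsum_recl n f : bsum n.+1 f = f 0%N + bsum n (fun k => f k.+1).
Proof. by rewrite -[n.+1]add1n bsum_cat /=; rewrite Rplus_0_l. Qed.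

Lemma bsum_rev n f : bsum n f = bsum n (fun k => f (n.-1 - k)%N).
Proof.
elim: n f => [|n IH] f //.
rewrite bsum_recl (IH (fun k => f k.+1)) /= subnn Rplus_comm; congr (_ + _).
apply: bsum_ext => k Hk; congr f; lia.
Qed.

Lemma bsum_mono n m f : (forall k, 0 <= f k) -> (n <= m)%N -> bsum n f <= bsum m f.
Proof.
move=> Hf; elim: m => [|m IH]; first by rewrite leqn0 => /eqP ->; lra.
rewrite leq_eqVlt => /orP [/eqP ->|]; first lra.
by rewrite ltnS /= => /IH; move: (Hf m); lra.
Qed.

Lemma Rabs_bsum n f : Rabs (bsum n f) <= bsum n (fun k => Rabs (f k)).
Proof.
elim: n => [|n IH] /=; first by rewrite Rabs_R0; lra.
by apply: (Rle_trans _ _ _ (Rabs_triang _ _)); lra.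
Qed.

Lemma is_lim_seq_bsum n (u : nat -> nat -> R) (l : nat -> R) :
  (forall k, is_lim_seq (u k) (l k)) ->
  is_lim_seq (fun m => bsum n (fun k => u k m)) (bsum n l).
Proof.
move=> H; elim: n => [|n IH] /=; first exact: is_lim_seq_const.
exact: is_lim_seq_plus'.
Qed.

Lemma is_lim_seq_eps (u : nat -> R) (l : R) :
  is_lim_seq u l <->
  (forall e, 0 < e -> exists N, forall n, (N <= n)%N -> Rabs (u n - l) < e).
Proof.
rewrite -is_lim_seq_spec; split => H.
- move=> e He; have [N HN] := H (mkposreal e He).
  by exists N => n Hn; apply: HN; lia.
- by case=> e He /=; have [N HN] := H e He; exists N => n Hn; apply: HN; lia.
Qed.

(** sin x - x cos x vanishes at 0 and has derivative x sin x, which is nonnegative on [0, PI]. *)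
Lemma x_cos_le_sin x : 0 <= x <= PI -> x * cos x <= sin x.
Proof.
move=> [H0 H1].
have [||c [Hc E]] := MVT_gen (fun x => sin x - x * cos x) 0 x (fun x => x * sin x).
- move=> y _; auto_derive => //; ring.
- move=> y _; apply: derivable_continuous_pt; apply: ex_derive_Reals_0; auto_derive => //.
move: Hc E; rewrite /Rmin /Rmax; case: Rle_dec => // _ [Hc0 Hc1].
rewrite sin_0 cos_0 => E.
have : 0 <= c * sin c * (x - 0); last by lra.
by apply: Rmult_le_pos; [apply: Rmult_le_pos => //; apply: sin_ge_0; lra|lra].
Qed.

(** The upper bound is 1 / sin^2 = 1 + cot^2 together with cot x <= 1 / x. *)
Lemma inv_sin2_bounds x : 0 < x < PI / 2 -> / x ^ 2 <= / sin x ^ 2 <= 1 + / x ^ 2.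
Proof.
move=> [H0 H1].
have Hs : 0 < sin x by apply: sin_gt_0; lra.
have Hc : 0 < cos x by apply: cos_gt_0; lra.
have Hsx := sin_lt_x x H0.
have Hxc : x * cos x <= sin x by apply: x_cos_le_sin; lra.
split.
  by apply: Rinv_le_contravar; [apply: pow_lt|apply: pow_incr; lra].
have -> : / sin x ^ 2 = 1 + (cos x / sin x) ^ 2.
  have := sin2_cos2 x; rewrite /Rsqr => E; field_simplify; [|lra|lra].
  by congr (_ / _); lra.
apply: Rplus_le_compat_l; rewrite -pow_inv; apply: pow_incr; split.
  by apply: Rlt_le; apply: Rdiv_lt_0_compat.
apply: (Rmult_le_reg_r (x * sin x)); first by apply: Rmult_lt_0_compat.
by field_simplify; lra.
Qed.

Lemma inv_sin2_duplication x : sin x <> 0 -> cos x <> 0 ->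
  / sin x ^ 2 + / sin (PI / 2 - x) ^ 2 = 4 * / sin (2 * x) ^ 2.
Proof.
move=> Hs Hc; rewrite sin_shift sin_2a.
have := sin2_cos2 x; rewrite /Rsqr => E.
have -> : / sin x ^ 2 + / cos x ^ 2 = (sin x * sin x + cos x * cos x) / (sin x ^ 2 * cos x ^ 2).
  by field; lra.
by rewrite E; field; lra.
Qed.

Lemma INR_pow2 n : INR (2 ^ n)%N = 2 ^ n.
Proof.
elim: n => [|n IH]; first by rewrite expn0.
by rewrite expnS mult_INR IH.
Qed.

Definition dyadic_angle (n k : nat) : R := (2 * INR k + 1) * PI / (4 * 2 ^ n).

Lemma dyadic_angle_bounds n k : (k < 2 ^ n)%N -> 0 < dyadic_angle n k < PI / 2.
Proof.
move=> Hk; have HP := PI_RGT_0; have H2 : 0 < 2 ^ n by apply: pow_lt; lra.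
have Hk' : INR k + 1 <= 2 ^ n.
  by rewrite -S_INR -INR_pow2; apply: le_INR; apply/leP.
have Hk0 := pos_INR k; rewrite /dyadic_angle; split.
  by apply: Rdiv_lt_0_compat; nra.
apply: (Rmult_lt_reg_r (4 * 2 ^ n)); first lra.
have -> : (2 * INR k + 1) * PI / (4 * 2 ^ n) * (4 * 2 ^ n) = (2 * INR k + 1) * PI by field; lra.
nra.
Qed.

(** The angles are the odd multiples of PI / 2^(n+2) below PI / 2. At level n+1 the angles of index
    k and 2^(n+1) - 1 - k are complementary, and twice the former is the angle k of level n; the
    duplication formula thus multiplies the sum by 4 at each level. *)
Lemma sum_inv_sin2_dyadic n :
  bsum (2 ^ n) (fun k => / sin (dyadic_angle n k) ^ 2) = 2 * 4 ^ n.
Proof.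
elim: n => [|n IH].
  rewrite expn0 /=; have -> : dyadic_angle 0 0 = PI / 4 by rewrite /dyadic_angle /=; field.
  rewrite sin_PI4 /= .
  have H2 := sqrt_lt_R0 2 ltac:(lra); have := sqrt_sqrt 2 ltac:(lra) => E.
  field_simplify; [|lra]; rewrite -[sqrt 2 ^ 2]/(sqrt 2 * (sqrt 2 * 1)); lra.
have -> : (2 ^ n.+1 = 2 ^ n + 2 ^ n)%N by rewrite expnS; lia.
rewrite bsum_cat [X in _ + X]bsum_rev -bsum_plus.
rewrite (bsum_ext _ _ (fun k => 4 * / sin (dyadic_angle n k) ^ 2)).
  by rewrite bsum_scal IH /=; ring.
move=> k Hk.
have H2 : 0 < 2 ^ n by apply: pow_lt; lra.
have -> : dyadic_angle n k = 2 * dyadic_angle n.+1 k by rewrite /dyadic_angle /=; field; lra.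
have Hb := dyadic_angle_bounds n.+1 k ltac:(rewrite expnS; lia).
rewrite -inv_sin2_duplication; first last.
- by have := cos_gt_0 (dyadic_angle n.+1 k) ltac:(lra) ltac:(lra); lra.
- by have := sin_gt_0 (dyadic_angle n.+1 k) ltac:(lra) ltac:(lra); lra.
congr (_ + / sin _ ^ 2).
rewrite /dyadic_angle plus_INR minus_INR; last by lia.
have -> : INR (2 ^ n).-1 = 2 ^ n - 1.
  by rewrite -INR_pow2 -[in RHS](prednK (n := 2 ^ n)%N) ?expn_gt0 // S_INR; lra.
by rewrite INR_pow2 /=; field; lra.
Qed.

(** Summing 1/x^2 <= 1/sin^2 x <= 1 + 1/x^2 over the 2^n angles costs an error of 2^n against the
    exact value 2 * 4^n, hence the geometric rate. *)
Lemma odd_squares_dyadic n :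
  PI ^ 2 / 8 - PI ^ 2 / 16 * (/ 2) ^ n <= bsum (2 ^ n) (fun k => / (2 * INR k + 1) ^ 2) <= PI ^ 2 / 8.
Proof.
have HP := PI_RGT_0; have H2 : 0 < 2 ^ n by apply: pow_lt; lra.
have H4 : 4 ^ n = 2 ^ n * 2 ^ n by rewrite -Rpow_mult_distr; congr (_ ^ _); lra.
have E : bsum (2 ^ n) (fun k => / dyadic_angle n k ^ 2) =
  16 * 4 ^ n / PI ^ 2 * bsum (2 ^ n) (fun k => / (2 * INR k + 1) ^ 2).
  rewrite -bsum_scal; apply: bsum_ext => k _; rewrite /dyadic_angle H4.
  have := pos_INR k => Hk; field; split; [|split]; lra.
have L : bsum (2 ^ n) (fun k => / dyadic_angle n k ^ 2) <= 2 * 4 ^ n.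
  rewrite -sum_inv_sin2_dyadic; apply: bsum_le => k Hk.
  by have := inv_sin2_bounds _ (dyadic_angle_bounds n k Hk); lra.
have U : 2 * 4 ^ n <= 2 ^ n + bsum (2 ^ n) (fun k => / dyadic_angle n k ^ 2).
  rewrite -sum_inv_sin2_dyadic.
  have -> : 2 ^ n = bsum (2 ^ n) (fun=> 1) by rewrite bsum_const INR_pow2; lra.
  rewrite -bsum_plus; apply: bsum_le => k Hk.
  by have := inv_sin2_bounds _ (dyadic_angle_bounds n k Hk); lra.
move: L U; rewrite E; set O := bsum _ _ => L U.
have HP2 : 0 < PI ^ 2 by apply: pow_lt.
have Hc : 0 < 16 * 4 ^ n / PI ^ 2.
  by rewrite H4; apply: Rdiv_lt_0_compat => //; nra.
split; apply: (Rmult_le_reg_l (16 * 4 ^ n / PI ^ 2)) => //.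
- apply: (Rle_trans _ (2 * 4 ^ n - 2 ^ n)); last lra.
  apply: Req_le; rewrite H4 pow_inv; field; lra.
- apply: (Rle_trans _ (2 * 4 ^ n)); first lra.
  by apply: Req_le; rewrite H4; field; lra.
Qed.

Lemma odd_squares_lim : is_lim_seq (fun n => bsum n (fun k => / (2 * INR k + 1) ^ 2)) (PI ^ 2 / 8).
Proof.
set f := fun k : nat => / (2 * INR k + 1) ^ 2.
have Hf k : 0 <= f k.
  rewrite /f; apply: Rlt_le; apply: Rinv_0_lt_compat; apply: pow_lt; have := pos_INR k; lra.
have Hup n : bsum n f <= PI ^ 2 / 8.
  apply: (Rle_trans _ (bsum (2 ^ n) f)); last by have := odd_squares_dyadic n; rewrite -/f; lra.
  by apply: bsum_mono => //; apply: ltnW; apply: ltn_expl.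
apply/is_lim_seq_eps => e He.
have [m Hm] : exists m, PI ^ 2 / 16 * (/ 2) ^ m < e.
  have : is_lim_seq (fun m => PI ^ 2 / 16 * (/ 2) ^ m) (PI ^ 2 / 16 * 0).
    by apply: is_lim_seq_mult'; [exact: is_lim_seq_const|apply: is_lim_seq_geom; rewrite Rabs_right; lra].
  move/is_lim_seq_eps /(_ e He) => [m /(_ m (leqnn m))].
  by move/Rabs_def2; exists m; lra.
exists (2 ^ m)%N => n Hn.
have := bsum_mono _ _ f Hf Hn; have := odd_squares_dyadic m; rewrite -/f.
by have := Hup n; move=> *; apply: Rabs_def1; lra.
Qed.

(** With O the sum over odd squares and Z the sum over all squares, splitting by parity gives Z = O
    + Z / 4, while the alternating sum is O - Z / 4. Since O = PI^2 / 8, this yields Z = PI^2 / 6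
    and PI^2 / 12. Partial sums of even length keep the pairs complete. *)
Lemma alternating_squares_lim :
  is_lim_seq (fun n => bsum (n + n) (fun k => (-1) ^ k / (INR k + 1) ^ 2)) (PI ^ 2 / 12).
Proof.
set z := fun k : nat => / (INR k + 1) ^ 2.
set o := fun k : nat => / (2 * INR k + 1) ^ 2.
have Hz k : 0 < z k.
  rewrite /z; apply: Rinv_0_lt_compat; apply: pow_lt; have := pos_INR k; lra.
have Hsplit f n : bsum (n + n) f = bsum n (fun k => f (k + k)%N) + bsum n (fun k => f (k + k).+1).
  elim: n => [|n IH]; first by rewrite /=; lra.
  by rewrite addSn addnS /= IH; lra.
have Hodd k : INR (k + k).+1 + 1 = 2 * (INR k + 1) by rewrite S_INR plus_INR; lra.
have Heven k : INR (k + k) + 1 = 2 * INR k + 1 by rewrite plus_INR; lra.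
have Ez n : bsum (n + n) z = bsum n o + / 4 * bsum n z.
  rewrite Hsplit -bsum_scal; congr (_ + _); apply: bsum_ext => k _; rewrite /z /o ?Heven ?Hodd //.
  by rewrite Rpow_mult_distr Rinv_mult; congr (_ * _); lra.
have Ea n : bsum (n + n) (fun k => (-1) ^ k / (INR k + 1) ^ 2) = bsum n o - / 4 * bsum n z.
  have -> : bsum n o - / 4 * bsum n z = bsum n o + (- / 4) * bsum n z by lra.
  rewrite Hsplit -bsum_scal; congr (_ + _); apply: bsum_ext => k _; rewrite /z /o ?Heven ?Hodd.
    have -> : (-1) ^ (k + k) = 1 by rewrite -[(k + k)%N]/(Nat.add k k) pow_add -Rpow_mult_distr Rmult_opp_opp Rmult_1_l pow1.
    by rewrite /Rdiv Rmult_1_l.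
  have -> : (-1) ^ (k + k).+1 = -1.
    by rewrite /= -[(k + k)%N]/(Nat.add k k) pow_add -Rpow_mult_distr Rmult_opp_opp Rmult_1_l pow1; lra.
  have := pos_INR k => Hk; field; lra.
have [l Hl] : ex_finite_lim_seq (fun n => bsum n z).
  apply: (ex_finite_lim_seq_incr _ (PI ^ 2 / 6)) => n; first by rewrite /=; have := Hz n; lra.
  have : bsum n z <= bsum (n + n) z by apply: bsum_mono; [move=> k; have := Hz k; lra|lia].
  rewrite Ez => H.
  have : bsum n o <= PI ^ 2 / 8; last by lra.
  apply: (is_lim_seq_incr_compare _ _ odd_squares_lim) => k.
  suff : 0 <= o k by rewrite -/o [bsum k.+1 o]/=; lra.
  rewrite /o; apply: Rlt_le; apply: Rinv_0_lt_compat; apply: pow_lt; have := pos_INR k; lra.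
have Hl2 : is_lim_seq (fun n => bsum (n + n) z) l.
  apply: (is_lim_seq_subseq (fun n => bsum n z) _ (fun n => (n + n)%N) _ Hl).
  apply: eventually_subseq => n; lia.
have E1 : is_lim_seq (fun n => bsum (n + n) z) (PI ^ 2 / 8 + / 4 * l).
  apply: (is_lim_seq_ext _ _ _ (fun n => esym (Ez n))).
  apply: is_lim_seq_plus'; first exact: odd_squares_lim.
  by apply: is_lim_seq_mult' => //; exact: is_lim_seq_const.
have := is_lim_seq_unique _ _ Hl2; rewrite (is_lim_seq_unique _ _ E1) => -[El].
apply: (is_lim_seq_ext _ _ _ (fun n => esym (Ea n))).
have -> : PI ^ 2 / 12 = PI ^ 2 / 8 - / 4 * l by lra.
apply: is_lim_seq_minus'; first exact: odd_squares_lim.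
by apply: is_lim_seq_mult' => //; exact: is_lim_seq_const.
Qed.

(** * Strict partitions and the asymptotics of eps(N) *)

(** Distinct parts make the recursion binary: the largest admissible part is absent or occurs once.
    This is the factorisation of Z_R into factors 1 + eps^k. *)
Fixpoint strict_parts (m : nat) : seq (seq nat) :=
  match m with
  | O => [:: [::]]
  | S m' => strict_parts m' ++ map (cons m) (strict_parts m')
  end.

Lemma isQ_cons a q : isQ (a :: q) = [&& (0 < a)%N, all (fun k => (k < a)%N) q & isQ q].
Proof.
rewrite /isQ /= path_sortedE; last by move=> x y z /=; lia.
by rewrite -andbA; case: (0 < a)%N; rewrite ?andbF.
Qed.

Lemma mem_strict_parts m q : (q \in strict_parts m) = isQ q && all (fun k => (k <= m)%N) q.
Proof.
elim: m q => [|m IH] q.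
  rewrite inE; case: q => [|a q] //=; rewrite isQ_cons.
  by case: a => [|a] //=; rewrite andbF.
rewrite /= mem_cat IH.
have Hw (r : seq nat) : all (fun k => (k <= m)%N) r -> all (fun k => (k <= m.+1)%N) r.
  by apply: sub_all => k; lia.
case: q => [|a q].
  by [].
apply/orP/andP => [[/andP [H1 H2]|/mapP [r Hr [-> ->]]]|[H1 H2]].
- by split => //; apply: Hw.
- move: Hr; rewrite IH isQ_cons => /andP [H1 H2]; rewrite H1 /= leqnn (Hw _ H2) /=.
  by rewrite andbT; split => //; move: H2; apply: sub_all => k; lia.
- move: H1 H2; rewrite isQ_cons /= => /and3P [Ha Hq HQ] /andP [Ham _].
  move: Ham; rewrite leq_eqVlt => /orP [/eqP E|Ham].
    right; rewrite E; apply: map_f; rewrite IH HQ /=.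
    by move: Hq; rewrite E; apply: sub_all => k; lia.
  left; rewrite Ha Hq HQ /=; apply/andP; split; first by lia.
  by move: Hq; apply: sub_all => k; lia.
Qed.

Lemma uniq_strict_parts m : uniq (strict_parts m).
Proof.
elim: m => [|m IH] //=; rewrite cat_uniq IH map_inj_uniq ?IH; last by move=> x y [].
rewrite andbT; apply/hasPn => q /mapP [r _ ->].
by rewrite mem_strict_parts /=; apply/negP => /andP [_]; lia.
Qed.

Lemma powD (x : R) m n : x ^ (m + n)%N = x ^ m * x ^ n.
Proof. exact: pow_add. Qed.

Lemma lsum_strict_parts eps m :
  lsum (fun q => eps ^ nq q) (strict_parts m) = prodZ eps m.
Proof.
elim: m => [|m IH]; first by rewrite /lsum /=; lra.
rewrite /= lsum_cat lsum_map IH.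
rewrite (lsum_ext _ (fun q => (eps * eps ^ m) * eps ^ nq q)).
  by rewrite lsum_scal IH; lra.
by move=> q; rewrite /nq -[sumn (_ :: _)]/(m.+1 + sumn q)%N powD /=; ring.
Qed.

(** Under mu_R the parts are independent and k is present with probability eps^k / (1 + eps^k), a
    Fermi occupation number. This is the mean contribution to n(q) of the parts 1, ..., m. *)
Definition fermi_sum (eps : R) (m : nat) : R :=
  bsum m (fun k => INR k.+1 * eps ^ k.+1 / (1 + eps ^ k.+1)).

Lemma lsum_nq_strict_parts eps m : 0 < eps ->
  lsum (fun q => INR (nq q) * eps ^ nq q) (strict_parts m) = prodZ eps m * fermi_sum eps m.
Proof.
move=> He; elim: m => [|m IH]; first by rewrite /lsum /fermi_sum /=; lra.
have Hp : 0 < eps ^ m.+1 by apply: pow_lt.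
rewrite [strict_parts _]/= lsum_cat lsum_map IH.
rewrite (lsum_ext _ (fun q => (INR m.+1 * eps ^ m.+1) * eps ^ nq q + eps ^ m.+1 * (INR (nq q) * eps ^ nq q))).
  rewrite lsum_plus !lsum_scal IH lsum_strict_parts /fermi_sum bsumS -[prodZ _ _.+1]/(prodZ eps m * (1 + eps ^ m.+1)).
  by field; lra.
by move=> q; rewrite /nq -[sumn (_ :: _)]/(m.+1 + sumn q)%N powD plus_INR; ring.
Qed.

Lemma kpow_sum_eq x m :
  (1 - x) ^ 2 * bsum m (fun k => INR k.+1 * x ^ k.+1) =
  x - INR m.+1 * x ^ m.+1 + INR m * x ^ m.+2.
Proof.
elim: m => [|m IH]; first by rewrite /=; lra.
rewrite bsumS Rmult_plus_distr_l IH !S_INR /=; ring.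
Qed.

Lemma kpow_sum_le x m : 0 < x < 1 -> bsum m (fun k => INR k.+1 * x ^ k.+1) <= x / (1 - x) ^ 2.
Proof.
move=> Hx; have H2 : 0 < (1 - x) ^ 2 by apply: pow_lt; lra.
apply: (Rmult_le_reg_l ((1 - x) ^ 2)) => //; rewrite kpow_sum_eq.
have -> : (1 - x) ^ 2 * (x / (1 - x) ^ 2) = x by field; lra.
have Hp : 0 < x ^ m.+1 by apply: pow_lt; lra.
rewrite -[x ^ m.+2]/(x * x ^ m.+1) S_INR.
suff : 0 <= INR m * (x ^ m.+1 * (1 - x)) by lra.
by apply: Rmult_le_pos; [exact: pos_INR|nra].
Qed.

Lemma is_lim_seq_shift (u : nat -> R) (l : Rbar) : is_lim_seq u l <-> is_lim_seq (fun n => u n.+1) l.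
Proof. exact: is_lim_seq_incr_1. Qed.

(** The terms are differences of consecutive partial sums of a bounded increasing sequence. *)
Lemma kpow_lim0 x : 0 < x < 1 -> is_lim_seq (fun m => INR m * x ^ m) 0.
Proof.
move=> Hx.
have [l Hl] : ex_finite_lim_seq (fun m => bsum m (fun k => INR k.+1 * x ^ k.+1)).
  apply: (ex_finite_lim_seq_incr _ (x / (1 - x) ^ 2)) => m; last exact: kpow_sum_le.
  have : 0 < x ^ m.+1 by apply: pow_lt; lra.
  rewrite bsumS; have := pos_INR m.+1; nra.
apply/is_lim_seq_shift.
apply: (is_lim_seq_ext (fun m => bsum m.+1 (fun k => INR k.+1 * x ^ k.+1) - bsum m (fun k => INR k.+1 * x ^ k.+1))).
  by move=> m; rewrite bsumS; lra.
rewrite -[Finite 0]/(Finite 0); have -> : 0 = l - l by lra.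
apply: is_lim_seq_minus' => //.
by apply/(is_lim_seq_shift (fun m => bsum m _)).
Qed.

Lemma kpow_sum_lim x : 0 < x < 1 ->
  is_lim_seq (fun m => bsum m (fun k => INR k.+1 * x ^ k.+1)) (x / (1 - x) ^ 2).
Proof.
move=> Hx; have H2 : 0 < (1 - x) ^ 2 by apply: pow_lt; lra.
have L0 := kpow_lim0 x Hx; move/is_lim_seq_shift: (L0) => L1.
apply: (is_lim_seq_ext (fun m => / (1 - x) ^ 2 * (x - INR m.+1 * x ^ m.+1 + x ^ 2 * (INR m * x ^ m)))).
  move=> m; apply: (Rmult_eq_reg_l ((1 - x) ^ 2)); last lra.
  by rewrite kpow_sum_eq /=; field; lra.
have -> : x / (1 - x) ^ 2 = / (1 - x) ^ 2 * (x - 0 + x ^ 2 * 0) by field; lra.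
apply: is_lim_seq_mult'; first exact: is_lim_seq_const.
apply: is_lim_seq_plus'.
  by apply: is_lim_seq_minus' => //; exact: is_lim_seq_const.
by apply: is_lim_seq_mult' => //; exact: is_lim_seq_const.
Qed.

Lemma prodZ_ge1 eps m : 0 < eps -> 1 <= prodZ eps m.
Proof.
move=> He; elim: m => [|m IH] /=; first lra.
by have : 0 < eps ^ m.+1 by [apply: pow_lt]; rewrite /=; nra.
Qed.

Lemma prodZ_lim eps : 0 < eps < 1 -> is_lim_seq (prodZ eps) (ZR eps) /\ 1 <= ZR eps.
Proof.
move=> He.
have [l Hl] : ex_finite_lim_seq (prodZ eps).
  apply: (ex_finite_lim_seq_incr _ (exp (eps / (1 - eps)))) => m.
    have := prodZ_ge1 eps m ltac:(lra); have : 0 < eps ^ m.+1 by apply: pow_lt; lra.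
    by rewrite /=; nra.
  (* From 1 + x <= exp x. The finite geometric sum stands in the exponent, rather than its limit, so
     that the induction on m closes. *)
  apply: (Rle_trans _ (exp ((eps - eps ^ m.+1) / (1 - eps)))); last first.
    apply: exp_le; apply: Rmult_le_compat_r; first by apply: Rlt_le; apply: Rinv_0_lt_compat; lra.
    by have : 0 < eps ^ m.+1 by [apply: pow_lt; lra]; lra.
  elim: m => [|m IH].
    by rewrite /= Rmult_1_r Rminus_diag /Rdiv Rmult_0_l exp_0; lra.
  have -> : (eps - eps ^ m.+2) / (1 - eps) = (eps - eps ^ m.+1) / (1 - eps) + eps ^ m.+1.
    by rewrite /=; field; lra.
  rewrite exp_plus [prodZ _ _.+1]/=; apply: Rmult_le_compat => //.
  - by have := prodZ_ge1 eps m ltac:(lra); lra.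
  - by have : 0 < eps ^ m.+1 by [apply: pow_lt; lra]; rewrite /=; lra.
  - exact: exp_ineq1_le.
have E : ZR eps = l by rewrite /ZR (is_lim_seq_unique _ _ Hl).
rewrite E; split => //.
apply: (is_lim_seq_le (fun=> 1) (prodZ eps) 1 l) => //; last exact: is_lim_seq_const.
by move=> m; apply: prodZ_ge1; lra.
Qed.

Lemma fermi_sum_lim eps : 0 < eps < 1 ->
  is_lim_seq (fermi_sum eps) (ExpN eps).
Proof.
move=> He; have [HZ HZ1] := prodZ_lim eps He.
have Hpos k : 0 < eps ^ k by apply: pow_lt; lra.
have [A HA] : ex_finite_lim_seq (fermi_sum eps).
  apply: (ex_finite_lim_seq_incr _ (eps / (1 - eps) ^ 2)) => m.
    rewrite /fermi_sum bsumS.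
    suff : 0 <= INR m.+1 * eps ^ m.+1 / (1 + eps ^ m.+1) by lra.
    apply: Rmult_le_pos; first by apply: Rmult_le_pos; [exact: pos_INR|exact: Rlt_le].
    by apply: Rlt_le; apply: Rinv_0_lt_compat; have := Hpos m.+1; lra.
  apply: Rle_trans (kpow_sum_le eps m He); apply: bsum_le => k _.
  have Hk := Hpos k.+1; apply: (Rmult_le_reg_r (1 + eps ^ k.+1)); first lra.
  rewrite /Rdiv Rmult_assoc Rinv_l; last lra.
  have : 0 <= INR k.+1 * eps ^ k.+1 by apply: Rmult_le_pos; [exact: pos_INR|exact: Rlt_le].
  nra.
suff -> : ExpN eps = A by [].
apply: (sumQ_exhaust _ strict_parts).
- move=> q; apply: Rmult_le_pos; first exact: pos_INR.
  rewrite /muR; case: (isQ q); last lra.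
  by apply: Rlt_le; apply: Rdiv_lt_0_compat; [exact: Hpos|lra].
- exact: uniq_strict_parts.
- by move=> m x Hx; rewrite /= mem_cat Hx.
- move=> q; rewrite /muR; case E: (isQ q); last by rewrite Rmult_0_r.
  move=> _; exists (sumn q); rewrite mem_strict_parts E /=.
  elim: q {E} => [|a q IH] //=; rewrite leq_addr /=.
  by move: IH; apply: sub_all => k; lia.
- apply: (is_lim_seq_ext (fun m => prodZ eps m * fermi_sum eps m * / ZR eps)).
    move=> m; rewrite -lsum_nq_strict_parts; last lra.
    rewrite Rmult_comm -lsum_scal; apply: lsum_ext_in => q.
    by rewrite mem_strict_parts => /andP [Hq _]; rewrite /muR Hq; field; lra.
  have -> : A = ZR eps * A * / ZR eps by field; lra.
  apply: is_lim_seq_mult'; last exact: is_lim_seq_const.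
  exact: is_lim_seq_mult'.
Qed.

(** * From Fermi to Bose sums: the asymptotics of E[n] *)

Lemma alternating_geometric x M : 0 < x ->
  Rabs (x / (1 + x) - bsum M (fun j => (-1) ^ j * x ^ j.+1)) <= x ^ M.+1.
Proof.
move=> Hx.
have -> : x / (1 + x) - bsum M (fun j => (-1) ^ j * x ^ j.+1) = (-1) ^ M * (x ^ M.+1 / (1 + x)).
  elim: M => [|M IH]; first by rewrite /=; field; lra.
  rewrite bsumS; move: IH; set b := bsum M _ => IH.
  have -> : b = x / (1 + x) - (-1) ^ M * (x ^ M.+1 / (1 + x)) by lra.
  by rewrite /=; field; lra.
rewrite Rabs_mult pow_1_abs Rmult_1_l.
have Hp : 0 < x ^ M.+1 by apply: pow_lt.
rewrite Rabs_right; last by apply: Rle_ge; apply: Rlt_le; apply: Rdiv_lt_0_compat; lra.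
apply: (Rmult_le_reg_r (1 + x)); first lra.
by rewrite /Rdiv Rmult_assoc Rinv_l; nra.
Qed.

Definition bose (x : R) : R := x / (1 - x) ^ 2.

(** Expand x / (1 + x) at x = eps^k into M alternating powers with remainder at most x^(M+1), then
    sum over k: each power gives sum_k k y^k = y / (1 - y)^2, which is [bose y]. Truncation at M
    precedes the limit in the number of parts, so only finite sums are exchanged. *)
Lemma ExpN_alternating eps M : 0 < eps < 1 ->
  Rabs (ExpN eps - bsum M (fun j => (-1) ^ j * bose (eps ^ j.+1))) <= bose (eps ^ M.+1).
Proof.
move=> He.
have Hp j : 0 < eps ^ j.+1 < 1.
  split; first by apply: pow_lt; lra.
  by have := pow_lt_1_compat eps j.+1 ltac:(lra) ltac:(lia); lra.
have H m : Rabs (fermi_sum eps m - bsum M (fun j => (-1) ^ j * bsum m (fun k => INR k.+1 * (eps ^ j.+1) ^ k.+1)))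
    <= bsum m (fun k => INR k.+1 * (eps ^ M.+1) ^ k.+1).
  rewrite (bsum_ext M _ (fun j => bsum m (fun k => (-1) ^ j * (INR k.+1 * (eps ^ j.+1) ^ k.+1)))); last first.
    by move=> j _; rewrite bsum_scal.
  have -> : bsum M (fun j => bsum m (fun k => (-1) ^ j * (INR k.+1 * (eps ^ j.+1) ^ k.+1))) =
            bsum m (fun k => bsum M (fun j => (-1) ^ j * (INR k.+1 * (eps ^ j.+1) ^ k.+1))).
    elim: (M) => [|n IH]; first by rewrite /= bsum_const; lra.
    by rewrite bsumS IH -bsum_plus.
  have -> u v : bsum m u - bsum m v = bsum m (fun k => u k + (-1) * v k).
    by rewrite bsum_plus bsum_scal; lra.
  apply: Rle_trans (Rabs_bsum _ _) _; apply: bsum_le => k _.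
  have Hx := Hp k; have := alternating_geometric (eps ^ k.+1) M ltac:(lra).
  have -> : (eps ^ M.+1) ^ k.+1 = (eps ^ k.+1) ^ M.+1.
    by rewrite -!pow_mult Nat.mul_comm.
  have -> : bsum M (fun j => (-1) ^ j * (INR k.+1 * (eps ^ j.+1) ^ k.+1)) =
    INR k.+1 * bsum M (fun j => (-1) ^ j * (eps ^ k.+1) ^ j.+1).
    rewrite -bsum_scal; apply: bsum_ext => j _.
    have -> : (eps ^ j.+1) ^ k.+1 = (eps ^ k.+1) ^ j.+1 by rewrite -!pow_mult Nat.mul_comm.
    by ring.
  set b := bsum M _ => Hb.
  have -> : INR k.+1 * eps ^ k.+1 / (1 + eps ^ k.+1) + -1 * (INR k.+1 * b) =
    INR k.+1 * (eps ^ k.+1 / (1 + eps ^ k.+1) - b) by field; lra.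
  rewrite Rabs_mult Rabs_right; last by apply: Rle_ge; exact: pos_INR.
  by apply: Rmult_le_compat_l; [exact: pos_INR|].
apply: (is_lim_seq_le _ _ (Finite (Rabs (ExpN eps - bsum M (fun j => (-1) ^ j * bose (eps ^ j.+1))))) (Finite (bose (eps ^ M.+1))) H); last exact: kpow_sum_lim.
apply: (is_lim_seq_abs _ (Finite _)); apply: is_lim_seq_minus'; first exact: fermi_sum_lim.
apply: is_lim_seq_bsum => j; apply: is_lim_seq_mult'; first exact: is_lim_seq_const.
exact: kpow_sum_lim.
Qed.

(** The left side is the square of (y / 2) / sinh (y / 2). *)
Lemma bose_exp_bound y : 0 < y -> y ^ 2 * bose (exp (- y)) <= 1.
Proof.
move=> Hy; rewrite /bose.
have He : 0 < exp (- y) < 1 by split; [exact: exp_pos|rewrite -exp_0; apply: exp_increasing; lra].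
have H2 : 0 < (1 - exp (- y)) ^ 2 by apply: pow_lt; lra.
apply: (Rmult_le_reg_r ((1 - exp (- y)) ^ 2)) => //.
have -> : y ^ 2 * (exp (- y) / (1 - exp (- y)) ^ 2) * (1 - exp (- y)) ^ 2 = y ^ 2 * exp (- y) by field; lra.
rewrite Rmult_1_l.
have E : exp (- y) = exp (- (y / 2)) * exp (- (y / 2)) by rewrite -exp_plus; congr exp; lra.
have E1 : exp (y / 2) * exp (- (y / 2)) = 1 by rewrite -exp_plus -exp_0; congr exp; lra.
have H0 := exp_pos (- (y / 2)).
(* sinh(y/2) >= y/2 *)
have Hs : y <= exp (y / 2) - exp (- (y / 2)).
  have [||c [Hc]] := MVT_gen (fun z => exp z - exp (- z) - 2 * z) 0 (y / 2) (fun z => exp z + exp (- z) - 2).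
  - move=> z _; auto_derive => //; ring.
  - move=> z _; apply: derivable_continuous_pt; apply: ex_derive_Reals_0; auto_derive => //.
  rewrite Ropp_0 exp_0 => E2.
  suff : 0 <= exp c + exp (- c) - 2 by nra.
  have E3 : exp c * exp (- c) = 1 by rewrite -exp_plus -exp_0; congr exp; lra.
  have -> : exp c + exp (- c) - 2 = exp (- c) * (exp c - 1) ^ 2 by ring [E3].
  by apply: Rmult_le_pos; [exact: exp_ge0|exact: pow2_ge_0].
have -> : 1 - exp (- y) = exp (- (y / 2)) * (exp (y / 2) - exp (- (y / 2))) by rewrite Rmult_minus_distr_l -E; lra.
have -> : y ^ 2 * exp (- y) = (exp (- (y / 2)) * y) ^ 2 by rewrite E; ring.
apply: pow_incr; split; nra.
Qed.

(** The quotient (1 - exp (- c b)) / b tends to the derivative c at 0. *)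
Lemma bose_exp_lim (b : nat -> R) (c : R) : 0 < c -> (forall n, 0 < b n) -> is_lim_seq b 0 ->
  is_lim_seq (fun n => b n ^ 2 * bose (exp (- (c * b n)))) (/ c ^ 2).
Proof.
move=> Hc Hb0 Hb.
pose f := fun x => (1 - exp (- (c * x))) / x.
have Hf : is_lim_seq (fun n => f (b n)) c.
  have HD : is_derive (fun x => 1 - exp (- (c * x))) 0 c.
    by auto_derive => //; rewrite Rmult_0_r Ropp_0 exp_0; lra.
  have /is_derive_Reals HD' := HD.
  apply/is_lim_seq_eps => e He; have [d Hd] := HD' e He.
  have [N HN] := proj1 (is_lim_seq_eps _ _) Hb d (cond_pos d).
  exists N => n /HN; rewrite Rminus_0_r => Hn.
  have := Hd (b n) ltac:(have := Hb0 n; lra) Hn.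
  by rewrite Rplus_0_l Rmult_0_r Ropp_0 exp_0 Rminus_diag Rminus_0_r /f.
apply: (is_lim_seq_ext (fun n => exp (- (c * b n)) * / (f (b n)) ^ 2)).
  move=> n; rewrite /f /bose; have Hn := Hb0 n.
  have : exp (- (c * b n)) < 1 by rewrite -exp_0; apply: exp_increasing; nra.
  by move=> ?; field; lra.
have -> : / c ^ 2 = 1 * / c ^ 2 by lra.
apply: is_lim_seq_mult'.
  have -> : 1 = exp (- (c * 0)) by rewrite Rmult_0_r Ropp_0 exp_0.
  apply: (is_lim_seq_continuous exp); first by apply: derivable_continuous_pt; exact: derivable_pt_exp.
  by apply: (proj1 (is_lim_seq_opp _ (Finite _))); apply: is_lim_seq_mult' => //; exact: is_lim_seq_const.
apply: (is_lim_seq_inv _ (c ^ 2)); last by move=> [E]; have := pow_lt c 2 Hc; rewrite /= in E *; rewrite E; lra.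
apply: (is_lim_seq_continuous (fun x => x ^ 2)) => //.
by apply: derivable_continuous_pt; exact: derivable_pt_pow.
Qed.

(** Since E[n] = N^2, (N b)^2 equals b^2 E[n]. For a fixed truncation M each term of its alternating
    expansion converges as b tends to 0, and the remainder is at most 1 / (M+1)^2 uniformly in N;
    the Basel-type sum then appears as M grows. *)
Lemma eps_asymptotics (eps : nat -> R) :
  (forall N : nat, (1 <= N)%N -> 0 < eps N < 1 /\ ExpN (eps N) = INR N ^ 2) ->
  is_lim_seq (fun N => INR N * - ln (eps N)) (PI / sqrt 12).
Proof.
move=> H.
apply/is_lim_seq_shift.
pose e n := eps n.+1; pose b n := - ln (e n).
have He n : 0 < e n < 1 by apply: (H n.+1 isT).1.
have HE n : ExpN (e n) = INR n.+1 ^ 2 by apply: (H n.+1 isT).2.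
have Hb n : 0 < b n by rewrite /b; have := ln_increasing (e n) 1 ltac:(have := He n; lra) ltac:(have := He n; lra); rewrite ln_1; lra.
have Heb n k : e n ^ k = exp (- (INR k * b n)).
  elim: k => [|k IH]; first by rewrite /= Rmult_0_l Ropp_0 exp_0.
  have -> : - (INR k.+1 * b n) = ln (e n) + - (INR k * b n) by rewrite S_INR /b; ring.
  by rewrite exp_plus exp_ln -?IH //; have := He n; lra.
have Hb0 : is_lim_seq b 0.
  apply: (is_lim_seq_ext (fun n => - ln (e n))) => //.
  rewrite -[0]Ropp_0 -ln_1; apply: (proj1 (is_lim_seq_opp _ (Finite _))).
  apply: is_lim_seq_continuous.
    by apply: derivable_continuous_pt; exists (/ 1); apply: derivable_pt_lim_ln; lra.
  (* The case M = 0 of the expansion, N^2 <= e / (1 - e)^2, already gives 1 - e <= 1/N and hence b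
     -> 0. *)
  have Hub n : 1 - / INR n.+1 <= e n <= 1.
    have := He n => Hen; split; last lra.
    have := ExpN_alternating (e n) 0 Hen; rewrite HE /bose pow_1 [bsum 0 _]/= Rminus_0_r => HA.
    have HN : 0 < INR n.+1 by apply: lt_0_INR; lia.
    have H2 : INR n.+1 ^ 2 * (1 - e n) ^ 2 <= 1.
      have : INR n.+1 ^ 2 <= e n / (1 - e n) ^ 2 by apply: Rle_trans HA; exact: Rle_abs.
      move/(Rmult_le_compat_r ((1 - e n) ^ 2) _ _ (pow2_ge_0 _)).
      by rewrite /Rdiv Rmult_assoc Rinv_l; [lra|apply: pow_nonzero; lra].
    have H3 : INR n.+1 * (1 - e n) <= 1.
      by apply: Rnot_lt_le => Hc; move: H2; rewrite -Rpow_mult_distr; nra.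
    have : 1 - e n <= / INR n.+1; last lra.
    by apply: (Rmult_le_reg_l (INR n.+1)) => //; rewrite Rinv_r; lra.
  apply: (is_lim_seq_le_le (fun n => 1 - / INR n.+1) _ (fun=> 1)) => //; last exact: is_lim_seq_const.
  have {2}-> : 1 = 1 - 0 by lra.
  apply: is_lim_seq_minus'; first exact: is_lim_seq_const.
  apply/(is_lim_seq_shift (fun n => / INR n)).
  by apply: (is_lim_seq_inv _ p_infty) => //; exact: is_lim_seq_INR.
have HX : is_lim_seq (fun n => (INR n.+1 * b n) ^ 2) (PI ^ 2 / 12).
  apply/is_lim_seq_eps => d Hd.
  have [M0 HM0] := proj1 (is_lim_seq_eps _ _) alternating_squares_lim (d / 3) ltac:(lra).
  have Hi : is_lim_seq (fun n => / INR n) 0.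
    by apply: (is_lim_seq_inv _ p_infty) => //; exact: is_lim_seq_INR.
  have [M1 HM1] := proj1 (is_lim_seq_eps _ _) Hi (d / 3) ltac:(lra).
  (* M is even to match the partial sums of [alternating_squares_lim], and large enough for both the
     tail of that sum and the remainder 1 / (M+1)^2. *)
  set m := maxn M0 M1; pose M := (m + m)%N.
  have HA := HM0 m (leq_maxl _ _).
  have HB : / INR M.+1 ^ 2 < d / 3.
    have := HM1 M.+1 ltac:(rewrite /M /m; lia); rewrite Rminus_0_r.
    have HM : 1 <= INR M.+1 by rewrite S_INR; have := pos_INR M; lra.
    have Hi0 : 0 < / INR M.+1 by apply: Rinv_0_lt_compat; lra.
    have Hi1 : / INR M.+1 <= 1 by rewrite -Rinv_1; apply: Rinv_le_contravar; lra.
    rewrite Rabs_right; last lra.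
    by rewrite -pow_inv -Rsqr_pow2 /Rsqr; nra.
  have HC : is_lim_seq (fun n => bsum M (fun j => (-1) ^ j * (b n ^ 2 * bose (exp (- (INR j.+1 * b n))))))
      (bsum M (fun j => (-1) ^ j * / (INR j.+1) ^ 2)).
    apply: (is_lim_seq_bsum M (fun j n => (-1) ^ j * (b n ^ 2 * bose (exp (- (INR j.+1 * b n)))))) => j.
    apply: is_lim_seq_mult'; first exact: is_lim_seq_const.
    by apply: bose_exp_lim => //; apply: lt_0_INR; lia.
  have [N0 HN0] := proj1 (is_lim_seq_eps _ _) HC (d / 3) ltac:(lra).
  exists N0 => n /HN0.
  have -> : bsum M (fun j => (-1) ^ j * / INR j.+1 ^ 2) = bsum M (fun j => (-1) ^ j / (INR j + 1) ^ 2).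
    by apply: bsum_ext => j _; rewrite S_INR.
  move=> HD.
  have HF : Rabs ((INR n.+1 * b n) ^ 2 - bsum M (fun j => (-1) ^ j * (b n ^ 2 * bose (exp (- (INR j.+1 * b n)))))) <= / INR M.+1 ^ 2.
    have -> : (INR n.+1 * b n) ^ 2 - bsum M (fun j => (-1) ^ j * (b n ^ 2 * bose (exp (- (INR j.+1 * b n))))) =
      b n ^ 2 * (ExpN (e n) - bsum M (fun j => (-1) ^ j * bose (e n ^ j.+1))).
      rewrite HE Rmult_minus_distr_l Rpow_mult_distr Rmult_comm -bsum_scal; congr (_ - _).
      by apply: bsum_ext => j _; rewrite Heb; lra.
    rewrite Rabs_mult Rabs_right; last by apply: Rle_ge; exact: pow2_ge_0.
    apply: (Rle_trans _ (b n ^ 2 * bose (e n ^ M.+1))).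
      by apply: Rmult_le_compat_l; [exact: pow2_ge_0|exact: ExpN_alternating].
    have HM : 0 < INR M.+1 by apply: lt_0_INR; lia.
    rewrite Heb; apply: (Rmult_le_reg_l (INR M.+1 ^ 2)); first exact: pow_lt.
    rewrite Rinv_r; last by apply: pow_nonzero; lra.
    rewrite -Rmult_assoc -Rpow_mult_distr; apply: bose_exp_bound.
    by apply: Rmult_lt_0_compat.
  move: HA HB HD HF; rewrite -/M; set s1 := bsum M _; set s2 := bsum M _ => HA HB HD HF.
  have HF1 := Rle_abs ((INR n.+1 * b n) ^ 2 - s2).
  have HF2 := Rcomplements.Rabs_maj2 ((INR n.+1 * b n) ^ 2 - s2).
  move/Rabs_def2: HA => HA; move/Rabs_def2: HD => HD.
  by apply: Rabs_def1; lra.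
apply: (is_lim_seq_ext (fun n => sqrt ((INR n.+1 * b n) ^ 2))).
  move=> n; apply: sqrt_pow2; apply: Rmult_le_pos; first exact: pos_INR.
  exact: Rlt_le.
have -> : PI / sqrt 12 = sqrt (PI ^ 2 / 12).
  rewrite sqrt_div_alt; last lra.
  by rewrite sqrt_pow2 //; apply: Rlt_le; exact: PI_RGT_0.
by apply: (is_lim_seq_continuous sqrt) => //; apply: continuity_pt_sqrt; apply: Rmult_le_pos; [exact: pow2_ge_0|lra].
Qed.

(** * The generator acting on the Hopf-Cole variables *)

Lemma leq_split m n : (m <= n)%N -> m = n \/ (m < n)%N.
Proof. lia. Qed.

Lemma mem_nat_nth (q : seq nat) (x : nat) :
  x \in q -> exists i : nat, (i < size q)%N /\ nth 0%N q i = x.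
Proof. by case/(nthP 0%N) => i Hi E; exists i. Qed.

Lemma mem_nthn (q : seq nat) (i : nat) : (i < size q)%N -> nth 0%N q i \in q.
Proof. exact: mem_nth. Qed.

Definition hq (q : seq nat) (k : nat) : nat := count (fun x => (k < x)%N) q.

(** The index [size q] is included: [nth] returns its default 0 there, which is the first zero entry
    of the infinite sequence. *)
Lemma isQ_nth_gt q i j : isQ q -> (i < j)%N -> (j <= size q)%N -> (nth 0%N q j < nth 0%N q i)%N.
Proof.
case/andP => Hs Ha Hij; case/leq_split => [E|Hj].
  by rewrite [nth _ _ j]nth_default ?E //; apply: (allP Ha); apply: mem_nthn; lia.
by apply: (sorted_ltn_nth (leT := fun a b => (b < a)%N)) => //; [move=> x y z /=; lia|rewrite inE; lia].
Qed.

Lemma isQ_nth_gt0 q j : isQ q -> (0 < nth 0%N q j)%N = (j < size q)%N.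
Proof.
case/andP => _ Ha; case: (ltnP j (size q)) => Hj; last by rewrite nth_default.
exact: (allP Ha _ (mem_nthn q j Hj)).
Qed.

Lemma isQ_nth_inj q i j : isQ q -> (i <= size q)%N -> (j <= size q)%N ->
  nth 0%N q i = nth 0%N q j -> i = j.
Proof.
move=> HQ Hi Hj E; case: (ltngtP i j) => // H.
- by have := isQ_nth_gt q i j HQ H Hj; lia.
- by have := isQ_nth_gt q j i HQ H Hi; lia.
Qed.

Lemma isQ_not0 q : isQ q -> 0%N \notin q.
Proof. by case/andP => _ Ha; apply/negP => /(allP Ha). Qed.

(** Reads the parts as particles on sites 1, 2, ...: a particle may jump right exactly when the
    target site is empty. The index [size q] is the creation of a particle at site 1. *)
Lemma up_condE q j : isQ q -> (j <= size q)%N -> up_cond q j = ((nth 0%N q j).+1 \notin q).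
Proof.
move=> HQ Hj; apply/idP/idP.
- move=> Hu; apply/negP => /mem_nat_nth [i [Hi E]].
  have Hij : (i < j)%N.
    rewrite ltnNge; apply/negP; case/leq_split => [Eij|Hji]; first by rewrite Eij in E; lia.
    by have := isQ_nth_gt q j i HQ Hji (ltnW Hi); lia.
  case: j Hj Hu E Hij => [|j] //= Hj Hu E; rewrite ltnS; case/leq_split => [Eij|Hji].
    by rewrite Eij in E; lia.
  by have := isQ_nth_gt q i j HQ Hji ltac:(lia); lia.
- case: j Hj => [|j] //= Hj Hn.
  have H1 := isQ_nth_gt q j j.+1 HQ (ltnSn _) Hj.
  rewrite addn1 ltn_neqAle H1 andbT; apply: contra Hn => /eqP ->; exact: mem_nthn.
Qed.

(** The exclusion rule to the left; the alternative q_i = 1 is annihilation, since 0 never belongs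
    to q. *)
Lemma down_condE q j : isQ q -> (j < size q)%N -> down_cond q j = ((nth 0%N q j).-1 \notin q).
Proof.
move=> HQ Hj; have Hp : (0 < nth 0%N q j)%N by rewrite isQ_nth_gt0.
rewrite /down_cond; apply/idP/idP.
- move=> Hd; apply/negP => /mem_nat_nth [i [Hi E]].
  have Hip : (0 < nth 0%N q i)%N by rewrite isQ_nth_gt0.
  have Hij : (j < i)%N.
    rewrite ltnNge; apply/negP; case/leq_split => [Eij|Hji]; first by rewrite Eij in E; lia.
    by have := isQ_nth_gt q i j HQ Hji (ltnW Hj); lia.
  move: Hij; case/leq_split => [Eij|Hji]; first by move: Hd; rewrite Eij; lia.
  by have := isQ_nth_gt q j.+1 i HQ Hji (ltnW Hi); lia.
- move=> Hn; have H1 := isQ_nth_gt q j j.+1 HQ (ltnSn _) Hj.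
  case: eqP => [->|Hne]; first by rewrite orbT.
  rewrite orbF; rewrite ltnNge; apply/negP => Hle.
  have Hj1 : (j.+1 < size q)%N by rewrite -(isQ_nth_gt0 _ _ HQ); lia.
  have E : (nth 0%N q j).-1 = nth 0%N q j.+1 by lia.
  by move: Hn; rewrite E mem_nthn.
Qed.

Lemma down_cond_size q j : isQ q -> down_cond q j -> (j < size q)%N.
Proof.
move=> HQ; case: (ltnP j (size q)) => // Hj; rewrite /down_cond !nth_default //; lia.
Qed.

(** Stated additively because subtraction on [nat] truncates. The zeros that [qmod] removes are
    never counted by [hq]. *)
Lemma hq_qmod q j v k :
  (hq (qmod q j v) k + (k < nth 0%N q j) = hq q k + (k < v))%N.
Proof.
rewrite /hq /qmod count_filter.
rewrite (eq_count (a2 := fun x => (k < x)%N)); last by move=> x /=; lia.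
rewrite count_set_nthF //.
have : ((k < nth 0 q j) <= count (fun x => k < x) q)%N.
  case: (ltnP j (size q)) => Hj; last by rewrite nth_default.
  case E: (k < nth 0 q j)%N => //; rewrite -has_count; apply/hasP.
  by exists (nth 0%N q j) => //; exact: mem_nthn.
lia.
Qed.

Lemma hq_up q j k : hq (qmod q j (nth 0%N q j).+1) k = (hq q k + (k == nth 0%N q j))%N.
Proof. have := hq_qmod q j (nth 0%N q j).+1 k; lia. Qed.

Lemma hq_down q j k : isQ q -> (j < size q)%N ->
  hq q k = (hq (qmod q j (nth 0%N q j).-1) k + (k.+1 == nth 0%N q j))%N.
Proof.
move=> HQ Hj; have Hp : (0 < nth 0%N q j)%N by rewrite isQ_nth_gt0.
have := hq_qmod q j (nth 0%N q j).-1 k; lia.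
Qed.

Lemma hq_step q k : isQ q -> hq q k = (hq q k.+1 + (k.+1 \in q))%N.
Proof.
case/andP => Hs Ha.
have Hu : uniq q.
  by apply: (sorted_uniq (leT := fun a b => (b < a)%N)) => //; [move=> x y z /=; lia|move=> x /=; lia].
rewrite /hq -count_uniq_mem // -[RHS]/(_ + _)%N.
elim: q {Hs Ha Hu} => //= a q ->; case: eqP; lia.
Qed.

Lemma isQ_qmod q j v : isQ q -> (j <= size q)%N ->
  (forall i, j = i.+1 -> (v < nth 0%N q i)%N) ->
  ((j.+1 < size q)%N -> (nth 0%N q j.+1 < v)%N) -> isQ (qmod q j v).
Proof.
move=> HQ Hj H1 H2; rewrite /qmod /isQ filter_all andbT.
apply: sorted_filter; first by move=> x y z /=; lia.
apply/(sortedP 0%N) => i; rewrite size_set_nth => Hi; rewrite !nth_set_nth /=.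
case: (eqVneq i j) => [Eij|Nij]; case: (eqVneq i.+1 j) => [Eij'|Nij'].
- lia.
- by rewrite Eij; apply: H2; lia.
- by apply: H1.
- by apply: isQ_nth_gt => //; lia.
Qed.

Lemma lsum_le_In {T : Type} (f g : T -> R) (l : seq T) :
  (forall x, List.In x l -> f x <= g x) -> lsum f l <= lsum g l.
Proof.
elim: l => [|a l IH] H; first exact: Rle_refl.
rewrite !lsum_cons; apply: Rplus_le_compat; first by apply: H; left.
by apply: IH => x Hx; apply: H; right.
Qed.

Lemma In_moves eps q p : List.In p (moves eps q) ->
  exists j : nat, (j <= size q)%N /\
    ((up_cond q j /\ p = (eps, qmod q j (nth 0%N q j).+1)) \/
     (down_cond q j /\ p = (1, qmod q j (nth 0%N q j).-1))).
Proof.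
rewrite /moves.
have Hle j : j \in iota 0%N (size q).+1 -> (j <= size q)%N by rewrite mem_iota add0n /= ltnS.
elim: (iota _ _) Hle => [|j l IH] Hle //=.
rewrite -catA => H; case: (List.in_app_or _ _ _ H) => {H}.
  case: ifP => // Hu [<-|//]; exists j; split; last by left.
  by apply: Hle; rewrite mem_head.
move=> H; case: (List.in_app_or _ _ _ H) => {H}; last by apply: IH => i Hi; apply: Hle; rewrite inE Hi orbT.
case: ifP => // Hu [<-|//]; exists j; split; last by right.
by apply: Hle; rewrite mem_head.
Qed.

Lemma isQ_moves eps q p : isQ q -> List.In p (moves eps q) -> isQ p.2.
Proof.
move=> HQ /In_moves [j [Hj [[Hc ->]|[Hc ->]]]] /=.
- apply: isQ_qmod => // [i E|Hs]; first by move: Hc; rewrite E /up_cond; lia.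
  by have := isQ_nth_gt q j j.+1 HQ (ltnSn _) (ltnW Hs); lia.
- have Hs := down_cond_size q j HQ Hc.
  apply: isQ_qmod => // [i E|Hs'].
    have := isQ_nth_gt q i j HQ ltac:(lia) ltac:(lia); lia.
  have H0 : (0 < nth 0%N q j.+1)%N by rewrite isQ_nth_gt0.
  have := isQ_nth_gt q j j.+1 HQ (ltnSn _) (ltnW Hs').
  move: Hc; rewrite /down_cond; lia.
Qed.

Definition b2r (c : bool) : R := if c then 1 else 0.

Lemma lsum_moves eps q (G : seq nat -> R) :
  lsum (fun p => p.1 * G p.2) (moves eps q) =
  lsum (fun j => b2r (up_cond q j) * (eps * G (qmod q j (nth 0%N q j).+1)) +
                 b2r (down_cond q j) * G (qmod q j (nth 0%N q j).-1)) (iota 0%N (size q).+1).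
Proof.
rewrite /moves lsum_flatten lsum_map; apply: lsum_ext => j.
by rewrite lsum_cat /b2r; case: (up_cond q j); case: (down_cond q j); rewrite /lsum /=; lra.
Qed.

Lemma lsum_single {T : eqType} (P : pred T) (s : seq T) j0 :
  uniq s -> (forall j, j \in s -> P j -> j = j0) ->
  lsum (fun j => b2r (P j)) s = b2r ((j0 \in s) && P j0).
Proof.
elim: s => [|a s IH] //= /andP [Ha Hu] H.
rewrite lsum_cons IH // => [|j Hj]; last by apply: H; rewrite inE Hj orbT.
rewrite inE; case: (eqVneq j0 a) => [E|N] /=.
  by rewrite E (negbTE Ha) /= /b2r; lra.
case Pa: (P a); last by rewrite /b2r; lra.
by move: N; rewrite (H a (mem_head _ _) Pa) eqxx.
Qed.

(** The height at k rises when a particle crosses from k to k+1 and falls ([down_site]) when one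
    crosses back; site 0 acts as a reservoir that can always emit and absorb. *)
Definition up_site (q : seq nat) (k : nat) : bool := ((k == 0%N) || (k \in q)) && (k.+1 \notin q).
Definition down_site (q : seq nat) (k : nat) : bool := (k.+1 \in q) && ((k == 0%N) || (k \notin q)).

(** Entries are distinct, so a single index carries the value k; for k = 0 it is [size q]. *)
Lemma count_up q k : isQ q ->
  lsum (fun j => b2r (up_cond q j && (k == nth 0%N q j))) (iota 0%N (size q).+1) = b2r (up_site q k).
Proof.
move=> HQ.
pose j0 := if k == 0%N then size q else index k q.
have Hj0 : (j0 <= size q)%N by rewrite /j0; case: ifP => // _; exact: index_size.
have E0 : (k == nth 0%N q j0) = ((k == 0%N) || (k \in q)).
  rewrite /j0; case: (eqVneq k 0%N) => [->|Hk] /=; first by rewrite nth_default.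
  case Hin: (k \in q); first by rewrite nth_index // eqxx.
  by rewrite nth_default ?(negbTE Hk) // leqNgt index_mem Hin.
rewrite (lsum_single _ _ j0) ?iota_uniq //.
- rewrite mem_iota add0n ltnS Hj0 /= up_condE // /up_site andbC E0.
  case E1: ((k == 0%N) || (k \in q)) => //=.
  by move: E0; rewrite E1 => /eqP <-.
- move=> j; rewrite mem_iota add0n ltnS => /= Hj /andP [_ /eqP E].
  apply: (isQ_nth_inj q) => //; apply/eqP; rewrite -E E0.
  case: (ltnP j (size q)) => Hs; first by rewrite E mem_nthn ?orbT.
  by rewrite E nth_default.
Qed.

Lemma count_down q k : isQ q ->
  lsum (fun j => b2r (down_cond q j && (k.+1 == nth 0%N q j))) (iota 0%N (size q).+1) = b2r (down_site q k).
Proof.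
move=> HQ.
have Hin : (k.+1 == nth 0%N q (index k.+1 q)) = (k.+1 \in q).
  case H: (k.+1 \in q); first by rewrite nth_index // eqxx.
  by rewrite nth_default // leqNgt index_mem H.
rewrite (lsum_single _ _ (index k.+1 q)) ?iota_uniq //.
- rewrite mem_iota add0n ltnS index_size /= /down_site andbC Hin.
  case H: (k.+1 \in q) => //=.
  rewrite down_condE ?index_mem // nth_index //=.
  by case: eqP => [->|] //=; rewrite isQ_not0.
- move=> j; rewrite mem_iota add0n ltnS => /= Hj /andP [Hd /eqP E].
  have Hs := down_cond_size q j HQ Hd.
  apply: (isQ_nth_inj q) => //; first exact: index_size.
  by apply/eqP; rewrite -E Hin E mem_nthn.
Qed.

(* Microscopic Hopf-Cole transform. *)
Definition Vexp (b : R) (q : seq nat) (k : nat) : R := exp (b * (INR (hq q k) + INR k / 2)).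

Lemma Vexp_gt0 b q k : 0 < Vexp b q k.
Proof. exact: exp_pos. Qed.

Lemma Vexp_up b q j k :
  Vexp b (qmod q j (nth 0%N q j).+1) k = if k == nth 0%N q j then Vexp b q k * exp b else Vexp b q k.
Proof.
rewrite /Vexp hq_up; case: eqP => _; last by rewrite addn0.
by rewrite -exp_plus addn1 S_INR; congr exp; ring.
Qed.

Lemma Vexp_down b q j k : isQ q -> down_cond q j ->
  Vexp b (qmod q j (nth 0%N q j).-1) k = if k.+1 == nth 0%N q j then Vexp b q k * exp (- b) else Vexp b q k.
Proof.
move=> HQ Hd; have Hs := down_cond_size q j HQ Hd.
have := hq_down q j k HQ Hs; rewrite /Vexp => ->; case: eqP => _; last by rewrite addn0.
by rewrite -exp_plus addn1 S_INR; congr exp; ring.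
Qed.

(** The tilt k / 2 makes the two possible slopes symmetric: the ratio is exp (- b / 2) at an
    occupied site and exp (b / 2) at an empty one. *)
Lemma Vexp_step b q k : isQ q ->
  Vexp b q k.+1 = Vexp b q k * exp (b * (/ 2 - b2r (k.+1 \in q))).
Proof.
move=> HQ; rewrite /Vexp -exp_plus (hq_step q k HQ) plus_INR S_INR; congr exp.
by case: (k.+1 \in q); rewrite /b2r /=; field.
Qed.

Definition gen (rs : seq (R * seq nat)) (F : seq nat -> R) (q : seq nat) : R :=
  lsum (fun p => p.1 * (F p.2 - F q)) rs.

(** The carre du champ, gen (F^2) - 2 F gen F, that is, the rate of quadratic variation of F. *)
Definition carre (rs : seq (R * seq nat)) (F : seq nat -> R) (q : seq nat) : R :=
  lsum (fun p => p.1 * (F p.2 - F q) ^ 2) rs.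

(** As phi vanishes at the current value of V_k, only moves that change the height at k contribute,
    and there is at most one in each direction. *)
Lemma lsum_moves_site eps b q k (phi : R -> R) : isQ q -> phi (Vexp b q k) = 0 ->
  lsum (fun p => p.1 * phi (Vexp b p.2 k)) (moves eps q) =
  b2r (up_site q k) * (eps * phi (Vexp b q k * exp b)) +
  b2r (down_site q k) * phi (Vexp b q k * exp (- b)).
Proof.
move=> HQ H0; rewrite (lsum_moves eps q (fun r => phi (Vexp b r k))).
rewrite -count_up // -count_down // Rmult_comm -lsum_scal Rplus_comm Rmult_comm -lsum_scal -lsum_plus.
apply: lsum_ext => j; rewrite Vexp_up.
case Hd: (down_cond q j); first rewrite Vexp_down //; case: (up_cond q j);
  case: (k == nth 0%N q j); case: (k.+1 == nth 0%N q j); rewrite /b2r /= ?H0; ring.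
Qed.

Lemma gen_sq rs F q : gen rs (fun r => F r ^ 2) q = 2 * F q * gen rs F q + carre rs F q.
Proof.
rewrite /gen /carre -lsum_scal -lsum_plus; apply: lsum_ext => p; ring.
Qed.

Lemma gen_lin rs F G c d q :
  gen rs (fun r => c * F r + d * G r) q = c * gen rs F q + d * gen rs G q.
Proof. rewrite /gen -!lsum_scal -lsum_plus; apply: lsum_ext => p; ring. Qed.

Lemma gen_scal rs F c q : gen rs (fun r => c * F r) q = c * gen rs F q.
Proof. rewrite /gen -!lsum_scal; apply: lsum_ext => p; ring. Qed.

Lemma gen_bsum rs n (F : nat -> seq nat -> R) q :
  gen rs (fun r => bsum n (fun k => F k r)) q = bsum n (fun k => gen rs (F k) q).
Proof.
elim: n => [|n IH].
  by rewrite /gen /=; elim: rs => [|p rs IH] //; rewrite lsum_cons IH; lra.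
rewrite bsumS -IH.
have := gen_lin rs (fun r => bsum n (fun k => F k r)) (F n) 1 1 q.
rewrite !Rmult_1_l => <-; rewrite /gen; apply: lsum_ext => p; rewrite !bsumS; ring.
Qed.

Lemma gen_const rs c q : gen rs (fun=> c) q = 0.
Proof. by rewrite /gen; elim: rs => [|p rs IH] //; rewrite lsum_cons IH; lra. Qed.

Lemma gen_ext rs F G q : (forall r, F r = G r) -> gen rs F q = gen rs G q.
Proof. by move=> H; apply: lsum_ext => p; rewrite !H. Qed.

Lemma gen_ratesN N eps F q : gen (ratesN N eps q) F q = INR N ^ 2 * gen (moves eps q) F q.
Proof. rewrite /gen /ratesN lsum_map -lsum_scal; apply: lsum_ext => p /=; ring. Qed.

(* Even reflection at 0: the boundary rates give V_0 the equation of an interior site with V_(-1) = V_1. *)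
Definition Vprev (b : R) (q : seq nat) (k : nat) : R :=
  match k with O => Vexp b q 1 | S k' => Vexp b q k' end.

(** With eps = exp (- b) an upward jump changes V_k at rate times size V_k (1 - exp (- b)), and a
    downward one by the opposite amount. For k > 0, with eta the occupation, up minus down is eta_k
    (1 - eta_(k+1)) - eta_(k+1) (1 - eta_k) = eta_k - eta_(k+1): the quadratic terms cancel and the
    rest is linear in the neighbours of V_k. *)
Lemma gen_Vexp b q k : isQ q ->
  gen (moves (exp (- b)) q) (fun r => Vexp b r k) q =
  exp (- (b / 2)) * (Vprev b q k + Vexp b q k.+1) - (1 + exp (- b)) * Vexp b q k.
Proof.
move=> HQ.
have E1 : exp (- b) * exp b = 1 by rewrite -exp_plus -exp_0; congr exp; lra.
have E2 : exp (- (b / 2)) * exp (b / 2) = 1 by rewrite -exp_plus -exp_0; congr exp; lra.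
have E3 : exp (- (b / 2)) * exp (- (b / 2)) = exp (- b) by rewrite -exp_plus; congr exp; lra.
(* [S] and [P] express both neighbours as V_k times a factor fixed by one occupation, so that the
   identity becomes a finite case check. *)
have S k' : exp (- (b / 2)) * Vexp b q k'.+1 = Vexp b q k' * (if k'.+1 \in q then exp (- b) else 1).
  rewrite Vexp_step // Rmult_comm Rmult_assoc; congr (_ * _); case: (_ \in q); rewrite /b2r.
    by rewrite -exp_plus; congr exp; lra.
  by rewrite -exp_plus -exp_0; congr exp; lra.
have P k' : exp (- (b / 2)) * Vprev b q k'.+1 = Vexp b q k'.+1 * (if k'.+1 \in q then 1 else exp (- b)).
  rewrite /Vprev Vexp_step // Rmult_comm Rmult_assoc; congr (_ * _); case: (_ \in q); rewrite /b2r.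
    by rewrite Rmult_1_r; congr exp; lra.
  by rewrite -!exp_plus; congr exp; lra.
rewrite /gen (lsum_moves_site _ b q k (fun v => v - Vexp b q k)) //; last by lra.
rewrite Rmult_plus_distr_l S.
have -> : exp (- b) * (Vexp b q k * exp b - Vexp b q k) = Vexp b q k * (1 - exp (- b)) by ring [E1].
case: k => [|k].
  rewrite /Vprev S /up_site /down_site /=.
  by case: (1%N \in q); rewrite /b2r /=; ring.
rewrite P /up_site /down_site /=.
by case: (k.+1 \in q); case: (k.+2 \in q); rewrite /b2r /=; ring.
Qed.

Lemma carre_Vexp b q k : isQ q ->
  carre (moves (exp (- b)) q) (fun r => Vexp b r k) q <=
  (1 - exp (- b)) ^ 2 * (exp b + 1) * Vexp b q k ^ 2.
Proof.
move=> HQ.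
have E1 : exp (- b) * exp b = 1 by rewrite -exp_plus -exp_0; congr exp; lra.
rewrite /carre (lsum_moves_site _ b q k (fun v => (v - Vexp b q k) ^ 2)) //; last by ring.
have -> : exp (- b) * (Vexp b q k * exp b - Vexp b q k) ^ 2 = (1 - exp (- b)) ^ 2 * exp b * Vexp b q k ^ 2.
  by ring [E1].
have -> : (Vexp b q k * exp (- b) - Vexp b q k) ^ 2 = (1 - exp (- b)) ^ 2 * Vexp b q k ^ 2 by ring.
have H1 : 0 <= (1 - exp (- b)) ^ 2 * Vexp b q k ^ 2 by apply: Rmult_le_pos; exact: pow2_ge_0.
have H2 : 0 <= (1 - exp (- b)) ^ 2 * exp b * Vexp b q k ^ 2.
  by apply: Rmult_le_pos; [apply: Rmult_le_pos; [exact: pow2_ge_0|exact: exp_ge0]|exact: pow2_ge_0].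
by case: (up_site q k); case: (down_site q k); rewrite /b2r; lra.
Qed.

Lemma moves_single_site eps b q p : isQ q -> List.In p (moves eps q) ->
  exists k0, forall k, k <> k0 -> Vexp b p.2 k = Vexp b q k.
Proof.
move=> HQ /In_moves [j [Hj [[Hc ->]|[Hc ->]]]] /=.
- by exists (nth 0%N q j) => k /eqP /negbTE Hk; rewrite Vexp_up Hk.
- exists (nth 0%N q j).-1 => k Hk; rewrite Vexp_down //; case: eqP => // E; lia.
Qed.

(** V_0 sits on the axis of the even reflection and is shared by both sides, hence counted half. *)
Definition Usum (b : R) (N : nat) (q : seq nat) (k : nat) : R :=
  / INR N * (Vexp b q 0 / 2 + bsum k (fun j => Vexp b q j.+1)).

Lemma Usum_S b N q k : Usum b N q k.+1 = Usum b N q k + / INR N * Vexp b q k.+1.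
Proof. rewrite /Usum bsumS; ring. Qed.

(* U is the primitive of V, so the even reflection of V becomes an odd one, around -1/2. *)
Definition Uprev (b : R) (N : nat) (q : seq nat) (k : nat) : R :=
  match k with O => - Usum b N q 0 | S k' => Usum b N q k' end.

(** Summation commutes with the discrete Laplacian under the reflection, so U solves the same
    equation. The zero-order coefficient is 1 + exp (- b) - 2 exp (- b / 2), a perfect square of
    order 1/N^2 when b is of order 1/N. *)
Lemma gen_Usum b N q k : isQ q ->
  gen (moves (exp (- b)) q) (fun r => Usum b N r k) q =
  exp (- (b / 2)) * (Usum b N q k.+1 + Uprev b N q k - 2 * Usum b N q k)
  - (1 - exp (- (b / 2))) ^ 2 * Usum b N q k.
Proof.
move=> HQ.
have E3 : exp (- b) = exp (- (b / 2)) * exp (- (b / 2)) by rewrite -exp_plus; congr exp; lra.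
elim: k => [|k IH].
  rewrite (gen_ext _ _ (fun r => (/ INR N * / 2) * Vexp b r 0)); last first.
    by move=> r; rewrite /Usum /= /Rdiv; ring.
  by rewrite gen_scal gen_Vexp // /Uprev Usum_S /Usum /= E3; move: (/ INR N) => IN; field.
rewrite (gen_ext _ _ (fun r => 1 * Usum b N r k + / INR N * Vexp b r k.+1)); last first.
  by move=> r; rewrite Usum_S; ring.
rewrite (gen_lin _ (fun r => Usum b N r k) (fun r => Vexp b r k.+1)) IH gen_Vexp // !Usum_S E3.
rewrite [Vprev _ _ _]/= [Uprev _ _ _ k.+1]/=.
have -> : Uprev b N q k = Usum b N q k - / INR N * Vexp b q k.
  by case: k {IH} => [|k] /=; rewrite ?Usum_S /Usum /=; move: (/ INR N) => IN; field.
ring.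
Qed.

Lemma bsum_single_sq n (f : nat -> R) k0 : (forall k, k <> k0 -> f k = 0) ->
  (bsum n f) ^ 2 = bsum n (fun k => f k ^ 2).
Proof.
move=> H; elim: n => [|n IH]; first by rewrite /=; ring.
rewrite !bsumS -IH; have [E|E] := PeanoNat.Nat.eq_dec n k0.
  have -> : bsum n f = 0.
    have : forall m, (m <= k0)%N -> bsum m f = 0; last by apply; lia.
    by elim=> [|m IHm] Hm //; rewrite bsumS IHm ?H; [lra|lia|lia].
  ring.
by rewrite (H n E); ring.
Qed.

(** A move alters only one V_j, so the square of the jump of the sum is the sum of the squares. With
    b of order 1/N and k of order N this is N^-2 N^-2 N, hence O(1/N) after the time scaling N^2. *)
Lemma carre_Usum b N q k : isQ q -> (0 < N)%N ->
  carre (moves (exp (- b)) q) (fun r => Usum b N r k) q <=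
  / INR N ^ 2 * ((1 - exp (- b)) ^ 2 * (exp b + 1) * bsum k.+1 (fun j => Vexp b q j ^ 2)).
Proof.
move=> HQ HN; have HN' : 0 < INR N by apply: lt_0_INR; lia.
pose c j : R := if j is 0%N then / 2 else 1.
have EU r : Usum b N r k = / INR N * bsum k.+1 (fun j => c j * Vexp b r j).
  rewrite /Usum bsum_recl /c; congr (_ * (_ + _)); first by lra.
  by apply: bsum_ext => j _; lra.
rewrite -bsum_scal -bsum_scal.
apply: (Rle_trans _ (bsum k.+1 (fun j => / INR N ^ 2 * carre (moves (exp (- b)) q) (fun r => Vexp b r j) q))); last first.
  apply: bsum_le => j _; apply: Rmult_le_compat_l; first by apply: Rlt_le; apply: Rinv_0_lt_compat; exact: pow_lt.
  exact: carre_Vexp.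
rewrite bsum_scal.
have -> : bsum k.+1 (fun j => carre (moves (exp (- b)) q) (fun r => Vexp b r j) q) =
   lsum (fun p => p.1 * bsum k.+1 (fun j => (Vexp b p.2 j - Vexp b q j) ^ 2)) (moves (exp (- b)) q).
  rewrite /carre; elim: k.+1 => [|n IH].
    by rewrite /=; elim: (moves _ q) => [|p l IH] //; rewrite lsum_cons -IH; ring.
  by rewrite bsumS IH -lsum_plus; apply: lsum_ext => p; rewrite bsumS; ring.
rewrite -lsum_scal /carre; apply: lsum_le_In => p Hp.
have Hrate : 0 <= p.1.
  move: Hp => /In_moves [j [_ [[_ ->]|[_ ->]]]] /=; last lra.
  exact: exp_ge0.
rewrite !EU -Rmult_minus_distr_l.
have -> : bsum k.+1 (fun j => c j * Vexp b p.2 j) - bsum k.+1 (fun j => c j * Vexp b q j) =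
  bsum k.+1 (fun j => c j * (Vexp b p.2 j - Vexp b q j)).
  have -> u v : u - v = u + (-1) * v by lra.
  by rewrite -bsum_scal -bsum_plus; apply: bsum_ext => j _; ring.
have [k0 Hk0] := moves_single_site _ b q p HQ Hp.
rewrite Rpow_mult_distr (bsum_single_sq _ _ k0); last by move=> j Hj; rewrite Hk0 //; ring.
rewrite pow_inv; have HI : 0 < / INR N ^ 2 by apply: Rinv_0_lt_compat; exact: pow_lt.
rewrite -Rmult_assoc [p.1 * _]Rmult_comm Rmult_assoc; apply: Rmult_le_compat_l; first lra.
apply: Rmult_le_compat_l => //; apply: bsum_le => j _; rewrite Rpow_mult_distr.
have := pow2_ge_0 (Vexp b p.2 j - Vexp b q j).
by rewrite /c; case: j => [|j]; rewrite ?pow1; lra.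
Qed.

(** * Supermartingales and transition probabilities *)

(* Coquelicot lemmas leave equations typed in the sort of R_NormedModule, where ring and lra fail. *)
Ltac eqR := match goal with |- @eq _ ?a ?b => change (@eq R a b) end.

Lemma sum_n_bsum (a : nat -> R) n : sum_n a n = bsum n.+1 a.
Proof.
elim: n => [|n IH]; first by rewrite sum_O /=; lra.
by rewrite sum_Sn IH [RHS]bsumS.
Qed.

Lemma continuous_lsum {T : Type} (f : T -> R -> R) (l : seq T) t :
  (forall p, List.In p l -> continuous (f p) t) ->
  continuous (fun s => lsum (fun p => f p s) l) t.
Proof.
elim: l => [|a l IH] H; first exact: continuous_const.
apply: (continuous_plus (f a) (fun s => lsum (fun p => f p s) l)); first by apply: H; left.
by apply: IH => p Hp; apply: H; right.
Qed.

Lemma continuous_bsum n (f : nat -> R -> R) t :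
  (forall k, (k < n)%N -> continuous (f k) t) -> continuous (fun s => bsum n (fun k => f k s)) t.
Proof.
elim: n => [|n IH] H; first exact: continuous_const.
apply: (continuous_plus (fun s => bsum n (fun k => f k s)) (f n)); last exact: H.
by apply: IH => k Hk; apply: H; lia.
Qed.

Lemma continuous_exp_scal a t : continuous (fun s => exp (a * s)) t.
Proof. by apply: ex_derive_continuous; auto_derive. Qed.

Lemma ex_RInt_cont (f : R -> R) a b : (forall t, continuous f t) -> ex_RInt f a b.
Proof. by move=> H; apply: ex_RInt_continuous => z _. Qed.

Lemma RInt_plusR (f g : R -> R) a b :
  (forall t, continuous f t) -> (forall t, continuous g t) ->
  RInt (fun s => f s + g s) a b = RInt f a b + RInt g a b.
Proof. by move=> Hf Hg; apply: (RInt_plus (V := R_CompleteNormedModule)); apply: ex_RInt_cont. Qed.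

Lemma RInt_scalR (f : R -> R) c a b :
  (forall t, continuous f t) -> RInt (fun s => c * f s) a b = c * RInt f a b.
Proof. by move=> Hf; apply: (RInt_scal (V := R_CompleteNormedModule)); apply: ex_RInt_cont. Qed.

Lemma RInt_lsum {T : Type} (f : T -> R -> R) (l : seq T) a b :
  (forall p t, List.In p l -> continuous (f p) t) ->
  RInt (fun s => lsum (fun p => f p s) l) a b = lsum (fun p => RInt (f p) a b) l.
Proof.
elim: l => [|p l IH] H.
  by rewrite RInt_const /scal /= /mult /= /lsum /=; lra.
have Hp t : continuous (f p) t by apply: H; left.
have Hl t : continuous (fun s => lsum (fun p => f p s) l) t.
  by apply: continuous_lsum => r Hr; apply: H; right.
rewrite lsum_cons -IH; last by move=> r t Hr; apply: H; right.
by rewrite -RInt_plusR.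
Qed.

Lemma lsum_ge0_In {T : Type} (f : T -> R) (l : seq T) :
  (forall x, List.In x l -> 0 <= f x) -> 0 <= lsum f l.
Proof.
elim: l => [|a l IH] H; first exact: Rle_refl.
rewrite lsum_cons; apply: Rplus_le_le_0_compat; first by apply: H; left.
by apply: IH => x Hx; apply: H; right.
Qed.

Definition pstep (rt : seq nat -> seq (R * seq nat)) n x y (u : R) : R :=
  lsum (fun p : R * seq nat => p.1 * pjump rt n p.2 y u) (rt x).

Lemma pjump_S_continuous rt n :
  (forall x y t, continuous (pjump rt n x y) t) ->
  forall x y t, continuous (pstep rt n x y) t.
Proof.
move=> H x y t; apply: continuous_lsum => p _.
by apply: (continuous_scal_r p.1 (pjump rt n p.2 y)).
Qed.

Lemma continuous_comp_refl (f : R -> R) t s : (forall u, continuous f u) -> continuous (fun u => f (t - u)) s.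
Proof.
move=> H; apply: (continuous_comp (fun u => t - u) f); last exact: H.
by apply: ex_derive_continuous; auto_derive.
Qed.

(** The variable t occurs both in the limit of integration and in the integrand. Substituting s -> t
    - s pulls exp (- lam t) out and leaves a primitive of a continuous function. *)
Lemma pjump_continuous rt n x y t : continuous (pjump rt n x y) t.
Proof.
elim: n x y t => [|n IH] x y t.
  rewrite /=; case: eqP => _; [exact: continuous_exp_scal|exact: continuous_const].
have Hk := pjump_S_continuous rt n IH x y.
pose h u := exp (lam (rt x) * u) * pstep rt n x y u.
have Hh u : continuous h u.
  by apply: (continuous_mult (fun u => exp (lam (rt x) * u)) (pstep rt n x y)); [exact: continuous_exp_scal|].
have E s : pjump rt n.+1 x y s = exp (- lam (rt x) * s) * RInt h 0 s.
  rewrite -[pjump _ _ _ _ _]/(RInt (fun u => exp (- lam (rt x) * u) * pstep rt n x y (s - u)) 0 s).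
  have Hr := RInt_comp_lin (V := R_CompleteNormedModule) h (-1) s 0 s.
  rewrite Rmult_0_r Rplus_0_l in Hr.
  have E1 : -1 * s + s = 0 by lra.
  rewrite E1 in Hr.
  have {}Hr := Hr (ex_RInt_cont _ _ _ Hh).
  have <- : - RInt h s 0 = RInt h 0 s by apply: (opp_RInt_swap h); exact: ex_RInt_cont.
  rewrite -Hr.
  have Hc u : continuous (fun u => h (-1 * u + s)) u.
    apply: (continuous_comp (fun u => -1 * u + s) h); last exact: Hh.
    by apply: ex_derive_continuous; auto_derive.
  rewrite (RInt_scalR (fun u => h (-1 * u + s)) (-1)) //.
  have -> a r : a * - (-1 * r) = a * r by ring.
  rewrite -RInt_scalR //.
  apply: RInt_ext => u _; rewrite /h.
  have -> : -1 * u + s = s - u by lra.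
  have -> : exp (- lam (rt x) * u) = exp (- lam (rt x) * s) * exp (lam (rt x) * (s - u)).
    by rewrite -exp_plus; congr exp; ring.
  by eqR; ring.
apply: (continuous_ext (fun s => exp (- lam (rt x) * s) * RInt h 0 s)); first by move=> s; rewrite E.
apply: (continuous_mult (fun u => exp (- lam (rt x) * u)) (RInt h 0)); first exact: continuous_exp_scal.
apply: ex_derive_continuous; exists (h t).
apply: (is_derive_RInt h (RInt h 0) 0 t); last exact: Hh.
apply: filter_forall => u; apply: (RInt_correct (V := R_CompleteNormedModule)); exact: ex_RInt_cont.
Qed.

Lemma pjump_ge0 rt n x y t : (forall x p, List.In p (rt x) -> 0 <= p.1) -> 0 <= t -> 0 <= pjump rt n x y t.
Proof.
move=> Hr; elim: n x y t => [|n IH] x y t Ht.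
  rewrite /=; case: eqP => _; last lra.
  exact: exp_ge0.
apply: RInt_ge_0 => //.
  apply: ex_RInt_cont => s.
  apply: (continuous_mult (fun u => exp (- lam (rt x) * u)) (fun s => pstep rt n x y (t - s))); first exact: continuous_exp_scal.
  by apply: continuous_comp_refl; apply: pjump_S_continuous; exact: pjump_continuous.
move=> s Hs; apply: Rmult_le_pos; first exact: exp_ge0.
rewrite -[sumR _]/(pstep rt n x y (t - s)).
apply: lsum_ge0_In => p Hp; apply: Rmult_le_pos; [apply: Hr Hp|apply: IH; lra].
Qed.

Lemma nonincreasing_of_derive (G : R -> R) t : 0 <= t ->
  (forall s, 0 <= s <= t -> continuous G s) ->
  (forall s, 0 < s < t -> exists d, is_derive G s d /\ d <= 0) -> G t <= G 0.
Proof.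
move=> Ht Hc Hd.
(* The intermediate point may be an endpoint, where nothing is known about the derivative; the
   [Rmin] makes the sign right there too. *)
have [||c [_ E]] := MVT_gen G 0 t (fun s => Rmin 0 (Derive G s)).
- move=> s; rewrite Rmin_left // Rmax_right // => Hs; have [d [Hd1 Hd2]] := Hd s Hs.
  by rewrite (is_derive_unique _ _ _ Hd1) Rmin_right.
- move=> s; rewrite Rmin_left // Rmax_right // => Hs.
  by apply/continuity_pt_filterlim; apply: Hc.
have := Rmin_l 0 (Derive G c); nra.
Qed.

(** The expectation of FT at time t, restricted to fewer than n jumps and to final states in Y. Both
    truncations keep the sums finite and, for nonnegative FT, only lower the value. *)
Definition pjump_mean (rt : seq nat -> seq (R * seq nat)) (FT : seq nat -> R) (Y : seq (seq nat)) n x t : R :=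
  lsum (fun y => bsum n (fun m => pjump rt m x y t) * FT y) Y.

Lemma pjump_mean_continuous rt FT Y n x t : continuous (pjump_mean rt FT Y n x) t.
Proof.
apply: continuous_lsum => y _.
apply: (continuous_mult (fun t => bsum n (fun m => pjump rt m x y t)) (fun=> FT y)); last exact: continuous_const.
by apply: continuous_bsum => k _; exact: pjump_continuous.
Qed.

(** Decomposition at the first jump. *)
Lemma pjump_mean_S rt FT Y n x t :
  pjump_mean rt FT Y n.+1 x t = lsum (fun y => pjump rt 0 x y t * FT y) Y +
  RInt (fun s => exp (- lam (rt x) * s) * lsum (fun p => p.1 * pjump_mean rt FT Y n p.2 (t - s)) (rt x)) 0 t.
Proof.
have Hc m y s : continuous (fun s => exp (- lam (rt x) * s) * pstep rt m x y (t - s)) s.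
  apply: (continuous_mult (fun u => exp (- lam (rt x) * u)) (fun s => pstep rt m x y (t - s))); first exact: continuous_exp_scal.
  by apply: continuous_comp_refl; apply: pjump_S_continuous; exact: pjump_continuous.
have Hb k y s : continuous (fun s => bsum k (fun m => exp (- lam (rt x) * s) * pstep rt m x y (t - s))) s.
  by apply: continuous_bsum => m _; apply: Hc.
have HI y : bsum n (fun m => pjump rt m.+1 x y t) =
    RInt (fun s => bsum n (fun m => exp (- lam (rt x) * s) * pstep rt m x y (t - s))) 0 t.
  elim: (n) => [|k IH]; first by rewrite /= RInt_const /scal /= /mult /=; lra.
  rewrite bsumS IH -[pjump _ _ _ _ _]/(RInt (fun u => exp (- lam (rt x) * u) * pstep rt k x y (t - u)) 0 t).
  by rewrite -RInt_plusR.
rewrite /pjump_mean.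
rewrite (lsum_ext _ (fun y => pjump rt 0 x y t * FT y +
   RInt (fun s => FT y * bsum n (fun m => exp (- lam (rt x) * s) * pstep rt m x y (t - s))) 0 t)); last first.
  move=> y; rewrite bsum_recl HI RInt_scal; last by apply: ex_RInt_cont.
  by rewrite /scal /= /mult /=; ring.
rewrite lsum_plus -RInt_lsum; last by move=> y s _; apply: (continuous_scal_r (FT y)); exact: Hb.
congr (_ + _); apply: RInt_ext => s _.
rewrite -lsum_scal.
rewrite (lsum_ext _ (fun y => lsum (fun p => exp (- lam (rt x) * s) * (p.1 * (bsum n (fun m => pjump rt m p.2 y (t - s)) * FT y))) (rt x))).
  rewrite lsum_exchange; apply: lsum_ext => p; rewrite !lsum_scal //.
move=> y; rewrite bsum_scal.
have -> : bsum n (fun m => pstep rt m x y (t - s)) = lsum (fun p => p.1 * bsum n (fun m => pjump rt m p.2 y (t - s))) (rt x).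
  elim: (n) => [|k IH].
    by rewrite /=; elim: (rt x) => [|p l IHl] //; rewrite lsum_cons -IHl; ring.
  rewrite bsumS IH /pstep -lsum_plus; apply: lsum_ext => p; rewrite bsumS; ring.
rewrite lsum_scal -Rmult_assoc [FT y * _]Rmult_comm Rmult_assoc; congr (_ * _).
rewrite -lsum_scal; apply: lsum_ext => p; ring.
Qed.

(** The analytic condition (d/ds + L) F <= 0, required on the states of [good] only, a set to be
    invariant under the moves. *)
Definition supermartingale (rt : seq nat -> seq (R * seq nat)) (good : seq nat -> bool)
  (F : R -> seq nat -> R) (T : R) : Prop :=
  (forall s x, 0 <= s <= T -> 0 <= F s x) /\
  (forall x s, continuous (fun s => F s x) s) /\
  (forall x s, good x -> 0 < s < T ->
    exists d, is_derive (fun s => F s x) s d /\ d + gen (rt x) (F s) x <= 0).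

Lemma gen_lam rs F q : gen rs F q = lsum (fun p => p.1 * F p.2) rs - lam rs * F q.
Proof.
have -> : lam rs * F q = lsum (fun p => F q * p.1) rs by rewrite lsum_scal Rmult_comm.
by rewrite /gen; elim: rs => [|p l IH]; rewrite ?lsum_cons ?IH /lsum /=; ring.
Qed.

(** Induction on the number of jumps: after the first jump at time s, the induction hypothesis
    bounds the rest by F (T - (t - s)), and the variation-of-constants formula closes the step. The
    truncated mean starts at 0 <= F. *)
Lemma pjump_mean_le rt (good : seq nat -> bool) F T Y n x t :
  (forall x p, List.In p (rt x) -> 0 <= p.1) ->
  (forall x p, good x -> List.In p (rt x) -> good p.2) ->
  supermartingale rt good F T ->
  uniq Y -> good x -> 0 <= t <= T -> pjump_mean rt (F T) Y n x t <= F (T - t) x.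
Proof.
move=> Hr0 Hrg [F0 [Fc Fd]] HY; elim: n x t => [|n IH] x t Hx Ht.
  apply: (Rle_trans _ 0); last by apply: F0; lra.
  by rewrite /pjump_mean lsum0; [lra|move=> y _ /=; ring].
set l := lam (rt x).
pose K s := lsum (fun p => p.1 * F (T - t + s) p.2) (rt x).
have HFc y s : continuous (fun s => F (T - t + s) y) s.
  apply: (continuous_comp (fun s => T - t + s) (fun s => F s y)); last exact: Fc.
  by apply: ex_derive_continuous; auto_derive.
have HK s : continuous K s.
  by apply: continuous_lsum => p _; apply: (continuous_scal_r p.1 (fun s => F (T - t + s) p.2)).
pose k s := exp (- l * s) * K s.
have Hk s : continuous k s.
  by apply: (continuous_mult (fun s => exp (- l * s)) K); first exact: continuous_exp_scal.
have HM p s : continuous (fun s => p.1 * pjump_mean rt (F T) Y n p.2 (t - s)) s.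
  apply: (continuous_scal_r p.1 (fun s => pjump_mean rt (F T) Y n p.2 (t - s))).
  by apply: continuous_comp_refl; exact: pjump_mean_continuous.
have H1 : lsum (fun y => pjump rt 0 x y t * F T y) Y <= exp (- l * t) * F T x.
  have H0 : 0 <= F T x by apply: F0; lra.
  case Hin: (x \in Y).
    rewrite (lsum_rem _ x) // lsum0.
      by rewrite /= eqxx -/l; lra.
    move=> y; rewrite mem_rem_uniq // inE => /andP [/negbTE Hy _].
    by rewrite /= eq_sym Hy; ring.
  rewrite lsum0; first by apply: Rmult_le_pos => //; exact: exp_ge0.
  move=> y Hy /=; case: eqP => [E|_]; last ring.
  by move: Hy; rewrite -E Hin.
have H2 : RInt (fun s => exp (- l * s) * lsum (fun p => p.1 * pjump_mean rt (F T) Y n p.2 (t - s)) (rt x)) 0 t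
    <= RInt k 0 t.
  apply: RInt_le; first lra.
  - apply: ex_RInt_cont => s.
    apply: (continuous_mult (fun s => exp (- l * s)) (fun s => lsum (fun p => p.1 * pjump_mean rt (F T) Y n p.2 (t - s)) (rt x))).
      exact: continuous_exp_scal.
    by apply: continuous_lsum => p _; apply: HM.
  - exact: ex_RInt_cont.
  - move=> s Hs; apply: Rmult_le_compat_l; first exact: exp_ge0.
    apply: lsum_le_In => p Hp; apply: Rmult_le_compat_l; first exact: Hr0 Hp.
    have -> : T - t + s = T - (t - s) by lra.
    by apply: IH; [apply: Hrg Hp|lra].
(* Its derivative is exp (- l s) times (d/ds + L) F, hence nonpositive. G 0 is the desired bound,
   and G t dominates the first-jump decomposition. *)
pose G s := exp (- l * s) * F (T - t + s) x + RInt k 0 s.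
have HI s : is_derive (RInt k 0) s (k s).
  apply: (is_derive_RInt k (RInt k 0) 0 s); last exact: Hk.
  by apply: filter_forall => u; apply: (RInt_correct (V := R_CompleteNormedModule)); exact: ex_RInt_cont.
have HG : G t <= G 0.
  apply: nonincreasing_of_derive => [|s _|s Hs]; first lra.
    apply: (continuous_plus (fun s => exp (- l * s) * F (T - t + s) x) (RInt k 0)).
      by apply: (continuous_mult (fun s => exp (- l * s)) (fun s => F (T - t + s) x)); [exact: continuous_exp_scal|].
    by apply: ex_derive_continuous; exists (k s).
  have [d [Hd1 Hd2]] := Fd x (T - t + s) Hx ltac:(lra).
  exists (exp (- l * s) * (- l * F (T - t + s) x + d) + k s); split.
    have Hd' : is_derive (fun s => F (T - t + s) x) s d.
      have := is_derive_comp (fun s => F s x) (fun s => T - t + s) s d 1 Hd1.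
      rewrite /scal /= /mult /= Rmult_1_l; apply.
      by auto_derive => //; ring.
    apply: (is_derive_plus (fun s => exp (- l * s) * F (T - t + s) x) (RInt k 0)) => //.
    have -> : exp (- l * s) * (- l * F (T - t + s) x + d) =
      plus (mult (exp (- l * s) * - l) (F (T - t + s) x)) (mult (exp (- l * s)) d).
      by rewrite /plus /mult /=; ring.
    apply: (is_derive_mult (fun s => exp (- l * s)) (fun s => F (T - t + s) x)) => //.
      by auto_derive => //; ring.
    by move=> a b; exact: Rmult_comm.
  move: Hd2; rewrite gen_lam -/l -/(K s) /k => Hd2.
  have := exp_pos (- l * s) => He.
  have -> : exp (- l * s) * (- l * F (T - t + s) x + d) + exp (- l * s) * K s =
    exp (- l * s) * (d + (K s - l * F (T - t + s) x)) by ring.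
  nra.
move: HG; rewrite /G Rplus_0_r RInt_point /zero /= Rmult_0_r exp_0.
have -> : T - t + t = T by lra.
rewrite pjump_mean_S -/l; lra.
Qed.

Lemma pjump_sum_le1 rt (good : seq nat -> bool) x y n t :
  (forall x p, List.In p (rt x) -> 0 <= p.1) ->
  (forall x p, good x -> List.In p (rt x) -> good p.2) ->
  good x -> 0 <= t -> bsum n (fun m => pjump rt m x y t) <= 1.
Proof.
move=> Hr0 Hrg Hx Ht.
have := pjump_mean_le rt good (fun _ _ => 1) t [:: y] n x t Hr0 Hrg.
rewrite /pjump_mean /lsum /= Rmult_1_r Rplus_0_r; apply => //; last lra.
split; first by move=> *; lra.
split; first by move=> *; exact: continuous_const.
move=> z s _ _; exists 0; split; first by apply: (is_derive_const (V := R_NormedModule)).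
by rewrite gen_const; lra.
Qed.

Lemma ex_trans rt (good : seq nat -> bool) x y t :
  (forall x p, List.In p (rt x) -> 0 <= p.1) ->
  (forall x p, good x -> List.In p (rt x) -> good p.2) ->
  good x -> 0 <= t -> ex_series (fun n => pjump rt n x y t).
Proof.
move=> Hr0 Hrg Hx Ht; apply: (proj1 (is_series_nonneg_bounded _ 1 _ _)).
- by move=> n; apply: pjump_ge0.
- by move=> n; rewrite sum_n_bsum; apply: (pjump_sum_le1 rt good).
Qed.

Lemma trans_ge0 rt (good : seq nat -> bool) x y t :
  (forall x p, List.In p (rt x) -> 0 <= p.1) ->
  (forall x p, good x -> List.In p (rt x) -> good p.2) ->
  good x -> 0 <= t -> 0 <= trans rt t x y.
Proof.
move=> Hr0 Hrg Hx Ht.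
apply: Rle_trans (sum_n_le_Series _ 0 _ (ex_trans rt good x y t Hr0 Hrg Hx Ht)); last by move=> n; apply: pjump_ge0.
by rewrite sum_O; apply: pjump_ge0.
Qed.

Lemma trans_mean_le_all rt (good : seq nat -> bool) F T x g :
  (forall x p, List.In p (rt x) -> 0 <= p.1) ->
  (forall x p, good x -> List.In p (rt x) -> good p.2) ->
  supermartingale rt good F T -> good x -> 0 <= T ->
  (forall y, 0 <= g y <= F T y) ->
  0 <= sumQ (fun y => trans rt T x y * g y) <= F 0 x.
Proof.
move=> Hr0 Hrg HF Hx HT Hg.
have Hpos y : 0 <= trans rt T x y * g y.
  by apply: Rmult_le_pos; [apply: (trans_ge0 rt good)|move: (Hg y); lra].
split; first exact: sumQ_ge0.
apply: (proj2 (sumQ_le _ _ Hpos _)) => Y HY.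
have HL : is_lim_seq (fun n => lsum (fun y => bsum n.+1 (fun m => pjump rt m x y T) * g y) Y)
    (lsum (fun y => trans rt T x y * g y) Y).
  elim: (Y) => [|y l IH]; first exact: is_lim_seq_const.
  apply: is_lim_seq_plus'; last exact: IH.
  apply: is_lim_seq_mult'; last exact: is_lim_seq_const.
  apply: (is_lim_seq_ext (sum_n (fun m => pjump rt m x y T))); first by move=> n; rewrite sum_n_bsum.
  by apply: Series_correct; apply: (ex_trans rt good).
apply: (is_lim_seq_le _ _ (Finite _) (Finite (F 0 x)) _ HL (is_lim_seq_const _)) => n.
have := pjump_mean_le rt good F T Y n.+1 x T Hr0 Hrg HF HY Hx ltac:(lra).
rewrite Rminus_diag; apply: Rle_trans; apply: lsum_le => y.
apply: Rmult_le_compat_l; last by move: (Hg y); lra.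
by apply: bsum_ge0 => k _; apply: pjump_ge0.
Qed.

(* The indicator of the complement of [good] is a supermartingale. *)
Lemma trans_not_good rt (good : seq nat -> bool) x y t :
  (forall x p, List.In p (rt x) -> 0 <= p.1) ->
  (forall x p, good x -> List.In p (rt x) -> good p.2) ->
  good x -> 0 <= t -> ~~ good y -> trans rt t x y = 0.
Proof.
move=> Hr0 Hrg Hx Ht Hy.
pose F (_ : R) z := if good z then 0 else 1.
have HF : supermartingale rt good F t.
  split; first by move=> s z _; rewrite /F; case: (good z); lra.
  split; first by move=> z s; exact: continuous_const.
  move=> z s Hz _; exists 0; split; first by apply: (is_derive_const (V := R_NormedModule)).
  rewrite Rplus_0_l /gen /F Hz; apply: (Rle_trans _ (lsum (fun=> 0 * 0) (rt z))); last by rewrite lsum_scal; lra.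
  by apply: lsum_le_In => p Hp; rewrite (Hrg z p Hz Hp); lra.
have E n : sum_n (fun m => pjump rt m x y t) n = 0.
  rewrite sum_n_bsum; apply: Rle_antisym; last first.
    by apply: bsum_ge0 => k _; apply: pjump_ge0.
  have := pjump_mean_le rt good F t [:: y] n.+1 x t Hr0 Hrg HF isT Hx ltac:(lra).
  by rewrite /pjump_mean /F /lsum /sumR [map _ _]/= [foldr _ _ _]/= (negbTE Hy) Hx Rmult_1_r Rplus_0_r.
by rewrite /trans /Series (Lim_seq_ext _ _ E) Lim_seq_const.
Qed.

Lemma trans_mean_le rt (good : seq nat -> bool) F T x g :
  (forall x p, List.In p (rt x) -> 0 <= p.1) ->
  (forall x p, good x -> List.In p (rt x) -> good p.2) ->
  supermartingale rt good F T -> good x -> 0 <= T ->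
  (forall y, good y -> 0 <= g y <= F T y) ->
  0 <= sumQ (fun y => trans rt T x y * g y) <= F 0 x.
Proof.
move=> Hr0 Hrg HF Hx HT Hg.
rewrite (sumQ_ext _ (fun y => trans rt T x y * (if good y then g y else 0))).
  apply: (trans_mean_le_all rt good) => // y; case Ey: (good y); first exact: Hg.
  by split; [lra|apply: HF.1; lra].
move=> y; case Ey: (good y) => //.
by rewrite (trans_not_good rt good) ?Ey //; ring.
Qed.

(** * Gaussian averages *)

(** The integral over the line through symmetric windows; [dom] provides the convergence and an
    explicit tail bound. *)
Definition gI (F : R -> R) : R := real (Lim_seq (fun n => RInt F (- INR n) (INR n))).

Definition dom (C : R) (F : R -> R) : Prop :=
  (forall z, continuous F z) /\ forall z, Rabs (F z) <= C * exp (- Rabs z).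

Lemma dom_C_ge0 C F : dom C F -> 0 <= C.
Proof.
case=> _ /(_ 0); rewrite Rabs_R0 Ropp_0 exp_0 Rmult_1_r; have := Rabs_pos (F 0); lra.
Qed.

Lemma is_derive_RInt_sym (F : R -> R) y : (forall z, continuous F z) ->
  is_derive (fun y => RInt F (- y) y) y (F y + F (- y)).
Proof.
move=> HF.
have HI s : is_derive (RInt F 0) s (F s).
  apply: (is_derive_RInt F (RInt F 0) 0 s); last exact: HF.
  by apply: filter_forall => u; apply: (RInt_correct (V := R_CompleteNormedModule)); exact: ex_RInt_cont.
apply: (is_derive_ext (fun y => RInt F 0 y - RInt F 0 (- y))).
  move=> t; rewrite -(RInt_Chasles F (- t) 0 t); try exact: ex_RInt_cont.
  rewrite -(opp_RInt_swap F (- t) 0); last exact: ex_RInt_cont.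
  by rewrite /plus /opp /=; eqR; ring.
have -> : F y + F (- y) = minus (F y) (scal (-1) (F (- y))).
  by rewrite /minus /plus /opp /scal /= /mult /=; ring.
apply: (is_derive_minus (RInt F 0) (fun y => RInt F 0 (- y))) => //.
apply: (is_derive_comp (RInt F 0) (fun y => - y)) => //.
by auto_derive => //; ring.
Qed.

(** The integral over [-y, y] plus 2 C exp (- y) is nonincreasing in y. *)
Lemma RInt_sym_incr (F : R -> R) (C x y : R) : (forall z, continuous F z) ->
  (forall z, F z <= C * exp (- Rabs z)) -> 0 <= x <= y ->
  RInt F (- y) y - RInt F (- x) x <= 2 * C * (exp (- x) - exp (- y)).
Proof.
move=> HF Hle Hxy.
pose G s := RInt F (- (x + s)) (x + s) + 2 * C * exp (- (x + s)).
have HD s : is_derive G s (F (x + s) + F (- (x + s)) + - (2 * C * exp (- (x + s)))).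
  apply: (is_derive_plus (fun s => RInt F (- (x + s)) (x + s)) (fun s => 2 * C * exp (- (x + s)))).
    have -> : F (x + s) + F (- (x + s)) = scal 1 (F (x + s) + F (- (x + s))) by rewrite /scal /= /mult /=; ring.
    apply: (is_derive_comp (fun y => RInt F (- y) y) (fun s => x + s)); first exact: is_derive_RInt_sym.
    by auto_derive => //; ring.
  by auto_derive => //; ring.
have := nonincreasing_of_derive G (y - x).
have -> : G (y - x) = RInt F (- y) y + 2 * C * exp (- y).
  by rewrite /G; have -> : x + (y - x) = y by lra.
rewrite /G Rplus_0_r => H.
suff : RInt F (- y) y + 2 * C * exp (- y) <= RInt F (- x) x + 2 * C * exp (- x) by lra.
apply: H => [|s _|s Hs]; first lra.
  by apply: ex_derive_continuous; eexists; exact: HD.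
eexists; split; first exact: HD.
have := Hle (x + s); have := Hle (- (x + s)); rewrite Rabs_Ropp Rabs_right; lra.
Qed.

Lemma RInt_opp_fun (F : R -> R) a b : (forall z, continuous F z) -> RInt (fun z => - F z) a b = - RInt F a b.
Proof.
move=> HF; rewrite -[RHS]Rmult_1_l -Ropp_mult_distr_r Ropp_mult_distr_l -RInt_scalR //.
by apply: RInt_ext => z _; eqR; ring.
Qed.

Lemma dom_opp C F : dom C F -> dom C (fun z => - F z).
Proof.
move=> [Hc Hb]; split => z; last by rewrite Rabs_Ropp.
exact: (continuous_opp F).
Qed.

Lemma RInt_sym_cauchy C F x y : dom C F -> 0 <= x <= y ->
  Rabs (RInt F (- y) y - RInt F (- x) x) <= 2 * C * exp (- x).
Proof.
move=> HF Hxy; have HC := dom_C_ge0 _ _ HF; have Hy := exp_pos (- y).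
have [Hc Hb] := HF.
have H1 := RInt_sym_incr F C x y Hc (fun z => Rle_trans _ _ _ (Rle_abs _) (Hb z)) Hxy.
have [Hc' Hb'] := dom_opp _ _ HF.
have H2 := RInt_sym_incr _ C x y Hc' (fun z => Rle_trans _ _ _ (Rle_abs _) (Hb' z)) Hxy.
rewrite !RInt_opp_fun // in H2.
apply: Rabs_le; nra.
Qed.

Lemma exp_neg_INR_lim0 : is_lim_seq (fun n => exp (- INR n)) 0.
Proof.
apply: (is_lim_seq_ext (fun n => (exp (-1)) ^ n)).
  elim=> [|n IH]; first by rewrite /= Ropp_0 exp_0.
  by rewrite S_INR Ropp_plus_distr Rplus_comm exp_plus -IH.
apply: is_lim_seq_geom; rewrite Rabs_exp.
by rewrite -exp_0; apply: exp_increasing; lra.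
Qed.

Lemma gI_lim C F : dom C F -> is_lim_seq (fun n => RInt F (- INR n) (INR n)) (gI F).
Proof.
move=> HF; have HC := dom_C_ge0 _ _ HF.
have [l Hl] : ex_finite_lim_seq (fun n => RInt F (- INR n) (INR n)).
  apply/ex_lim_seq_cauchy_corr => e.
  have [N HN] := proj1 (is_lim_seq_eps _ _) exp_neg_INR_lim0 (e / (4 * C + 1)) ltac:(apply: Rdiv_lt_0_compat; [exact: cond_pos|lra]).
  exists N => n m Hn Hm.
  have HeN : 4 * C * exp (- INR N) < e.
    have := HN N (leqnn N); rewrite Rminus_0_r Rabs_exp.
    have H := exp_pos (- INR N); move/(Rmult_lt_compat_r (4 * C + 1) _ _ ltac:(lra)).
    by rewrite /Rdiv Rmult_assoc Rinv_l; nra.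
  have H1 := RInt_sym_cauchy C F (INR N) (INR n) HF (conj (pos_INR _) (le_INR _ _ Hn)).
  have H2 := RInt_sym_cauchy C F (INR N) (INR m) HF (conj (pos_INR _) (le_INR _ _ Hm)).
  move: H1 H2; set a := RInt F _ _; set b := RInt F _ _; set c := RInt F _ _ => H1 H2.
  have -> : a - c = (a - b) - (c - b) by ring.
  by apply: Rle_lt_trans (Rabs_triang _ _) _; rewrite Rabs_Ropp; lra.
by rewrite /gI (is_lim_seq_unique _ _ Hl).
Qed.

Lemma gI_tail C F n : dom C F -> Rabs (gI F - RInt F (- INR n) (INR n)) <= 2 * C * exp (- INR n).
Proof.
move=> HF; have HL := gI_lim C F HF.
apply: (is_lim_seq_le_loc (fun m => Rabs (RInt F (- INR m) (INR m) - RInt F (- INR n) (INR n))) (fun=> 2 * C * exp (- INR n))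
  (Finite (Rabs (gI F - RInt F (- INR n) (INR n)))) (Finite (2 * C * exp (- INR n)))).
- exists n => m Hm; apply: RInt_sym_cauchy => //; split; [exact: pos_INR|exact: le_INR].
- apply: (is_lim_seq_abs _ (Finite _)); apply: is_lim_seq_minus' => //; exact: is_lim_seq_const.
- exact: is_lim_seq_const.
Qed.

Lemma dom_plus C C' F G : dom C F -> dom C' G -> dom (C + C') (fun z => F z + G z).
Proof.
move=> [Hc Hb] [Hc' Hb']; split => z; first exact: (continuous_plus F G).
apply: Rle_trans (Rabs_triang _ _) _; have := Hb z; have := Hb' z; lra.
Qed.

Lemma dom_scal c C F : dom C F -> dom (Rabs c * C) (fun z => c * F z).
Proof.
move=> [Hc Hb]; split => z; first exact: (continuous_scal_r c F).
by rewrite Rabs_mult Rmult_assoc; apply: Rmult_le_compat_l; [exact: Rabs_pos|].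
Qed.

Lemma gI_plus C C' F G : dom C F -> dom C' G -> gI (fun z => F z + G z) = gI F + gI G.
Proof.
move=> HF HG.
have H1 := gI_lim _ _ (dom_plus _ _ _ _ HF HG).
have H2 : is_lim_seq (fun n => RInt (fun z => F z + G z) (- INR n) (INR n)) (gI F + gI G).
  apply: (is_lim_seq_ext (fun n => RInt F (- INR n) (INR n) + RInt G (- INR n) (INR n))).
    by move=> n; rewrite RInt_plusR //; [apply: HF.1|apply: HG.1].
  by apply: is_lim_seq_plus'; apply: gI_lim; eassumption.
have := is_lim_seq_unique _ _ H1; rewrite (is_lim_seq_unique _ _ H2) => -[]//.
Qed.

Lemma gI_scal C c F : dom C F -> gI (fun z => c * F z) = c * gI F.
Proof.
move=> HF.
have H1 := gI_lim _ _ (dom_scal c _ _ HF).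
have H2 : is_lim_seq (fun n => RInt (fun z => c * F z) (- INR n) (INR n)) (c * gI F).
  apply: (is_lim_seq_ext (fun n => c * RInt F (- INR n) (INR n))).
    by move=> n; rewrite RInt_scalR //; apply: HF.1.
  by apply: is_lim_seq_mult'; [exact: is_lim_seq_const|apply: gI_lim; eassumption].
have := is_lim_seq_unique _ _ H1; rewrite (is_lim_seq_unique _ _ H2) => -[]//.
Qed.

Lemma gI_ext F G : (forall z, F z = G z) -> gI F = gI G.
Proof.
by move=> H; rewrite /gI; congr real; apply: Lim_seq_ext => n; apply: RInt_ext => z _; rewrite H.
Qed.

Lemma gI_le C C' F G : dom C F -> dom C' G -> (forall z, F z <= G z) -> gI F <= gI G.
Proof.
move=> HF HG H.
apply: (is_lim_seq_le _ _ (Finite _) (Finite _) _ (gI_lim _ _ HF) (gI_lim _ _ HG)) => n.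
apply: RInt_le => //; first by have := pos_INR n; lra.
- by apply: ex_RInt_cont; apply: HF.1.
- by apply: ex_RInt_cont; apply: HG.1.
Qed.

Lemma gI_opp C F : dom C F -> gI (fun z => - F z) = - gI F.
Proof.
by move=> HF; rewrite -[RHS]Rmult_1_l -Ropp_mult_distr_r Ropp_mult_distr_l -(gI_scal C) //; apply: gI_ext => z; ring.
Qed.

Lemma gI_abs_le C C' F G : dom C F -> dom C' G -> (forall z, Rabs (F z) <= G z) -> Rabs (gI F) <= gI G.
Proof.
move=> HF HG H; apply: Rabs_le; split.
  rewrite -(gI_opp C') //; apply: (gI_le _ _ _ _ (dom_opp _ _ HG) HF) => z.
  by have := H z; move/Rabs_le_between; lra.
apply: (gI_le _ _ _ _ HF HG) => z; have := H z; move/Rabs_le_between; lra.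
Qed.

(** Plays the role of dominated convergence: first n is chosen for the tail, then the integrand is
    made uniformly small on the window. *)
Lemma gI_small C F n eta : dom C F -> (forall z, Rabs z <= INR n -> Rabs (F z) <= eta) ->
  Rabs (gI F) <= 2 * INR n * eta + 2 * C * exp (- INR n).
Proof.
move=> HF H.
have Hn := pos_INR n.
have H1 : Rabs (RInt F (- INR n) (INR n)) <= 2 * INR n * eta.
  have -> : 2 * INR n * eta = (INR n - - INR n) * eta by ring.
  apply: abs_RInt_le_const; [lra|by apply: ex_RInt_cont; apply: HF.1|].
  by move=> z Hz; apply: H; apply: Rabs_le.
have := gI_tail C F n HF => H2.
have -> : gI F = RInt F (- INR n) (INR n) + (gI F - RInt F (- INR n) (INR n)) by ring.
by apply: Rle_trans (Rabs_triang _ _) _; lra.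
Qed.

Lemma gI_odd C F : dom C F -> (forall z, F (- z) = - F z) -> gI F = 0.
Proof.
move=> HF Hodd.
have E n : RInt F (- INR n) (INR n) = 0.
  have H : forall G, (forall z, continuous G z) -> (forall z, G (- z) = - G z) -> RInt G (- INR n) (INR n) <= 0.
    move=> G HG HoG; have := nonincreasing_of_derive (fun y => RInt G (- y) y) (INR n) (pos_INR n).
    rewrite Ropp_0 RInt_point; apply => [s _|s _].
      by apply: ex_derive_continuous; eexists; exact: is_derive_RInt_sym.
    by exists (G s + G (- s)); split; [exact: is_derive_RInt_sym|rewrite HoG; lra].
  have [Hc _] := HF; apply: Rle_antisym; first exact: H.
  have := H (fun z => - F z) (dom_opp _ _ HF).1; rewrite RInt_opp_fun //.
  move=> /(_ (fun z => _)) H'; have := H' (fun z => f_equal Ropp (Hodd z)); lra.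
have := gI_lim C F HF => /is_lim_seq_unique.
by rewrite (Lim_seq_ext _ _ E) Lim_seq_const => -[].
Qed.

Lemma RInt_le_gI C F n : dom C F -> (forall z, 0 <= F z) -> RInt F (- INR n) (INR n) <= gI F.
Proof.
move=> HF H0.
apply: (is_lim_seq_le_loc (fun=> RInt F (- INR n) (INR n)) _ (Finite _) (Finite _) _ (is_lim_seq_const _) (gI_lim _ _ HF)).
exists n => m Hm; have := RInt_sym_incr (fun z => - F z) 0 (INR n) (INR m) (dom_opp _ _ HF).1.
rewrite !RInt_opp_fun ?Rmult_0_r ?Rmult_0_l; try exact: HF.1.
move=> H; suff : - RInt F (- INR m) (INR m) - - RInt F (- INR n) (INR n) <= 0 by lra.
apply: H; first by move=> z; rewrite Rmult_0_l; have := H0 z; lra.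
by split; [exact: pos_INR|exact: le_INR].
Qed.

(** * Gaussian averages of functions of exponential growth *)

Definition gk (k : nat) (z : R) : R := z ^ k * exp (- z ^ 2).

(** The transformed initial profile grows like exp (beta |y| / 2), which fits rate 1 because beta <=
    2. *)
Definition growth (L : R) (f : R -> R) : Prop :=
  (forall y, continuous f y) /\ forall y, Rabs (f y) <= L * exp (Rabs y).

Lemma growth_ge0 L f : growth L f -> 0 <= L.
Proof. by case=> _ /(_ 0); rewrite Rabs_R0 exp_0; have := Rabs_pos (f 0); lra. Qed.

Lemma gk_continuous k z : continuous (gk k) z.
Proof. by apply: ex_derive_continuous; rewrite /gk; auto_derive. Qed.

Lemma gk_bound k z : (k <= 2)%N -> Rabs (gk k z) <= 2 * exp (- (z ^ 2 / 2)).
Proof.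
move=> Hk; rewrite /gk Rabs_mult Rabs_exp.
have -> : - z ^ 2 = - (z ^ 2 / 2) + - (z ^ 2 / 2) by field.
rewrite exp_plus -Rmult_assoc; apply: Rmult_le_compat_r; first exact: exp_ge0.
have E : exp (z ^ 2 / 2) * exp (- (z ^ 2 / 2)) = 1 by rewrite -exp_plus -exp_0; congr exp; lra.
have Hp := exp_pos (- (z ^ 2 / 2)).
apply: (Rle_trans _ (2 * exp (z ^ 2 / 2) * exp (- (z ^ 2 / 2)))); last by rewrite Rmult_assoc E; lra.
apply: Rmult_le_compat_r; first lra.
have H1 := exp_ineq1_le (z ^ 2 / 2); have H2 := pow2_ge_0 z.
rewrite -RPow_abs.
have H3 : Rabs z ^ 2 = z ^ 2 by rewrite pow2_abs.
have H4 := Rabs_pos z.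
case: k Hk => [|[|[|k]]] // _; rewrite ?pow_O ?pow_1 ?H3; [lra| |lra].
have := pow2_ge_0 (Rabs z - 1); nra.
Qed.

Lemma gk_le2 k z : (k <= 2)%N -> Rabs (gk k z) <= 2.
Proof.
move=> Hk; apply: Rle_trans (gk_bound k z Hk) _.
have : exp (- (z ^ 2 / 2)) <= exp 0 by apply: exp_le; have := pow2_ge_0 z; lra.
by rewrite exp_0; lra.
Qed.

(** Completing the square: A |z| - z^2 / 2 <= (A + 1)^2 / 2 - |z|. *)
Lemma gk_exp_bound k z A : (k <= 2)%N -> 0 <= A ->
  Rabs (gk k z) * exp (A * Rabs z) <= 2 * exp ((A + 1) ^ 2 / 2) * exp (- Rabs z).
Proof.
move=> Hk HA; apply: (Rle_trans _ (2 * exp (- (z ^ 2 / 2)) * exp (A * Rabs z))).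
  by apply: Rmult_le_compat_r; [exact: exp_ge0|exact: gk_bound].
rewrite !Rmult_assoc -!exp_plus; apply: Rmult_le_compat_l; first lra.
apply: exp_le; rewrite -(pow2_abs z).
have := pow2_ge_0 (Rabs z - (A + 1)); nra.
Qed.

Lemma gauss_dom k L f x r X A : (k <= 2)%N -> growth L f -> Rabs x <= X -> Rabs r <= A ->
  dom (2 * L * exp X * exp ((A + 1) ^ 2 / 2)) (fun z => gk k z * f (x + r * z)).
Proof.
move=> Hk Hf Hx Hr; have HL := growth_ge0 _ _ Hf; have [Hc Hb] := Hf; split => z.
  apply: (continuous_mult (gk k) (fun z => f (x + r * z))); first exact: gk_continuous.
  apply: (continuous_comp (fun z => x + r * z) f); last exact: Hc.
  by apply: ex_derive_continuous; auto_derive.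
have HA : 0 <= A by have := Rabs_pos r; lra.
have Hz := Rabs_pos z.
rewrite Rabs_mult.
apply: (Rle_trans _ (Rabs (gk k z) * (L * (exp X * exp (A * Rabs z))))).
  apply: Rmult_le_compat_l; first exact: Rabs_pos.
  apply: Rle_trans (Hb _) _; apply: Rmult_le_compat_l => //.
  rewrite -exp_plus; apply: exp_le; apply: Rle_trans (Rabs_triang _ _) _.
  by rewrite Rabs_mult; have : Rabs r * Rabs z <= A * Rabs z by [apply: Rmult_le_compat_r]; lra.
have := gk_exp_bound k z A Hk HA => H.
have -> : Rabs (gk k z) * (L * (exp X * exp (A * Rabs z))) = (L * exp X) * (Rabs (gk k z) * exp (A * Rabs z)) by ring.
have -> : 2 * L * exp X * exp ((A + 1) ^ 2 / 2) * exp (- Rabs z) =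
  (L * exp X) * (2 * exp ((A + 1) ^ 2 / 2) * exp (- Rabs z)) by ring.
apply: Rmult_le_compat_l => //; apply: Rmult_le_pos => //; exact: exp_ge0.
Qed.

(** The space point x and the scale r are kept as independent variables, so that time derivatives
    come from the chain rule with r = 2 sqrt t. *)
Definition gM (k : nat) (f : R -> R) (x r : R) : R := gI (fun z => gk k z * f (x + r * z)).

Lemma heine (f : R -> R) A e : (forall y, continuous f y) -> 0 < e ->
  exists d, 0 < d /\ forall y y', Rabs y <= A -> Rabs y' <= A -> Rabs (y - y') < d -> Rabs (f y - f y') < e.
Proof.
move=> Hf He.
have [d Hd] := Heine_cor2 (f := f) (a := - A) (b := A) (fun y _ => proj2 (continuity_pt_filterlim f y) (Hf y)) (mkposreal e He).
by exists d; split; [exact: cond_pos|move=> y y' Hy Hy'; apply: Hd; apply/Rabs_le_between].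
Qed.

Lemma exp_neg_small C e : 0 <= C -> 0 < e -> exists n : nat, C * exp (- INR n) < e.
Proof.
move=> HC He.
have [N HN] := proj1 (is_lim_seq_eps _ _) exp_neg_INR_lim0 (e / (C + 1)) ltac:(apply: Rdiv_lt_0_compat; lra).
exists N; have := HN N (leqnn N); rewrite Rminus_0_r Rabs_exp.
have H := exp_pos (- INR N); move/(Rmult_lt_compat_r (C + 1) _ _ ltac:(lra)).
by rewrite /Rdiv Rmult_assoc Rinv_l; nra.
Qed.

Lemma gM_cont_eps k L f x r e : (k <= 2)%N -> growth L f -> 0 < e ->
  exists d, 0 < d /\ forall x' r', Rabs (x' - x) < d -> Rabs (r' - r) < d ->
    Rabs (gM k f x' r' - gM k f x r) < e.
Proof.
move=> Hk Hf He; have HL := growth_ge0 _ _ Hf.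
pose X := Rabs x + 1; pose A := Rabs r + 1.
pose C := 2 * L * exp X * exp ((A + 1) ^ 2 / 2).
have HC : 0 <= C.
  by apply: Rmult_le_pos; [apply: Rmult_le_pos; [lra|]|]; exact: exp_ge0.
have [n Hn] := exp_neg_small (4 * C) (e / 2) ltac:(lra) ltac:(lra).
have Hn0 := pos_INR n.
have [d [Hd Hdf]] := heine f (X + A * INR n) (e / (8 * (INR n + 1))) Hf.1 ltac:(apply: Rdiv_lt_0_compat; lra).
have Hdn : 0 < d / (INR n + 1) by apply: Rdiv_lt_0_compat; lra.
exists (Rmin 1 (d / (INR n + 1))); split; first by apply: Rmin_glb_lt; lra.
move=> x' r' Hx' Hr'.
have := Rmin_l 1 (d / (INR n + 1)); have := Rmin_r 1 (d / (INR n + 1)) => M1 M2.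
have HX' : Rabs x' <= X by have := Rabs_triang_inv x' x; rewrite /X; lra.
have HR' : Rabs r' <= A by have := Rabs_triang_inv r' r; rewrite /A; lra.
have HX : Rabs x <= X by rewrite /X; lra.
have HR : Rabs r <= A by rewrite /A; lra.
have D1 := gauss_dom k L f x' r' X A Hk Hf HX' HR'.
have D0 := gauss_dom k L f x r X A Hk Hf HX HR.
have D := dom_plus _ _ _ _ D1 (dom_opp _ _ D0); rewrite -/C in D.
have -> : gM k f x' r' - gM k f x r = gI (fun z => gk k z * f (x' + r' * z) + - (gk k z * f (x + r * z))).
  by rewrite (gI_plus C C) // ?(gI_opp C) //; exact: dom_opp.
apply: Rle_lt_trans (gI_small _ _ n (e / (4 * (INR n + 1))) D _) _.
  move=> z Hz.
  have -> : gk k z * f (x' + r' * z) + - (gk k z * f (x + r * z)) = gk k z * (f (x' + r' * z) - f (x + r * z)) by ring.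
  rewrite Rabs_mult.
  have Hg := gk_le2 k z Hk.
  have Hz0 := Rabs_pos z; have Hr0 := Rabs_pos r; have Hr0' := Rabs_pos r'.
  have B s y : Rabs y <= X -> Rabs s <= A -> Rabs (y + s * z) <= X + A * INR n.
    move=> Hy Hs; apply: Rle_trans (Rabs_triang _ _) _; rewrite Rabs_mult.
    have : Rabs s * Rabs z <= A * INR n by apply: Rmult_le_compat => //; exact: Rabs_pos.
    lra.
  have : Rabs (f (x' + r' * z) - f (x + r * z)) < e / (8 * (INR n + 1)).
    apply: Hdf; try by apply: B.
    have -> : x' + r' * z - (x + r * z) = (x' - x) + (r' - r) * z by ring.
    apply: Rle_lt_trans (Rabs_triang _ _) _; rewrite Rabs_mult.
    have : Rabs (r' - r) * Rabs z <= d / (INR n + 1) * INR n by apply: Rmult_le_compat => //; [exact: Rabs_pos|lra].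
    have : d / (INR n + 1) + d / (INR n + 1) * INR n = d by field; lra.
    lra.
  have -> : e / (4 * (INR n + 1)) = 2 * (e / (8 * (INR n + 1))) by field; lra.
  by have := Rabs_pos (f (x' + r' * z) - f (x + r * z)); move=> *; apply: Rmult_le_compat => //; [exact: Rabs_pos|lra].
have : 2 * INR n * (e / (4 * (INR n + 1))) <= e / 2.
  apply: (Rmult_le_reg_r (4 * (INR n + 1))); first lra.
  have -> : 2 * INR n * (e / (4 * (INR n + 1))) * (4 * (INR n + 1)) = 2 * INR n * e by field; lra.
  nra.
lra.
Qed.

(** Differentiation under the integral along the direction (a, c), which covers the x and the r
    derivative at once. The factor z produced by the scale raises the moment from k to k+1. *)
Lemma gM_derive k L L' f f' x r a c : (k.+1 <= 2)%N -> growth L f -> growth L' f' ->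
  (forall y, is_derive f y (f' y)) ->
  is_derive (fun s => gM k f (x + s * a) (r + s * c)) 0 (a * gM k f' x r + c * gM k.+1 f' x r).
Proof.
move=> Hk Hf Hf' Hd; have HL := growth_ge0 _ _ Hf'.
have Hk' : (k <= 2)%N by lia.
pose X := Rabs x + Rabs a; pose A := Rabs r + Rabs c.
have Ha := Rabs_pos a; have Hc := Rabs_pos c; have Hx := Rabs_pos x; have Hr := Rabs_pos r.
pose Q := 2 * exp X * exp ((A + 1) ^ 2 / 2).
have HQ : 0 <= Q by apply: Rmult_le_pos; [apply: Rmult_le_pos; [lra|]|]; exact: exp_ge0.
pose C := 2 * L' * (Rabs a + Rabs c) * Q.
have HC : 0 <= C by apply: Rmult_le_pos => //; apply: Rmult_le_pos; lra.
apply/is_derive_Reals => e He.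
have [n Hn] := exp_neg_small (2 * C) (e / 2) ltac:(lra) ltac:(lra).
have Hn0 := pos_INR n.
pose W := (2 * INR n + 1) * (2 * (Rabs a + Rabs c * INR n) + 1).
have HW : 0 < W by apply: Rmult_lt_0_compat; [lra|have : 0 <= Rabs c * INR n by apply: Rmult_le_pos]; lra.
have [d [Hd0 Hdf]] := heine f' (X + A * INR n) (e / (2 * W)) Hf'.1 ltac:(apply: Rdiv_lt_0_compat; lra).
pose B := Rabs a + Rabs c * INR n + 1.
have HB : 0 < B by rewrite /B; have : 0 <= Rabs c * INR n by [apply: Rmult_le_pos]; lra.
have HdB : 0 < d / B by apply: Rdiv_lt_0_compat.
have Hdel : 0 < Rmin 1 (d / B) by apply: Rmin_glb_lt; lra.
exists (mkposreal _ Hdel) => s Hs0 /= Hs.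
have M1 := Rmin_l 1 (d / B); have M2 := Rmin_r 1 (d / B).
have Habs := Rabs_pos s.
have HX' : Rabs (x + s * a) <= X.
  by apply: Rle_trans (Rabs_triang _ _) _; rewrite Rabs_mult /X; nra.
have HR' : Rabs (r + s * c) <= A.
  by apply: Rle_trans (Rabs_triang _ _) _; rewrite Rabs_mult /A; nra.
have HX : Rabs x <= X by rewrite /X; lra.
have HR : Rabs r <= A by rewrite /A; lra.
have D1 := gauss_dom k L f (x + s * a) (r + s * c) X A Hk' Hf HX' HR'.
have D0 := gauss_dom k L f x r X A Hk' Hf HX HR.
have D2 := gauss_dom k L' f' x r X A Hk' Hf' HX HR.
have D3 := gauss_dom k.+1 L' f' x r X A Hk Hf' HX HR.
rewrite Rplus_0_l !Rmult_0_l !Rplus_0_r.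
(* H is the difference quotient minus its limit. The domination [DH] degenerates like 1/s; [HMV]
   rewrites H by the mean value theorem, which gives in [HDC] a constant independent of s. *)
pose H z := (/ s * (gk k z * f (x + s * a + (r + s * c) * z)) + (- / s) * (gk k z * f (x + r * z)))
   + ((- a) * (gk k z * f' (x + r * z)) + (- c) * (gk k.+1 z * f' (x + r * z))).
have DH := dom_plus _ _ _ _ (dom_plus _ _ _ _ (dom_scal (/ s) _ _ D1) (dom_scal (- / s) _ _ D0))
                    (dom_plus _ _ _ _ (dom_scal (- a) _ _ D2) (dom_scal (- c) _ _ D3)).
rewrite -/H in DH.
have -> : (gM k f (x + s * a) (r + s * c) - gM k f x r) / s - (a * gM k f' x r + c * gM k.+1 f' x r) = gI H.
  rewrite /H.
  rewrite (gI_plus _ _ _ _ (dom_plus _ _ _ _ (dom_scal (/ s) _ _ D1) (dom_scal (- / s) _ _ D0))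
                    (dom_plus _ _ _ _ (dom_scal (- a) _ _ D2) (dom_scal (- c) _ _ D3))).
  rewrite (gI_plus _ _ _ _ (dom_scal (/ s) _ _ D1) (dom_scal (- / s) _ _ D0)).
  rewrite (gI_plus _ _ _ _ (dom_scal (- a) _ _ D2) (dom_scal (- c) _ _ D3)).
  rewrite (gI_scal _ _ _ D1) (gI_scal _ _ _ D0) (gI_scal _ _ _ D2) (gI_scal _ _ _ D3) -/(gM _ _ _ _).
  by rewrite -/(gM k f x r) -/(gM k f' x r) -/(gM k.+1 f' x r); field.
have HMV z : exists xi, Rabs (xi - (x + r * z)) <= Rabs s * (Rabs a + Rabs c * Rabs z) /\
    H z = (a * gk k z + c * gk k.+1 z) * (f' xi - f' (x + r * z)).
  have [||xi [Hxi E]] := MVT_gen f (x + r * z) (x + s * a + (r + s * c) * z) f'.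
  - by move=> y _.
  - by move=> y _; apply/continuity_pt_filterlim; apply: Hf.1.
  exists xi; split.
    have Hm : Rabs (xi - (x + r * z)) <= Rabs (s * (a + c * z)).
      move: Hxi; have -> : x + s * a + (r + s * c) * z = x + r * z + s * (a + c * z) by ring.
      move: (x + r * z) (s * (a + c * z)) => u w.
      rewrite /Rmin /Rmax; case: Rle_dec => H1 Hxi.
        by rewrite [Rabs w]Rabs_right; [rewrite Rabs_right; lra|lra].
      by rewrite [Rabs w]Rabs_left; [rewrite Rabs_left1; lra|lra].
    apply: Rle_trans Hm _; rewrite Rabs_mult; apply: Rmult_le_compat_l => //.
    by apply: Rle_trans (Rabs_triang _ _) _; rewrite Rabs_mult; lra.
  have -> : H z = gk k z * (f (x + s * a + (r + s * c) * z) - f (x + r * z)) / s - (a * gk k z + c * gk k.+1 z) * f' (x + r * z).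
    by rewrite /H; field.
  by rewrite E /gk /=; field.
have HDC : dom C H.
  split; first exact: DH.1.
  move=> z; have [xi [Hxi ->]] := HMV z.
  have Hz := Rabs_pos z.
  have HAz : Rabs (x + r * z) <= X + A * Rabs z.
    by apply: Rle_trans (Rabs_triang _ _) _; rewrite Rabs_mult; nra.
  have Hxi2 : Rabs xi <= X + A * Rabs z.
    have -> : xi = (xi - (x + r * z)) + (x + r * z) by ring.
    apply: Rle_trans (Rabs_triang _ _) _.
    have : Rabs (x + r * z) <= Rabs x + Rabs r * Rabs z.
      by apply: Rle_trans (Rabs_triang _ _) _; rewrite Rabs_mult; lra.
    have : 0 <= Rabs c * Rabs z by apply: Rmult_le_pos.
    rewrite /X /A; nra.
  have Hfb y : Rabs y <= X + A * Rabs z -> Rabs (f' y) <= L' * (exp X * exp (A * Rabs z)).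
    move=> Hy; apply: Rle_trans (Hf'.2 y) _; apply: Rmult_le_compat_l => //.
    by rewrite -exp_plus; apply: exp_le.
  have Hdiff : Rabs (f' xi - f' (x + r * z)) <= 2 * L' * (exp X * exp (A * Rabs z)).
    apply: Rle_trans (Rabs_triang _ _) _; rewrite Rabs_Ropp.
    by have := Hfb _ Hxi2; have := Hfb _ HAz; lra.
  have HA0 : 0 <= A by rewrite /A; lra.
  have G1 := gk_exp_bound k z A Hk' HA0; have G2 := gk_exp_bound k.+1 z A Hk HA0.
  rewrite Rabs_mult.
  have Hsum : Rabs (a * gk k z + c * gk k.+1 z) <= Rabs a * Rabs (gk k z) + Rabs c * Rabs (gk k.+1 z).
    by apply: Rle_trans (Rabs_triang _ _) _; rewrite !Rabs_mult; lra.
  apply: (Rle_trans _ ((Rabs a * Rabs (gk k z) + Rabs c * Rabs (gk k.+1 z)) * (2 * L' * (exp X * exp (A * Rabs z))))).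
    by apply: Rmult_le_compat => //; exact: Rabs_pos.
  have -> : (Rabs a * Rabs (gk k z) + Rabs c * Rabs (gk k.+1 z)) * (2 * L' * (exp X * exp (A * Rabs z))) =
    2 * L' * exp X * (Rabs a * (Rabs (gk k z) * exp (A * Rabs z)) + Rabs c * (Rabs (gk k.+1 z) * exp (A * Rabs z))) by ring.
  have -> : C * exp (- Rabs z) = 2 * L' * exp X * (Rabs a * (2 * exp ((A + 1) ^ 2 / 2) * exp (- Rabs z)) + Rabs c * (2 * exp ((A + 1) ^ 2 / 2) * exp (- Rabs z))).
    by rewrite /C /Q; ring.
  apply: Rmult_le_compat_l; first by apply: Rmult_le_pos; [lra|exact: exp_ge0].
  by apply: Rplus_le_compat; apply: Rmult_le_compat_l.
pose eta := 2 * (Rabs a + Rabs c * INR n) * (e / (2 * W)).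
have HeW : 0 < e / (2 * W) by apply: Rdiv_lt_0_compat; lra.
apply: Rle_lt_trans (gI_small _ _ n eta HDC _) _.
  move=> z Hz; have [xi [Hxi ->]] := HMV z.
  have Hz0 := Rabs_pos z.
  have Hcz : Rabs c * Rabs z <= Rabs c * INR n by apply: Rmult_le_compat_l.
  have Hcz0 : 0 <= Rabs c * Rabs z by apply: Rmult_le_pos.
  have Hrz : Rabs r * Rabs z <= Rabs r * INR n by apply: Rmult_le_compat_l.
  have Hrz0 : 0 <= Rabs r * Rabs z by apply: Rmult_le_pos.
  have HAz1 : Rabs (x + r * z) <= Rabs x + Rabs r * Rabs z.
    by apply: Rle_trans (Rabs_triang _ _) _; rewrite Rabs_mult; lra.
  have HAz : Rabs (x + r * z) <= X + A * INR n by rewrite /X /A; nra.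
  have Hxi2 : Rabs xi <= X + A * INR n.
    have -> : xi = (xi - (x + r * z)) + (x + r * z) by ring.
    apply: Rle_trans (Rabs_triang _ _) _; rewrite /X /A; nra.
  have Hclose : Rabs (xi - (x + r * z)) < d.
    apply: Rle_lt_trans Hxi _.
    have : Rabs s * B < d.
      have : Rabs s * B < d / B * B by apply: Rmult_lt_compat_r; lra.
      by have -> : d / B * B = d by [field; lra].
    rewrite /B; nra.
  have := Hdf xi (x + r * z) Hxi2 HAz Hclose => Hfd.
  rewrite Rabs_mult /eta; apply: Rmult_le_compat; try exact: Rabs_pos; last lra.
  have -> : a * gk k z + c * gk k.+1 z = (a + c * z) * gk k z by rewrite /gk /=; ring.
  rewrite Rabs_mult.
  have Hg := gk_le2 k z Hk'.
  have : Rabs (a + c * z) <= Rabs a + Rabs c * INR n.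
    by apply: Rle_trans (Rabs_triang _ _) _; rewrite Rabs_mult; lra.
  have := Rabs_pos (a + c * z); have := Rabs_pos (gk k z); nra.
have : 2 * INR n * eta <= e / 2; last lra.
have -> : e / 2 = W * (e / (2 * W)) by field; lra.
rewrite /eta -Rmult_assoc; apply: Rmult_le_compat_r; first lra.
by rewrite /W; have : 0 <= Rabs c * INR n by [apply: Rmult_le_pos]; nra.
Qed.

(** Integration by parts, as z exp (- z^2) is the derivative of - exp (- z^2) / 2; the boundary
    terms vanish by domination. *)
Lemma gM_ibp L L' f f' x r : growth L f -> growth L' f' -> (forall y, is_derive f y (f' y)) ->
  gM 1 f x r = r / 2 * gM 0 f' x r.
Proof.
move=> Hf Hf' Hd.
have D1 := gauss_dom 1 L f x r (Rabs x) (Rabs r) isT Hf (Rle_refl _) (Rle_refl _).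
have D0 := gauss_dom 0 L f x r (Rabs x) (Rabs r) isT Hf (Rle_refl _) (Rle_refl _).
have D2 := gauss_dom 0 L' f' x r (Rabs x) (Rabs r) isT Hf' (Rle_refl _) (Rle_refl _).
have D3 := dom_scal (- (r / 2)) _ _ D2.
have D := dom_plus _ _ _ _ D1 D3.
suff : gI (fun z => gk 1 z * f (x + r * z) + - (r / 2) * (gk 0 z * f' (x + r * z))) = 0.
  by rewrite (gI_plus _ _ _ _ D1 D3) (gI_scal _ _ _ D2) -/(gM 1 f x r) -/(gM 0 f' x r); lra.
pose P z := - / 2 * (gk 0 z * f (x + r * z)).
have HP z : is_derive P z (gk 1 z * f (x + r * z) + - (r / 2) * (gk 0 z * f' (x + r * z))).
  have -> : gk 1 z * f (x + r * z) + - (r / 2) * (gk 0 z * f' (x + r * z)) =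
    scal (- / 2) (plus (mult (- 2 * z * exp (- z ^ 2)) (f (x + r * z))) (mult (gk 0 z) (r * f' (x + r * z)))).
    by rewrite /scal /plus /mult /= /mult /= /gk /=; field.
  apply: (is_derive_scal (fun z => gk 0 z * f (x + r * z))).
  apply: (is_derive_mult (gk 0) (fun z => f (x + r * z))); last by move=> u w; exact: Rmult_comm.
    by rewrite /gk; auto_derive => //; rewrite /=; ring.
  apply: (is_derive_comp f (fun z => x + r * z)); first exact: Hd.
  by auto_derive => //; ring.
have HI n : RInt (fun z => gk 1 z * f (x + r * z) + - (r / 2) * (gk 0 z * f' (x + r * z))) (- INR n) (INR n) = P (INR n) - P (- INR n).
  apply: is_RInt_unique; apply: (is_RInt_derive P) => z _; first exact: HP.
  exact: D.1.
have := gI_lim _ _ D => /is_lim_seq_unique.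
rewrite (Lim_seq_ext _ _ HI) => HL.
have : is_lim_seq (fun n => P (INR n) - P (- INR n)) 0.
  move: D0 => []; set C := (2 * _ * _ * _) => _ HC.
  have HC0 : 0 <= C by have := HC 0; rewrite Rabs_R0 Ropp_0 exp_0; have := Rabs_pos (gk 0 0 * f (x + r * 0)); lra.
  apply/is_lim_seq_eps => e He.
  have [N HN] := proj1 (is_lim_seq_eps _ _) exp_neg_INR_lim0 (e / (C + 1)) ltac:(apply: Rdiv_lt_0_compat; lra).
  exists N => n Hn; have := HN n Hn; rewrite !Rminus_0_r Rabs_exp.
  have H := exp_pos (- INR n); move/(Rmult_lt_compat_r (C + 1) _ _ ltac:(lra)).
  rewrite /Rdiv Rmult_assoc Rinv_l; last lra.
  move=> H2; apply: Rle_lt_trans (Rabs_triang _ _) _; rewrite Rabs_Ropp /P.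
  have := HC (INR n); have := HC (- INR n).
  rewrite Rabs_Ropp [Rabs (INR n)]Rabs_right; last by apply: Rle_ge; exact: pos_INR.
  rewrite !(Rabs_mult (- / 2)) [Rabs (- / 2)]Rabs_Ropp (Rabs_right (/ 2)); last lra.
  lra.
by move/is_lim_seq_unique; rewrite HL => -[].
Qed.

(** * The heat flow *)

Definition gmass : R := gI (gk 0).

Lemma gk0_gt0 z : 0 < gk 0 z.
Proof. by rewrite /gk /= Rmult_1_l; exact: exp_pos. Qed.

Lemma growth_const c : growth (Rabs c) (fun=> c).
Proof.
split => y; first exact: continuous_const.
have : 1 <= exp (Rabs y) by rewrite -exp_0; apply: exp_le; exact: Rabs_pos.
have := Rabs_pos c; nra.
Qed.

Lemma gmass_gt0 : 0 < gmass.
Proof.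
have D := gauss_dom 0 _ _ 0 0 0 0 isT (growth_const 1) ltac:(rewrite Rabs_R0; lra) ltac:(rewrite Rabs_R0; lra).
have E : gmass = gI (fun z => gk 0 z * 1) by apply: gI_ext => z; ring.
rewrite E; apply: Rlt_le_trans (RInt_le_gI _ _ 1 D _); last by move=> z; have := gk0_gt0 z; lra.
apply: RInt_gt_0; first by rewrite /=; lra.
  by move=> z _; have := gk0_gt0 z; lra.
by move=> z _; exact: D.1.
Qed.

(** The heat kernel after the substitution y = x + 2 sqrt t z, regular at t = 0. Since [sqrt] is 0
    on negative numbers, the flow is the identity for t <= 0, so continuity and growth hold for
    every real t. *)
Definition heat (f : R -> R) (t x : R) : R := gM 0 f x (2 * sqrt t) / gmass.
(** The space derivative of the flow written without differentiating f. It gives the second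
    derivative of [heat f] when f' is only continuous, at the price of 1 / sqrt t. *)
Definition heat1 (f : R -> R) (t x : R) : R := gM 1 f x (2 * sqrt t) / (gmass * sqrt t).

Lemma continuous_R2 (F : R -> R -> R) t x :
  (forall e, 0 < e -> exists d, 0 < d /\ forall t' x', Rabs (t' - t) < d -> Rabs (x' - x) < d ->
     Rabs (F t' x' - F t x) < e) ->
  continuous (fun q : R * R => F (fst q) (snd q)) (t, x).
Proof.
move=> H; apply/filterlim_locally => e; have [d [Hd HF]] := H e (cond_pos e).
exists (mkposreal d Hd) => -[t' x'] [/= H1 H2]; exact: HF.
Qed.

Lemma continuous_R2_inv (F : R -> R -> R) t x :
  continuous (fun q : R * R => F (fst q) (snd q)) (t, x) ->
  (forall e, 0 < e -> exists d, 0 < d /\ forall t' x', Rabs (t' - t) < d -> Rabs (x' - x) < d ->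
     Rabs (F t' x' - F t x) < e).
Proof.
move/filterlim_locally => H e He; have [d Hd] := H (mkposreal e He).
exists d; split; first exact: cond_pos.
by move=> t' x' H1 H2; apply: (Hd (t', x')); split.
Qed.

Lemma continuous_eps (f : R -> R) t : continuous f t ->
  forall e, 0 < e -> exists d, 0 < d /\ forall s, Rabs (s - t) < d -> Rabs (f s - f t) < e.
Proof.
move/filterlim_locally => H e He; have [d Hd] := H (mkposreal e He).
by exists d; split; [exact: cond_pos|exact: Hd].
Qed.

Lemma continuous_of_eps (f : R -> R) t :
  (forall e, 0 < e -> exists d, 0 < d /\ forall s, Rabs (s - t) < d -> Rabs (f s - f t) < e) ->
  continuous f t.
Proof.
move=> H; apply/filterlim_locally => e; have [d [Hd Hf]] := H e (cond_pos e).
by exists (mkposreal d Hd).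
Qed.

Lemma gM_sqrt_continuous k L f t x : (k <= 2)%N -> growth L f ->
  continuous (fun q : R * R => gM k f (snd q) (2 * sqrt (fst q))) (t, x).
Proof.
move=> Hk Hf; apply: (continuous_R2 (fun t x => gM k f x (2 * sqrt t))) => e He.
have [d [Hd HM]] := gM_cont_eps k L f x (2 * sqrt t) e Hk Hf He.
have [d' [Hd' Hs]] := continuous_eps sqrt t (continuous_sqrt t) (d / 2) ltac:(lra).
exists (Rmin d d'); split; first by apply: Rmin_glb_lt.
have M1 := Rmin_l d d'; have M2 := Rmin_r d d'.
move=> t' x' Ht Hx; apply: HM; first lra.
rewrite -Rmult_minus_distr_l Rabs_mult Rabs_right; last lra.
have := Hs t' ltac:(lra); lra.
Qed.

Lemma heat_continuous L f t x : growth L f ->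
  continuous (fun q : R * R => heat f (fst q) (snd q)) (t, x).
Proof.
move=> Hf; apply: (continuous_mult (fun q : R * R => gM 0 f (snd q) (2 * sqrt (fst q))) (fun=> / gmass)).
  exact: (gM_sqrt_continuous 0 L).
exact: continuous_const.
Qed.

Lemma heat1_continuous L f t x : growth L f -> 0 < t ->
  continuous (fun q : R * R => heat1 f (fst q) (snd q)) (t, x).
Proof.
move=> Hf Ht; apply: (continuous_mult (fun q : R * R => gM 1 f (snd q) (2 * sqrt (fst q))) (fun q => / (gmass * sqrt (fst q)))).
  exact: (gM_sqrt_continuous 1 L).
apply: (continuous_comp (fst : R * R -> R) (fun t => / (gmass * sqrt t))).
  exact: continuous_fst.
have Hp : gmass * sqrt t <> 0.
  by have := Rmult_lt_0_compat _ _ gmass_gt0 (sqrt_lt_R0 t Ht); lra.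
by apply: ex_derive_continuous; auto_derive.
Qed.

Lemma is_derive_shift (f : R -> R) (x l : R) : is_derive (fun s => f (x + s)) 0 l -> is_derive f x l.
Proof.
move=> H; apply: (is_derive_ext (fun y => (fun s => f (x + s)) (y - x))).
  by move=> y; congr f; ring.
have -> : l = scal 1 l by rewrite /scal /= /mult /=; ring.
apply: (is_derive_comp (fun s => f (x + s)) (fun y => y - x)).
  by have -> : x - x = 0 by ring.
by auto_derive => //; ring.
Qed.

Lemma gM_dx k L L' f f' x r : (k.+1 <= 2)%N -> growth L f -> growth L' f' ->
  (forall y, is_derive f y (f' y)) -> is_derive (fun x => gM k f x r) x (gM k f' x r).
Proof.
move=> Hk Hf Hf' Hd; apply: is_derive_shift.
have := gM_derive k L L' f f' x r 1 0 Hk Hf Hf' Hd.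
rewrite Rmult_1_l Rmult_0_l Rplus_0_r; apply: is_derive_ext => s.
by rewrite Rmult_1_r Rmult_0_r Rplus_0_r.
Qed.

Lemma gM_dr k L L' f f' x r : (k.+1 <= 2)%N -> growth L f -> growth L' f' ->
  (forall y, is_derive f y (f' y)) -> is_derive (fun r => gM k f x r) r (gM k.+1 f' x r).
Proof.
move=> Hk Hf Hf' Hd; apply: is_derive_shift.
have := gM_derive k L L' f f' x r 0 1 Hk Hf Hf' Hd.
rewrite Rmult_1_l Rmult_0_l Rplus_0_l; apply: is_derive_ext => s.
by rewrite Rmult_1_r Rmult_0_r Rplus_0_r.
Qed.

Lemma heat_dx L L' f f' t x : growth L f -> growth L' f' ->
  (forall y, is_derive f y (f' y)) -> is_derive (fun x => heat f t x) x (heat f' t x).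
Proof.
move=> Hf Hf' Hd; rewrite /heat.
apply: (is_derive_ext (fun x => / gmass * gM 0 f x (2 * sqrt t))); first by move=> y; eqR; rewrite /Rdiv; ring.
have -> : gM 0 f' x (2 * sqrt t) / gmass = scal (/ gmass) (gM 0 f' x (2 * sqrt t)).
  by rewrite /scal /= /mult /= /Rdiv; ring.
by apply: (is_derive_scal (fun x => gM 0 f x (2 * sqrt t))); apply: (gM_dx 0 L L').
Qed.

Lemma heat_dt L L' f f' t x : growth L f -> growth L' f' -> 0 < t ->
  (forall y, is_derive f y (f' y)) -> is_derive (fun t => heat f t x) t (heat1 f' t x).
Proof.
move=> Hf Hf' Ht Hd; rewrite /heat /heat1.
have Hs := sqrt_lt_R0 t Ht; have Hg := gmass_gt0.
apply: (is_derive_ext (fun t => / gmass * gM 0 f x (2 * sqrt t))); first by move=> y; eqR; rewrite /Rdiv; ring.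
have -> : gM 1 f' x (2 * sqrt t) / (gmass * sqrt t) = scal (/ gmass) (scal (/ sqrt t) (gM 1 f' x (2 * sqrt t))).
  by rewrite /scal /= /mult /=; field; lra.
apply: (is_derive_scal (fun t => gM 0 f x (2 * sqrt t))).
apply: (is_derive_comp (fun r => gM 0 f x r) (fun t => 2 * sqrt t)).
  exact: (gM_dr 0 L L').
by auto_derive => //; field; lra.
Qed.

Lemma heat1_heat L L' f f' t x : growth L f -> growth L' f' -> 0 < t ->
  (forall y, is_derive f y (f' y)) -> heat1 f t x = heat f' t x.
Proof.
move=> Hf Hf' Ht Hd; rewrite /heat /heat1 (gM_ibp L L' f f') //.
by have := sqrt_lt_R0 t Ht; have := gmass_gt0; move=> *; field; lra.
Qed.

(** [heat f'] equals [heat1 f] by parts, and the latter is differentiated through f. The result is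
    the expression found for the time derivative in [heat_dt], so the heat equation holds by
    comparison. *)
Lemma heat_dxx L L' f f' t x : growth L f -> growth L' f' -> 0 < t ->
  (forall y, is_derive f y (f' y)) -> is_derive (fun x => heat f' t x) x (heat1 f' t x).
Proof.
move=> Hf Hf' Ht Hd.
apply: (is_derive_ext (fun x => heat1 f t x)); first by move=> y; exact: (heat1_heat L L').
rewrite /heat1.
apply: (is_derive_ext (fun x => / (gmass * sqrt t) * gM 1 f x (2 * sqrt t))); first by move=> y; eqR; rewrite /Rdiv; ring.
have -> : gM 1 f' x (2 * sqrt t) / (gmass * sqrt t) = scal (/ (gmass * sqrt t)) (gM 1 f' x (2 * sqrt t)).
  by rewrite /scal /= /mult /= /Rdiv; ring.
by apply: (is_derive_scal (fun x => gM 1 f x (2 * sqrt t))); apply: (gM_dx 1 L L').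
Qed.

Lemma growth_dom L f t x : growth L f ->
  dom (2 * L * exp (Rabs x) * exp ((Rabs (2 * sqrt t) + 1) ^ 2 / 2)) (fun z => gk 0 z * f (x + 2 * sqrt t * z)).
Proof. by move=> Hf; apply: gauss_dom => //; lra. Qed.

Lemma heat_le L L' f g t x : growth L f -> growth L' g -> (forall y, f y <= g y) -> heat f t x <= heat g t x.
Proof.
move=> Hf Hg H; rewrite /heat; apply: Rmult_le_compat_r; first by apply: Rlt_le; apply: Rinv_0_lt_compat; exact: gmass_gt0.
apply: (gI_le _ _ _ _ (growth_dom L f t x Hf) (growth_dom L' g t x Hg)) => z.
by apply: Rmult_le_compat_l; [apply: Rlt_le; exact: gk0_gt0|].
Qed.

Lemma heat_abs_le L L' f g t x : growth L f -> growth L' g -> (forall y, Rabs (f y) <= g y) ->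
  Rabs (heat f t x) <= heat g t x.
Proof.
move=> Hf Hg H; have Hm := gmass_gt0; rewrite /heat /Rdiv Rabs_mult [Rabs (/ _)]Rabs_right; last first.
  by apply: Rle_ge; apply: Rlt_le; apply: Rinv_0_lt_compat.
apply: Rmult_le_compat_r; first by apply: Rlt_le; apply: Rinv_0_lt_compat.
apply: (gI_abs_le _ _ _ _ (growth_dom L f t x Hf) (growth_dom L' g t x Hg)) => z.
rewrite Rabs_mult Rabs_right; last by apply: Rle_ge; apply: Rlt_le; exact: gk0_gt0.
by apply: Rmult_le_compat_l; [apply: Rlt_le; exact: gk0_gt0|].
Qed.

Lemma heat_scal L f c t x : growth L f -> heat (fun y => c * f y) t x = c * heat f t x.
Proof.
move=> Hf; rewrite /heat /gM (gI_ext _ (fun z => c * (gk 0 z * f (x + 2 * sqrt t * z)))); last by move=> z; ring.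
by rewrite (gI_scal _ _ _ (growth_dom L f t x Hf)) /Rdiv; ring.
Qed.

Lemma heat_minus L L' f g t x : growth L f -> growth L' g ->
  heat (fun y => f y - g y) t x = heat f t x - heat g t x.
Proof.
move=> Hf Hg; rewrite /heat /gM (gI_ext _ (fun z => gk 0 z * f (x + 2 * sqrt t * z) + - (gk 0 z * g (x + 2 * sqrt t * z)))); last by move=> z; ring.
rewrite (gI_plus _ _ _ _ (growth_dom L f t x Hf) (dom_opp _ _ (growth_dom L' g t x Hg))).
by rewrite (gI_opp _ _ (growth_dom L' g t x Hg)) /Rdiv; ring.
Qed.

Lemma heat_odd L f t x : growth L f -> (forall y, f (- y) = - f y) -> heat f t (- x) = - heat f t x.
Proof.
move=> Hf Ho; have D1 := growth_dom L f t x Hf; have D2 := growth_dom L f t (- x) Hf.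
have := gI_odd _ _ (dom_plus _ _ _ _ D1 D2); rewrite (gI_plus _ _ _ _ D1 D2) => E.
suff : gM 0 f x (2 * sqrt t) + gM 0 f (- x) (2 * sqrt t) = 0.
  move=> E'; have E2 : gM 0 f (- x) (2 * sqrt t) = - gM 0 f x (2 * sqrt t) by lra.
  by rewrite /heat E2 /Rdiv; ring.
apply: E => z.
have Eg : gk 0 (- z) = gk 0 z by rewrite /gk /=; congr (1 * exp _); ring.
have -> : x + 2 * sqrt t * - z = - (- x + 2 * sqrt t * z) by ring.
have -> : - x + 2 * sqrt t * - z = - (x + 2 * sqrt t * z) by ring.
by rewrite Eg !Ho; ring.
Qed.

Lemma heat_growth L f t x T : growth L f -> t <= T ->
  Rabs (heat f t x) <= 4 * L / gmass * exp ((2 * sqrt T + 1) ^ 2 / 2) * exp (Rabs x).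
Proof.
move=> Hf Ht; have Hm := gmass_gt0; have HL := growth_ge0 _ _ Hf.
have Hr : Rabs (2 * sqrt t) <= 2 * sqrt T.
  rewrite Rabs_right; last by have := sqrt_pos t; lra.
  by have := sqrt_le_1_alt _ _ Ht; lra.
have D := gauss_dom 0 L f x _ (Rabs x) _ isT Hf (Rle_refl _) Hr.
(* [gI_small] with a window of length zero: only the tail term, the full domination constant,
   remains. *)
have Hz z : Rabs z <= INR 0 -> Rabs (gk 0 z * f (x + 2 * sqrt t * z)) <= Rabs (gk 0 0 * f (x + 2 * sqrt t * 0)).
  move=> /= Hz; have -> : z = 0 by have := Rabs_pos z; move=> ?; apply: Rabs_eq_0; lra.
  exact: Rle_refl.
have := gI_small _ _ 0 _ D Hz; move: (Rabs (gk 0 0 * _)) => eta.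
rewrite [INR 0]/= Rmult_0_r Rmult_0_l Rplus_0_l Ropp_0 exp_0 -/(gM 0 f x (2 * sqrt t)) => H.
rewrite /heat /Rdiv Rabs_mult [Rabs (/ _)]Rabs_right; last by apply: Rle_ge; apply: Rlt_le; apply: Rinv_0_lt_compat.
apply: Rle_trans (Rmult_le_compat_r (/ gmass) _ _ _ H) _.
  by apply: Rlt_le; apply: Rinv_0_lt_compat.
by apply: Req_le; rewrite /Rdiv; field; lra.
Qed.

Lemma heat_0 f x : heat f 0 x = f x.
Proof.
have Hm := gmass_gt0.
rewrite /heat /gM sqrt_0 (gI_ext _ (fun z => f x * (gk 0 z * 1))); last first.
  by move=> z; rewrite Rmult_0_r Rmult_0_l Rplus_0_r; ring.
have D := gauss_dom 0 _ _ 0 0 0 0 isT (growth_const 1) ltac:(rewrite Rabs_R0; lra) ltac:(rewrite Rabs_R0; lra).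
rewrite (gI_scal _ _ _ D) (gI_ext _ (gk 0)); last by move=> z; ring.
by rewrite -/gmass; field; lra.
Qed.

Lemma growth_exp k : 0 <= k <= 1 -> growth 1 (fun y => exp (k * y)).
Proof.
move=> Hk; split => y; first exact: continuous_exp_scal.
rewrite Rabs_exp.
rewrite Rmult_1_l; apply: exp_le; have := Rle_abs y; have := Rabs_pos y; nra.
Qed.

(* The Gaussian moment generating function, obtained from its linear ODE in the scale r. *)
Lemma heat_exp k t x : 0 <= k <= 1 -> 0 <= t -> heat (fun y => exp (k * y)) t x = exp (k * x + k ^ 2 * t).
Proof.
move=> Hk Ht; have Hm := gmass_gt0.
have Hg := growth_exp k Hk.
have Hg' : growth (Rabs k * 1) (fun y => k * exp (k * y)).
  split => y; first by apply: (continuous_scal_r k (fun y => exp (k * y))); exact: continuous_exp_scal.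
  by rewrite Rabs_mult Rmult_assoc; apply: Rmult_le_compat_l; [exact: Rabs_pos|exact: Hg.2].
have Hd y : is_derive (fun y => exp (k * y)) y (k * exp (k * y)) by auto_derive => //; ring.
pose phi r := gM 0 (fun y => exp (k * y)) x r.
have Hphi r : is_derive phi r (k ^ 2 * r / 2 * phi r).
  have := gM_dr 0 _ _ _ _ x r isT Hg Hg' Hd.
  suff -> : gM 1 (fun y => k * exp (k * y)) x r = k ^ 2 * r / 2 * phi r by [].
  have D1 := gauss_dom 1 _ _ x r _ _ isT Hg (Rle_refl _) (Rle_refl _).
  have D0 := gauss_dom 0 _ _ x r _ _ isT Hg (Rle_refl _) (Rle_refl _).
  have E1 : gM 1 (fun y => k * exp (k * y)) x r = k * gM 1 (fun y => exp (k * y)) x r.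
    by rewrite /gM -(gI_scal _ _ _ D1); apply: gI_ext => z; ring.
  rewrite E1 (gM_ibp _ _ _ _ x r Hg Hg' Hd).
  have -> : gM 0 (fun y => k * exp (k * y)) x r = k * phi r.
    by rewrite /gM /phi -(gI_scal _ _ _ D0); apply: gI_ext => z; ring.
  by field.
pose h r := phi r * exp (- (k ^ 2 * r ^ 2 / 4)).
have Hh r : is_derive h r 0.
  have -> : 0 = plus (mult (k ^ 2 * r / 2 * phi r) (exp (- (k ^ 2 * r ^ 2 / 4)))) (mult (phi r) (- (k ^ 2 * r / 2) * exp (- (k ^ 2 * r ^ 2 / 4)))).
    by rewrite /plus /mult /=; field.
  apply: (is_derive_mult phi (fun r => exp (- (k ^ 2 * r ^ 2 / 4)))) => //.
    by auto_derive => //; rewrite /Rdiv /=; field.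
  by move=> a b; exact: Rmult_comm.
have Hs := sqrt_pos t.
have Hc s : continuous h s by apply: ex_derive_continuous; exists 0.
have L1 := nonincreasing_of_derive h (2 * sqrt t) ltac:(lra) (fun s _ => Hc s) (fun s _ => ex_intro _ 0 (conj (Hh s) (Rle_refl 0))).
have L2 := nonincreasing_of_derive (fun r => - h r) (2 * sqrt t) ltac:(lra)
   (fun s _ => continuous_opp h s (Hc s)) (fun s _ => _).
have {}L2 : - h (2 * sqrt t) <= - h 0.
  apply: L2; exists (- 0); split; last lra.
  exact: (is_derive_opp h).
have E : h (2 * sqrt t) = h 0 by lra.
have E0 : h 0 = gmass * exp (k * x).
  rewrite /h /phi /gM /= !Rmult_0_l Rmult_0_r /Rdiv Rmult_0_l Ropp_0 exp_0 Rmult_1_r.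
  have D := gauss_dom 0 _ _ 0 0 0 0 isT (growth_const 1) ltac:(rewrite Rabs_R0; lra) ltac:(rewrite Rabs_R0; lra).
  rewrite (gI_ext _ (fun z => exp (k * x) * (gk 0 z * 1))); last by move=> z; rewrite Rmult_0_l Rplus_0_r; ring.
  rewrite (gI_scal _ _ _ D) (gI_ext _ (gk 0)); last by move=> z; ring.
  by rewrite -/gmass; ring.
have E1 : h (2 * sqrt t) = phi (2 * sqrt t) * exp (- (k ^ 2 * t)).
  rewrite /h; congr (_ * exp (- _)).
  have {2}<- := sqrt_sqrt t Ht; rewrite /=; field.
have E2 : exp (- (k ^ 2 * t)) * exp (k ^ 2 * t) = 1 by rewrite -exp_plus -exp_0; congr exp; ring.
rewrite /heat -/(phi (2 * sqrt t)).
have -> : phi (2 * sqrt t) = h (2 * sqrt t) * exp (k ^ 2 * t) by rewrite E1; ring [E2].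
by rewrite E E0 exp_plus; field; lra.
Qed.

(** * The Cauchy problem *)

(** Adding u / 2 turns the slope -1/2 at the origin into slope 0, so the even extension has no
    kink. *)
Definition evenpart (p : R -> R) (y : R) : R := p (Rabs y) + Rabs y / 2.

Lemma is_derive_eps (f : R -> R) x l :
  (forall e, 0 < e -> exists d, 0 < d /\ forall h, h <> 0 -> Rabs h < d -> Rabs ((f (x + h) - f x) / h - l) < e) ->
  is_derive f x l.
Proof.
move=> H; apply/is_derive_Reals => e He; have [d [Hd Hf]] := H e He.
by exists (mkposreal d Hd).
Qed.

Lemma at_right_eps (f : R -> R) x l :
  filterlim f (at_right x) (locally l) ->
  (forall e, 0 < e -> exists d, 0 < d /\ forall h, x < h < x + d -> Rabs (f h - l) < e).
Proof.
move/filterlim_locally => H e He; have [d Hd] := H (mkposreal e He).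
exists d; split; first exact: cond_pos.
move=> h Hh; apply: (Hd h); last lra.
by rewrite /ball /= /AbsRing_ball /abs /minus /plus /opp /=; apply: Rabs_def1; lra.
Qed.

Lemma at_right_of_eps (f : R -> R) x l :
  (forall e, 0 < e -> exists d, 0 < d /\ forall h, x < h < x + d -> Rabs (f h - l) < e) ->
  filterlim f (at_right x) (locally l).
Proof.
move=> H; apply/filterlim_locally => e; have [d [Hd Hf]] := H e (cond_pos e).
exists (mkposreal d Hd) => h /Rabs_def2 /= Hh Hx; apply: Hf.
by move: Hh; rewrite /minus /plus /opp /=; lra.
Qed.

(** The bound 1/2 is the condition -1 <= p' <= 0 after the tilt. At y = 0 the one-sided data of
    [in_XR] serve both sides by symmetry. *)
Lemma evenpart_smooth p : in_XR p -> exists dp : R -> R,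
  (forall y, is_derive (evenpart p) y (dp y)) /\ (forall y, continuous dp y) /\
  (forall y, Rabs (dp y) <= / 2) /\ (forall y, dp (- y) = - dp y).
Proof.
case=> d [_ [Hd [Hd0 [Hc [Hc0 [Hb [E0 _]]]]]]].
pose dp y := if Rlt_dec y 0 then - (d (- y) + / 2) else d y + / 2.
have dpp y : 0 <= y -> dp y = d y + / 2 by move=> H; rewrite /dp; case: Rlt_dec => [?|//]; lra.
have dpn y : y <= 0 -> dp y = - (d (- y) + / 2).
  move=> H; rewrite /dp; case: Rlt_dec => [//|?] /=.
  by have -> : y = 0 by [lra]; rewrite Ropp_0 E0; lra.
have dpodd y : dp (- y) = - dp y.
  case: (Rle_dec 0 y) => H; first by rewrite dpn ?(dpp y) ?Ropp_involutive //; lra.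
  by rewrite (dpp (- y)) ?(dpn y) //; lra.
have loc y (P : R -> Prop) : 0 < Rabs y -> (forall z, Rabs (z - y) < Rabs y -> P z) -> locally y P.
  by move=> H HP; exists (mkposreal _ H).
exists dp; split; last split; last split => //.
- move=> y; case: (Rtotal_order y 0) => [Hy|[->|Hy]].
  + apply: (is_derive_ext_loc (fun y => p (- y) - y / 2)).
      apply: loc; rewrite Rabs_left //; first lra.
      by move=> z /Rabs_def2 Hz; rewrite /evenpart Rabs_left; lra.
    rewrite dpn; last lra.
    have -> : - (d (- y) + / 2) = minus (scal (-1) (d (- y))) (/ 2).
      by rewrite /minus /plus /opp /scal /= /mult /=; ring.
    apply: (is_derive_minus (fun y => p (- y)) (fun y => y / 2)).
      apply: (is_derive_comp p (fun y => - y)); first by apply: Hd; lra.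
      by auto_derive => //; ring.
    by auto_derive => //; field.
  + rewrite dpp; last lra.
    apply: is_derive_eps => e He.
    have [d' [Hd' H]] := at_right_eps _ _ _ Hd0 e He.
    exists d'; split => // h Hh0 Hh.
    have := H (Rabs h) ltac:(have := Rabs_pos_lt h Hh0; lra).
    rewrite Rplus_0_l /evenpart Rabs_R0 E0.
    case: (Rle_dec 0 h) => Hs.
      rewrite [Rabs h]Rabs_right; last lra.
      have -> : (p h + h / 2 - (p 0 + 0 / 2)) / h - (- (1 / 2) + / 2) = (p h - p 0) / h - - (1 / 2) by field.
      by [].
    rewrite [Rabs h]Rabs_left; last lra.
    have -> : (p (- h) + - h / 2 - (p 0 + 0 / 2)) / h - (- (1 / 2) + / 2) = - ((p (- h) - p 0) / (- h) - - (1 / 2)) by field; lra.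
    by rewrite Rabs_Ropp.
  + apply: (is_derive_ext_loc (fun y => p y + y / 2)).
      apply: loc; rewrite Rabs_right //; try lra.
      by move=> z /Rabs_def2 Hz; rewrite /evenpart Rabs_right; lra.
    rewrite dpp; last lra.
    by apply: (is_derive_plus p (fun y => y / 2)); [apply: Hd|auto_derive => //; field].
- move=> y; case: (Rtotal_order y 0) => [Hy|[->|Hy]].
  + apply: (continuous_ext_loc _ (fun y => - (d (- y) + / 2))).
      apply: loc; rewrite Rabs_left //; first lra.
      by move=> z /Rabs_def2 Hz; rewrite dpn; lra.
    apply: (continuous_opp (fun y => d (- y) + / 2)).
    apply: (continuous_plus (fun y => d (- y)) (fun=> / 2)); last exact: continuous_const.
    apply: (continuous_comp (fun y => - y) d); last by apply: Hc; lra.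
    by apply: ex_derive_continuous; auto_derive.
  + apply: continuous_of_eps => e He.
    have [d' [Hd' H]] := at_right_eps _ _ _ Hc0 e He.
    exists d'; split => // s; rewrite Rminus_0_r => Hs.
    rewrite (dpp 0) ?E0; last lra.
    case: (Req_dec s 0) => [->|Hs0].
      by rewrite dpp ?E0 ?Rminus_diag ?Rabs_R0; lra.
    have := H (Rabs s) ltac:(have := Rabs_pos_lt s Hs0; lra); rewrite E0.
    case: (Rle_dec 0 s) => Hs'.
      by rewrite [Rabs s]Rabs_right; [rewrite dpp // => Hx; have -> : d s + / 2 - (- (1 / 2) + / 2) = d s - - (1 / 2) by lra|lra].
    rewrite [Rabs s]Rabs_left; last lra.
    rewrite dpn; last lra.
    have -> : - (d (- s) + / 2) - (- (1 / 2) + / 2) = - (d (- s) - - (1 / 2)) by lra.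
    by rewrite Rabs_Ropp.
  + apply: (continuous_ext_loc _ (fun y => d y + / 2)).
      apply: loc; rewrite Rabs_right //; try lra.
      by move=> z /Rabs_def2 Hz; rewrite dpp; lra.
    by apply: (continuous_plus d (fun=> / 2)); [apply: Hc|exact: continuous_const].
- move=> y; apply: Rabs_le; case: (Rle_dec 0 y) => H.
    by rewrite dpp //; have := Hb y H; lra.
  by rewrite dpn; [have := Hb (- y) ltac:(lra); lra|lra].
Qed.

(* Hopf-Cole transform of p, extended evenly to R; in_XR makes the extension C^1. *)
Definition ic (beta : R) (p : R -> R) (y : R) : R := exp (beta * evenpart p y).

Lemma ic_gt0 beta p y : 0 < ic beta p y.
Proof. exact: exp_pos. Qed.

Lemma is_derive_ic beta p dp y : is_derive (evenpart p) y dp ->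
  is_derive (ic beta p) y (beta * dp * ic beta p y).
Proof.
move=> H; have -> : beta * dp * ic beta p y = scal (scal dp beta) (ic beta p y).
  by rewrite /scal /= /mult /=; ring.
have -> : scal (scal dp beta) (ic beta p y) = scal dp (beta * ic beta p y).
  by rewrite /scal /= /mult /=; ring.
apply: (is_derive_comp (fun z => exp (beta * z)) (evenpart p)) => //.
by auto_derive => //; rewrite /ic; ring.
Qed.

Lemma evenpart_even p y : evenpart p (- y) = evenpart p y.
Proof. by rewrite /evenpart Rabs_Ropp. Qed.

Lemma evenpart_ge p y : in_XR p -> Rabs y / 2 <= evenpart p y.
Proof. by case=> d [H _]; have := H (Rabs y) (Rabs_pos y); rewrite /evenpart; lra. Qed.

Lemma evenpart_le p y : in_XR p -> evenpart p y <= p 0 + Rabs y / 2.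
Proof.
move=> Hp; have [dp [Hd [Hc [Hb _]]]] := evenpart_smooth p Hp.
have [||c [_ E]] := MVT_gen (evenpart p) 0 y dp.
- by move=> x _.
- by move=> x _; apply/continuity_pt_filterlim; apply: ex_derive_continuous; eexists; exact: Hd.
have E0 : evenpart p 0 = p 0 by rewrite /evenpart Rabs_R0; lra.
rewrite -E0; have := Rle_abs (evenpart p y - evenpart p 0).
rewrite {1}E Rminus_0_r E Rabs_mult Rminus_0_r => H.
have := Rmult_le_compat_r (Rabs y) _ _ (Rabs_pos y) (Hb c); lra.
Qed.

Lemma ic_le beta p y : 0 <= beta -> in_XR p -> ic beta p y <= exp (beta * p 0) * exp (beta / 2 * Rabs y).
Proof.
move=> Hb Hp; rewrite -exp_plus; apply: exp_le; have := evenpart_le p y Hp; nra.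
Qed.

Lemma ic_ge beta p y : 0 <= beta -> in_XR p -> exp (beta / 2 * Rabs y) <= ic beta p y.
Proof. by move=> Hb Hp; apply: exp_le; have := evenpart_ge p y Hp; nra. Qed.

Definition icint (beta : R) (p : R -> R) (y : R) : R := RInt (ic beta p) 0 y.

Definition hv beta p := heat (ic beta p).
Definition hw beta p := heat (icint beta p).

Lemma ic_continuous beta p y : in_XR p -> continuous (ic beta p) y.
Proof.
move=> Hp; have [dp [Hd _]] := evenpart_smooth p Hp.
by apply: ex_derive_continuous; eexists; apply: is_derive_ic.
Qed.

Lemma growth_ic beta p : 0 < beta <= 2 -> in_XR p -> growth (exp (beta * p 0)) (ic beta p).
Proof.
move=> Hb Hp; split => y; first exact: ic_continuous.
rewrite Rabs_right; last by apply: Rle_ge; apply: Rlt_le; exact: ic_gt0.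
apply: Rle_trans (ic_le beta p y ltac:(lra) Hp) _; apply: Rmult_le_compat_l; first exact: exp_ge0.
by apply: exp_le; have := Rabs_pos y; nra.
Qed.

Lemma is_derive_icint beta p y : in_XR p -> is_derive (icint beta p) y (ic beta p y).
Proof.
move=> Hp; apply: (is_derive_RInt (ic beta p) (RInt (ic beta p) 0) 0 y); last exact: ic_continuous.
apply: filter_forall => u; apply: (RInt_correct (V := R_CompleteNormedModule)); apply: ex_RInt_cont => z.
exact: ic_continuous.
Qed.

Lemma icint_odd beta p y : in_XR p -> icint beta p (- y) = - icint beta p y.
Proof.
move=> Hp; have Hc z := ic_continuous beta p z Hp.
have H := RInt_comp_lin (V := R_CompleteNormedModule) (ic beta p) (-1) 0 0 y (ex_RInt_cont _ _ _ Hc).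
have E u : -1 * u + 0 = - u by ring.
rewrite !E Ropp_0 in H; rewrite /icint -H -RInt_opp_fun //.
apply: RInt_ext => z _; rewrite E /scal /= /mult /= /ic evenpart_even; eqR; ring.
Qed.

Lemma growth_icint beta p : 0 < beta <= 2 -> in_XR p ->
  growth (2 / beta * exp (beta * p 0)) (icint beta p).
Proof.
move=> Hb Hp; split => y.
  by apply: ex_derive_continuous; eexists; exact: is_derive_icint.
pose L := 2 / beta * exp (beta * p 0).
have HL : 0 < L by apply: Rmult_lt_0_compat; [apply: Rdiv_lt_0_compat; lra|exact: exp_pos].
have Hpos : forall y, 0 <= y -> Rabs (icint beta p y) <= L * exp y.
  move=> z Hz.
  have H0 : 0 <= icint beta p z.
    apply: RInt_ge_0 => //; first by apply: ex_RInt_cont => u; exact: ic_continuous.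
    by move=> u _; apply: Rlt_le; exact: ic_gt0.
  rewrite Rabs_right; last lra.
  have := nonincreasing_of_derive (fun s => icint beta p s - L * exp (beta / 2 * s)) z Hz.
  have -> : icint beta p 0 = 0 by rewrite /icint RInt_point.
  rewrite Rmult_0_r exp_0 => H.
  have HD s : is_derive (fun s => icint beta p s - L * exp (beta / 2 * s)) s (ic beta p s - L * (beta / 2 * exp (beta / 2 * s))).
    apply: (is_derive_minus (icint beta p) (fun s => L * exp (beta / 2 * s))); first exact: is_derive_icint.
    by auto_derive => //; ring.
  have {}H : icint beta p z - L * exp (beta / 2 * z) <= 0 - L * 1.
    apply: H => [s _|s Hs]; first by apply: ex_derive_continuous; eexists; exact: HD.
    eexists; split; first exact: HD.
    have := ic_le beta p s ltac:(lra) Hp; rewrite (Rabs_right s); last lra.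
    have -> : L * (beta / 2 * exp (beta / 2 * s)) = exp (beta * p 0) * exp (beta / 2 * s) by rewrite /L; field; lra.
    lra.
  have : exp (beta / 2 * z) <= exp z by apply: exp_le; nra.
  move=> H1; have := Rmult_le_compat_l L _ _ (Rlt_le _ _ HL) H1; lra.
rewrite -/L; case: (Rle_dec 0 y) => Hy; first by have := Hpos y Hy; rewrite (Rabs_right y); lra.
have := Hpos (- y) ltac:(lra); rewrite icint_odd // Rabs_Ropp (Rabs_left y); lra.
Qed.

(* v solves the heat equation with initial value ic, w is its odd primitive, and vx, vxx are its space derivatives. *)
Record heat_pkg (beta : R) (p : R -> R) (w v vx vxx : R -> R -> R) : Prop := HeatPkg {
  hp_wx : forall t x, is_derive (w t) x (v t x);
  hp_vx : forall t x, is_derive (v t) x (vx t x);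
  hp_vxx : forall t x, 0 < t -> is_derive (vx t) x (vxx t x);
  hp_wt : forall t x, 0 < t -> is_derive (fun s => w s x) t (vx t x);
  hp_vt : forall t x, 0 < t -> is_derive (fun s => v s x) t (vxx t x);
  hp_wc : forall t x, continuous (fun q : R * R => w (fst q) (snd q)) (t, x);
  hp_vc : forall t x, continuous (fun q : R * R => v (fst q) (snd q)) (t, x);
  hp_vxc : forall t x, continuous (fun q : R * R => vx (fst q) (snd q)) (t, x);
  hp_vxxc : forall t x, 0 < t -> continuous (fun q : R * R => vxx (fst q) (snd q)) (t, x);
  hp_wodd : forall t x, w t (- x) = - w t x;
  hp_growth : forall T, exists C, forall t x, t <= T ->
    Rabs (w t x) <= C * exp (Rabs x) /\ Rabs (v t x) <= C * exp (Rabs x) /\ Rabs (vx t x) <= C * exp (Rabs x);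
  hp_vx0 : forall t, vx t 0 = 0;
  hp_vxb : forall t x, Rabs (vx t x) <= beta / 2 * v t x;
  hp_vlow : forall t x, 0 <= t -> exp (beta / 2 * x + (beta / 2) ^ 2 * t) <= v t x;
  hp_v_init : forall x, v 0 x = ic beta p x;
  hp_v_inf : forall t, 0 <= t -> is_lim (fun x => v t x * exp (- (beta / 2 * x + (beta / 2) ^ 2 * t))) p_infty 1
}.

(** This becomes psi (t, u) -> 0 at infinity. The flow maps exp (k y) to an exact exponential, and
    the excess of [ic] over it is relatively small far to the right because p tends to 0. *)
Lemma hv_limit beta p t : 0 < beta <= 2 -> in_XR p -> 0 <= t ->
  is_lim (fun x => hv beta p t x * exp (- (beta / 2 * x + (beta / 2) ^ 2 * t))) p_infty 1.
Proof.
move=> Hb Hp Ht; set k := beta / 2; have Hk : 0 < k <= 1 by rewrite /k; lra.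
have Hm := gmass_gt0; have Hs := sqrt_pos t.
have Hg := growth_ic beta p Hb Hp; have Hge := growth_exp k ltac:(lra).
apply/is_lim_spec => -[e He] /=.
pose E x := exp (- (k * x + k ^ 2 * t)).
have HE x : heat (fun y => exp (k * y)) t x * E x = 1.
  by rewrite heat_exp //; [rewrite /E -exp_plus Rplus_opp_r exp_0|lra].
pose L := exp (beta * p 0) + 1; have HL : 0 < L by have := exp_pos (beta * p 0); rewrite /L; lra.
pose A := 2 * sqrt t.
pose C := 2 * L * exp ((A + 1) ^ 2 / 2).
have HC : 0 <= C by apply: Rmult_le_pos; [lra|exact: exp_ge0].
have [n Hn] := exp_neg_small (2 * C) (e * gmass / 2) ltac:(lra) ltac:(have := Rmult_lt_0_compat _ _ He Hm; lra).
have Hn0 := pos_INR n.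
(* Since p tends to 0, ic - exp(k y) is negligible against exp(k y). *)
pose eta := e * gmass / (4 * (INR n + 1)).
have Heta : 0 < eta by apply: Rdiv_lt_0_compat; [exact: Rmult_lt_0_compat|lra].
pose eta1 := eta / (2 * exp (A * INR n) + 1).
have HeA := exp_pos (A * INR n).
have Heta1 : 0 < eta1 by apply: Rdiv_lt_0_compat; lra.
have [Y HY] : exists Y, 0 <= Y /\ forall y, Y < y -> Rabs (exp (beta * p y) - 1) < eta1.
  have HL0 : is_lim (fun y => exp (beta * p y)) p_infty 1.
    have -> : Finite 1 = Finite (exp (beta * 0)) by rewrite Rmult_0_r exp_0.
    case: Hp => d [_ [_ [_ [_ [_ [_ [_ Hlim]]]]]]].
    apply: (is_lim_comp_continuous p (fun z => exp (beta * z)) p_infty 0 Hlim).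
    exact: continuous_exp_scal.
  have [M HM] := proj2 (is_lim_spec _ _ _) HL0 (mkposreal _ Heta1).
  exists (Rmax 0 M); split; first exact: Rmax_l.
  by move=> y Hy; apply: HM; have := Rmax_r 0 M; lra.
(* Then x + A z > Y for every z in the window [-n, n], where the excess is controlled. *)
exists (Y + A * INR n) => x Hx.
have HA0 : 0 <= A by rewrite /A; lra.
have HAn : 0 <= A * INR n by apply: Rmult_le_pos.
have Hx0 : 0 < x by lra.
have -> : hv beta p t x * exp (- (k * x + k ^ 2 * t)) - 1 =
   (heat (ic beta p) t x - heat (fun y => exp (k * y)) t x) * E x.
  by rewrite Rmult_minus_distr_r HE.
rewrite -(heat_minus _ _ _ _ t x Hg Hge).
pose H z := gk 0 z * ((ic beta p (x + A * z) - exp (k * (x + A * z))) * exp (- (k * x))).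
have HEle : 0 < E x <= exp (- (k * x)).
  split; first exact: exp_pos.
  by apply: exp_le; have := pow2_ge_0 k; nra.
have Hdiff y : 0 <= ic beta p y - exp (k * y) <= L * exp (k * Rabs y).
  have := ic_ge beta p y ltac:(lra) Hp; have := ic_le beta p y ltac:(lra) Hp.
  rewrite -/k => H1 H2.
  have H3 : exp (k * y) <= exp (k * Rabs y) by apply: exp_le; apply: Rmult_le_compat_l; [lra|exact: Rle_abs].
  have := exp_pos (k * y); have := exp_pos (k * Rabs y); rewrite /L; nra.
have HD : dom C H.
  split.
    move=> z; apply: (continuous_mult (gk 0) (fun z => (ic beta p (x + A * z) - exp (k * (x + A * z))) * exp (- (k * x)))); first exact: gk_continuous.
    apply: (continuous_mult (fun z => ic beta p (x + A * z) - exp (k * (x + A * z))) (fun=> exp (- (k * x)))); last exact: continuous_const.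
    apply: (continuous_comp (fun z => x + A * z) (fun y => ic beta p y - exp (k * y))).
      by apply: ex_derive_continuous; auto_derive.
    by apply: (continuous_minus (ic beta p) (fun y => exp (k * y))); [exact: ic_continuous|exact: continuous_exp_scal].
  move=> z; rewrite /H Rabs_mult Rabs_mult.
  have Hz := Rabs_pos z.
  have [D1 D2] := Hdiff (x + A * z).
  rewrite (Rabs_right (ic _ _ _ - _)); last lra.
  rewrite Rabs_exp.
  have HB : (ic beta p (x + A * z) - exp (k * (x + A * z))) * exp (- (k * x)) <= L * exp (A * Rabs z).
    apply: (Rle_trans _ (L * exp (k * Rabs (x + A * z)) * exp (- (k * x)))).
      by apply: Rmult_le_compat_r => //; exact: exp_ge0.
    rewrite Rmult_assoc -exp_plus; apply: Rmult_le_compat_l; first lra.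
    apply: exp_le; have := Rabs_triang x (A * z); rewrite Rabs_mult (Rabs_right x) ?(Rabs_right A); try lra.
    have : 0 <= A * Rabs z by apply: Rmult_le_pos.
    nra.
  apply: (Rle_trans _ (Rabs (gk 0 z) * (L * exp (A * Rabs z)))).
    by apply: Rmult_le_compat_l => //; exact: Rabs_pos.
  have := gk_exp_bound 0 z A isT HA0; have := exp_pos (- Rabs z); rewrite /C => H1 H2.
  have := Rmult_le_compat_l L _ _ (Rlt_le _ _ HL) H2; lra.
have HHle : Rabs (gI H) <= 2 * INR n * eta + 2 * C * exp (- INR n).
  apply: gI_small => // z Hz.
  have Hzn : Rabs (A * z) <= A * INR n.
    by rewrite Rabs_mult (Rabs_right A); [apply: Rmult_le_compat_l|lra].
  move/Rabs_le_between: Hzn => Hzn.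
  have Hy : Y < x + A * z by lra.
  have Hy0 : 0 <= x + A * z by lra.
  have := HY.2 _ Hy => Hsm.
  have Eic : ic beta p (x + A * z) = exp (beta * p (x + A * z)) * exp (k * (x + A * z)).
    rewrite /ic /evenpart Rabs_right; last lra.
    by rewrite -exp_plus /k; congr exp; field.
  rewrite /H Eic.
  have -> : (exp (beta * p (x + A * z)) * exp (k * (x + A * z)) - exp (k * (x + A * z))) * exp (- (k * x)) =
     (exp (beta * p (x + A * z)) - 1) * exp (k * (A * z)).
    have -> : exp (k * (A * z)) = exp (k * (x + A * z)) * exp (- (k * x)) by rewrite -exp_plus; congr exp; ring.
    ring.
  rewrite Rabs_mult [X in _ * X]Rabs_mult Rabs_exp.
  have H1 : exp (k * (A * z)) <= exp (A * INR n) by apply: exp_le; nra.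
  have H2 := gk_le2 0 z isT.
  have H3 := exp_pos (k * (A * z)).
  have : Rabs (exp (beta * p (x + A * z)) - 1) * exp (k * (A * z)) <= eta1 * exp (A * INR n).
    by apply: Rmult_le_compat => //; [exact: Rabs_pos|lra|lra].
  have H4 : 0 <= Rabs (exp (beta * p (x + A * z)) - 1) * exp (k * (A * z)) by apply: Rmult_le_pos; [exact: Rabs_pos|lra].
  move=> H5; apply: (Rle_trans _ (2 * (eta1 * exp (A * INR n)))).
    by rewrite -/A; apply: Rmult_le_compat; [exact: Rabs_pos|exact: H4|exact: H2|exact: H5].
  have : eta1 * (2 * exp (A * INR n) + 1) = eta by rewrite /eta1; field; lra.
  nra.
have Hheat : heat (fun y => ic beta p y - exp (k * y)) t x * exp (- (k * x)) = gI H / gmass.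
  rewrite /heat /gM -/A.
  have Hgr : growth L (fun y => ic beta p y - exp (k * y)).
    split => y; first by apply: (continuous_minus (ic beta p) (fun y => exp (k * y))); [exact: ic_continuous|exact: continuous_exp_scal].
    have [D1 D2] := Hdiff y; rewrite Rabs_right; last lra.
    apply: Rle_trans D2 _; apply: Rmult_le_compat_l; first lra.
    by apply: exp_le; have := Rabs_pos y; nra.
  have {}Dg := growth_dom _ _ t x Hgr; rewrite -/A in Dg.
  have -> : gI H = exp (- (k * x)) * gI (fun z => gk 0 z * (ic beta p (x + A * z) - exp (k * (x + A * z)))).
    by rewrite -(gI_scal _ _ _ Dg); apply: gI_ext => z; rewrite /H; ring.
  by field; lra.
have Hpos : 0 <= heat (fun y => ic beta p y - exp (k * y)) t x.
  have := heat_le _ _ (fun y => exp (k * y)) (ic beta p) t x Hge Hg.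
  rewrite (heat_minus _ _ _ _ t x Hg Hge) => HH; suff : heat (fun y => exp (k * y)) t x <= heat (ic beta p) t x by lra.
  by apply: HH => y; have := Hdiff y; lra.
rewrite Rabs_right; last by apply: Rle_ge; apply: Rmult_le_pos; lra.
apply: (Rle_lt_trans _ (gI H / gmass)).
  by rewrite -Hheat; apply: Rmult_le_compat_l => //; lra.
apply: (Rmult_lt_reg_r gmass) => //; rewrite /Rdiv Rmult_assoc Rinv_l ?Rmult_1_r; last lra.
have : 2 * INR n * eta <= e * gmass / 2.
  rewrite /eta; apply: (Rmult_le_reg_r (4 * (INR n + 1))); first lra.
  have -> : 2 * INR n * (e * gmass / (4 * (INR n + 1))) * (4 * (INR n + 1)) = 2 * INR n * (e * gmass) by field; lra.
  have := Rmult_lt_0_compat _ _ He Hm; nra.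
have := Rle_abs (gI H); lra.
Qed.

Lemma heat_pkg_exists beta p : 0 < beta <= 2 -> in_XR p ->
  exists w vx vxx, heat_pkg beta p w (hv beta p) vx vxx.
Proof.
move=> Hb Hp; have [dp [Hd [Hc [Hbd Hodd]]]] := evenpart_smooth p Hp.
pose f' y := beta * dp y * ic beta p y.
have Hg := growth_ic beta p Hb Hp.
have Hgi := growth_icint beta p Hb Hp.
have Hf'b y : Rabs (f' y) <= beta / 2 * ic beta p y.
  rewrite /f' !Rabs_mult (Rabs_right beta); last lra.
  rewrite (Rabs_right (ic _ _ _)); last by apply: Rle_ge; apply: Rlt_le; exact: ic_gt0.
  apply: Rmult_le_compat_r; first by apply: Rlt_le; exact: ic_gt0.
  by have := Hbd y; nra.
have Hgb : growth (beta / 2 * exp (beta * p 0)) (fun y => beta / 2 * ic beta p y).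
  split => y; first by apply: (continuous_scal_r (beta / 2) (ic beta p)); exact: ic_continuous.
  by rewrite Rabs_mult (Rabs_right (beta / 2)); [rewrite Rmult_assoc; apply: Rmult_le_compat_l; [lra|exact: Hg.2]|lra].
have Hg' : growth (beta / 2 * exp (beta * p 0)) f'.
  split => y.
    apply: (continuous_mult (fun y => beta * dp y) (ic beta p)); last exact: ic_continuous.
    exact: (continuous_scal_r beta dp).
  apply: Rle_trans (Hf'b y) _; have := Hgb.2 y; have := Rle_abs (beta / 2 * ic beta p y); lra.
have Hdf y : is_derive (ic beta p) y (f' y) by apply: is_derive_ic.
have Hdi y := is_derive_icint beta p y Hp.
exists (hw beta p), (heat f'), (heat1 f'); split.
- by move=> t x; apply: (heat_dx _ _ _ _ t x Hgi Hg).
- by move=> t x; apply: (heat_dx _ _ _ _ t x Hg Hg').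
- by move=> t x Ht; apply: (heat_dxx _ _ _ _ t x Hg Hg' Ht).
- move=> t x Ht; have := heat_dt _ _ _ _ t x Hgi Hg Ht Hdi.
  by rewrite (heat1_heat _ _ _ _ t x Hg Hg' Ht Hdf).
- by move=> t x Ht; apply: (heat_dt _ _ _ _ t x Hg Hg' Ht).
- by move=> t x; apply: (heat_continuous _ _ t x Hgi).
- by move=> t x; apply: (heat_continuous _ _ t x Hg).
- by move=> t x; apply: (heat_continuous _ _ t x Hg').
- by move=> t x Ht; apply: (heat1_continuous _ _ t x Hg' Ht).
- by move=> t x; apply: (heat_odd _ _ t x Hgi) => y; apply: icint_odd.
- move=> T.
  have G (L L' : R) f t x : growth L f -> t <= T -> L <= L' ->
    Rabs (heat f t x) <= 4 * L' / gmass * exp ((2 * sqrt T + 1) ^ 2 / 2) * exp (Rabs x).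
    move=> Hf Ht HL; apply: Rle_trans (heat_growth L f t x T Hf Ht) _.
    apply: Rmult_le_compat_r; first exact: exp_ge0.
    apply: Rmult_le_compat_r; first exact: exp_ge0.
    by apply: Rmult_le_compat_r; [apply: Rlt_le; apply: Rinv_0_lt_compat; exact: gmass_gt0|lra].
  have G1 := growth_ge0 _ _ Hg; have G2 := growth_ge0 _ _ Hgi; have G3 := growth_ge0 _ _ Hg'.
  pose L := 2 / beta * exp (beta * p 0) + exp (beta * p 0) + beta / 2 * exp (beta * p 0).
  exists (4 * L / gmass * exp ((2 * sqrt T + 1) ^ 2 / 2)) => t x Ht.
  split; last split; [apply: (G _ L _ t x Hgi Ht)|apply: (G _ L _ t x Hg Ht)|apply: (G _ L _ t x Hg' Ht)]; rewrite /L; lra.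
- move=> t; have := heat_odd _ f' t 0 Hg' (fun y => _); rewrite Ropp_0 => E.
  suff : heat f' t 0 = - heat f' t 0 by lra.
  by apply: E => y; rewrite /f' Hodd /ic evenpart_even; ring.
- move=> t x; rewrite -(heat_scal _ _ _ t x Hg); exact: (heat_abs_le _ _ _ _ t x Hg' Hgb).
- move=> t x Ht; rewrite -heat_exp //; last lra.
  apply: (heat_le _ _ _ _ t x (growth_exp (beta / 2) ltac:(lra)) Hg) => y.
  apply: Rle_trans (ic_ge beta p y ltac:(lra) Hp); apply: exp_le.
  by apply: Rmult_le_compat_l; [lra|exact: Rle_abs].
- by move=> x; exact: heat_0.
- by move=> t Ht; exact: hv_limit.
Qed.

Lemma hp_v_gt0 beta p w v vx vxx t x : heat_pkg beta p w v vx vxx -> 0 <= t -> 0 < v t x.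
Proof. by move=> H Ht; apply: Rlt_le_trans (hp_vlow _ _ _ _ _ _ H t x Ht); exact: exp_pos. Qed.

Lemma continuous2_div (F G : R * R -> R) q : continuous F q -> continuous G q -> G q <> 0 ->
  continuous (fun q => F q / G q) q.
Proof.
move=> HF HG H0; apply: (continuous_mult F (fun q => / G q)) => //.
apply: (continuous_comp G (fun z => / z)) => //.
by apply: ex_derive_continuous; auto_derive.
Qed.

Lemma locally_fst_pos t x : 0 < t -> locally (t, x) (fun q : R * R => 0 < fst q).
Proof.
move=> Ht; exists (mkposreal t Ht) => -[t' x'] [/= H _].
move: H; rewrite /ball /= /AbsRing_ball /abs /minus /plus /opp /= => /Rabs_def2; lra.
Qed.

(** * Inverting the Hopf-Cole transform *)

Section ClassicalSolution.
Variables (beta : R) (p : R -> R) (w v vx vxx : R -> R -> R).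
Hypotheses (Hb : 0 < beta) (Hp : in_XR p) (H : heat_pkg beta p w v vx vxx).
(** Solves exp (beta (psi + u / 2)) = exp (- (beta / 2)^2 t) v; the term beta t / 4 is the damping
    divided by beta. *)
Let psi t u := ln (v t u) / beta - beta * t / 4 - u / 2.
Let vpos t x (Ht : 0 <= t) := hp_v_gt0 _ _ _ _ _ _ t x H Ht.

Lemma psi_dx t x : 0 <= t -> is_derive (psi t) x (vx t x / (beta * v t x) - / 2).
Proof.
move=> Ht; have Hv := vpos t x Ht.
apply: (is_derive_ext (fun x => ln (v t x) * / beta - (beta * t / 4 + x / 2))); first by move=> y; rewrite /psi; eqR; lra.
have -> : vx t x / (beta * v t x) - / 2 = minus (scal (/ beta) (scal (vx t x) (/ v t x))) (/ 2).
  by rewrite /minus /plus /opp /scal /= /mult /=; field; lra.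
apply: (is_derive_minus (fun x => ln (v t x) * / beta) (fun x => beta * t / 4 + x / 2)).
  apply: (is_derive_ext (fun x => scal (/ beta) (ln (v t x)))); first by move=> y; rewrite /scal /= /mult /=; eqR; ring.
  apply: (is_derive_scal (fun x => ln (v t x))).
  apply: (is_derive_comp ln (v t)); last exact: (hp_vx _ _ _ _ _ _ H).
  by apply/is_derive_Reals; exact: derivable_pt_lim_ln.
by auto_derive => //; field.
Qed.

Lemma psi_dt t x : 0 < t -> is_derive (fun s => psi s x) t (vxx t x / (beta * v t x) - beta / 4).
Proof.
move=> Ht; have Hv := vpos t x (Rlt_le _ _ Ht).
apply: (is_derive_ext (fun t => ln (v t x) * / beta - (beta * t / 4 + x / 2))); first by move=> y; rewrite /psi; eqR; lra.
have -> : vxx t x / (beta * v t x) - beta / 4 = minus (scal (/ beta) (scal (vxx t x) (/ v t x))) (beta / 4).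
  by rewrite /minus /plus /opp /scal /= /mult /=; field; lra.
apply: (is_derive_minus (fun t => ln (v t x) * / beta) (fun t => beta * t / 4 + x / 2)).
  apply: (is_derive_ext (fun t => scal (/ beta) (ln (v t x)))); first by move=> y; rewrite /scal /= /mult /=; eqR; ring.
  apply: (is_derive_scal (fun t => ln (v t x))).
  apply: (is_derive_comp ln (fun t => v t x)); last exact: (hp_vt _ _ _ _ _ _ H).
  by apply/is_derive_Reals; exact: derivable_pt_lim_ln.
by auto_derive => //; field.
Qed.

Lemma psi_dxx t x : 0 < t ->
  is_derive (fun x => vx t x / (beta * v t x) - / 2) x ((vxx t x * v t x - vx t x ^ 2) / (beta * v t x ^ 2)).
Proof.
move=> Ht; have Hv := vpos t x (Rlt_le _ _ Ht).
have H1 := hp_vxx _ _ _ _ _ _ H t x Ht; have H2 := hp_vx _ _ _ _ _ _ H t x.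
auto_derive.
  repeat split; [by eexists; exact: H1|by eexists; exact: H2|].
  by apply: Rmult_integral_contrapositive_currified; lra.
by rewrite (is_derive_unique (fun x => vx t x) _ _ H1) (is_derive_unique (fun x => v t x) _ _ H2); field; lra.
Qed.

(** Equivalent to |v_x| <= (beta / 2) v, which holds at time 0 and is preserved by Gaussian
    averaging. *)
Lemma psi_dx_bounds t x : 0 <= t -> -1 <= vx t x / (beta * v t x) - / 2 <= 0.
Proof.
move=> Ht; have Hv := vpos t x Ht.
have /Rabs_le_between Hxb := hp_vxb _ _ _ _ _ _ H t x.
have Hbv : 0 < beta * v t x by apply: Rmult_lt_0_compat.
split; apply: (Rmult_le_reg_r (beta * v t x)) => //.
  have -> : (vx t x / (beta * v t x) - / 2) * (beta * v t x) = vx t x - beta / 2 * v t x by field; lra.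
  lra.
have -> : (vx t x / (beta * v t x) - / 2) * (beta * v t x) = vx t x - beta / 2 * v t x by field; lra.
lra.
Qed.

Lemma continuous_psi t u : 0 <= t -> continuous (fun q : R * R => psi (fst q) (snd q)) (t, u).
Proof.
move=> Ht; have Hv := vpos t u Ht.
apply: (continuous_minus (fun q : R * R => ln (v (fst q) (snd q)) / beta - beta * fst q / 4) (fun q => snd q / 2)).
  apply: (continuous_minus (fun q : R * R => ln (v (fst q) (snd q)) / beta) (fun q => beta * fst q / 4)).
    apply: continuous2_div; [|exact: continuous_const|lra].
    apply: (continuous_comp (fun q : R * R => v (fst q) (snd q)) ln); first exact: (hp_vc _ _ _ _ _ _ H).
    by apply: ex_derive_continuous; auto_derive.
  apply: (continuous_comp (fst : R * R -> R) (fun t => beta * t / 4)); first exact: continuous_fst.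
  by apply: ex_derive_continuous; auto_derive.
apply: (continuous_comp (snd : R * R -> R) (fun t => t / 2)); first exact: continuous_snd.
by apply: ex_derive_continuous; auto_derive.
Qed.

Lemma continuous_in_x (F : R -> R -> R) t x :
  continuous (fun q : R * R => F (fst q) (snd q)) (t, x) -> continuous (F t) x.
Proof.
move/continuous_R2_inv => HF; apply: continuous_of_eps => e He.
have [d [Hd Hd2]] := HF e He; exists d; split => // s Hs; apply: Hd2 => //.
by rewrite Rminus_diag Rabs_R0.
Qed.

Lemma psi_in_XR t : 0 <= t -> in_XR (psi t).
Proof.
move=> Ht.
pose d u := vx t u / (beta * v t u) - / 2.
have Hdc u : continuous d u.
  apply: (continuous_minus (fun u => vx t u / (beta * v t u)) (fun=> / 2)); last exact: continuous_const.
  have Hv := vpos t u Ht.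
  apply: (continuous_mult (vx t) (fun u => / (beta * v t u))).
    by apply: continuous_in_x; exact: (hp_vxc _ _ _ _ _ _ H).
  apply: (continuous_comp (v t) (fun z => / (beta * z))).
    by apply: continuous_in_x; exact: (hp_vc _ _ _ _ _ _ H).
  apply: ex_derive_continuous; auto_derive; apply: Rmult_integral_contrapositive_currified; lra.
have E0 : d 0 = - (1 / 2) by rewrite /d (hp_vx0 _ _ _ _ _ _ H) /Rdiv Rmult_0_l; lra.
exists d; refine (conj _ (conj _ (conj _ (conj _ (conj _ (conj _ (conj _ _))))))) => //.
- move=> u Hu; rewrite /psi; have Hl := hp_vlow _ _ _ _ _ _ H t u Ht.
  have : beta / 2 * u + (beta / 2) ^ 2 * t <= ln (v t u).
    rewrite -[X in X <= _]ln_exp; apply: Rcomplements.ln_le => //; exact: exp_pos.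
  move=> Hln; apply: (Rmult_le_reg_r beta) => //.
  have -> : (ln (v t u) / beta - beta * t / 4 - u / 2) * beta = ln (v t u) - ((beta / 2) ^ 2 * t + beta / 2 * u) by field; lra.
  lra.
- by move=> u Hu; exact: psi_dx.
- have /is_derive_Reals Hd0 := psi_dx t 0 Ht.
  apply: at_right_of_eps => e He; have [del Hdel] := Hd0 e He.
  exists del; split; first exact: cond_pos.
  move=> h Hh; have := Hdel h ltac:(lra) ltac:(rewrite Rabs_right; lra).
  by rewrite Rplus_0_l.
- by apply: filterlim_filter_le_1 (Hdc 0); exact: filter_le_within.
- by move=> u _; exact: psi_dx_bounds.
- have HL := hp_v_inf _ _ _ _ _ _ H t Ht.
  apply: (is_lim_ext (fun u => / beta * ln (v t u * exp (- (beta / 2 * u + (beta / 2) ^ 2 * t))))).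
    move=> u; rewrite ln_mult; [|exact: vpos|exact: exp_pos].
    by rewrite ln_exp /psi; field; lra.
  have -> : Finite 0 = Rbar_mult (/ beta) (ln 1) by rewrite ln_1 /= Rmult_0_r.
  apply: is_lim_scal_l; apply: (is_lim_comp_continuous _ ln _ _ HL).
  by apply: ex_derive_continuous; auto_derive; lra.
Qed.

Lemma psi_classical : classical_sol p beta psi.
Proof.
have Hdu t u : 0 <= t -> du psi t u = vx t u / (beta * v t u) - / 2.
  by move=> Ht; apply: is_derive_unique; exact: psi_dx.
have Hdt t u : 0 < t -> dt psi t u = vxx t u / (beta * v t u) - beta / 4.
  by move=> Ht; apply: is_derive_unique; exact: psi_dt.
have Hdx t u : 0 < t -> is_derive (fun x => du psi t x) u ((vxx t u * v t u - vx t u ^ 2) / (beta * v t u ^ 2)).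
  move=> Ht; apply: (is_derive_ext (fun x => vx t x / (beta * v t x) - / 2)); last exact: psi_dxx.
  by move=> x; rewrite Hdu; lra.
have Hduu t u : 0 < t -> duu psi t u = (vxx t u * v t u - vx t u ^ 2) / (beta * v t u ^ 2).
  by move=> Ht; apply: is_derive_unique; exact: Hdx.
refine (conj _ (conj _ (conj _ _))).
- move=> u Hu; rewrite /psi (hp_v_init _ _ _ _ _ _ H) /ic ln_exp /evenpart Rabs_right; last lra.
  by field; lra.
- exact: psi_in_XR.
- move=> t u Ht Hu; apply: filterlim_filter_le_1 (continuous_psi t u Ht); exact: filter_le_within.
move=> t u Ht Hu; refine (conj _ (conj _ (conj _ (conj _ (conj _ (conj _ _)))))).
- by eexists; apply: psi_dt.
- by eexists; apply: psi_dx; lra.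
- by eexists; apply: Hdx.
- have Hv := vpos t u ltac:(lra).
  have Hbv : beta * v t u <> 0 by apply: Rmult_integral_contrapositive_currified; lra.
  apply: (continuous_ext_loc _ (fun q : R * R => vxx (fst q) (snd q) / (beta * v (fst q) (snd q)) - beta / 4)).
    apply: (filter_imp (fun q : R * R => 0 < fst q)); last exact: locally_fst_pos.
    by move=> q Hq; rewrite Hdt.
  apply: (continuous_minus (fun q : R * R => vxx (fst q) (snd q) / (beta * v (fst q) (snd q))) (fun=> beta / 4)); last exact: continuous_const.
  apply: continuous2_div => //; first by apply: (hp_vxxc _ _ _ _ _ _ H); lra.
  by apply: (continuous_scal_r beta (fun q : R * R => v (fst q) (snd q))); exact: (hp_vc _ _ _ _ _ _ H).
- have Hv := vpos t u ltac:(lra).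
  have Hbv : beta * v t u <> 0 by apply: Rmult_integral_contrapositive_currified; lra.
  apply: (continuous_ext_loc _ (fun q : R * R => vx (fst q) (snd q) / (beta * v (fst q) (snd q)) - / 2)).
    apply: (filter_imp (fun q : R * R => 0 < fst q)); last exact: locally_fst_pos.
    by move=> q Hq; rewrite Hdu; lra.
  apply: (continuous_minus (fun q : R * R => vx (fst q) (snd q) / (beta * v (fst q) (snd q))) (fun=> / 2)); last exact: continuous_const.
  apply: continuous2_div => //; first exact: (hp_vxc _ _ _ _ _ _ H).
  by apply: (continuous_scal_r beta (fun q : R * R => v (fst q) (snd q))); exact: (hp_vc _ _ _ _ _ _ H).
- have Hv := vpos t u ltac:(lra).
  have Cv := hp_vc _ _ _ _ _ _ H t u; have Cx := hp_vxc _ _ _ _ _ _ H t u.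
  have Cxx := hp_vxxc _ _ _ _ _ _ H t u ltac:(lra).
  apply: (continuous_ext_loc _ (fun q : R * R => (vxx (fst q) (snd q) * v (fst q) (snd q) - vx (fst q) (snd q) * vx (fst q) (snd q)) / (beta * (v (fst q) (snd q) * v (fst q) (snd q))))).
    apply: (filter_imp (fun q : R * R => 0 < fst q)); last exact: locally_fst_pos.
    by move=> q Hq; rewrite Hduu // /= !Rmult_1_r.
  apply: continuous2_div.
  + apply: (continuous_minus (fun q : R * R => vxx (fst q) (snd q) * v (fst q) (snd q)) (fun q => vx (fst q) (snd q) * vx (fst q) (snd q))).
      exact: (continuous_mult (fun q : R * R => vxx (fst q) (snd q)) (fun q => v (fst q) (snd q))).
    exact: (continuous_mult (fun q : R * R => vx (fst q) (snd q)) (fun q => vx (fst q) (snd q))).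
  + apply: (continuous_scal_r beta (fun q : R * R => v (fst q) (snd q) * v (fst q) (snd q))).
    exact: (continuous_mult (fun q : R * R => v (fst q) (snd q)) (fun q => v (fst q) (snd q))).
  + by rewrite /=; have := Rmult_lt_0_compat _ _ Hb (Rmult_lt_0_compat _ _ Hv Hv); lra.
- have Hv := vpos t u ltac:(lra); rewrite Hdt ?Hduu ?Hdu; try lra.
  by field; lra.
Qed.
End ClassicalSolution.

(** * Uniqueness *)

Lemma derive_pos_incr (f : R -> R) x l : is_derive f x l -> 0 < l ->
  exists d, 0 < d /\ forall h, 0 < h < d -> f x < f (x + h) /\ f (x - h) < f x.
Proof.
move=> /is_derive_Reals Hd Hl; have [d Hd'] := Hd (l / 2) ltac:(lra).
exists d; split; first exact: cond_pos.
move=> h Hh; split.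
  have /Rabs_def2 [_ H] := Hd' h ltac:(lra) ltac:(rewrite Rabs_right; lra).
  have H1 : 0 < (f (x + h) - f x) / h by lra.
  have := Rmult_lt_0_compat _ _ H1 (proj1 Hh); rewrite /Rdiv Rmult_assoc Rinv_l; lra.
have /Rabs_def2 [_ H] := Hd' (- h) ltac:(lra) ltac:(rewrite Rabs_left; lra).
have H1 : 0 < (f (x + - h) - f x) / - h by lra.
have := Rmult_lt_0_compat _ _ H1 (proj1 Hh).
have -> : (f (x + - h) - f x) / - h * h = f x - f (x - h) by rewrite /Rminus; field; lra.
lra.
Qed.

Lemma interior_max_derive (f : R -> R) a b x l : is_derive f x l -> a < x < b ->
  (forall y, a < y < b -> f y <= f x) -> l = 0.
Proof.
move=> Hd Hx Hm; case: (Rtotal_order l 0) => [Hl|[//|Hl]].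
- have [d [Hd0 H]] := derive_pos_incr (fun x => - f x) x (- l) (is_derive_opp _ _ _ Hd) ltac:(lra).
  have H1 := Rmin_l d (x - a); have H2 := Rmin_r d (x - a).
  have H3 : 0 < Rmin d (x - a) by apply: Rmin_glb_lt; lra.
  have := H (Rmin d (x - a) / 2) ltac:(lra); have := Hm (x - Rmin d (x - a) / 2) ltac:(lra); lra.
- have [d [Hd0 H]] := derive_pos_incr f x l Hd Hl.
  have H1 := Rmin_l d (b - x); have H2 := Rmin_r d (b - x).
  have H3 : 0 < Rmin d (b - x) by apply: Rmin_glb_lt; lra.
  have := H (Rmin d (b - x) / 2) ltac:(lra); have := Hm (x + Rmin d (b - x) / 2) ltac:(lra); lra.
Qed.

Lemma interior_max_derive2 (f f' : R -> R) a b x l :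
  (forall y, a < y < b -> is_derive f y (f' y)) -> is_derive f' x l -> a < x < b ->
  (forall y, a < y < b -> f y <= f x) -> l <= 0.
Proof.
move=> Hd Hd' Hx Hm; apply: Rnot_lt_le => Hl.
have E0 := interior_max_derive f a b x _ (Hd x Hx) Hx Hm.
have [d [Hd0 H]] := derive_pos_incr f' x l Hd' Hl.
have H1 := Rmin_l d (b - x); have H2 := Rmin_r d (b - x).
have H3 : 0 < Rmin d (b - x) by apply: Rmin_glb_lt; lra.
pose h := Rmin d (b - x) / 2.
have Hh : 0 < h < Rmin d (b - x) by rewrite /h; lra.
have [c [Hc E]] : exists c, x < c < x + h /\ f (x + h) - f x = f' c * (x + h - x).
  have [] := MVT_cor2 f f' x (x + h) ltac:(lra).
    by move=> c Hc; apply/is_derive_Reals; apply: Hd; lra.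
  by move=> c [E Hc]; exists c.
have := (H (c - x) ltac:(lra)).1; have -> : x + (c - x) = c by ring.
rewrite E0; have := Hm (x + h) ltac:(lra); nra.
Qed.

(** A 1-Lipschitz projection onto [0, b]. It extends functions from a closed rectangle to the plane,
    where compactness results for total functions apply. *)
Definition clamp (b x : R) : R := Rmax 0 (Rmin b x).

Lemma clamp_bounds b x : 0 <= b -> 0 <= clamp b x <= b.
Proof.
move=> Hb; rewrite /clamp; split; first exact: Rmax_l.
by apply: Rmax_lub => //; exact: Rmin_l.
Qed.

Lemma clamp_id b x : 0 <= x <= b -> clamp b x = x.
Proof. by move=> Hx; rewrite /clamp Rmin_right ?Rmax_right; lra. Qed.

Lemma clamp_lip b x y : Rabs (clamp b x - clamp b y) <= Rabs (x - y).
Proof.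
rewrite /clamp /Rmax /Rmin; do 4?case: Rle_dec; rewrite /Rabs; do 2?case: Rcase_abs; lra.
Qed.

Lemma rectangle_max (g : R -> R -> R) T X : 0 <= T -> 0 <= X ->
  (forall t x, 0 <= t <= T -> 0 <= x <= X -> forall e, 0 < e -> exists d, 0 < d /\
     forall t' x', 0 <= t' -> 0 <= x' -> Rabs (t' - t) < d -> Rabs (x' - x) < d -> Rabs (g t' x' - g t x) < e) ->
  exists t x, 0 <= t <= T /\ 0 <= x <= X /\
    forall t' x', 0 <= t' <= T -> 0 <= x' <= X -> g t' x' <= g t x.
Proof.
move=> HT HX Hg.
pose G t x := g (clamp T t) (clamp X x).
have HG t x : continuity_2d_pt G t x.
  move=> e; have [d [Hd H]] := Hg _ _ (clamp_bounds T t HT) (clamp_bounds X x HX) e (cond_pos e).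
  exists (mkposreal d Hd) => t' x' /= Ht Hx; apply: H.
  - by have := clamp_bounds T t' HT; lra.
  - by have := clamp_bounds X x' HX; lra.
  - exact: Rle_lt_trans (clamp_lip _ _ _) Ht.
  - exact: Rle_lt_trans (clamp_lip _ _ _) Hx.
have HU := uniform_continuity_2d G 0 T 0 X (fun t x _ _ => HG t x).
have Hxm t : exists x, 0 <= x <= X /\ forall y, 0 <= y <= X -> G t y <= G t x.
  have [|x [Hx1 Hx2]] := continuity_ab_maj (G t) 0 X HX; last by exists x; split.
  move=> c _; apply/continuity_pt_filterlim; apply: continuous_of_eps => e He.
  have [d Hd] := HG t c (mkposreal e He); exists d; split; first exact: cond_pos.
  by move=> s Hs; apply: Hd => //; rewrite Rminus_diag Rabs_R0; exact: cond_pos.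
pose xm t := proj1_sig (ClassicalEpsilon.constructive_indefinite_description _ (Hxm t)).
have Hxm1 t : 0 <= xm t <= X by rewrite /xm; case: ClassicalEpsilon.constructive_indefinite_description => x [].
have Hxm2 t y : 0 <= y <= X -> G t y <= G t (xm t).
  by rewrite /xm; case: ClassicalEpsilon.constructive_indefinite_description => x [_ H] /=; exact: H.
pose m t := G (clamp T t) (xm (clamp T t)).
have Hm t : continuity_pt m t.
  apply/continuity_pt_filterlim; apply: continuous_of_eps => e He.
  have [d Hd] := HU (mkposreal e He); exists d; split; first exact: cond_pos.
  move=> s Hs.
  have Hcl : Rabs (clamp T s - clamp T t) < d by apply: Rle_lt_trans (clamp_lip _ _ _) Hs.
  have Hcl' : Rabs (clamp T t - clamp T s) < d by rewrite Rabs_minus_sym.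
  have H0 z : Rabs (z - z) < d by rewrite Rminus_diag Rabs_R0; exact: cond_pos.
  have Bs := clamp_bounds T s HT; have Bt := clamp_bounds T t HT.
  have /Rabs_def2 /= A1 := Hd (clamp T t) (xm (clamp T s)) (clamp T s) (xm (clamp T s)) Bt (Hxm1 _) Bs (Hxm1 _) Hcl (H0 _).
  have /Rabs_def2 /= A2 := Hd (clamp T s) (xm (clamp T t)) (clamp T t) (xm (clamp T t)) Bs (Hxm1 _) Bt (Hxm1 _) Hcl' (H0 _).
  have B1 := Hxm2 (clamp T s) (xm (clamp T t)) (Hxm1 _).
  have B2 := Hxm2 (clamp T t) (xm (clamp T s)) (Hxm1 _).
  by rewrite /m; apply: Rabs_def1; lra.
have [t [Ht1 Ht2]] := continuity_ab_maj m 0 T HT (fun c _ => Hm c).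
exists t, (xm t); split => //; split; first exact: Hxm1.
move=> t' x' Ht' Hx'.
have := Ht1 t' Ht'; rewrite /m !clamp_id // => H.
have := Hxm2 t' x' Hx'; move: H; rewrite /G !clamp_id //; lra.
Qed.

(** exp u beats bounded functions at infinity, and exp (-2 u) makes the slope at u = 0 strictly
    negative, so that a maximum of the difference minus the barrier cannot sit at the Neumann
    boundary. *)
Definition barrier (mu t u : R) : R := exp (mu * t) * (exp u + exp (-2 * u)).

Lemma classical_sol_le p beta phi psi : 0 < beta ->
  classical_sol p beta phi -> classical_sol p beta psi ->
  forall T e, 0 < T -> 0 < e -> forall t u, 0 <= t <= T -> 0 <= u ->
  phi t u - psi t u <= e * barrier (5 + 2 * beta) t u.
Proof.
move=> Hb [F0 [FX [Fc Fd]]] [P0 [PX [Pc Pd]]] T e HT He.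
(* The second derivative of the barrier costs at most 4 and its drift at most 2 beta times the
   barrier; the remaining 1 makes the inequality strict. *)
set mu := 5 + 2 * beta.
have Hdom (f : R -> R -> R) : (forall t u, 0 <= t -> 0 <= u ->
     filterlim (fun p : R * R => f (fst p) (snd p))
       (within (fun p : R * R => 0 <= fst p /\ 0 <= snd p) (locally (t, u))) (locally (f t u))) ->
   forall t u, 0 <= t -> 0 <= u -> forall e, 0 < e -> exists d, 0 < d /\ forall t' u', 0 <= t' -> 0 <= u' ->
     Rabs (t' - t) < d -> Rabs (u' - u) < d -> Rabs (f t' u' - f t u) < e.
  move=> Hf t u Ht Hu e' He'.
  have [d Hd] := proj1 (filterlim_locally _ _) (Hf t u Ht Hu) (mkposreal e' He').
  exists d; split; first exact: cond_pos.
  move=> t' u' Ht' Hu' H1 H2; apply: (Hd (t', u')) => //; by split.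
have Fe := Hdom _ Fc; have Pe := Hdom _ Pc.
(* phi is bounded on [0,T] x [0,oo) since it decreases in u *)
have [K HK] : exists K, forall t u, 0 <= t <= T -> 0 <= u -> phi t u <= K.
  have [t0 [x0 [_ [Hx0 Hmax]]]] := rectangle_max phi T 0 (Rlt_le _ _ HT) (Rle_refl 0)
    (fun t x Ht Hx => Fe t x (proj1 Ht) (proj1 Hx)).
  exists (phi t0 x0) => t u Ht Hu; apply: Rle_trans (Hmax t 0 Ht ltac:(lra)).
  have := evenpart_le (phi t) u (FX t (proj1 Ht)); rewrite /evenpart Rabs_right; lra.
move=> t1 u1 Ht1 Hu1; apply: Rnot_lt_le => Hbad.
(* Chosen so that e X >= K: at u = X the barrier already exceeds phi, and the bad point u1 lies
   inside. *)
pose X := u1 + 1 + Rabs K / e.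
have HKe : 0 <= Rabs K / e by apply: Rmult_le_pos; [exact: Rabs_pos|apply: Rlt_le; exact: Rinv_0_lt_compat].
have HX : u1 < X by rewrite /X; lra.
pose g t u := phi t u - psi t u - e * barrier mu t u.
have HBc t u : continuous (fun q : R * R => e * barrier mu (fst q) (snd q)) (t, u).
  apply: (continuous_scal_r e (fun q : R * R => barrier mu (fst q) (snd q))).
  apply: (continuous_mult (fun q : R * R => exp (mu * fst q)) (fun q => exp (snd q) + exp (-2 * snd q))).
    apply: (continuous_comp (fst : R * R -> R) (fun t => exp (mu * t))); first exact: continuous_fst.
    exact: continuous_exp_scal.
  apply: (continuous_comp (snd : R * R -> R) (fun u => exp u + exp (-2 * u))); first exact: continuous_snd.
  by apply: ex_derive_continuous; auto_derive.
have [t [u [Ht [Hu Hmax]]]] : exists t u, 0 <= t <= T /\ 0 <= u <= X /\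
    forall t' u', 0 <= t' <= T -> 0 <= u' <= X -> g t' u' <= g t u.
  apply: rectangle_max; [lra|lra|].
  move=> t u Ht Hu e' He'.
  have [d1 [Hd1 H1]] := Fe t u ltac:(lra) ltac:(lra) (e' / 3) ltac:(lra).
  have [d2 [Hd2 H2]] := Pe t u ltac:(lra) ltac:(lra) (e' / 3) ltac:(lra).
  have [d3 [Hd3 H3]] := continuous_R2_inv (fun t u => e * barrier mu t u) t u (HBc t u) (e' / 3) ltac:(lra).
  have M1 := Rmin_l d1 (Rmin d2 d3); have M2 := Rmin_r d1 (Rmin d2 d3).
  have M3 := Rmin_l d2 d3; have M4 := Rmin_r d2 d3.
  exists (Rmin d1 (Rmin d2 d3)); split; first by do 2?apply: Rmin_glb_lt.
  move=> t' u' Ht' Hu' Hdt Hdu.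
  have /Rabs_def2 A1 := H1 t' u' Ht' Hu' ltac:(lra) ltac:(lra).
  have /Rabs_def2 A2 := H2 t' u' Ht' Hu' ltac:(lra) ltac:(lra).
  have /Rabs_def2 A3 := H3 t' u' ltac:(lra) ltac:(lra).
  by rewrite /g; apply: Rabs_def1; lra.
have Hgpos : 0 < g t u by have := Hmax t1 u1 Ht1 ltac:(lra); rewrite /g; lra.
have HE s : 0 < exp (mu * s) by exact: exp_pos.
have Hbpos s x : 0 < barrier mu s x.
  by apply: Rmult_lt_0_compat => //; have := exp_pos x; have := exp_pos (-2 * x); lra.
have Ht0 : 0 < t.
  case: (Req_dec t 0) => [E|]; last lra.
  by move: Hgpos; rewrite /g E F0 ?P0; try lra; have := Rmult_lt_0_compat _ _ He (Hbpos 0 u); lra.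
have Hmu : 0 <= mu by rewrite /mu; lra.
have HuX : u < X.
  case: (Req_dec u X) => [E|]; last lra.
  have H1 := HK t u Ht (proj1 Hu).
  have H2 : 0 <= psi t u by case: (PX t (proj1 Ht)) => d [H _]; apply: H; lra.
  have H3 : X < barrier mu t u.
    have HX1 := exp_ineq1_le u; have H4 := exp_pos (-2 * u).
    have H5 : 1 <= exp (mu * t) by rewrite -exp_0; apply: exp_le; nra.
    by rewrite /barrier; nra.
  have : K <= e * X.
    have -> : e * X = e * (u1 + 1) + Rabs K by rewrite /X; field; lra.
    by have := Rle_abs K; nra.
  by move: Hgpos; rewrite /g; nra.
have [df [_ [Hdf [Hdf0 [_ [_ [Hdfb [Edf _]]]]]]]] := FX t (proj1 Ht).
have [dp [_ [Hdp [Hdp0 [_ [_ [Hdpb [Edp _]]]]]]]] := PX t (proj1 Ht).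
pose Bx x := exp (mu * t) * (exp x - 2 * exp (-2 * x)).
have HBx x : is_derive (barrier mu t) x (Bx x).
  by rewrite /barrier /Bx; auto_derive => //; ring.
case: (Req_dec u 0) => [Eu|Hu0].
  (* at u = 0 the Neumann condition makes g increase to the right *)
  have HB0 : is_derive (barrier mu t) 0 (- exp (mu * t)).
    by have := HBx 0; rewrite /Bx Rmult_0_r exp_0; have -> : exp (mu * t) * (1 - 2 * 1) = - exp (mu * t) by ring.
  have /is_derive_Reals HB0' := HB0.
  pose c := e * exp (mu * t) / 4.
  have Hc : 0 < c by apply: Rdiv_lt_0_compat; [exact: Rmult_lt_0_compat|lra].
  have [d1 [Hd1 H1]] := at_right_eps _ _ _ Hdf0 c Hc.
  have [d2 [Hd2 H2]] := at_right_eps _ _ _ Hdp0 c Hc.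
  have [d3 H3] := HB0' (exp (mu * t) / 4) ltac:(have := HE t; lra).
  pose d := Rmin (Rmin d1 d2) (Rmin d3 X).
  have M1 := Rmin_l (Rmin d1 d2) (Rmin d3 X); have M2 := Rmin_r (Rmin d1 d2) (Rmin d3 X).
  have M3 := Rmin_l d1 d2; have M4 := Rmin_r d1 d2; have M5 := Rmin_l d3 X; have M6 := Rmin_r d3 X.
  have Hd : 0 < d.
    by rewrite /d; apply: Rmin_glb_lt; apply: Rmin_glb_lt => //; [exact: cond_pos|lra].
  pose h := d / 2.
  have Hh : 0 < h < d by rewrite /h; lra.
  have /Rabs_def2 A1 := H1 h ltac:(rewrite /d in Hh; lra).
  have /Rabs_def2 A2 := H2 h ltac:(rewrite /d in Hh; lra).
  have /Rabs_def2 A3 := H3 h ltac:(lra) ltac:(rewrite Rabs_right; rewrite /d in Hh; lra).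
  have := Hmax t h Ht ltac:(rewrite /d in Hh; lra); rewrite Eu /g.
  rewrite Edf Edp Rplus_0_l in A1 A2 A3.
  have Q1 : phi t h - phi t 0 = (phi t h - phi t 0) / h * h by field; lra.
  have Q2 : psi t h - psi t 0 = (psi t h - psi t 0) / h * h by field; lra.
  have Q3 : barrier mu t h - barrier mu t 0 = (barrier mu t h - barrier mu t 0) / h * h by field; lra.
  move: Q1 Q2 Q3 A1 A2 A3; set a1 := (_ / h); set a2 := (_ / h); set a3 := (_ / h) => Q1 Q2 Q3 A1 A2 A3.
  have Q : 0 < (a1 - a2 - e * a3) * h.
    apply: Rmult_lt_0_compat; last lra.
    have : e * a3 < e * (- exp (mu * t) + exp (mu * t) / 4) by apply: Rmult_lt_compat_l; lra.
    by rewrite /c in A1 A2; lra.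
  have : (a1 - a2 - e * a3) * h = (phi t h - phi t 0) - (psi t h - psi t 0) - e * (barrier mu t h - barrier mu t 0).
    by rewrite Q1 Q2 Q3; ring.
  lra.
have [Ft [Fu [Fuu [_ [_ [_ Feq]]]]]] := Fd t u Ht0 ltac:(lra).
have [Pt [Pu [Puu [_ [_ [_ Peq]]]]]] := Pd t u Ht0 ltac:(lra).
have Hgx y : 0 < y < X -> is_derive (g t) y (du phi t y - du psi t y - e * Bx y).
  move=> Hy.
  have [_ [Fy _]] := Fd t y Ht0 ltac:(lra); have [_ [Py _]] := Pd t y Ht0 ltac:(lra).
  apply: (is_derive_minus (fun y => phi t y - psi t y) (fun y => e * barrier mu t y)); last first.
    by apply: (is_derive_scal (barrier mu t)).
  by apply: (is_derive_minus (phi t) (psi t)); apply: Derive_correct.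
have HBxx : is_derive Bx u (exp (mu * t) * (exp u + 4 * exp (-2 * u))).
  by rewrite /Bx; auto_derive => //; ring.
have Hgxx : is_derive (fun y => du phi t y - du psi t y - e * Bx y) u
    (duu phi t u - duu psi t u - e * (exp (mu * t) * (exp u + 4 * exp (-2 * u)))).
  apply: (is_derive_minus (fun y => du phi t y - du psi t y) (fun y => e * Bx y)); last first.
    by apply: (is_derive_scal Bx).
  by apply: (is_derive_minus (du phi t) (du psi t)); apply: Derive_correct.
have Hmx y : 0 < y < X -> g t y <= g t u by move=> Hy; apply: Hmax => //; lra.
have E1 := interior_max_derive (g t) 0 X u _ (Hgx u ltac:(lra)) ltac:(lra) Hmx.
have E2 := interior_max_derive2 (g t) _ 0 X u _ Hgx Hgxx ltac:(lra) Hmx.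
have Hgt : is_derive (fun s => g s u) t (dt phi t u - dt psi t u - e * (mu * barrier mu t u)).
  apply: (is_derive_minus (fun s => phi s u - psi s u) (fun s => e * barrier mu s u)).
    by apply: (is_derive_minus (fun s => phi s u) (fun s => psi s u)); apply: Derive_correct.
  by rewrite /barrier; auto_derive => //; ring.
have E3 : 0 <= dt phi t u - dt psi t u - e * (mu * barrier mu t u).
  apply: Rnot_lt_le => Hneg.
  have [d [Hd H]] := derive_pos_incr (fun s => - g s u) t _ (is_derive_opp _ _ _ Hgt) ltac:(rewrite /opp /=; lra).
  have M1 := Rmin_l d t; have M2 := Rmin_r d t.
  have M3 : 0 < Rmin d t by apply: Rmin_glb_lt; lra.
  have := (H (Rmin d t / 2) ltac:(lra)).2; have := Hmax (t - Rmin d t / 2) u ltac:(lra) ltac:(lra); lra.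
have Hfb : -1 <= du phi t u <= 0.
  by have -> : du phi t u = df u; [apply: is_derive_unique; apply: Hdf; lra|apply: Hdfb; lra].
have Hpb : -1 <= du psi t u <= 0.
  by have -> : du psi t u = dp u; [apply: is_derive_unique; apply: Hdp; lra|apply: Hdpb; lra].
have Ew : du phi t u - du psi t u = e * Bx u by lra.
(* The nonlinearity factors as (phi_u - psi_u) (1 + phi_u + psi_u); the second factor is at most 1
   in absolute value since both slopes lie in [-1, 0]. *)
have Ediff : dt phi t u - dt psi t u = duu phi t u - duu psi t u + beta * (e * Bx u) * (1 + du phi t u + du psi t u).
  by rewrite Feq Peq -Ew; ring.
have Hdrift : beta * (e * Bx u) * (1 + du phi t u + du psi t u) <= beta * (e * (2 * barrier mu t u)).
  have HBB : Rabs (Bx u) <= 2 * barrier mu t u.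
    have := exp_pos u; have := exp_pos (-2 * u) => P1 P2.
    have := HE t => P3.
    have Q1 : 0 < exp (mu * t) * exp u by apply: Rmult_lt_0_compat.
    have Q2 : 0 < exp (mu * t) * exp (-2 * u) by apply: Rmult_lt_0_compat.
    by rewrite /Bx /barrier; apply: Rabs_le; lra.
  apply: Rle_trans (Rle_abs _) _; rewrite (Rabs_mult (beta * _)) (Rabs_mult beta) (Rabs_mult e) (Rabs_right beta) ?(Rabs_right e); try lra.
  have H1 : Rabs (1 + du phi t u + du psi t u) <= 1 by apply: Rabs_le; lra.
  have H2 := Rabs_pos (Bx u); have H3 := Rabs_pos (1 + du phi t u + du psi t u).
  have H4 : Rabs (Bx u) * Rabs (1 + du phi t u + du psi t u) <= 2 * barrier mu t u * 1 by apply: Rmult_le_compat.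
  have -> : beta * (e * Rabs (Bx u)) * Rabs (1 + du phi t u + du psi t u) =
    beta * e * (Rabs (Bx u) * Rabs (1 + du phi t u + du psi t u)) by ring.
  have -> : beta * (e * (2 * barrier mu t u)) = beta * e * (2 * barrier mu t u * 1) by ring.
  by apply: Rmult_le_compat_l => //; apply: Rmult_le_pos; lra.
have Hsec : exp (mu * t) * (exp u + 4 * exp (-2 * u)) <= 4 * barrier mu t u.
  have Q1 : 0 < exp (mu * t) * exp u by apply: Rmult_lt_0_compat => //; exact: exp_pos.
  by rewrite /barrier; lra.
have := Rmult_lt_0_compat _ _ He (Hbpos t u) => Heb.
have := Rmult_le_compat_l e _ _ (Rlt_le _ _ He) Hsec => Hsec'.
have Hbe : 0 < beta * (e * barrier mu t u) by apply: Rmult_lt_0_compat.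
move: E3; rewrite Ediff {1}/mu => E3.
have : e * ((5 + 2 * beta) * barrier mu t u) = 5 * (e * barrier mu t u) + 2 * (beta * (e * barrier mu t u)) by ring.
lra.
Qed.

Lemma classical_sol_unique p beta phi psi : 0 < beta ->
  classical_sol p beta phi -> classical_sol p beta psi ->
  forall t u, 0 <= t -> 0 <= u -> phi t u = psi t u.
Proof.
move=> Hb Hphi Hpsi t u Ht Hu.
have Hle f g : classical_sol p beta f -> classical_sol p beta g -> f t u <= g t u.
  move=> Hf Hg; apply: le_epsilon => e He.
  have HB : 0 < barrier (5 + 2 * beta) t u.
    by apply: Rmult_lt_0_compat; [exact: exp_pos|have := exp_pos u; have := exp_pos (-2 * u); lra].
  have := classical_sol_le p beta f g Hb Hf Hg (t + 1) (e / barrier (5 + 2 * beta) t u)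
    ltac:(lra) (Rdiv_lt_0_compat _ _ He HB) t u ltac:(lra) Hu.
  have -> : e / barrier (5 + 2 * beta) t u * barrier (5 + 2 * beta) t u = e by field; lra.
  lra.
by apply: Rle_antisym; apply: Hle.
Qed.

(** * Discrete energy estimate *)

Lemma Vexp_upper b q j k : 0 <= b -> isQ q -> Vexp b q (j + k) <= Vexp b q j * exp (b * INR k / 2).
Proof.
move=> Hb HQ; elim: k => [|k IH].
  by rewrite addn0 /= Rmult_0_r /Rdiv Rmult_0_l exp_0; lra.
rewrite addnS Vexp_step //.
have -> : b * INR k.+1 / 2 = b * INR k / 2 + b / 2 by rewrite S_INR; field.
rewrite exp_plus -Rmult_assoc; apply: Rmult_le_compat => //.
- by apply: Rlt_le; exact: Vexp_gt0.
- exact: exp_ge0.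
- by apply: exp_le; case: (_ \in q); rewrite /b2r; lra.
Qed.

Lemma Vexp_lower b q j k : 0 <= b -> isQ q -> Vexp b q j * exp (- (b * INR k / 2)) <= Vexp b q (j + k).
Proof.
move=> Hb HQ; elim: k => [|k IH].
  by rewrite addn0 /= Rmult_0_r /Rdiv Rmult_0_l Ropp_0 exp_0; lra.
rewrite addnS Vexp_step //.
have -> : - (b * INR k.+1 / 2) = - (b * INR k / 2) + - (b / 2) by rewrite S_INR; field.
rewrite exp_plus -Rmult_assoc; apply: Rmult_le_compat => //.
- by apply: Rmult_le_pos; [apply: Rlt_le; exact: Vexp_gt0|exact: exp_ge0].
- exact: exp_ge0.
- by apply: exp_le; case: (_ \in q); rewrite /b2r; lra.
Qed.

Lemma INR_ge1 N : (0 < N)%N -> 1 <= INR N.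
Proof. by move=> H; apply: (le_INR 1); lia. Qed.

Lemma one_minus_exp_neg b : 0 <= b -> 0 <= 1 - exp (- b) <= b.
Proof.
move=> Hb; have := exp_ineq1_le (- b); have : exp (- b) <= exp 0 by apply: exp_le; lra.
rewrite exp_0; lra.
Qed.

Lemma exp_minus_one b : 0 <= b -> 0 <= exp b - 1 <= b * exp b.
Proof.
move=> Hb; have := one_minus_exp_neg b Hb; have He := exp_pos b.
have E : exp (- b) * exp b = 1 by rewrite -exp_plus -exp_0; congr exp; lra.
nra.
Qed.

(** Comparable to V_0^2, which sizes the noise. The generator of V_0^2 alone contains N^2 times a
    gradient; in the mean over N sites these gradients telescope to one far flux. The half weight at
    0 is again the reflection. *)
Definition Hfun (b : R) (N : nat) (q : seq nat) : R :=
  / INR N * (Vexp b q 0 ^ 2 / 2 + bsum N (fun j => Vexp b q j.+1 ^ 2)).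

Lemma gen_Vexp_sq_le b q k : 0 <= b -> isQ q ->
  gen (moves (exp (- b)) q) (fun r => Vexp b r k ^ 2) q <=
  exp (- (b / 2)) * (Vexp b q k.+1 ^ 2 + Vprev b q k ^ 2 - 2 * Vexp b q k ^ 2) +
  (1 - exp (- b)) ^ 2 * (exp b + 1) * Vexp b q k ^ 2.
Proof.
move=> Hb HQ; rewrite (gen_sq _ (fun r => Vexp b r k)) gen_Vexp //.
have := carre_Vexp b q k HQ.
have E3 : exp (- b) = exp (- (b / 2)) * exp (- (b / 2)) by rewrite -exp_plus; congr exp; lra.
move: (carre _ _ _) => c Hc; apply: Rplus_le_compat => //.
have Hs := exp_pos (- (b / 2)); rewrite E3.
set s := exp (- (b / 2)) in Hs *; set v := Vexp b q k; set v1 := Vexp b q k.+1; set v0 := Vprev b q k.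
have -> : 2 * v * (s * (v0 + v1) - (1 + s * s) * v) =
  s * (v1 ^ 2 + v0 ^ 2 - 2 * v ^ 2) - s * ((v1 - v) ^ 2 + (v0 - v) ^ 2) - 2 * ((1 - s) ^ 2 * v ^ 2) by ring.
have := Rmult_le_pos _ _ (Rlt_le _ _ Hs) (Rplus_le_le_0_compat _ _ (pow2_ge_0 (v1 - v)) (pow2_ge_0 (v0 - v))).
have := Rmult_le_pos _ _ (pow2_ge_0 (1 - s)) (pow2_ge_0 v); lra.
Qed.

Lemma Hfun_bounds b N q : (0 < N)%N -> 0 <= b -> INR N * b <= 2 -> isQ q ->
  exp (-2) * Vexp b q 0 ^ 2 <= Hfun b N q <= 2 * exp 2 * Vexp b q 0 ^ 2.
Proof.
move=> HN Hb HNb HQ; have HN1 := INR_ge1 N HN.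
have HV := Vexp_gt0 b q 0; have HV2 := pow2_ge_0 (Vexp b q 0).
have Hj j : (j < N)%N -> exp (-2) * Vexp b q 0 ^ 2 <= Vexp b q j.+1 ^ 2 <= exp 2 * Vexp b q 0 ^ 2.
  move=> Hj; have HjN : INR j.+1 <= INR N by apply: le_INR; lia.
  have Hbj : b * INR j.+1 <= 2 by nra.
  have U := Vexp_upper b q 0 j.+1 Hb HQ; have L := Vexp_lower b q 0 j.+1 Hb HQ; rewrite add0n in U L.
  have H0 := pos_INR j.+1.
  have E2 : exp 2 = exp 1 ^ 2 by rewrite /= Rmult_1_r -exp_plus; congr exp; lra.
  have E2' : exp (-2) = exp (-1) ^ 2 by rewrite /= Rmult_1_r -exp_plus; congr exp; lra.
  rewrite E2 E2' -!Rpow_mult_distr; split; apply: pow_incr.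
    split; first by apply: Rmult_le_pos; [exact: exp_ge0|lra].
    apply: Rle_trans L; rewrite Rmult_comm; apply: Rmult_le_compat_l; first lra.
    by apply: exp_le; lra.
  split; first by apply: Rlt_le; exact: Vexp_gt0.
  apply: Rle_trans U _; rewrite Rmult_comm; apply: Rmult_le_compat_r; first lra.
  by apply: exp_le; lra.
have L := bsum_le N (fun=> exp (-2) * Vexp b q 0 ^ 2) _ (fun j H => (Hj j H).1).
have U := bsum_le N _ (fun=> exp 2 * Vexp b q 0 ^ 2) (fun j H => (Hj j H).2).
rewrite bsum_const in L; rewrite bsum_const in U.
have He : 1 <= exp 2 by rewrite -exp_0; apply: exp_le; lra.
have EN x : INR N * (/ INR N * x) = x by field; lra.
have P1 := Rmult_le_compat_r _ _ _ HV2 He.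
have P2 : 1 * (exp 2 * Vexp b q 0 ^ 2) <= INR N * (exp 2 * Vexp b q 0 ^ 2) by apply: Rmult_le_compat_r; lra.
by rewrite /Hfun; split; apply: (Rmult_le_reg_l (INR N)); try lra; rewrite EN; lra.
Qed.

Definition cQ : R := exp 2 + 1.
(** The first term bounds the flux through site N, the second the quadratic variation; all bounds
    use N b <= 2. *)
Definition cH : R := 2 * exp 6 + 4 * cQ.

Lemma cQ_bound b N : (0 < N)%N -> 0 <= b -> INR N * b <= 2 -> exp b + 1 <= cQ.
Proof.
move=> HN Hb HNb; have HN1 := INR_ge1 N HN; rewrite /cQ.
have : exp b <= exp 2 by apply: exp_le; nra.
lra.
Qed.

Lemma scaled_gap b N : (0 < N)%N -> 0 <= b -> INR N * b <= 2 -> INR N ^ 2 * (1 - exp (- b)) ^ 2 <= 4.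
Proof.
move=> HN Hb HNb; have HN1 := INR_ge1 N HN; have H := one_minus_exp_neg b Hb.
rewrite -Rpow_mult_distr; have -> : 4 = 2 ^ 2 by ring.
apply: pow_incr; split; first by apply: Rmult_le_pos; lra.
by apply: Rle_trans HNb; apply: Rmult_le_compat_l; lra.
Qed.

Lemma gen_Hfun_le b N q : (0 < N)%N -> 0 <= b -> INR N * b <= 2 -> isQ q ->
  gen (ratesN N (exp (- b)) q) (Hfun b N) q <= cH * Hfun b N q.
Proof.
move=> HN Hb HNb HQ; have HN1 := INR_ge1 N HN.
have HH := Hfun_bounds b N q HN Hb HNb HQ.
rewrite gen_ratesN /Hfun gen_scal.
rewrite (gen_ext _ _ (fun r => (/ 2) * Vexp b r 0 ^ 2 + 1 * bsum N (fun j => Vexp b r j.+1 ^ 2))); last first.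
  by move=> r; field.
rewrite (gen_lin _ (fun r => Vexp b r 0 ^ 2) (fun r => bsum N (fun j => Vexp b r j.+1 ^ 2))).
rewrite (gen_bsum _ N (fun j r => Vexp b r j.+1 ^ 2)).
set s := exp (- (b / 2)); set Q := (1 - exp (- b)) ^ 2 * (exp b + 1).
have Hs : 0 < s <= 1.
  by split; [exact: exp_pos|rewrite -exp_0; apply: exp_le; lra].
have H0 := gen_Vexp_sq_le b q 0 Hb HQ; rewrite -/s -/Q in H0.
have HS : bsum N (fun j => gen (moves (exp (- b)) q) (fun r => Vexp b r j.+1 ^ 2) q) <=
   s * (Vexp b q N.+1 ^ 2 - Vexp b q N ^ 2 - (Vexp b q 1 ^ 2 - Vexp b q 0 ^ 2)) + Q * bsum N (fun j => Vexp b q j.+1 ^ 2).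
  elim: (N) => [|n IH]; first by rewrite /=; lra.
  rewrite !bsumS; have := gen_Vexp_sq_le b q n.+1 Hb HQ; rewrite -/s -/Q [Vprev _ _ _]/=; lra.
set S := bsum N (fun j => Vexp b q j.+1 ^ 2) in HS *.
have HSH : / INR N * (Vexp b q 0 ^ 2 / 2 + S) = Hfun b N q by [].
(* The increment of V^2 over one site is at most V_N^2 (exp b - 1), of order 1/N, which pays for the
   factor N. *)
have Htop : INR N * (s * (Vexp b q N.+1 ^ 2 - Vexp b q N ^ 2)) <= 2 * exp 6 * Hfun b N q.
  have HVN := Vexp_gt0 b q N.
  have HV0 := Vexp_gt0 b q 0.
  have U1 := Vexp_upper b q N 1 Hb HQ; rewrite addn1 /= Rmult_1_r in U1.
  have U2 := Vexp_upper b q 0 N Hb HQ; rewrite add0n in U2.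
  have Hem := exp_minus_one b Hb.
  have Heb : exp b <= exp 2 by apply: exp_le; nra.
  have Eb : exp b = exp (b / 2) ^ 2 by rewrite /= Rmult_1_r -exp_plus; congr exp; lra.
  have D : Vexp b q N.+1 ^ 2 - Vexp b q N ^ 2 <= (exp b - 1) * Vexp b q N ^ 2.
    have : Vexp b q N.+1 ^ 2 <= (Vexp b q N * exp (b / 2)) ^ 2.
      by apply: pow_incr; split => //; apply: Rlt_le; exact: Vexp_gt0.
    rewrite Rpow_mult_distr -Eb; lra.
  have HVN2 : Vexp b q N ^ 2 <= exp 2 * Vexp b q 0 ^ 2.
    have -> : exp 2 = exp 1 ^ 2 by rewrite /= Rmult_1_r -exp_plus; congr exp; lra.
    rewrite -Rpow_mult_distr; apply: pow_incr; split; first lra.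
    apply: Rle_trans U2 _; rewrite Rmult_comm; apply: Rmult_le_compat_r; first lra.
    by apply: exp_le; lra.
  have P0 := pow2_ge_0 (Vexp b q N); have P1 := pow2_ge_0 (Vexp b q 0).
  have HP := exp_pos 2.
  have A1 : s * (Vexp b q N.+1 ^ 2 - Vexp b q N ^ 2) <= (exp b - 1) * Vexp b q N ^ 2.
    have := Rmult_le_compat_l s _ _ (Rlt_le _ _ Hs.1) D.
    have : s * ((exp b - 1) * Vexp b q N ^ 2) <= 1 * ((exp b - 1) * Vexp b q N ^ 2).
      by apply: Rmult_le_compat_r; [apply: Rmult_le_pos; lra|lra].
    lra.
  have A2 : INR N * (exp b - 1) <= 2 * exp 2.
    apply: (Rle_trans _ (INR N * b * exp b)); first by rewrite Rmult_assoc; apply: Rmult_le_compat_l; lra.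
    by apply: Rmult_le_compat; try lra; apply: Rmult_le_pos; lra.
  have A3 : INR N * (s * (Vexp b q N.+1 ^ 2 - Vexp b q N ^ 2)) <= 2 * exp 2 * (exp 2 * Vexp b q 0 ^ 2).
    apply: (Rle_trans _ (INR N * ((exp b - 1) * Vexp b q N ^ 2))); first by apply: Rmult_le_compat_l; lra.
    rewrite -Rmult_assoc; apply: Rmult_le_compat => //.
    by apply: Rmult_le_pos; lra.
  have E6 : exp 6 * exp (-2) = exp 2 * exp 2 by rewrite -!exp_plus; congr exp; lra.
  have H6 := exp_pos 6.
  have := Rmult_le_compat_l (2 * exp 6) _ _ ltac:(lra) HH.1.
  have -> : 2 * exp 6 * (exp (-2) * Vexp b q 0 ^ 2) = 2 * exp 2 * (exp 2 * Vexp b q 0 ^ 2).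
    by rewrite -!Rmult_assoc (Rmult_assoc 2) E6; ring.
  lra.
have HQ4 : INR N ^ 2 * Q <= 4 * cQ.
  rewrite /Q -Rmult_assoc; apply: Rmult_le_compat.
  - by apply: Rmult_le_pos; exact: pow2_ge_0.
  - by have := exp_pos b; lra.
  - exact: scaled_gap.
  - exact: (cQ_bound b N).
have HHpos : 0 <= Hfun b N q.
  by apply: Rle_trans HH.1; apply: Rmult_le_pos; [exact: exp_ge0|exact: pow2_ge_0].
have HV1 : Vprev b q 0 = Vexp b q 1 by [].
rewrite HV1 in H0; rewrite HSH.
apply: (Rle_trans _ (INR N ^ 2 * (/ INR N * (s * (Vexp b q N.+1 ^ 2 - Vexp b q N ^ 2) + Q * (Vexp b q 0 ^ 2 / 2 + S))))).
  apply: Rmult_le_compat_l; first exact: pow2_ge_0.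
  apply: Rmult_le_compat_l; first by apply: Rlt_le; apply: Rinv_0_lt_compat; lra.
  lra.
have -> : INR N ^ 2 * (/ INR N * (s * (Vexp b q N.+1 ^ 2 - Vexp b q N ^ 2) + Q * (Vexp b q 0 ^ 2 / 2 + S))) =
   INR N * (s * (Vexp b q N.+1 ^ 2 - Vexp b q N ^ 2)) + INR N ^ 2 * Q * Hfun b N q.
  by rewrite -HSH; field; lra.
have := Rmult_le_compat_r _ _ _ HHpos HQ4; rewrite /cH; lra.
Qed.

(** The quadratic variation of U_k is bounded by a multiple of exp (3 k / N); rate 4 leaves the
    summable exp (- k / N). *)
Definition wt (N k : nat) : R := exp (- (4 * INR k / INR N)).

Lemma wt_gt0 N k : 0 < wt N k. Proof. exact: exp_pos. Qed.

Lemma mean_exp_le2 N K : (0 < N)%N -> / INR N * bsum K (fun k => exp (- (INR k / INR N))) <= 2.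
Proof.
move=> HN; have HN1 := INR_ge1 N HN.
pose r := exp (- / INR N).
have Hi : 0 < / INR N <= 1 by split; [apply: Rinv_0_lt_compat; lra|rewrite -Rinv_1; apply: Rinv_le_contravar; lra].
have Hr : r <= 1 - / INR N / 2.
  have H1 := exp_ineq1_le (/ INR N); have Hp := exp_pos (- / INR N).
  have E : exp (- / INR N) * exp (/ INR N) = 1 by rewrite -exp_plus -exp_0; congr exp; lra.
  rewrite /r; set i := / INR N in Hi H1 Hp E *; nra.
have Hr0 : 0 < r by exact: exp_pos.
have Hgeo : (1 - r) * bsum K (fun k => exp (- (INR k / INR N))) <= 1.
  have -> : (1 - r) * bsum K (fun k => exp (- (INR k / INR N))) = 1 - exp (- (INR K / INR N)).
    elim: K => [|K IH]; first by rewrite /= /Rdiv Rmult_0_l Ropp_0 exp_0; lra.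
    rewrite bsumS Rmult_plus_distr_l IH.
    have -> : exp (- (INR K.+1 / INR N)) = r * exp (- (INR K / INR N)).
      by rewrite /r -exp_plus S_INR; congr exp; field; lra.
    ring.
  have := exp_pos (- (INR K / INR N)); lra.
have HB : 0 <= bsum K (fun k => exp (- (INR k / INR N))) by apply: bsum_ge0 => k _; exact: exp_ge0.
have : / INR N / 2 * bsum K (fun k => exp (- (INR k / INR N))) <= (1 - r) * bsum K (fun k => exp (- (INR k / INR N))).
  by apply: Rmult_le_compat_r => //; lra.
lra.
Qed.

(** Moves the Laplacian onto the weight, whose second difference is O(1/N^2) relative to it. At k =
    0, [k.-1] encodes the reflection X_(-1) = X_0 and leaves the boundary term (1 - r') X_0, of
    favourable sign; the only cost is the flux at K. *)
Lemma summation_by_parts N K (X : nat -> R) : (0 < N)%N -> (forall k, 0 <= X k) ->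
  INR N ^ 2 * bsum K.+1 (fun k => wt N k * (X k.+1 + X k.-1 - 2 * X k)) <=
  16 * exp 8 * bsum K.+1 (fun k => wt N k * X k) + INR N ^ 2 * wt N K * X K.+1.
Proof.
move=> HN HX; have HN1 := INR_ge1 N HN.
pose r := exp (- (4 / INR N)); pose r' := exp (4 / INR N).
have Hrr : r * r' = 1 by rewrite -exp_plus -exp_0; congr exp; lra.
have Hr0 : 0 < r by exact: exp_pos.
have Hr' : 1 <= r'.
  by rewrite /r' -exp_0; apply: exp_le; apply: Rlt_le; apply: Rdiv_lt_0_compat; lra.
have HwS k : wt N k.+1 = r * wt N k by rewrite /wt /r -exp_plus S_INR; congr exp; field; lra.
have E n : bsum n.+1 (fun k => wt N k * (X k.+1 + X k.-1 - 2 * X k)) =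
   (r + r' - 2) * bsum n.+1 (fun k => wt N k * X k) + wt N n * X n.+1 - wt N n.+1 * X n + (1 - r') * X 0%N.
  elim: n => [|n IH].
    rewrite /= HwS; have -> : wt N 0 = 1 by rewrite /wt /= Rmult_0_r /Rdiv Rmult_0_l Ropp_0 exp_0.
    ring.
  rewrite bsumS IH [bsum n.+2 _]bsumS [n.+1.-1]/=.
  have -> : wt N n = r' * wt N n.+1 by rewrite HwS; ring [Hrr].
  rewrite (HwS n.+1); ring.
rewrite E.
have Hgap : INR N ^ 2 * (r + r' - 2) <= 16 * exp 8.
  have H4 : 0 <= 4 / INR N by apply: Rlt_le; apply: Rdiv_lt_0_compat; lra.
  have H1 := exp_minus_one (4 / INR N) H4; rewrite -/r' in H1.
  have H2 : r' <= exp 4.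
    apply: exp_le; apply: (Rmult_le_reg_r (INR N)); first lra.
    by rewrite /Rdiv Rmult_assoc Rinv_l; lra.
  have Hr1 : r <= 1 by nra.
  have -> : r + r' - 2 = r * (r' - 1) ^ 2 by ring [Hrr].
  have -> : exp 8 = exp 4 ^ 2 by rewrite /= Rmult_1_r -exp_plus; congr exp; lra.
  have Hsq : (INR N * (r' - 1)) ^ 2 <= (4 * exp 4) ^ 2.
    apply: pow_incr; split; first by apply: Rmult_le_pos; lra.
    apply: (Rle_trans _ (INR N * (4 / INR N * r'))); first by apply: Rmult_le_compat_l; lra.
    have -> : INR N * (4 / INR N * r') = 4 * r' by field; lra.
    lra.
  rewrite Rpow_mult_distr in Hsq.
  have := Rmult_le_pos _ _ (pow2_ge_0 (INR N)) (pow2_ge_0 (r' - 1)); move: Hsq.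
  set a := INR N ^ 2; set c := (r' - 1) ^ 2 => Hsq Hac.
  have -> : a * (r * c) = r * (a * c) by ring.
  have -> : 16 * exp 4 ^ 2 = (4 * exp 4) ^ 2 by ring.
  nra.
have HS : 0 <= bsum K.+1 (fun k => wt N k * X k).
  by apply: bsum_ge0 => k _; apply: Rmult_le_pos => //; apply: Rlt_le; exact: wt_gt0.
have := Rmult_le_compat_r _ _ _ HS Hgap.
have HN2 := pow2_ge_0 (INR N).
have T1 : 0 <= INR N ^ 2 * (wt N K.+1 * X K).
  by apply: Rmult_le_pos => //; apply: Rmult_le_pos => //; apply: Rlt_le; exact: wt_gt0.
have T2 : INR N ^ 2 * ((1 - r') * X 0%N) <= 0.
  by have := HX 0%N; have : 0 <= (r' - 1) * X 0%N by [apply: Rmult_le_pos; [lra|exact: HX]]; nra.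
lra.
Qed.

Definition uprev (u : nat -> R) (k : nat) : R := match k with O => - u 0%N | S k' => u k' end.

(** The cutoff at N^2 sites lies at macroscopic distance N, where the weight is exponentially small
    in N. *)
Definition energy (b : R) (N : nat) (u : nat -> R) (q : seq nat) : R :=
  / INR N * bsum (N ^ 2)%N.+1 (fun k => wt N k * (Usum b N q k - u k) ^ 2).

(* Consistency error of the discrete heat equation for a sequence u with time derivative r. *)
Definition cerr (b : R) (N : nat) (u r : nat -> R) (k : nat) : R :=
  INR N ^ 2 * (exp (- (b / 2)) * (u k.+1 + uprev u k - 2 * u k) - (1 - exp (- (b / 2))) ^ 2 * u k) - r k.

(** The second difference of the weight, plus 1 from splitting the product of deviation and
    consistency error. *)
Definition cE : R := 16 * exp 8 + 1.

(** With r the time derivative of u, the left side is (d/ds + L) of the energy. On the right stand a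
    Gronwall term, the consistency error, the flux at the cutoff and the jump noise. *)
Lemma gen_energy_le b N u r q : (0 < N)%N -> 0 <= b -> INR N * b <= 2 -> isQ q ->
  / INR N * bsum (N ^ 2)%N.+1 (fun k => wt N k * (-2 * (Usum b N q k - u k) * r k)) +
  gen (ratesN N (exp (- b)) q) (energy b N u) q <=
  cE * energy b N u q + / INR N * bsum (N ^ 2)%N.+1 (fun k => wt N k * cerr b N u r k ^ 2) +
  INR N * wt N (N ^ 2)%N * (Usum b N q (N ^ 2)%N.+1 - u (N ^ 2)%N.+1) ^ 2 +
  8 * cQ * / INR N * Vexp b q 0 ^ 2.
Proof.
move=> HN Hb HNb HQ; have HN1 := INR_ge1 N HN; set K := (N ^ 2)%N.
have Hi : 0 < / INR N by apply: Rinv_0_lt_compat; lra.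
pose D k := Usum b N q k - u k.
have Hs : 0 < exp (- (b / 2)) <= 1 by split; [exact: exp_pos|rewrite -exp_0; apply: exp_le; lra].
have HV0 := Vexp_gt0 b q 0.
(* Each V_j^2 is at most V_0^2 exp (2 k / N), and the number k + 1 of terms is at most N exp (k /
   N). *)
have Hcarre k : INR N ^ 2 * carre (moves (exp (- b)) q) (fun r => Usum b N r k) q <=
    4 * cQ / INR N * Vexp b q 0 ^ 2 * exp (3 * INR k / INR N).
  apply: Rle_trans (Rmult_le_compat_l _ _ _ (pow2_ge_0 (INR N)) (carre_Usum b N q k HQ HN)) _.
  have HB : bsum k.+1 (fun j => Vexp b q j ^ 2) <= INR k.+1 * (Vexp b q 0 ^ 2 * exp (2 * INR k / INR N)).
    rewrite -bsum_const; apply: bsum_le => j Hj.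
    have U := Vexp_upper b q 0 j Hb HQ; rewrite add0n in U.
    have -> : exp (2 * INR k / INR N) = exp (INR k / INR N) ^ 2 by rewrite /= Rmult_1_r -exp_plus; congr exp; lra.
    rewrite -Rpow_mult_distr; apply: pow_incr; split; first by apply: Rlt_le; exact: Vexp_gt0.
    apply: Rle_trans U _; apply: Rmult_le_compat_l; first lra.
    apply: exp_le; have Hjk : INR j <= INR k by apply: le_INR; lia.
    have Hj0 := pos_INR j; apply: (Rmult_le_reg_r (INR N)); first lra.
    have -> : INR k / INR N * INR N = INR k by field; lra.
    nra.
  have Hk : INR k.+1 <= INR N * exp (INR k / INR N).
    have := exp_ineq1_le (INR k / INR N) => He.
    have : INR N * (1 + INR k / INR N) <= INR N * exp (INR k / INR N) by apply: Rmult_le_compat_l; lra.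
    have -> : INR N * (1 + INR k / INR N) = INR N + INR k by field; lra.
    rewrite S_INR; lra.
  have HP : 0 <= Vexp b q 0 ^ 2 * exp (2 * INR k / INR N).
    by apply: Rmult_le_pos; [exact: pow2_ge_0|exact: exp_ge0].
  have HB' : bsum k.+1 (fun j => Vexp b q j ^ 2) <= INR N * (Vexp b q 0 ^ 2 * exp (3 * INR k / INR N)).
    apply: Rle_trans HB _.
    have -> : exp (3 * INR k / INR N) = exp (INR k / INR N) * exp (2 * INR k / INR N) by rewrite -exp_plus; congr exp; lra.
    have := Rmult_le_compat_r _ _ _ HP Hk; lra.
  have HB0 : 0 <= bsum k.+1 (fun j => Vexp b q j ^ 2) by apply: bsum_ge0 => j _; exact: pow2_ge_0.
  have Hc := cQ_bound b N HN Hb HNb; have Hg := scaled_gap b N HN Hb HNb.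
  have -> : INR N ^ 2 * (/ INR N ^ 2 * ((1 - exp (- b)) ^ 2 * (exp b + 1) * bsum k.+1 (fun j => Vexp b q j ^ 2))) =
    / INR N ^ 2 * (INR N ^ 2 * (1 - exp (- b)) ^ 2 * (exp b + 1) * bsum k.+1 (fun j => Vexp b q j ^ 2)).
    by field; lra.
  have -> : 4 * cQ / INR N * Vexp b q 0 ^ 2 * exp (3 * INR k / INR N) =
    / INR N ^ 2 * (4 * cQ * (INR N * (Vexp b q 0 ^ 2 * exp (3 * INR k / INR N)))).
    by field; lra.
  apply: Rmult_le_compat_l; first by apply: Rlt_le; apply: Rinv_0_lt_compat; apply: pow_lt; lra.
  apply: Rmult_le_compat => //.
    by apply: Rmult_le_pos; [apply: Rmult_le_pos; exact: pow2_ge_0|have := exp_pos b; lra].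
  apply: Rmult_le_compat => //; first by apply: Rmult_le_pos; exact: pow2_ge_0.
  by have := exp_pos b; lra.
have HD2 k : INR N ^ 2 * gen (moves (exp (- b)) q) (fun x => (Usum b N x k - u k) ^ 2) q + -2 * D k * r k <=
   INR N ^ 2 * (D k.+1 ^ 2 + D k.-1 ^ 2 - 2 * D k ^ 2) * exp (- (b / 2)) + D k ^ 2 + cerr b N u r k ^ 2 +
   4 * cQ / INR N * Vexp b q 0 ^ 2 * exp (3 * INR k / INR N).
  rewrite (gen_sq _ (fun x => Usum b N x k - u k)).
  have -> : gen (moves (exp (- b)) q) (fun x => Usum b N x k - u k) q = gen (moves (exp (- b)) q) (fun x => Usum b N x k) q.
    by apply: lsum_ext => pp; ring.
  have -> : carre (moves (exp (- b)) q) (fun x => Usum b N x k - u k) q = carre (moves (exp (- b)) q) (fun x => Usum b N x k) q.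
    by apply: lsum_ext => pp; ring.
  rewrite gen_Usum // -/(D k).
  have := Hcarre k; move: (carre _ _ _) (4 * cQ / INR N * Vexp b q 0 ^ 2 * exp (3 * INR k / INR N)) => c M HcM.
  have EU : Usum b N q k = D k + u k by rewrite /D; ring.
  have EU1 : Usum b N q k.+1 = D k.+1 + u k.+1 by rewrite /D; ring.
  (* The deviation inherits the odd reflection of U and u; squaring turns it into the even one of
     [summation_by_parts]. *)
  pose d := if k is O then - D 0%N else D k.-1.
  have EUp : Uprev b N q k = d + uprev u k by rewrite /d /D; case: (k) => [|k'] /=; ring.
  have Ed : D k.-1 ^ 2 = d ^ 2 by rewrite /d; case: (k) => [|k'] /=; ring.
  rewrite Ed EU EU1 EUp.
  set s := exp (- (b / 2)) in Hs *.
  have -> : INR N ^ 2 * (2 * D k * (s * (D k.+1 + u k.+1 + (d + uprev u k) - 2 * (D k + u k)) - (1 - s) ^ 2 * (D k + u k)) + c) + -2 * D k * r k =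
    INR N ^ 2 * s * (2 * D k * (D k.+1 + d - 2 * D k)) - 2 * (INR N ^ 2 * (1 - s) ^ 2 * D k ^ 2) + 2 * D k * cerr b N u r k + INR N ^ 2 * c.
    by rewrite /cerr -/s; ring.
  have P1 : 0 <= INR N ^ 2 * (1 - s) ^ 2 * D k ^ 2 by apply: Rmult_le_pos; [apply: Rmult_le_pos|]; exact: pow2_ge_0.
  have P2 : 2 * D k * cerr b N u r k <= D k ^ 2 + cerr b N u r k ^ 2 by have := pow2_ge_0 (D k - cerr b N u r k); lra.
  have P3 : 2 * D k * (D k.+1 + d - 2 * D k) <= D k.+1 ^ 2 + d ^ 2 - 2 * D k ^ 2.
    by have := pow2_ge_0 (D k.+1 - D k); have := pow2_ge_0 (d - D k); lra.
  have P4 : 0 <= INR N ^ 2 * s by apply: Rmult_le_pos; [exact: pow2_ge_0|lra].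
  have := Rmult_le_compat_l _ _ _ P4 P3; lra.
rewrite gen_ratesN /energy gen_scal (gen_bsum _ _ (fun k x => wt N k * (Usum b N x k - u k) ^ 2)).
have -> : INR N ^ 2 * (/ INR N * bsum K.+1 (fun k => gen (moves (exp (- b)) q) (fun x => wt N k * (Usum b N x k - u k) ^ 2) q)) =
   / INR N * bsum K.+1 (fun k => wt N k * (INR N ^ 2 * gen (moves (exp (- b)) q) (fun x => (Usum b N x k - u k) ^ 2) q)).
  rewrite -Rmult_assoc [_ * / INR N]Rmult_comm Rmult_assoc -bsum_scal; congr (_ * _); apply: bsum_ext => k _.
  by rewrite gen_scal; ring.
rewrite -Rmult_plus_distr_l -bsum_plus.
set S2 := bsum K.+1 (fun k => wt N k * cerr b N u r k ^ 2).
set S1 := bsum K.+1 (fun k => wt N k * (Usum b N q k - u k) ^ 2).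
have HX := summation_by_parts N K (fun k => D k ^ 2) HN (fun k => pow2_ge_0 (D k)).
have S1E : bsum K.+1 (fun k => wt N k * D k ^ 2) = S1 by [].
rewrite S1E in HX.
have Hmain : bsum K.+1 (fun k => wt N k * (-2 * (Usum b N q k - u k) * r k) +
     wt N k * (INR N ^ 2 * gen (moves (exp (- b)) q) (fun x => (Usum b N x k - u k) ^ 2) q)) <=
   exp (- (b / 2)) * (INR N ^ 2 * bsum K.+1 (fun k => wt N k * (D k.+1 ^ 2 + D k.-1 ^ 2 - 2 * D k ^ 2))) + S1 + S2 +
   4 * cQ / INR N * Vexp b q 0 ^ 2 * bsum K.+1 (fun k => exp (- (INR k / INR N))).
  rewrite /S1 /S2 -!bsum_scal -!bsum_plus; apply: bsum_le => k _.
  rewrite -/(D k).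
  have Hw := wt_gt0 N k.
  have := Rmult_le_compat_l (wt N k) _ _ (Rlt_le _ _ Hw) (HD2 k).
  have -> : exp (- (INR k / INR N)) = wt N k * exp (3 * INR k / INR N) by rewrite /wt -exp_plus; congr exp; field; lra.
  lra.
have HS1 : 0 <= S1.
  by apply: bsum_ge0 => k _; apply: Rmult_le_pos; [apply: Rlt_le; exact: wt_gt0|exact: pow2_ge_0].
have HB0 : 0 <= INR N ^ 2 * wt N K * D K.+1 ^ 2.
  by apply: Rmult_le_pos; [apply: Rmult_le_pos; [exact: pow2_ge_0|apply: Rlt_le; exact: wt_gt0]|exact: pow2_ge_0].
have HE8 : 0 < exp 8 by exact: exp_pos.
have Hstep : exp (- (b / 2)) * (INR N ^ 2 * bsum K.+1 (fun k => wt N k * (D k.+1 ^ 2 + D k.-1 ^ 2 - 2 * D k ^ 2))) <=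
    16 * exp 8 * S1 + INR N ^ 2 * wt N K * D K.+1 ^ 2.
  apply: (Rle_trans _ (exp (- (b / 2)) * (16 * exp 8 * S1 + INR N ^ 2 * wt N K * D K.+1 ^ 2))).
    by apply: Rmult_le_compat_l; [lra|exact: HX].
  rewrite -[X in _ <= X]Rmult_1_l; apply: Rmult_le_compat_r; last lra.
  by have : 0 <= 16 * exp 8 * S1 by [apply: Rmult_le_pos; lra]; lra.
have Hmean := mean_exp_le2 N K.+1 HN.
have HcQ : 0 < cQ by rewrite /cQ; have := exp_pos 2; lra.
have HM : 0 <= 4 * cQ / INR N * Vexp b q 0 ^ 2.
  by apply: Rmult_le_pos; [apply: Rlt_le; apply: Rdiv_lt_0_compat; lra|exact: pow2_ge_0].
have := Rmult_le_compat_l _ _ _ HM Hmean.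
have := Rmult_le_compat_l _ _ _ (Rlt_le _ _ Hi) Hmain.
have := Rmult_le_compat_l _ _ _ (Rlt_le _ _ Hi) Hstep.
have -> : INR N * wt N K * (Usum b N q K.+1 - u K.+1) ^ 2 = / INR N * (INR N ^ 2 * wt N K * D K.+1 ^ 2).
  by rewrite /D; field; lra.
have -> : 8 * cQ * / INR N * Vexp b q 0 ^ 2 = 4 * cQ / INR N * Vexp b q 0 ^ 2 * 2 by field; lra.
rewrite /cE.
set A := exp (- (b / 2)) * _; set B := bsum K.+1 (fun k => exp (- (INR k / INR N))); set M := 4 * cQ / INR N * Vexp b q 0 ^ 2.
set Y := INR N ^ 2 * wt N K * D K.+1 ^ 2.
lra.
Qed.

(** * Consistency with the heat equation *)

(** A window-and-tail bound: beyond M N the weight beats the square of A exp (k / N) and leaves a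
    factor exp (- M). *)
Lemma weighted_small N K (d : nat -> R) A M e : (0 < N)%N -> 0 <= e ->
  (forall k, Rabs (d k) <= A * exp (INR k / INR N)) ->
  (forall k, INR k <= M * INR N -> Rabs (d k) <= e) ->
  / INR N * bsum K (fun k => wt N k * d k ^ 2) <= 2 * (e ^ 2 + A ^ 2 * exp (- M)).
Proof.
move=> HN He HA HM; have HN1 := INR_ge1 N HN.
apply: (Rle_trans _ ((e ^ 2 + A ^ 2 * exp (- M)) * (/ INR N * bsum K (fun k => exp (- (INR k / INR N)))))); last first.
  rewrite Rmult_comm; apply: Rmult_le_compat_r; last exact: mean_exp_le2.
  by apply: Rplus_le_le_0_compat; [exact: pow2_ge_0|apply: Rmult_le_pos; [exact: pow2_ge_0|exact: exp_ge0]].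
rewrite -Rmult_assoc [_ * / INR N]Rmult_comm Rmult_assoc; apply: Rmult_le_compat_l.
  by apply: Rlt_le; apply: Rinv_0_lt_compat; lra.
rewrite -bsum_scal; apply: bsum_le => k _.
have Hk := pos_INR k; set y := INR k / INR N.
have Hy : 0 <= y by apply: Rmult_le_pos => //; apply: Rlt_le; apply: Rinv_0_lt_compat; lra.
have -> : wt N k = exp (- y) * exp (- (3 * y)) by rewrite /wt -exp_plus /y; congr exp; field; lra.
rewrite Rmult_assoc Rmult_comm; apply: Rmult_le_compat_r; first exact: exp_ge0.
have P1 := pow2_ge_0 (d k); have P2 := pow2_ge_0 A; have P3 := exp_pos (- M); have P4 := pow2_ge_0 e.
have P5 := Rmult_le_pos _ _ P2 (Rlt_le _ _ P3).
case: (Rle_dec (INR k) (M * INR N)) => H.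
  have Hd : d k ^ 2 <= e ^ 2 by rewrite -pow2_abs; apply: pow_incr; split; [exact: Rabs_pos|exact: HM].
  have : exp (- (3 * y)) <= 1 by rewrite -exp_0; apply: exp_le; lra.
  have := exp_pos (- (3 * y)); nra.
have HMy : M <= y.
  apply: (Rmult_le_reg_r (INR N)); first lra.
  by rewrite /y /Rdiv Rmult_assoc Rinv_l; lra.
have Hd : d k ^ 2 <= A ^ 2 * exp (2 * y).
  have -> : exp (2 * y) = exp y ^ 2 by rewrite /= Rmult_1_r -exp_plus; congr exp; lra.
  by rewrite -Rpow_mult_distr -pow2_abs; apply: pow_incr; split; [exact: Rabs_pos|exact: HA].
apply: (Rle_trans _ (A ^ 2 * (exp (- (3 * y)) * exp (2 * y)))).
  have := Rmult_le_compat_l _ _ _ (Rlt_le _ _ (exp_pos (- (3 * y)))) Hd; lra.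
rewrite -exp_plus; have : exp (- (3 * y) + 2 * y) <= exp (- M) by apply: exp_le; lra.
move=> H2; have := Rmult_le_compat_l _ _ _ P2 H2; lra.
Qed.

(** Two mean value theorems, with only a modulus of continuity of the second derivative: the third
    derivative of w may be singular at time 0. *)
Lemma second_difference (f g g2 : R -> R) x h om : 0 < h ->
  (forall y, is_derive f y (g y)) -> (forall y, is_derive g y (g2 y)) ->
  (forall y, Rabs (y - x) <= h -> Rabs (g2 y - g2 x) <= om) ->
  Rabs (f (x + h) + f (x - h) - 2 * f x - h ^ 2 * g2 x) <= 2 * om * h ^ 2.
Proof.
move=> Hh Hf Hg Hom.
pose F t := f (x + t) + f (x - t) - 2 * f x - t ^ 2 * g2 x.
pose F' t := g (x + t) - g (x - t) - 2 * t * g2 x.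
have HF t : is_derive F t (F' t).
  rewrite /F /F'; auto_derive.
    by repeat split; eexists; exact: Hf.
  rewrite (is_derive_unique (fun x => f x) _ _ (Hf (x + t))) (is_derive_unique (fun x => f x) _ _ (Hf (x + - t))) /Rminus /=; ring.
have [xi [E Hxi]] := MVT_cor2 F F' 0 h Hh (fun c _ => proj1 (is_derive_Reals _ _ _) (HF c)).
have [z [E2 Hz]] := MVT_cor2 g g2 (x - xi) (x + xi) ltac:(lra) (fun c _ => proj1 (is_derive_Reals _ _ _) (Hg c)).
have F0 : F 0 = 0 by rewrite /F Rplus_0_r Rminus_0_r; ring.
have -> : f (x + h) + f (x - h) - 2 * f x - h ^ 2 * g2 x = 2 * xi * (g2 z - g2 x) * h.
  by rewrite -/(F h); have -> : F h = F' xi * h by [lra]; rewrite /F' E2; ring.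
have Hzo := Hom z ltac:(apply: Rabs_le; lra).
rewrite !Rabs_mult (Rabs_right h) ?(Rabs_right xi) ?(Rabs_right 2); try lra.
have Ho : 0 <= om by apply: Rle_trans Hzo; exact: Rabs_pos.
have -> : 2 * om * h ^ 2 = 2 * h * om * h by ring.
apply: Rmult_le_compat_r; first lra.
by apply: Rmult_le_compat => //; [lra|exact: Rabs_pos|lra].
Qed.

Lemma gap_limit b N beta : (0 < N)%N -> 0 <= b -> INR N * b <= 2 -> 0 < beta <= 2 ->
  Rabs (INR N ^ 2 * (1 - exp (- (b / 2))) ^ 2 - (beta / 2) ^ 2) <= Rabs (INR N * b - beta) + 2 * / INR N.
Proof.
move=> HN Hb HNb Hbeta; have HN1 := INR_ge1 N HN.
set y := b / 2; have Hy : 0 <= y by rewrite /y; lra.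
have Hi : 0 < / INR N by apply: Rinv_0_lt_compat; lra.
have H1 := one_minus_exp_neg y Hy.
have Hlow : y - y ^ 2 <= 1 - exp (- y).
  have E : exp (- y) * exp y = 1 by rewrite -exp_plus -exp_0; congr exp; lra.
  have := exp_ineq1_le y; have := exp_pos (- y) => P1 P2.
  have : exp (- y) * (1 + y) <= 1 by rewrite -E; apply: Rmult_le_compat_l; lra.
  nra.
set a := INR N * (1 - exp (- y)).
have Hyi : y <= / INR N.
  by apply: (Rmult_le_reg_l (INR N)); [lra|rewrite Rinv_r /y; lra].
have Ha0 : 0 <= a by apply: Rmult_le_pos; lra.
have Ha1 : a <= INR N * y by apply: Rmult_le_compat_l; lra.
have HNy : INR N * y <= 1 by rewrite /y; lra.
have Ha2 : INR N * y - / INR N <= a.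
  have : INR N * (y - y ^ 2) <= a by apply: Rmult_le_compat_l; lra.
  have : INR N * y * y <= 1 * / INR N by apply: Rmult_le_compat => //; apply: Rmult_le_pos; lra.
  lra.
have -> : INR N ^ 2 * (1 - exp (- y)) ^ 2 - (beta / 2) ^ 2 = (a - beta / 2) * (a + beta / 2) by rewrite /a; ring.
rewrite Rabs_mult (Rabs_right (a + beta / 2)); last lra.
have H2 : Rabs (a - beta / 2) <= Rabs (INR N * b - beta) / 2 + / INR N.
  have := Rle_abs (INR N * b - beta); have := Rcomplements.Rabs_maj2 (INR N * b - beta) => A1 A2.
  by apply: Rabs_le; rewrite /y in Ha1 Ha2; lra.
have : Rabs (a - beta / 2) * (a + beta / 2) <= Rabs (a - beta / 2) * 2.
  by apply: Rmult_le_compat_l; [exact: Rabs_pos|lra].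
lra.
Qed.

(* U_k, with V_0 counted half, is the midpoint rule for an integral up to (k + 1/2) / N. *)
Definition xk (N k : nat) : R := (INR k + / 2) / INR N.

Lemma xk_bounds N k : (0 < N)%N -> 0 < xk N k /\ xk N k <= INR k / INR N + / 2 /\ exp (xk N k) <= exp 1 * exp (INR k / INR N).
Proof.
move=> HN; have HN1 := INR_ge1 N HN; have Hk := pos_INR k.
have Hi : / INR N <= 1 by rewrite -Rinv_1; apply: Rinv_le_contravar; lra.
have E : xk N k = INR k / INR N + / 2 * / INR N by rewrite /xk; field; lra.
have H1 : xk N k <= INR k / INR N + / 2 by rewrite E; lra.
split; first by apply: Rdiv_lt_0_compat; lra.
by split => //; rewrite -exp_plus; apply: exp_le; lra.
Qed.

Lemma xk_S N k : (0 < N)%N -> xk N k.+1 = xk N k + / INR N.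
Proof. by move=> HN; have := INR_ge1 N HN; rewrite /xk S_INR => H; field; lra. Qed.

(** The primitive of exp (beta (psi + u / 2)) at the points [xk]; [rsol] is its time derivative,
    from w_t = v_x. *)
Definition usol (beta : R) (w : R -> R -> R) (N : nat) (s : R) (k : nat) : R :=
  exp (- ((beta / 2) ^ 2 * s)) * w s (xk N k).

Definition rsol (beta : R) (w vx : R -> R -> R) (N : nat) (s : R) (k : nat) : R :=
  exp (- ((beta / 2) ^ 2 * s)) * (vx s (xk N k) - (beta / 2) ^ 2 * w s (xk N k)).

Lemma uprev_usol beta p w v vx vxx N s k : heat_pkg beta p w v vx vxx -> (0 < N)%N ->
  uprev (usol beta w N s) k = exp (- ((beta / 2) ^ 2 * s)) * w s (xk N k - / INR N).
Proof.
move=> H HN; have HN1 := INR_ge1 N HN; case: k => [|k]; rewrite /uprev /usol.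
  have -> : xk N 0 - / INR N = - xk N 0 by rewrite /xk /=; field; lra.
  by rewrite (hp_wodd _ _ _ _ _ _ H); ring.
by rewrite xk_S //; congr (_ * w s _); ring.
Qed.

Lemma exp_damp_le1 beta s : 0 <= s -> 0 < exp (- ((beta / 2) ^ 2 * s)) <= 1.
Proof.
move=> Hs; split; first exact: exp_pos.
by rewrite -exp_0; apply: exp_le; have := pow2_ge_0 (beta / 2); nra.
Qed.

Lemma unif_cont_2d (F : R -> R -> R) T M e : (forall t x, continuous (fun q : R * R => F (fst q) (snd q)) (t, x)) -> 0 < e ->
  exists d, 0 < d /\ forall t x y, 0 <= t <= T -> Rabs x <= M -> Rabs y <= M -> Rabs (y - x) < d -> Rabs (F t y - F t x) < e.
Proof.
move=> HF He.
have HG t x : continuity_2d_pt F t x.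
  move=> e'; have [d [Hd H]] := continuous_R2_inv F t x (HF t x) e' (cond_pos e').
  by exists (mkposreal d Hd).
have [d Hd] := uniform_continuity_2d F 0 T (- M) M (fun t x _ _ => HG t x) (mkposreal e He).
exists d; split; first exact: cond_pos.
move=> t x y Ht Hx Hy Hxy; apply: Hd => //; try exact/Rabs_le_between.
by rewrite Rminus_diag Rabs_R0; exact: cond_pos.
Qed.

(** Three sources of error: the Taylor remainder, the factor exp (- b / 2) in place of 1, and the
    discrete damping in place of (beta / 2)^2. *)
Lemma cerr_eq beta p w v vx vxx b N s k : heat_pkg beta p w v vx vxx -> (0 < N)%N ->
  cerr b N (usol beta w N s) (rsol beta w vx N s) k =
  exp (- ((beta / 2) ^ 2 * s)) *
   (exp (- (b / 2)) * (INR N ^ 2 * (w s (xk N k + / INR N) + w s (xk N k - / INR N) - 2 * w s (xk N k) - (/ INR N) ^ 2 * vx s (xk N k)))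
    - (1 - exp (- (b / 2))) * vx s (xk N k)
    - (INR N ^ 2 * (1 - exp (- (b / 2))) ^ 2 - (beta / 2) ^ 2) * w s (xk N k)).
Proof.
move=> H HN; have HN1 := INR_ge1 N HN.
by rewrite /cerr (uprev_usol beta p w v vx vxx) // /usol /rsol xk_S //; field; lra.
Qed.

(** On a fixed macroscopic window v_x is uniformly continuous on [0, T], time 0 included; outside,
    exponential growth and the weight suffice. The bound is uniform in the number K of sites. *)
Lemma consistency beta p w v vx vxx (b : nat -> R) T : heat_pkg beta p w v vx vxx -> 0 < beta <= 2 -> 0 < T ->
  (forall N, (0 < N)%N -> 0 < b N) -> is_lim_seq (fun N => INR N * b N) beta ->
  (forall N, (0 < N)%N -> INR N * b N <= 2) ->
  forall e, 0 < e -> exists N0 : nat, forall N K s, (0 < N)%N -> (N0 <= N)%N -> 0 <= s <= T ->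
    / INR N * bsum K (fun k => wt N k * cerr (b N) N (usol beta w N s) (rsol beta w vx N s) k ^ 2) <= e.
Proof.
move=> H Hbeta HT Hb0 Hblim Hb2 e He.
have [C0 HC0] := hp_growth _ _ _ _ _ _ H T.
pose C := Rmax C0 0.
have HCpos : 0 <= C by exact: Rmax_r.
have HC t x : t <= T -> Rabs (w t x) <= C * exp (Rabs x) /\ Rabs (vx t x) <= C * exp (Rabs x).
  move=> Ht; have [A1 [_ A2]] := HC0 t x Ht.
  have : C0 * exp (Rabs x) <= C * exp (Rabs x) by apply: Rmult_le_compat_r; [exact: exp_ge0|exact: Rmax_l].
  lra.
have He1 := exp_pos 1.
pose A := (4 * C * exp 1 + 3 * C) * exp 1.
have HA0 : 0 <= A by apply: Rmult_le_pos; [have := Rmult_le_pos _ _ HCpos (Rlt_le _ _ He1); lra|lra].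
have [M HM] := exp_neg_small (2 * A ^ 2) (e / 2) ltac:(have := pow2_ge_0 A; lra) ltac:(lra).
pose e1 := Rmin 1 (e / 4) / 2.
have Hm1 := Rmin_l 1 (e / 4); have Hm2 := Rmin_r 1 (e / 4); have Hm3 : 0 < Rmin 1 (e / 4) by apply: Rmin_glb_lt; lra.
have He10 : 0 < e1 by rewrite /e1; lra.
have HM0 := pos_INR M.
have [d [Hd Hunif]] := unif_cont_2d vx T (INR M + 3) (e1 / 4) (hp_vxc _ _ _ _ _ _ H) ltac:(lra).
have HeM := exp_pos (INR M + 1).
pose e2 := e1 / (2 * (C * exp (INR M + 1) + 1)).
have HCM : 0 <= C * exp (INR M + 1) by apply: Rmult_le_pos; lra.
have He2 : 0 < e2 by apply: Rdiv_lt_0_compat; lra.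
have [N1 HN1] := proj1 (is_lim_seq_eps _ _) Hblim (e2 / 2) ltac:(lra).
have Hi : is_lim_seq (fun n => / INR n) 0.
  by apply: (is_lim_seq_inv _ p_infty) => //; exact: is_lim_seq_INR.
have [N2 HN2] := proj1 (is_lim_seq_eps _ _) Hi (Rmin d (e2 / 6)) ltac:(apply: Rmin_glb_lt; lra).
exists (maxn N1 N2) => N K s HN0 HNN Hs.
have HNge := INR_ge1 N HN0.
have Hiv : 0 < / INR N <= 1 by split; [apply: Rinv_0_lt_compat; lra|rewrite -Rinv_1; apply: Rinv_le_contravar; lra].
have B1 := HN1 N ltac:(lia).
have := HN2 N ltac:(lia); rewrite Rminus_0_r Rabs_right; last lra.
move=> B2; have B3 := Rmin_l d (e2 / 6); have B4 := Rmin_r d (e2 / 6).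
have Hbn := Hb0 N HN0; have Hbn2 := Hb2 N HN0.
have Hgap := gap_limit (b N) N beta HN0 ltac:(lra) Hbn2 Hbeta.
set sb := exp (- (b N / 2)).
have Hsb : 0 <= 1 - sb <= / INR N.
  have := one_minus_exp_neg (b N / 2) ltac:(lra); rewrite -/sb => Hsb.
  have : b N / 2 <= / INR N; last by lra.
  by apply: (Rmult_le_reg_l (INR N)); [lra|rewrite Rinv_r; lra].
have Hsb0 : 0 < sb by exact: exp_pos.
have [Hx1 Hx2] := exp_damp_le1 beta s (proj1 Hs).
have HE k om : (forall y, Rabs (y - xk N k) <= / INR N -> Rabs (vx s y - vx s (xk N k)) <= om) ->
   Rabs (cerr (b N) N (usol beta w N s) (rsol beta w vx N s) k) <=
   2 * om + / INR N * Rabs (vx s (xk N k)) + (Rabs (INR N * b N - beta) + 2 * / INR N) * Rabs (w s (xk N k)).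
  move=> Hom; rewrite (cerr_eq beta p w v vx vxx) //.
  have Hsd := second_difference (w s) (v s) (vx s) (xk N k) (/ INR N) om ltac:(lra)
    (hp_wx _ _ _ _ _ _ H s) (hp_vx _ _ _ _ _ _ H s) Hom.
  rewrite Rabs_mult (Rabs_right (exp _)); last lra.
  set X1 := w s (xk N k + _) + _ - _ - _ in Hsd *.
  set g := INR N ^ 2 * (1 - exp (- (b N / 2))) ^ 2 - (beta / 2) ^ 2 in Hgap *.
  have Q : Rabs (exp (- (b N / 2)) * (INR N ^ 2 * X1) - (1 - exp (- (b N / 2))) * vx s (xk N k) - g * w s (xk N k)) <=
     2 * om + / INR N * Rabs (vx s (xk N k)) + (Rabs (INR N * b N - beta) + 2 * / INR N) * Rabs (w s (xk N k)).
    rewrite -/sb; apply: Rle_trans (Rabs_triang _ _) _; apply: Rplus_le_compat; last first.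
      by rewrite Rabs_Ropp Rabs_mult; apply: Rmult_le_compat_r; [exact: Rabs_pos|].
    apply: Rle_trans (Rabs_triang _ _) _; apply: Rplus_le_compat; last first.
      rewrite Rabs_Ropp Rabs_mult (Rabs_right (1 - sb)); last lra.
      by apply: Rmult_le_compat_r; [exact: Rabs_pos|lra].
    rewrite Rabs_mult (Rabs_mult (INR N ^ 2)) (Rabs_right sb) ?(Rabs_right (INR N ^ 2)); [|by apply: Rle_ge; exact: pow2_ge_0|lra].
    have HX : INR N ^ 2 * Rabs X1 <= 2 * om.
      have -> : 2 * om = INR N ^ 2 * (2 * om * (/ INR N) ^ 2) by field; lra.
      by apply: Rmult_le_compat_l => //; exact: pow2_ge_0.
    have := Rmult_le_pos _ _ (pow2_ge_0 (INR N)) (Rabs_pos X1); nra.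
  have := Rabs_pos (exp (- (b N / 2)) * (INR N ^ 2 * X1) - (1 - exp (- (b N / 2))) * vx s (xk N k) - g * w s (xk N k)).
  nra.
have Hsmall : 2 * (e1 ^ 2 + A ^ 2 * exp (- INR M)) <= e.
  have : e1 ^ 2 <= e / 4 by rewrite /= Rmult_1_r /e1; nra.
  lra.
apply: Rle_trans Hsmall.
apply: weighted_small => //; first lra.
- move=> k; have [K1 [K2 K3]] := xk_bounds N k HN0.
  have Habs : Rabs (xk N k) = xk N k by rewrite Rabs_right; lra.
  have [W1 W2] := HC s (xk N k) (proj2 Hs); rewrite Habs in W1 W2.
  have Hom y : Rabs (y - xk N k) <= / INR N -> Rabs (vx s y - vx s (xk N k)) <= 2 * C * exp 1 * exp (xk N k).
    move=> Hy; have [_ V2] := HC s y (proj2 Hs).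
    have Hyx : Rabs y <= 1 + xk N k.
      by have := Rabs_triang_inv y (xk N k); rewrite Habs; lra.
    have : exp (Rabs y) <= exp 1 * exp (xk N k) by rewrite -exp_plus; apply: exp_le.
    move=> Hey; have := Rmult_le_compat_l C _ _ HCpos Hey => Hey2.
    apply: Rle_trans (Rabs_triang _ _) _; rewrite Rabs_Ropp.
    have : C * exp (xk N k) <= C * (exp 1 * exp (xk N k)).
      apply: Rmult_le_compat_l => //; rewrite -[X in X <= _]Rmult_1_l; apply: Rmult_le_compat_r.
        exact: exp_ge0.
      by have := exp_ineq1_le 1; lra.
    lra.
  apply: Rle_trans (HE k _ Hom) _.
  have F1 : / INR N * Rabs (vx s (xk N k)) <= 1 * (C * exp (xk N k)) by apply: Rmult_le_compat; try lra; exact: Rabs_pos.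
  have F2 : (Rabs (INR N * b N - beta) + 2 * / INR N) * Rabs (w s (xk N k)) <= 2 * (C * exp (xk N k)).
    have He2' : e2 <= 1.
      apply: (Rmult_le_reg_r (2 * (C * exp (INR M + 1) + 1))); first lra.
      by rewrite /e2 /Rdiv Rmult_assoc Rinv_l /e1; lra.
    apply: Rmult_le_compat; try lra; last exact: Rabs_pos.
    by have := Rabs_pos (INR N * b N - beta); lra.
  have F3 : (4 * C * exp 1 + 3 * C) * exp (xk N k) <= (4 * C * exp 1 + 3 * C) * (exp 1 * exp (INR k / INR N)).
    by apply: Rmult_le_compat_l => //; have := Rmult_le_pos _ _ HCpos (Rlt_le _ _ He1); lra.
  rewrite /A; lra.
- move=> k Hk; have [K1 [K2 K3]] := xk_bounds N k HN0.
  have Habs : Rabs (xk N k) = xk N k by rewrite Rabs_right; lra.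
  have HkM : INR k / INR N <= INR M.
    by apply: (Rmult_le_reg_r (INR N)); [lra|rewrite /Rdiv Rmult_assoc Rinv_l; lra].
  have [W1 W2] := HC s (xk N k) (proj2 Hs); rewrite Habs in W1 W2.
  have Hom y : Rabs (y - xk N k) <= / INR N -> Rabs (vx s y - vx s (xk N k)) <= e1 / 4.
    move=> Hy; apply: Rlt_le; apply: Hunif => //; last lra.
      by rewrite Habs; lra.
    by have := Rabs_triang_inv y (xk N k); rewrite Habs; lra.
  apply: Rle_trans (HE k _ Hom) _.
  have Hex : C * exp (xk N k) <= C * exp (INR M + 1) by apply: Rmult_le_compat_l => //; apply: exp_le; lra.
  have F1 : / INR N * Rabs (vx s (xk N k)) <= e2 / 6 * (C * exp (INR M + 1)) by apply: Rmult_le_compat; try lra; exact: Rabs_pos.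
  have F2 : (Rabs (INR N * b N - beta) + 2 * / INR N) * Rabs (w s (xk N k)) <= (e2 / 2 + 2 * (e2 / 6)) * (C * exp (INR M + 1)).
    apply: Rmult_le_compat; try lra; last exact: Rabs_pos.
    by have := Rabs_pos (INR N * b N - beta); lra.
  have : e2 * (C * exp (INR M + 1) + 1) = e1 / 2 by rewrite /e2; field; lra.
  have : 0 <= e2 * (C * exp (INR M + 1)) by apply: Rmult_le_pos; lra.
  lra.
Qed.

Lemma Usum_bounds b N q k : (0 < N)%N -> 0 <= b -> INR N * b <= 2 -> isQ q ->
  0 <= Usum b N q k <= 2 * Vexp b q 0 * exp (INR k / INR N).
Proof.
move=> HN Hb HNb HQ; have HN1 := INR_ge1 N HN; have HV0 := Vexp_gt0 b q 0.
have Hi : 0 < / INR N by apply: Rinv_0_lt_compat; lra.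
split.
  apply: Rmult_le_pos; first lra.
  apply: Rplus_le_le_0_compat; first lra.
  by apply: bsum_ge0 => j _; apply: Rlt_le; exact: Vexp_gt0.
apply: (Rle_trans _ (Vexp b q 0 * (/ INR N * bsum k.+1 (fun j => exp (INR j / INR N))))).
  rewrite -Rmult_assoc [Vexp b q 0 * _]Rmult_comm Rmult_assoc; apply: Rmult_le_compat_l; first lra.
  rewrite bsum_recl /= /Rdiv Rmult_0_l exp_0 Rmult_plus_distr_l -bsum_scal.
  apply: Rplus_le_compat; first lra.
  apply: bsum_le => j _; have U := Vexp_upper b q 0 j.+1 Hb HQ; rewrite add0n in U.
  apply: Rle_trans U _; apply: Rmult_le_compat_l; first lra.
  apply: exp_le; have Hj := pos_INR j.+1; apply: (Rmult_le_reg_r (INR N)); first lra.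
  have -> : INR j.+1 * / INR N * INR N = INR j.+1 by field; lra.
  nra.
have -> : 2 * Vexp b q 0 * exp (INR k / INR N) = Vexp b q 0 * (exp (INR k / INR N) * 2) by ring.
apply: Rmult_le_compat_l; first lra.
rewrite bsum_rev /=.
rewrite -[bsum k _ + _]/(bsum k.+1 (fun j => exp (INR (k - j) / INR N))).
rewrite (bsum_ext _ _ (fun j => exp (INR k / INR N) * exp (- (INR j / INR N)))); last first.
  by move=> j Hj; rewrite minus_INR -?exp_plus; [congr exp; field; lra|lia].
rewrite bsum_scal -Rmult_assoc [/ INR N * _]Rmult_comm Rmult_assoc; apply: Rmult_le_compat_l; last exact: mean_exp_le2.
exact: exp_ge0.
Qed.

Lemma is_derive_bsum n (f : nat -> R -> R) (d : nat -> R) t :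
  (forall k, is_derive (f k) t (d k)) -> is_derive (fun s => bsum n (fun k => f k s)) t (bsum n d).
Proof.
move=> H; elim: n => [|n IH]; first by apply: (is_derive_const (V := R_NormedModule)).
by apply: (is_derive_plus (fun s => bsum n (fun k => f k s)) (f n)).
Qed.

Lemma usol_continuous beta p w v vx vxx N k s : heat_pkg beta p w v vx vxx ->
  continuous (fun s => usol beta w N s k) s.
Proof.
move=> H; apply: (continuous_mult (fun s => exp (- ((beta / 2) ^ 2 * s))) (fun s => w s (xk N k))).
  by apply: ex_derive_continuous; auto_derive.
have HW := continuous_R2_inv w s (xk N k) (hp_wc _ _ _ _ _ _ H s (xk N k)).
apply: continuous_of_eps => e He; have [d [Hd Hd2]] := HW e He.
by exists d; split => // t Ht; apply: Hd2 => //; rewrite Rminus_diag Rabs_R0.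
Qed.

Lemma usol_derive beta p w v vx vxx N k s : heat_pkg beta p w v vx vxx -> 0 < s ->
  is_derive (fun s => usol beta w N s k) s (rsol beta w vx N s k).
Proof.
move=> H Hs; have Hw := hp_wt _ _ _ _ _ _ H s (xk N k) Hs.
rewrite /usol /rsol; auto_derive; first by repeat split; eexists; exact: Hw.
rewrite (is_derive_unique (fun s => w s (xk N k)) _ _ Hw) /=; ring.
Qed.

(** The exponential absorbs the growth of energy and H. The decreasing factor kappa (T - s) releases
    kappa (1 + H) per unit time, which pays for every vanishing error. At s = T only the energy
    remains. *)
Definition lyap (beta : R) (w : R -> R -> R) (b : R) (N : nat) (kappa T s : R) (q : seq nat) : R :=
  exp ((cE + cH) * (T - s)) * (energy b N (usol beta w N s) q + kappa * (T - s) * (1 + Hfun b N q)).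

Lemma Hfun_ge0 b N q : (0 < N)%N -> 0 <= Hfun b N q.
Proof.
move=> HN; have HN1 := INR_ge1 N HN; apply: Rmult_le_pos; first by apply: Rlt_le; apply: Rinv_0_lt_compat; lra.
apply: Rplus_le_le_0_compat; first by have := pow2_ge_0 (Vexp b q 0); lra.
by apply: bsum_ge0 => j _; exact: pow2_ge_0.
Qed.

Lemma energy_ge0 b N u q : (0 < N)%N -> 0 <= energy b N u q.
Proof.
move=> HN; have HN1 := INR_ge1 N HN; apply: Rmult_le_pos; first by apply: Rlt_le; apply: Rinv_0_lt_compat; lra.
by apply: bsum_ge0 => j _; apply: Rmult_le_pos; [apply: Rlt_le; exact: wt_gt0|exact: pow2_ge_0].
Qed.

(** At site N^2 + 1 squares grow like exp (2 N) while the weight is exp (- 4 N), and N exp (- 2 N) =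
    (N exp (- N))^2 / N <= 1/N. *)
Lemma boundary_le b N q (x C : R) : (0 < N)%N -> 0 <= b -> INR N * b <= 2 -> isQ q ->
  0 <= C -> Rabs x <= C * exp (xk N (N ^ 2)%N.+1) ->
  INR N * wt N (N ^ 2)%N * (Usum b N q (N ^ 2)%N.+1 - x) ^ 2 <=
  / INR N * exp 2 * (8 * Vexp b q 0 ^ 2 + 2 * (C * exp 1) ^ 2).
Proof.
move=> HN Hb HNb HQ HC Hx; have HN1 := INR_ge1 N HN; have HV0 := Vexp_gt0 b q 0.
set K := (N ^ 2)%N; have HK : INR K = INR N * INR N by rewrite /K expnS expn1 mult_INR.
have EK : INR K.+1 / INR N = INR N + / INR N by rewrite S_INR HK; field; lra.
have Hi : 0 < / INR N <= 1 by split; [apply: Rinv_0_lt_compat; lra|rewrite -Rinv_1; apply: Rinv_le_contravar; lra].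
have [U0 U1] := Usum_bounds b N q K.+1 HN Hb HNb HQ; rewrite -/K in Hx.
have Hexp : exp (INR K.+1 / INR N) <= exp (INR N + 1) by rewrite EK; apply: exp_le; lra.
have [_ [_ X1]] := xk_bounds N K.+1 HN.
have He1 := exp_pos 1; have HeN := exp_pos (INR N + 1).
have Hx2 : Rabs x <= C * exp 1 * exp (INR N + 1).
  apply: Rle_trans Hx _; rewrite Rmult_assoc; apply: Rmult_le_compat_l => //.
  by apply: Rle_trans X1 _; apply: Rmult_le_compat_l; lra.
have U2 : Usum b N q K.+1 <= 2 * Vexp b q 0 * exp (INR N + 1).
  by apply: Rle_trans U1 _; apply: Rmult_le_compat_l; lra.
set Y := exp (INR N + 1) in Hx2 U2 HeN *.
have Hsq : (Usum b N q K.+1 - x) ^ 2 <= (8 * Vexp b q 0 ^ 2 + 2 * (C * exp 1) ^ 2) * Y ^ 2.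
  have S1 : Usum b N q K.+1 ^ 2 <= (2 * Vexp b q 0 * Y) ^ 2 by apply: pow_incr.
  have S2 : x ^ 2 <= (C * exp 1 * Y) ^ 2.
    by rewrite -(pow2_abs x); apply: pow_incr; split; [exact: Rabs_pos|].
  have S3 := pow2_ge_0 (Usum b N q K.+1 + x).
  have -> : (8 * Vexp b q 0 ^ 2 + 2 * (C * exp 1) ^ 2) * Y ^ 2 = 2 * (2 * Vexp b q 0 * Y) ^ 2 + 2 * (C * exp 1 * Y) ^ 2 by ring.
  lra.
have EY : wt N K * Y ^ 2 = exp 2 * exp (- INR N) ^ 2.
  rewrite /wt /Y HK /= !Rmult_1_r -!exp_plus; congr exp; field; lra.
have HNe : INR N * exp (- INR N) <= 1.
  have E : exp (INR N) * exp (- INR N) = 1 by rewrite -exp_plus -exp_0; congr exp; ring.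
  by have := exp_ineq1_le (INR N); have := exp_pos (- INR N); nra.
have HW : 0 <= INR N * wt N K by apply: Rmult_le_pos; [lra|apply: Rlt_le; exact: wt_gt0].
apply: Rle_trans (Rmult_le_compat_l _ _ _ HW Hsq) _.
set S := 8 * Vexp b q 0 ^ 2 + 2 * (C * exp 1) ^ 2.
have HS : 0 <= S by have := pow2_ge_0 (Vexp b q 0); have := pow2_ge_0 (C * exp 1); rewrite /S; lra.
have -> : INR N * wt N K * (S * Y ^ 2) = / INR N * (INR N * exp (- INR N)) ^ 2 * exp 2 * S.
  by have -> : INR N * wt N K * (S * Y ^ 2) = INR N * (wt N K * Y ^ 2) * S by [ring]; rewrite EY; field; lra.
apply: Rmult_le_compat_r => //; apply: Rmult_le_compat_r; first exact: exp_ge0.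
rewrite -[X in _ <= X]Rmult_1_r; apply: Rmult_le_compat_l; first lra.
have H0 : 0 <= INR N * exp (- INR N) by apply: Rmult_le_pos; [lra|exact: exp_ge0].
rewrite -[X in _ <= X](pow1 2); exact: pow_incr.
Qed.

Lemma In_map {S T : Type} (f : S -> T) (l : seq S) (y : T) :
  List.In y (map f l) -> exists x, f x = y /\ List.In x l.
Proof.
elim: l => [|a l IH] //= [<-|/IH [x [Hx Hl]]]; first by exists a; split => //; left.
by exists x; split => //; right.
Qed.

Lemma ratesN_ge0 N eps x p : 0 <= eps -> List.In p (ratesN N eps x) -> 0 <= p.1.
Proof.
move=> He Hin; have [pp [<- Hp]] := In_map _ _ _ Hin; rewrite /=.
apply: Rmult_le_pos; first exact: pow2_ge_0.
by move: Hp => /In_moves [j [_ [[_ ->]|[_ ->]]]] /=; lra.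
Qed.

Lemma isQ_ratesN N eps x p : isQ x -> List.In p (ratesN N eps x) -> isQ p.2.
Proof.
move=> HQ Hin; have [pp [<- Hp]] := In_map _ _ _ Hin; exact: (isQ_moves eps x pp).
Qed.

Lemma lyap_supermartingale beta p w v vx vxx (b : nat -> R) T : heat_pkg beta p w v vx vxx ->
  0 < beta <= 2 -> 0 < T ->
  (forall N, (0 < N)%N -> 0 < b N) -> is_lim_seq (fun N => INR N * b N) beta ->
  (forall N, (0 < N)%N -> INR N * b N <= 2) ->
  forall kappa, 0 < kappa -> exists N0 : nat, forall N, (0 < N)%N -> (N0 <= N)%N ->
    supermartingale (ratesN N (exp (- b N))) isQ (lyap beta w (b N) N kappa T) T.
Proof.
move=> H Hbeta HT Hb0 Hblim Hb2 kappa Hk.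
have [N1 HN1] := consistency beta p w v vx vxx b T H Hbeta HT Hb0 Hblim Hb2 (kappa / 2) ltac:(lra).
have [C0 HC0] := hp_growth _ _ _ _ _ _ H T.
pose C := Rmax C0 0; have HC : 0 <= C by exact: Rmax_r.
have HcQ : 0 < cQ by rewrite /cQ; have := exp_pos 2; lra.
have He2 := exp_pos 2.
(* Collects the coefficients of (1 + H) / N in the cutoff flux and the noise, with V_0^2 <= exp 2 H.
   They take one half of kappa, the consistency error the other. *)
pose C3 := exp 2 * (2 * (C * exp 1) ^ 2) + exp 2 * (8 * exp 2) + 8 * cQ * exp 2.
have HC3 : 0 <= C3.
  have := Rmult_le_pos _ _ (Rlt_le _ _ He2) (pow2_ge_0 (C * exp 1)); have := Rmult_lt_0_compat _ _ HcQ He2.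
  by have := Rmult_lt_0_compat _ _ He2 He2; rewrite /C3; lra.
have Hi : is_lim_seq (fun n => / INR n) 0.
  by apply: (is_lim_seq_inv _ p_infty) => //; exact: is_lim_seq_INR.
have [N2 HN2] := proj1 (is_lim_seq_eps _ _) Hi (kappa / (2 * (C3 + 1))) ltac:(apply: Rdiv_lt_0_compat; lra).
exists (maxn N1 N2) => N HN0 HNN; have HNge := INR_ge1 N HN0.
have HcE : 0 < cE by rewrite /cE; have := exp_pos 8; lra.
have HcH : 0 < cH by rewrite /cH; have := exp_pos 6; lra.
have Hinv : 0 < / INR N by apply: Rinv_0_lt_compat; lra.
have HC3N : / INR N * C3 <= kappa / 2.
  have := HN2 N ltac:(lia); rewrite Rminus_0_r Rabs_right; last lra.
  move=> B; have : / INR N * (C3 + 1) <= kappa / (2 * (C3 + 1)) * (C3 + 1) by apply: Rmult_le_compat_r; lra.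
  have -> : kappa / (2 * (C3 + 1)) * (C3 + 1) = kappa / 2 by field; lra.
  lra.
have Hbn := Hb0 N HN0; have Hbn2 := Hb2 N HN0.
have Hlyap_d x s : 0 < s -> is_derive (fun s => energy (b N) N (usol beta w N s) x) s
   (/ INR N * bsum (N ^ 2)%N.+1 (fun k => wt N k * (-2 * (Usum (b N) N x k - usol beta w N s k) * rsol beta w vx N s k))).
  move=> Hs; apply: (is_derive_scal (fun s => bsum (N ^ 2)%N.+1 (fun k => wt N k * (Usum (b N) N x k - usol beta w N s k) ^ 2))).
  apply: (is_derive_bsum _ (fun k s => wt N k * (Usum (b N) N x k - usol beta w N s k) ^ 2)) => k.
  have Hu := usol_derive beta p w v vx vxx N k s H Hs.
  have -> : wt N k * (-2 * (Usum (b N) N x k - usol beta w N s k) * rsol beta w vx N s k) =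
     scal (rsol beta w vx N s k) (wt N k * (-2 * (Usum (b N) N x k - usol beta w N s k))).
    by rewrite /scal /= /mult /=; ring.
  apply: (is_derive_comp (fun u => wt N k * (Usum (b N) N x k - u) ^ 2) (fun s => usol beta w N s k)) => //.
  by auto_derive => //; rewrite /=; ring.
split; last split.
- move=> s x Hs; apply: Rmult_le_pos; first exact: exp_ge0.
  apply: Rplus_le_le_0_compat; first exact: energy_ge0.
  by apply: Rmult_le_pos; [apply: Rmult_le_pos; lra|have := Hfun_ge0 (b N) N x HN0; lra].
- move=> x s; apply: (continuous_mult (fun s => exp ((cE + cH) * (T - s))) (fun s => energy (b N) N (usol beta w N s) x + kappa * (T - s) * (1 + Hfun (b N) N x))).
    by apply: ex_derive_continuous; auto_derive.
  apply: (continuous_plus (fun s => energy (b N) N (usol beta w N s) x) (fun s => kappa * (T - s) * (1 + Hfun (b N) N x))); last first.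
    by apply: ex_derive_continuous; auto_derive.
  apply: (continuous_scal_r (/ INR N) (fun s => bsum (N ^ 2)%N.+1 (fun k => wt N k * (Usum (b N) N x k - usol beta w N s k) ^ 2))).
  apply: (continuous_bsum _ (fun k s => wt N k * (Usum (b N) N x k - usol beta w N s k) ^ 2)) => k _.
  apply: (continuous_comp (fun s => usol beta w N s k) (fun u => wt N k * (Usum (b N) N x k - u) ^ 2)); first exact: (usol_continuous beta p w v vx vxx).
  by apply: ex_derive_continuous; auto_derive.
- move=> x s HQ Hs.
  set E' := (/ INR N * bsum (N ^ 2)%N.+1 (fun k => wt N k * (-2 * (Usum (b N) N x k - usol beta w N s k) * rsol beta w vx N s k))) in Hlyap_d *.
  have HE' := Hlyap_d x s (proj1 Hs); rewrite -/E' in HE'.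
  set E := fun s => energy (b N) N (usol beta w N s) x in HE'.
  set h := Hfun (b N) N x.
  have Hh : 0 <= h by exact: Hfun_ge0.
  exists (exp ((cE + cH) * (T - s)) * (- (cE + cH) * (E s + kappa * (T - s) * (1 + h)) + E' - kappa * (1 + h))).
  split.
    have G (f : R -> R) : is_derive f s E' ->
      is_derive (fun s => exp ((cE + cH) * (T - s)) * (f s + kappa * (T - s) * (1 + h))) s
        (exp ((cE + cH) * (T - s)) * (- (cE + cH) * (f s + kappa * (T - s) * (1 + h)) + E' - kappa * (1 + h))).
      move=> Hf; auto_derive; first by eexists; exact: Hf.
      by rewrite (is_derive_unique (fun s => f s) _ _ Hf) /Rminus; ring.
    exact: (G E).
  have EG : gen (ratesN N (exp (- b N)) x) (lyap beta w (b N) N kappa T s) x =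
    exp ((cE + cH) * (T - s)) * (gen (ratesN N (exp (- b N)) x) (energy (b N) N (usol beta w N s)) x +
      kappa * (T - s) * gen (ratesN N (exp (- b N)) x) (Hfun (b N) N) x).
    rewrite /lyap (gen_scal _ (fun r => energy (b N) N (usol beta w N s) r + kappa * (T - s) * (1 + Hfun (b N) N r))).
    congr (_ * _); rewrite /gen -lsum_scal -lsum_plus; apply: lsum_ext => pp; ring.
  rewrite EG -Rmult_plus_distr_l.
  have H1 := gen_energy_le (b N) N (usol beta w N s) (rsol beta w vx N s) x HN0 (Rlt_le _ _ Hbn) Hbn2 HQ.
  rewrite -/E' -/(E s) in H1.
  have H2 := gen_Hfun_le (b N) N x HN0 (Rlt_le _ _ Hbn) Hbn2 HQ; rewrite -/h in H2.
  have H3 := HN1 N (N ^ 2)%N.+1 s HN0 ltac:(lia) ltac:(lra).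
  have HV : Vexp (b N) x 0 ^ 2 <= exp 2 * h.
    have := (Hfun_bounds (b N) N x HN0 (Rlt_le _ _ Hbn) Hbn2 HQ).1; rewrite -/h => HB.
    have Eone : exp 2 * exp (-2) = 1 by rewrite -exp_plus -exp_0; congr exp; ring.
    have := Rmult_le_compat_l _ _ _ (Rlt_le _ _ He2) HB; rewrite -Rmult_assoc Eone; lra.
  have HX : Rabs (usol beta w N s (N ^ 2)%N.+1) <= C * exp (xk N (N ^ 2)%N.+1).
    have [X0 _] := xk_bounds N (N ^ 2)%N.+1 HN0.
    rewrite /usol Rabs_mult Rabs_exp.
    have [D1 D2] := exp_damp_le1 beta s ltac:(lra).
    have [W _] := HC0 s (xk N (N ^ 2)%N.+1) ltac:(lra); rewrite (Rabs_right (xk _ _)) in W; last lra.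
    have : C0 * exp (xk N (N ^ 2)%N.+1) <= C * exp (xk N (N ^ 2)%N.+1).
      by apply: Rmult_le_compat_r; [exact: exp_ge0|exact: Rmax_l].
    have := Rabs_pos (w s (xk N (N ^ 2)%N.+1)); nra.
  have H4 := boundary_le (b N) N x _ C HN0 (Rlt_le _ _ Hbn) Hbn2 HQ HC HX.
  have HErr : / INR N * exp 2 * (8 * Vexp (b N) x 0 ^ 2 + 2 * (C * exp 1) ^ 2) + 8 * cQ * / INR N * Vexp (b N) x 0 ^ 2 <=
     kappa / 2 * (1 + h).
    apply: (Rle_trans _ (/ INR N * C3 * (1 + h))); last by apply: Rmult_le_compat_r; lra.
    have -> : / INR N * exp 2 * (8 * Vexp (b N) x 0 ^ 2 + 2 * (C * exp 1) ^ 2) + 8 * cQ * / INR N * Vexp (b N) x 0 ^ 2 =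
      / INR N * (exp 2 * (2 * (C * exp 1) ^ 2) + (exp 2 * 8 + 8 * cQ) * Vexp (b N) x 0 ^ 2) by ring.
    rewrite Rmult_assoc; apply: Rmult_le_compat_l; first lra.
    have P1 : (exp 2 * 8 + 8 * cQ) * Vexp (b N) x 0 ^ 2 <= (exp 2 * 8 + 8 * cQ) * (exp 2 * h) by apply: Rmult_le_compat_l; lra.
    have P2 : 0 <= exp 2 * (2 * (C * exp 1) ^ 2) * h.
      by apply: Rmult_le_pos => //; apply: Rmult_le_pos; [lra|have := pow2_ge_0 (C * exp 1); lra].
    have P3 : 0 <= exp 2 * (8 * exp 2) by apply: Rmult_le_pos; lra.
    have P4 : 0 <= 8 * cQ * exp 2 by apply: Rmult_le_pos; lra.
    rewrite /C3; lra.
  have HTs : 0 <= kappa * (T - s) by apply: Rmult_le_pos; lra.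
  have H5 := Rmult_le_compat_l _ _ _ HTs H2.
  have HE0 : 0 <= E s by exact: energy_ge0.
  have Hbr : - (cE + cH) * (E s + kappa * (T - s) * (1 + h)) + E' - kappa * (1 + h) +
     (gen (ratesN N (exp (- b N)) x) (energy (b N) N (usol beta w N s)) x + kappa * (T - s) * gen (ratesN N (exp (- b N)) x) (Hfun (b N) N) x) <= 0.
    have Q1 : 0 <= cH * E s by apply: Rmult_le_pos; lra.
    have Q2 : 0 <= cE * (kappa * (T - s) * (1 + h)) by apply: Rmult_le_pos; [lra|apply: Rmult_le_pos; lra].
    have Q3 : 0 <= cH * (kappa * (T - s)) by apply: Rmult_le_pos; lra.
    have Q4 : 0 <= kappa * h by apply: Rmult_le_pos; lra.
    have -> : - (cE + cH) * (E s + kappa * (T - s) * (1 + h)) = - (cE * E s) - cH * E s - cE * (kappa * (T - s) * (1 + h)) - cH * (kappa * (T - s)) - cH * (kappa * (T - s)) * h by ring.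
    move: H1 H3 H4 HErr H5; set g1 := gen _ (energy _ _ _) _; set g2 := gen _ (Hfun _ _) _ => H1 H3 H4 HErr H5.
    lra.
  have := exp_pos ((cE + cH) * (T - s)); nra.
Qed.

(** * From heights to energy and back *)

Lemma psi_q_floor q u k : INR k <= u < INR k.+1 -> psi_q q u = INR (hq q k).
Proof.
move=> Hu; rewrite /psi_q /hq; elim: q => [|x q IH] //=.
rewrite [sumR _]IH plus_INR; congr (_ + _).
case: Rlt_dec => Hx.
  by have -> : (k < x)%N = true by apply/ltP; apply: INR_lt; lra.
have -> : (k < x)%N = false; last by [].
apply/negbTE; rewrite -leqNgt; apply/leP; have : INR x < INR k.+1 by lra.
by move/INR_lt; lia.
Qed.

Lemma nfloor u : 0 <= u -> exists k : nat, INR k <= u < INR k.+1.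
Proof. by move=> Hu; have [k Hk] := nfloor_ex u Hu; exists k; rewrite S_INR. Qed.

(* log V_j = N b P_j. *)
Definition Pval (N : nat) (q : seq nat) (j : nat) : R := (INR (hq q j) + INR j / 2) / INR N.

Lemma Vexp_Pval b N q j : (0 < N)%N -> Vexp b q j = exp (INR N * b * Pval N q j).
Proof. by move=> HN; have := INR_ge1 N HN; rewrite /Vexp /Pval => H; congr exp; field; lra. Qed.

Lemma Pval_ge0 N q j : (0 < N)%N -> 0 <= Pval N q j.
Proof.
move=> HN; have := INR_ge1 N HN; have := pos_INR (hq q j); have := pos_INR j => H1 H2 H3.
by apply: Rmult_le_pos; [lra|apply: Rlt_le; apply: Rinv_0_lt_compat; lra].
Qed.

Lemma Pval_lip N q j m : (0 < N)%N -> isQ q -> Rabs (Pval N q (j + m) - Pval N q j) <= INR m / (2 * INR N).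
Proof.
move=> HN HQ; have HN1 := INR_ge1 N HN; elim: m => [|m IH].
  by rewrite addn0 Rminus_diag Rabs_R0 /= /Rdiv Rmult_0_l; lra.
have -> : Pval N q (j + m.+1) - Pval N q j = (Pval N q (j + m).+1 - Pval N q (j + m)) + (Pval N q (j + m) - Pval N q j).
  by rewrite addnS; ring.
apply: Rle_trans (Rabs_triang _ _) _.
have -> : INR m.+1 / (2 * INR N) = / (2 * INR N) + INR m / (2 * INR N) by rewrite S_INR; field; lra.
apply: Rplus_le_compat => //.
rewrite /Pval (hq_step q (j + m)) // plus_INR S_INR.
have H2 : 0 < / (2 * INR N) by apply: Rinv_0_lt_compat; lra.
case: (_ \in q) => /=; apply: Rabs_le.
  have -> : (INR (hq q (j + m).+1) + (INR (j + m) + 1) / 2) / INR N - (INR (hq q (j + m).+1) + 1 + INR (j + m) / 2) / INR N = - / (2 * INR N) by field; lra.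
  lra.
have -> : (INR (hq q (j + m).+1) + (INR (j + m) + 1) / 2) / INR N - (INR (hq q (j + m).+1) + 0 + INR (j + m) / 2) / INR N = / (2 * INR N) by field; lra.
lra.
Qed.

Lemma psiN_floor N q u k : (0 < N)%N -> INR k <= INR N * u < INR k.+1 ->
  psiN N q u = Pval N q k - INR k / (2 * INR N).
Proof.
move=> HN Hk; have HN1 := INR_ge1 N HN.
by rewrite /psiN (psi_q_floor q _ k) // /Pval; field; lra.
Qed.

Definition closeN (N : nat) (q : seq nat) (f : R -> R) (M e : R) : Prop :=
  forall u, 0 <= u <= M -> Rabs (psiN N q u - f u) <= e.

Lemma evenpart_lip p x y : in_XR p -> Rabs (evenpart p x - evenpart p y) <= Rabs (x - y) / 2.
Proof.
move=> Hp; have [dp [Hd [Hc [Hb _]]]] := evenpart_smooth p Hp.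
have [||c [_ E]] := MVT_gen (evenpart p) y x dp.
- by move=> z _.
- by move=> z _; apply/continuity_pt_filterlim; apply: ex_derive_continuous; eexists; exact: Hd.
rewrite E Rabs_mult; have := Rmult_le_compat_r (Rabs (x - y)) _ _ (Rabs_pos _) (Hb c); lra.
Qed.

Lemma evenpart_pos p x : 0 <= x -> evenpart p x = p x + x / 2.
Proof. by move=> Hx; rewrite /evenpart Rabs_right; lra. Qed.

Lemma exp_diff_le a c d : Rabs (a - c) <= d -> Rabs (exp a - exp c) <= exp c * (exp d - 1).
Proof.
move=> /Rabs_le_between H.
have -> : exp a - exp c = exp c * (exp (a - c) - 1).
  by rewrite Rmult_minus_distr_l -exp_plus; have -> : c + (a - c) = a by [ring]; ring.
rewrite Rabs_mult Rabs_exp.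
apply: Rmult_le_compat_l; first exact: exp_ge0.
have H1 : exp (a - c) <= exp d by apply: exp_le; lra.
have H2 : exp (- d) <= exp (a - c) by apply: exp_le; lra.
have H3 : exp d * exp (- d) = 1 by rewrite -exp_plus -exp_0; congr exp; ring.
have Hp := exp_pos d; have Hq := exp_pos (- d).
apply: Rabs_le; split; last lra.
have : 2 <= exp d + exp (- d) by have := pow2_ge_0 (exp d - exp (- d)); nra.
lra.
Qed.

(** Increments of [usol] are values of the transformed solution at intermediate points, to be
    compared with the increments V_(k+1) / N of U. *)
Lemma usol_S beta p w v vx vxx N s k : heat_pkg beta p w v vx vxx -> (0 < N)%N ->
  exists xi, xk N k <= xi <= xk N k.+1 /\
    usol beta w N s k.+1 - usol beta w N s k = / INR N * (exp (- ((beta / 2) ^ 2 * s)) * v s xi).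
Proof.
move=> H HN; have HN1 := INR_ge1 N HN; have Hi : 0 < / INR N by apply: Rinv_0_lt_compat; lra.
have HxS := xk_S N k HN.
have [xi [E Hxi]] := MVT_cor2 (w s) (v s) (xk N k) (xk N k.+1) ltac:(lra)
  (fun c _ => proj1 (is_derive_Reals _ _ _) (hp_wx _ _ _ _ _ _ H s c)).
exists xi; split; first lra.
by rewrite /usol -Rmult_minus_distr_l E HxS; ring.
Qed.

Lemma usol_0 beta p w v vx vxx N s : heat_pkg beta p w v vx vxx -> (0 < N)%N ->
  exists xi, 0 <= xi <= xk N 0 /\
    usol beta w N s 0 = / 2 * / INR N * (exp (- ((beta / 2) ^ 2 * s)) * v s xi).
Proof.
move=> H HN; have HN1 := INR_ge1 N HN.
have [Hx0 _] := xk_bounds N 0 HN.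
have [xi [E Hxi]] := MVT_cor2 (w s) (v s) 0 (xk N 0) Hx0
  (fun c _ => proj1 (is_derive_Reals _ _ _) (hp_wx _ _ _ _ _ _ H s c)).
have W0 : w s 0 = 0 by have := hp_wodd _ _ _ _ _ _ H s 0; rewrite Ropp_0; lra.
exists xi; split; first lra.
rewrite /usol; have -> : w s (xk N 0) = v s xi * (xk N 0 - 0) by lra.
by rewrite /xk /=; field; lra.
Qed.

(** The upper bound of [Hfun_bounds] when the rescaled height at 0 is within 1 of p 0. *)
Definition Hbound (p : R -> R) : R := 2 * exp 2 * exp (2 * (p 0 + 1)) ^ 2.

(** Closeness of heights on [0, M] makes each V_j close to [ic]; at most about M N differences of
    weight 1/N add up. Outside the window both primitives have a priori exponential bounds. *)
Lemma init_small beta p w v vx vxx (b : nat -> R) : heat_pkg beta p w v vx vxx -> in_XR p -> 0 < beta <= 2 ->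
  (forall N, (0 < N)%N -> 0 < b N) -> is_lim_seq (fun N => INR N * b N) beta ->
  (forall N, (0 < N)%N -> INR N * b N <= 2) ->
  forall e, 0 < e -> exists (M d : R) (N0 : nat), 0 <= M /\ 0 < d /\ forall N q, (0 < N)%N -> (N0 <= N)%N -> isQ q ->
    closeN N q p M d -> energy (b N) N (usol beta w N 0) q <= e /\ Hfun (b N) N q <= Hbound p.
Proof.
move=> H Hp Hbeta Hb0 Hblim Hb2 e He.
have Hp0 : 0 <= p 0 by case: Hp => d [Hd _]; apply: Hd; lra.
have [C0 HC0] := hp_growth _ _ _ _ _ _ H 0.
pose C := Rmax C0 0; have HC : 0 <= C by exact: Rmax_r.
have He1 := exp_pos 1.
pose V0 := exp (2 * (p 0 + 1)); have HV0 : 0 < V0 by exact: exp_pos.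
pose A := 2 * V0 + C * exp 1.
have [M HM] := exp_neg_small (2 * A ^ 2) (e / 2) ltac:(have := pow2_ge_0 A; lra) ltac:(lra).
have HM0 := pos_INR M.
pose e1 := Rmin 1 (e / 4).
have Hm1 : e1 <= 1 by exact: Rmin_l.
have Hm2 : e1 <= e / 4 by exact: Rmin_r.
have He10 : 0 < e1 by apply: Rmin_glb_lt; lra.
pose B := p 0 + INR M + 1.
(* The tolerance for V_j: accumulated over macroscopic length M + 1 it gives e1. *)
pose om := e1 / (INR M + 1).
have Hom : 0 < om by apply: Rdiv_lt_0_compat; lra.
have HeB := exp_pos (2 * B).
pose d := Rmin 1 (om / (3 * exp (2 * B))).
have Hd : 0 < d by apply: Rmin_glb_lt; [lra|apply: Rdiv_lt_0_compat; lra].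
have Hd1 : d <= 1 by exact: Rmin_l.
have Hd2 : d <= om / (3 * exp (2 * B)) by exact: Rmin_r.
have HB : 0 < B by rewrite /B; lra.
have [N1 HN1] := proj1 (is_lim_seq_eps _ _) Hblim (d / (4 * B)) ltac:(apply: Rdiv_lt_0_compat; lra).
have Hi : is_lim_seq (fun n => / INR n) 0.
  by apply: (is_lim_seq_inv _ p_infty) => //; exact: is_lim_seq_INR.
have [N2 HN2] := proj1 (is_lim_seq_eps _ _) Hi (d / 4) ltac:(lra).
exists (INR M), (d / 4), (maxn N1 N2); split => //; split; first lra.
move=> N q HN0 HNN HQ Hclose; have HNge := INR_ge1 N HN0.
have Hbn := Hb0 N HN0; have Hbn2 := Hb2 N HN0.
have B1 := HN1 N ltac:(lia).
have Hiv : 0 < / INR N <= 1 by split; [apply: Rinv_0_lt_compat; lra|rewrite -Rinv_1; apply: Rinv_le_contravar; lra].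
have := HN2 N ltac:(lia); rewrite Rminus_0_r Rabs_right; last lra.
move=> B2.
have HP j : INR j <= INR M * INR N -> Rabs (Pval N q j - evenpart p (INR j / INR N)) <= d / 4.
  move=> Hj; have Hj0 := pos_INR j.
  have Hu : 0 <= INR j / INR N <= INR M.
    split; first by apply: Rmult_le_pos; lra.
    by apply: (Rmult_le_reg_r (INR N)); [lra|rewrite /Rdiv Rmult_assoc Rinv_l; lra].
  have := Hclose _ Hu; rewrite (psiN_floor N q _ j) // ?evenpart_pos; try lra; last first.
    by rewrite S_INR; have -> : INR N * (INR j / INR N) = INR j by [field; lra]; lra.
  have -> : Pval N q j - INR j / (2 * INR N) - p (INR j / INR N) = Pval N q j - (p (INR j / INR N) + INR j / INR N / 2) by field; lra.
  by [].
have HVb : Vexp (b N) q 0 <= V0.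
  rewrite (Vexp_Pval (b N) N) //; apply: exp_le.
  have /Rabs_le_between := HP 0%N ltac:(rewrite /=; apply: Rmult_le_pos; lra).
  have -> : INR 0 / INR N = 0 by rewrite /= /Rdiv Rmult_0_l.
  rewrite evenpart_pos => [HP0|]; last lra.
  have HP1 : Pval N q 0 <= p 0 + 1 by lra.
  apply: Rmult_le_compat => //; [apply: Rmult_le_pos; lra|exact: Pval_ge0].
have HV j xi : INR j <= INR M * INR N -> 0 <= xi -> Rabs (xi - INR j / INR N) <= / INR N ->
    Rabs (Vexp (b N) q j - ic beta p xi) <= om.
  move=> Hj Hxi0 Hxi; rewrite (Vexp_Pval (b N) N) // /ic.
  have HjM : INR j / INR N <= INR M.
    by apply: (Rmult_le_reg_r (INR N)); [lra|rewrite /Rdiv Rmult_assoc Rinv_l; lra].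
  have HG : 0 <= evenpart p xi <= B.
    split; first by have := evenpart_ge p xi Hp; have := Rabs_pos xi; lra.
    have := evenpart_le p xi Hp; rewrite (Rabs_right xi); last lra.
    by move/Rabs_le_between: Hxi; rewrite /B; lra.
  have H1 := HP j Hj; have H2 := evenpart_lip p (INR j / INR N) xi Hp.
  rewrite Rabs_minus_sym in Hxi.
  have H3 : Rabs (Pval N q j - evenpart p xi) <= 3 / 8 * d.
    have -> : Pval N q j - evenpart p xi = (Pval N q j - evenpart p (INR j / INR N)) + (evenpart p (INR j / INR N) - evenpart p xi) by ring.
    by apply: Rle_trans (Rabs_triang _ _) _; lra.
  have H4 : Rabs (INR N * b N * Pval N q j - beta * evenpart p xi) <= d.
    have -> : INR N * b N * Pval N q j - beta * evenpart p xi =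
      INR N * b N * (Pval N q j - evenpart p xi) + (INR N * b N - beta) * evenpart p xi by ring.
    apply: Rle_trans (Rabs_triang _ _) _; rewrite !(Rabs_mult (_ - beta)) Rabs_mult (Rabs_right (INR N * b N)); last by apply: Rle_ge; apply: Rmult_le_pos; lra.
    rewrite (Rabs_right (evenpart p xi)); last lra.
    have : Rabs (INR N * b N - beta) * evenpart p xi <= d / (4 * B) * B.
      by apply: Rmult_le_compat; try lra; exact: Rabs_pos.
    have -> : d / (4 * B) * B = d / 4 by field; lra.
    have : INR N * b N * Rabs (Pval N q j - evenpart p xi) <= 2 * (3 / 8 * d).
      by apply: Rmult_le_compat => //; [apply: Rmult_le_pos; lra|exact: Rabs_pos].
    lra.
  apply: Rle_trans (exp_diff_le _ _ _ H4) _.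
  have H5 : exp (beta * evenpart p xi) <= exp (2 * B) by apply: exp_le; nra.
  have H6 : exp d - 1 <= 3 * d.
    have := exp_minus_one d ltac:(lra); have : exp d <= exp 1 by apply: exp_le; lra.
    have := exp_le_3; nra.
  have H7 := exp_minus_one d ltac:(lra); have H8 := exp_pos (beta * evenpart p xi).
  apply: (Rle_trans _ (exp (2 * B) * (3 * d))); first by apply: Rmult_le_compat; lra.
  have : exp (2 * B) * (3 * (om / (3 * exp (2 * B)))) = om by field; lra.
  by have : exp (2 * B) * (3 * d) <= exp (2 * B) * (3 * (om / (3 * exp (2 * B)))) by [apply: Rmult_le_compat_l; lra]; lra.
split; last first.
  have := (Hfun_bounds (b N) N q HN0 (Rlt_le _ _ Hbn) Hbn2 HQ).2.
  move=> HH; apply: Rle_trans HH _; rewrite /Hbound; apply: Rmult_le_compat_l; first by have := exp_pos 2; lra.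
  by apply: pow_incr; split => //; apply: Rlt_le; exact: Vexp_gt0.
have Esmall : 2 * (e1 ^ 2 + A ^ 2 * exp (- INR M)) <= e.
  have : e1 ^ 2 <= e / 4 by rewrite /= Rmult_1_r; nra.
  lra.
apply: Rle_trans Esmall.
have Hinit x : exp (- ((beta / 2) ^ 2 * 0)) * v 0 x = ic beta p x.
  by rewrite Rmult_0_r Ropp_0 exp_0 Rmult_1_l (hp_v_init _ _ _ _ _ _ H).
apply: (weighted_small N _ (fun k => Usum (b N) N q k - usol beta w N 0 k)) => //; first lra.
- move=> k; have [U0 U1] := Usum_bounds (b N) N q k HN0 (Rlt_le _ _ Hbn) Hbn2 HQ.
  have [X0 [X1 X2]] := xk_bounds N k HN0.
  have HW : Rabs (usol beta w N 0 k) <= C * exp 1 * exp (INR k / INR N).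
    rewrite /usol Rmult_0_r Ropp_0 exp_0 Rmult_1_l.
    have [W _] := HC0 0 (xk N k) (Rle_refl 0); rewrite (Rabs_right (xk N k)) in W; last lra.
    apply: Rle_trans W _; apply: (Rle_trans _ (C * exp (xk N k))).
      by apply: Rmult_le_compat_r; [exact: exp_ge0|exact: Rmax_l].
    by rewrite Rmult_assoc; apply: Rmult_le_compat_l.
  apply: Rle_trans (Rabs_triang _ _) _; rewrite Rabs_Ropp (Rabs_right (Usum _ _ _ _)); last lra.
  have := Rmult_le_compat_r _ _ _ (Rlt_le _ _ (exp_pos (INR k / INR N))) HVb; rewrite /A; lra.
- move=> k Hk.
  have : Rabs (Usum (b N) N q k - usol beta w N 0 k) <= (INR k + 1) * / INR N * om.
    elim: k Hk => [|k IH] Hk.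
      have [xi [Hxi ->]] := usol_0 beta p w v vx vxx N 0 H HN0; rewrite Hinit.
      have -> : Usum (b N) N q 0 - / 2 * / INR N * ic beta p xi = / 2 * / INR N * (Vexp (b N) q 0 - ic beta p xi).
        by rewrite /Usum /=; field; lra.
      rewrite Rabs_mult (Rabs_right (/ 2 * / INR N)); last lra.
      have HX : Rabs (Vexp (b N) q 0 - ic beta p xi) <= om.
        apply: HV => //; first lra.
        rewrite /= /Rdiv Rmult_0_l Rminus_0_r Rabs_right; last lra.
        have : xk N 0 = / 2 * / INR N by rewrite /xk /=; field; lra.
        lra.
      have := Rmult_le_compat_l (/ 2 * / INR N) _ _ ltac:(lra) HX.
      have := Rmult_lt_0_compat _ _ (proj1 Hiv) Hom; rewrite /=; lra.
    have [xi [Hxi E]] := usol_S beta p w v vx vxx N 0 k H HN0; rewrite Hinit in E.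
    have -> : Usum (b N) N q k.+1 - usol beta w N 0 k.+1 =
      (Usum (b N) N q k - usol beta w N 0 k) + / INR N * (Vexp (b N) q k.+1 - ic beta p xi) by rewrite Usum_S; lra.
    apply: Rle_trans (Rabs_triang _ _) _; rewrite Rabs_mult (Rabs_right (/ INR N)); last lra.
    have HX : Rabs (Vexp (b N) q k.+1 - ic beta p xi) <= om.
      have [X0 _] := xk_bounds N k HN0.
      apply: HV => //; first lra.
      have E1 : xk N k.+1 = INR k.+1 / INR N + / 2 * / INR N by rewrite /xk; field; lra.
      have E2 := xk_S N k HN0; apply: Rabs_le; lra.
    have IH' := IH ltac:(rewrite S_INR in Hk; lra).
    have := Rmult_le_compat_l (/ INR N) _ _ ltac:(lra) HX; rewrite S_INR; lra.
  move=> HD; apply: Rle_trans HD _.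
  have HkM : INR k / INR N <= INR M.
    by apply: (Rmult_le_reg_r (INR N)); [lra|rewrite /Rdiv Rmult_assoc Rinv_l; lra].
  have : (INR k + 1) * / INR N <= INR M + 1 by rewrite Rmult_plus_distr_r; rewrite /Rdiv in HkM; lra.
  move=> HL; have := Rmult_le_compat_r om _ _ (Rlt_le _ _ Hom) HL.
  have -> : (INR M + 1) * om = e1 by rewrite /om; field; lra.
  by [].
Qed.

(* If sigma V exceeds sigma theta along a window of 2m sites, the increments of D add up and D^2 is large on average. *)
Lemma window_lower (D : nat -> R) k m sg g : (sg = 1 \/ sg = -1) -> 0 <= g ->
  (forall j, (k <= j)%N -> (j < k + (m + m))%N -> g <= sg * (D j.+1 - D j)) ->
  INR m * (INR m * g) ^ 2 / 2 <= bsum (m + m) (fun i => D (k + i)%N ^ 2).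
Proof.
move=> Hsg Hg HD.
have Hinc i n : (i + n <= m + m)%N -> INR n * g <= sg * (D (k + (i + n))%N - D (k + i)%N).
  elim: n => [|n IH] Hn; first by rewrite addn0 Rminus_diag /=; lra.
  have H1 := IH ltac:(lia); have := HD (k + (i + n))%N ltac:(lia) ltac:(lia).
  have -> : (k + (i + n)).+1 = (k + (i + n.+1))%N by lia.
  rewrite S_INR; lra.
rewrite bsum_cat -bsum_plus.
have -> : INR m * (INR m * g) ^ 2 / 2 = bsum m (fun=> (INR m * g) ^ 2 / 2) by rewrite bsum_const; field.
apply: bsum_le => i Hi.
have H1 := Hinc i m ltac:(lia).
have -> : (k + (m + i))%N = (k + (i + m))%N by lia.
set a := D (k + i)%N; set c := D (k + (i + m))%N in H1 *.
have H2 : (INR m * g) ^ 2 <= (sg * (c - a)) ^ 2.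
  by apply: pow_incr; split => //; apply: Rmult_le_pos => //; exact: pos_INR.
have H3 : (sg * (c - a)) ^ 2 = (c - a) ^ 2 by case: Hsg => ->; ring.
have := pow2_ge_0 (c + a); rewrite H3 in H2; lra.
Qed.

Lemma energy_window b N u q k n M e : (0 < N)%N -> (k + n <= (N ^ 2).+1)%N -> INR (k + n) <= (M + 1) * INR N ->
  e <= bsum n (fun i => (Usum b N q (k + i)%N - u (k + i)%N) ^ 2) ->
  / INR N * (exp (- (4 * (M + 1))) * e) <= energy b N u q.
Proof.
move=> HN Hkn HM He; have HN1 := INR_ge1 N HN.
have Hi : 0 < / INR N by apply: Rinv_0_lt_compat; lra.
rewrite /energy; apply: Rmult_le_compat_l; first lra.
apply: (Rle_trans _ (bsum (k + n) (fun k => wt N k * (Usum b N q k - u k) ^ 2))); last first.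
  apply: bsum_mono Hkn => j; apply: Rmult_le_pos; [apply: Rlt_le; exact: wt_gt0|exact: pow2_ge_0].
rewrite bsum_cat.
have H0 : 0 <= bsum k (fun k => wt N k * (Usum b N q k - u k) ^ 2).
  by apply: bsum_ge0 => j _; apply: Rmult_le_pos; [apply: Rlt_le; exact: wt_gt0|exact: pow2_ge_0].
apply: (Rle_trans _ (exp (- (4 * (M + 1))) * bsum n (fun i => (Usum b N q (k + i)%N - u (k + i)%N) ^ 2))).
  by apply: Rmult_le_compat_l => //; exact: exp_ge0.
rewrite -bsum_scal; apply: (Rle_trans _ (bsum n (fun i => wt N (k + i)%N * (Usum b N q (k + i)%N - u (k + i)%N) ^ 2))); last lra.
apply: bsum_le => i Hin; apply: Rmult_le_compat_r; first exact: pow2_ge_0.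
apply: exp_le; apply: Ropp_le_contravar.
have H1 : INR (k + i) <= INR (k + n) by apply: le_INR; lia.
apply: (Rmult_le_reg_r (INR N)); first lra.
have -> : 4 * INR (k + i) / INR N * INR N = 4 * INR (k + i) by field; lra.
lra.
Qed.

(** By contraposition: a height error above e at u persists, by Lipschitz continuity, as an error of
    at least 3 e / 4 with the same sign on a window of order e N sites. There V misses the limit by
    at least c1, so U - u drifts linearly and cannot be small in square mean. *)
Lemma energy_close beta p w v vx vxx (b : nat -> R) T f : heat_pkg beta p w v vx vxx -> in_XR f -> 0 < beta <= 2 ->
  (forall N, (0 < N)%N -> 0 < b N) -> is_lim_seq (fun N => INR N * b N) beta ->
  (forall N, (0 < N)%N -> INR N * b N <= 2) ->
  (forall x, 0 <= x -> exp (- ((beta / 2) ^ 2 * T)) * v T x = exp (beta * evenpart f x)) ->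
  forall M e, 0 <= M -> 0 < e <= 1 -> exists (c : R) (N0 : nat), 0 < c /\ forall N q, (0 < N)%N -> (N0 <= N)%N -> isQ q ->
    energy (b N) N (usol beta w N T) q < c -> closeN N q f M e.
Proof.
move=> H Hf Hbeta Hb0 Hblim Hb2 Htheta M e HM He.
have Hf0 : 0 <= f 0 by case: Hf => d [Hd _]; apply: Hd; lra.
pose B := f 0 + (M + 2) / 2 + 1.
have HB : 0 < B by rewrite /B; lra.
(* Replacing N b by beta costs at most del * B = beta e / 4 in the exponent, leaving g = beta e / 2
   of the gap 3 beta e / 4. *)
pose del := beta * e / (4 * B).
have Hdel : 0 < del by apply: Rdiv_lt_0_compat; [apply: Rmult_lt_0_compat|]; lra.
pose g := beta * e / 2.
have Hg : 0 < g by apply: Rdiv_lt_0_compat; [apply: Rmult_lt_0_compat|]; lra.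
pose c1 := 1 - exp (- g).
have Hc1 : 0 < c1 by have : exp (- g) < exp 0 by [apply: exp_increasing; lra]; rewrite exp_0 /c1; lra.
(* The bound of [window_lower] with increments c1 / N and m / N >= e / 32, times the smallest weight
   up to M + 1. *)
pose c := exp (- (4 * (M + 1))) * ((e / 32) * ((e / 32) * c1) ^ 2 / 2).
have Hc : 0 < c.
  apply: Rmult_lt_0_compat; first exact: exp_pos.
  apply: Rdiv_lt_0_compat; last lra.
  by apply: Rmult_lt_0_compat; [lra|apply: pow_lt; apply: Rmult_lt_0_compat; lra].
have [N1 HN1] := proj1 (is_lim_seq_eps _ _) Hblim del Hdel.
have Hi : is_lim_seq (fun n => / INR n) 0.
  by apply: (is_lim_seq_inv _ p_infty) => //; exact: is_lim_seq_INR.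
have [N2 HN2] := proj1 (is_lim_seq_eps _ _) Hi (Rmin (e / 32) (/ (M + 1))) ltac:(apply: Rmin_glb_lt; [lra|apply: Rinv_0_lt_compat; lra]).
exists c, (maxn N1 N2); split => //.
move=> N q HN0 HNN HQ HE u Hu; have HNge := INR_ge1 N HN0.
have Hbn := Hb0 N HN0; have Hbn2 := Hb2 N HN0.
have /Rabs_def2 B1 := HN1 N ltac:(lia).
have Hiv : 0 < / INR N <= 1 by split; [apply: Rinv_0_lt_compat; lra|rewrite -Rinv_1; apply: Rinv_le_contravar; lra].
have := HN2 N ltac:(lia); rewrite Rminus_0_r Rabs_right; last lra.
move=> B2; have B3 := Rmin_l (e / 32) (/ (M + 1)); have B4 := Rmin_r (e / 32) (/ (M + 1)).
(* Keeps the window below the cutoff: (M + 1) N <= N^2. *)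
have HNM : M + 1 <= INR N.
  apply: Rnot_lt_le => Hlt; have : / (M + 1) < / INR N by apply: Rinv_lt_contravar => //; nra.
  lra.
(* Makes the integer part m of N e / 16 at least N e / 32. *)
have HNe : 32 <= INR N * e.
  have : / INR N * INR N = 1 by field; lra.
  have : / INR N * INR N <= e / 32 * INR N by apply: Rmult_le_compat_r; lra.
  lra.
apply: Rnot_lt_le => Hbad.
have [k Hk] := nfloor (INR N * u) ltac:(apply: Rmult_le_pos; lra).
have [m Hm] := nfloor (INR N * (e / 16)) ltac:(apply: Rmult_le_pos; lra).
rewrite S_INR in Hm.
have Hm32 : INR N * (e / 32) <= INR m by lra.
have Hku : INR k / INR N <= u < INR k / INR N + / INR N.
  rewrite S_INR in Hk; split.
    by apply: (Rmult_le_reg_r (INR N)); [lra|rewrite /Rdiv Rmult_assoc Rinv_l; lra].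
  apply: (Rmult_lt_reg_r (INR N)); first lra.
  have -> : (INR k / INR N + / INR N) * INR N = INR k + 1 by field; lra.
  lra.
have HmN : INR m / INR N <= e / 16.
  by apply: (Rmult_le_reg_r (INR N)); [lra|rewrite /Rdiv Rmult_assoc Rinv_l; lra].
have HmN0 : 0 <= INR m / INR N by apply: Rmult_le_pos; [exact: pos_INR|lra].
have Hpsi := psiN_floor N q u k HN0 Hk.
have Hwin j xi : (k <= j)%N -> (j < k + (m + m))%N -> xk N j <= xi <= xk N j.+1 ->
    Rabs (Pval N q j.+1 - evenpart f xi - (psiN N q u - f u)) <= e / 4 /\ 0 <= evenpart f xi <= B - 1.
  move=> Hkj Hj Hxi.
  have [X0 _] := xk_bounds N j HN0.
  have HjE : INR j = INR k + INR (j - k) by rewrite -plus_INR; congr INR; lia.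
  have Hjk : INR (j - k) + 1 <= 2 * INR m.
    by have -> : 2 * INR m = INR (m + m) by [rewrite plus_INR; ring]; rewrite -S_INR; apply: le_INR; lia.
  have HP := Pval_lip N q k (j.+1 - k) HN0 HQ.
  rewrite (_ : (k + (j.+1 - k))%N = j.+1) in HP; last by lia.
  have HP2 : INR (j.+1 - k) / (2 * INR N) <= INR m / INR N.
    rewrite (_ : (j.+1 - k)%N = (j - k).+1); last by lia.
    rewrite S_INR; apply: (Rmult_le_reg_r (2 * INR N)); first lra.
    have -> : INR m / INR N * (2 * INR N) = 2 * INR m by field; lra.
    by rewrite /Rdiv Rmult_assoc Rinv_l; lra.
  have HxiU : Rabs (xi - u) <= 2 * (INR m / INR N) + / INR N.
    have E1 : xk N j = INR k / INR N + INR (j - k) * / INR N + / 2 * / INR N by rewrite /xk HjE; field; lra.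
    have E2 := xk_S N j HN0.
    have P0 : 0 <= INR (j - k) * / INR N by apply: Rmult_le_pos; [exact: pos_INR|lra].
    have P1 : (INR (j - k) + 1) * / INR N <= 2 * INR m * / INR N by apply: Rmult_le_compat_r; lra.
    by apply: Rabs_le; rewrite /Rdiv in Hku E1 *; lra.
  have HG := evenpart_lip f xi u Hf; rewrite (evenpart_pos f u) in HG; last lra.
  split; last first.
    split; first by have := evenpart_ge f xi Hf; have := Rabs_pos xi; lra.
    have := evenpart_le f xi Hf; rewrite (Rabs_right xi); last lra.
    by move/Rabs_le_between: HxiU; rewrite /B; lra.
  have E : Pval N q j.+1 - evenpart f xi - (psiN N q u - f u) =
    (Pval N q j.+1 - Pval N q k) - (evenpart f xi - (f u + u / 2)) + (INR k / (2 * INR N) - u / 2) by rewrite Hpsi; ring.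
  have E3 : INR k / (2 * INR N) = INR k / INR N / 2 by field; lra.
  rewrite E E3; move/Rabs_le_between: HP => HP; move/Rabs_le_between: HG => HG.
  by apply: Rabs_le; lra.
have HV j : (k <= j)%N -> (j < k + (m + m))%N ->
   (e < psiN N q u - f u -> c1 * / INR N <= 1 * ((Usum (b N) N q j.+1 - usol beta w N T j.+1) - (Usum (b N) N q j - usol beta w N T j))) /\
   (psiN N q u - f u < - e -> c1 * / INR N <= -1 * ((Usum (b N) N q j.+1 - usol beta w N T j.+1) - (Usum (b N) N q j - usol beta w N T j))).
  move=> Hkj Hj.
  have [xi [Hxi E]] := usol_S beta p w v vx vxx N T j H HN0.
  have [X0 _] := xk_bounds N j HN0.
  rewrite Htheta in E; last lra.
  have [/Rabs_le_between W1 W2] := Hwin j xi Hkj Hj Hxi.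
  set G := evenpart f xi in E W1 W2.
  have -> : Usum (b N) N q j.+1 - usol beta w N T j.+1 - (Usum (b N) N q j - usol beta w N T j) =
    / INR N * (Vexp (b N) q j.+1 - exp (beta * G)) by rewrite Usum_S; lra.
  rewrite (Vexp_Pval (b N) N) //; set P := Pval N q j.+1 in W1 *.
  have HP0 : 0 <= P by exact: Pval_ge0.
  have Hth : 1 <= exp (beta * G) by rewrite -exp_0; apply: exp_le; apply: Rmult_le_pos; lra.
  have Edel : del * B = beta * e / 4 by rewrite /del; field; lra.
  split => Hs.
    have HPG : G + 3 / 4 * e <= P by lra.
    have H1 : beta * G + g <= INR N * b N * P.
      have A1 : INR N * b N * (G + 3 / 4 * e) <= INR N * b N * P by apply: Rmult_le_compat_l => //; apply: Rmult_le_pos; lra.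
      have A2 : (beta - del) * (G + 3 / 4 * e) <= INR N * b N * (G + 3 / 4 * e) by apply: Rmult_le_compat_r; lra.
      have A3 : del * (G + 3 / 4 * e) <= del * B by apply: Rmult_le_compat_l; lra.
      rewrite /g; lra.
    have H2 : exp (beta * G) * exp g <= exp (INR N * b N * P) by rewrite -exp_plus; apply: exp_le.
    have H3 := exp_ineq1_le g; have H4 := exp_ineq1_le (- g).
    have H5 : c1 <= exp (INR N * b N * P) - exp (beta * G).
      have : 1 * (exp g - 1) <= exp (beta * G) * (exp g - 1) by apply: Rmult_le_compat_r; lra.
      rewrite /c1; lra.
    by have := Rmult_le_compat_l (/ INR N) _ _ ltac:(lra) H5; lra.
  have HPG : P <= G - 3 / 4 * e by lra.
  have H1 : INR N * b N * P <= beta * G - g.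
    have A1 : INR N * b N * P <= (beta + del) * (G - 3 / 4 * e) by apply: Rmult_le_compat => //; [apply: Rmult_le_pos; lra|lra].
    have A3 : del * (G - 3 / 4 * e) <= del * B by apply: Rmult_le_compat_l; lra.
    have A4 := Rmult_lt_0_compat beta e ltac:(lra) ltac:(lra).
    rewrite /g; lra.
  have H2 : exp (INR N * b N * P) <= exp (beta * G) * exp (- g) by rewrite -exp_plus; apply: exp_le; lra.
  have H5 : c1 <= exp (beta * G) - exp (INR N * b N * P).
    have : 1 * c1 <= exp (beta * G) * c1 by apply: Rmult_le_compat_r; lra.
    rewrite {2}/c1; lra.
  by have := Rmult_le_compat_l (/ INR N) _ _ ltac:(lra) H5; lra.
have [sg [Hsg Hinc]] : exists sg, (sg = 1 \/ sg = -1) /\ forall j, (k <= j)%N -> (j < k + (m + m))%N ->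
    c1 * / INR N <= sg * ((Usum (b N) N q j.+1 - usol beta w N T j.+1) - (Usum (b N) N q j - usol beta w N T j)).
  case: (Rle_dec 0 (psiN N q u - f u)) => Hs.
    exists 1; split; first by left.
    by move=> j H1 H2; apply: (HV j H1 H2).1; rewrite Rabs_right in Hbad; lra.
  exists (-1); split; first by right.
  by move=> j H1 H2; apply: (HV j H1 H2).2; rewrite Rabs_left in Hbad; lra.
have Hcn : 0 <= c1 * / INR N by apply: Rmult_le_pos; lra.
have Hlow := window_lower (fun j => Usum (b N) N q j - usol beta w N T j) k m sg _ Hsg Hcn Hinc.
have Hk2 : INR (k + (m + m)) <= (M + 1) * INR N.
  rewrite !plus_INR.
  have : INR N * u <= INR N * M by apply: Rmult_le_compat_l; lra.
  have : INR N * (e / 16) <= INR N * (1 / 16) by apply: Rmult_le_compat_l; lra.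
  lra.
have HKn : (k + (m + m) <= (N ^ 2).+1)%N.
  apply: leqW; apply/leP; apply: INR_le; apply: Rle_trans Hk2 _.
  by rewrite expnS expn1 mult_INR; apply: Rmult_le_compat_r; lra.
have := energy_window (b N) N (usol beta w N T) q k (m + m) M _ HN0 HKn Hk2 Hlow.
suff : c <= / INR N * (exp (- (4 * (M + 1))) * (INR m * (INR m * (c1 * / INR N)) ^ 2 / 2)) by lra.
have -> : / INR N * (exp (- (4 * (M + 1))) * (INR m * (INR m * (c1 * / INR N)) ^ 2 / 2)) =
  exp (- (4 * (M + 1))) * (INR m / INR N * (INR m / INR N * c1) ^ 2 / 2) by field; lra.
have Hlo : e / 32 <= INR m / INR N.
  by apply: (Rmult_le_reg_r (INR N)); [lra|rewrite /Rdiv (Rmult_assoc (INR m)) Rinv_l; lra].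
apply: Rmult_le_compat_l; first exact: exp_ge0.
apply: Rmult_le_compat_r; first lra.
apply: Rmult_le_compat; [lra|exact: pow2_ge_0|exact: Hlo|].
apply: pow_incr; split; first by apply: Rmult_le_pos; lra.
by apply: Rmult_le_compat_r; lra.
Qed.

(** * Test functions *)

Lemma Int0inf_compact (F : R -> R) (b l : R) : 0 < b -> (forall u, b < u -> F u = 0) -> is_RInt F 0 b l -> Int0inf F = l.
Proof.
move=> Hb HF HI; rewrite /Int0inf; refine (@is_RInt_gen_unique R_CompleteNormedModule (at_point 0) (Rbar_locally p_infty) _ _ F l _).
rewrite /is_RInt_gen /filterlimi => P HP; rewrite /filtermapi; apply: (Filter_prod _ _ _ (fun x => x = 0) (fun y => b < y)).
- by [].
- by exists b.
- move=> x y /= -> Hy; exists l; split; last by apply: (locally_singleton l P HP).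
  have -> : l = plus l 0 :> R by rewrite /plus /=; eqR; ring.
  apply: (is_RInt_Chasles F 0 b y) => //.
  have E0 : is_RInt (fun=> 0) b y (scal (y - b) 0) by exact: (is_RInt_const (V := R_NormedModule)).
  have E1 : scal (y - b) 0 = 0 :> R by rewrite /scal /= /mult /=; ring.
  rewrite E1 in E0; apply: is_RInt_ext E0 => z; rewrite Rmin_left ?Rmax_right; try lra.
  by move=> Hz; rewrite HF //; lra.
Qed.

Lemma ex_RInt_zero (F : R -> R) a b : a <= b -> (forall u, a < u < b -> F u = 0) -> ex_RInt F a b.
Proof.
move=> Hab HF; apply: (ex_RInt_ext (fun=> 0)); last exact: ex_RInt_const.
by move=> z; rewrite Rmin_left ?Rmax_right // => Hz; rewrite HF.
Qed.

Lemma ex_RInt_indicator (f : R -> R) c B : (forall u, continuous f u) -> 0 <= B ->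
  ex_RInt (fun u => f u * (if Rlt_dec u c then 1 else 0)) 0 B.
Proof.
move=> Hf HB.
have Hlow s : 0 <= s -> s <= c -> ex_RInt (fun u => f u * (if Rlt_dec u c then 1 else 0)) 0 s.
  move=> Hs0 Hs; apply: (ex_RInt_ext f); last exact: ex_RInt_cont.
  by move=> z; rewrite Rmin_left ?Rmax_right // => Hz; case: Rlt_dec => [?|/= ?] /=; [eqR; ring|lra].
case: (Rle_dec c 0) => Hc0.
  by apply: ex_RInt_zero => // u Hu; case: Rlt_dec => [?|?] /=; [lra|ring].
case: (Rle_dec B c) => HBc; first exact: Hlow.
apply: (ex_RInt_Chasles _ 0 c B); first by apply: Hlow; lra.
by apply: ex_RInt_zero; [lra|move=> u Hu; case: Rlt_dec => [?|?] /=; [lra|ring]].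
Qed.

(** By induction on q, as the height is a finite sum of indicators of half-lines. *)
Lemma ex_RInt_psiN (f : R -> R) N q B : (0 < N)%N -> (forall u, continuous f u) -> 0 <= B ->
  ex_RInt (fun u => f u * psiN N q u) 0 B.
Proof.
move=> HN Hf HB; have HN1 := INR_ge1 N HN.
apply: (ex_RInt_ext (fun u => scal (/ INR N) (f u * psi_q q (INR N * u)))).
  by move=> u _; rewrite /psiN /scal /= /mult /=; eqR; ring.
apply: ex_RInt_scal; elim: q => [|x q IH].
  by apply: ex_RInt_zero => // u _; rewrite /psi_q /=; ring.
apply: (ex_RInt_ext (fun u => plus (f u * (if Rlt_dec u (INR x / INR N) then 1 else 0)) (f u * psi_q q (INR N * u)))).
  move=> u _; rewrite /plus /= /psi_q /=.
  have -> : (if Rlt_dec u (INR x / INR N) then 1 else 0) = (if Rlt_dec (INR N * u) (INR x) then 1 else 0).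
    have E : INR x = INR N * (INR x / INR N) by field; lra.
    case: Rlt_dec => H1; case: Rlt_dec => H2 //=; exfalso.
      by apply: H2; rewrite E; apply: Rmult_lt_compat_l; lra.
    by apply: H1; apply: (Rmult_lt_reg_l (INR N)); lra.
  by eqR; ring.
by apply: ex_RInt_plus => //; exact: ex_RInt_indicator.
Qed.

Lemma in_XR_ex_RInt (f g : R -> R) B : (forall u, continuous f u) -> in_XR g -> 0 <= B ->
  ex_RInt (fun u => f u * g u) 0 B.
Proof.
move=> Hf Hg HB; have [dp [Hd _]] := evenpart_smooth g Hg.
apply: (ex_RInt_ext (fun u => f u * (evenpart g u - u / 2))).
  by move=> u; rewrite Rmin_left ?Rmax_right // => Hu; rewrite evenpart_pos; [eqR; ring|lra].
apply: ex_RInt_cont => u; apply: (continuous_mult f (fun u => evenpart g u - u / 2)) => //.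
apply: (continuous_minus (evenpart g) (fun u => u / 2)); apply: ex_derive_continuous.
  by eexists; exact: Hd.
by auto_derive.
Qed.

Lemma Int_diff f g N q b : (0 < N)%N -> (forall u, continuous f u) -> 0 < b -> (forall u, b < u -> f u = 0) -> in_XR g ->
  Int0inf (fun u => f u * psiN N q u) - Int0inf (fun u => f u * g u) =
    RInt (fun u => f u * psiN N q u - f u * g u) 0 b /\
  ex_RInt (fun u => f u * psiN N q u - f u * g u) 0 b.
Proof.
move=> HN Hf Hb Hfb Hg.
have I1 := ex_RInt_psiN f N q b HN Hf ltac:(lra); have I2 := in_XR_ex_RInt f g b Hf Hg ltac:(lra).
rewrite (Int0inf_compact _ b _ Hb _ (RInt_correct _ _ _ I1)); last by move=> u Hu; rewrite Hfb //; ring.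
rewrite (Int0inf_compact _ b _ Hb _ (RInt_correct _ _ _ I2)); last by move=> u Hu; rewrite Hfb //; ring.
split; last exact: (ex_RInt_minus (V := R_NormedModule)).
by symmetry; apply: (RInt_minus (V := R_CompleteNormedModule) (fun u => f u * psiN N q u) (fun u => f u * g u)).
Qed.

Lemma C0pos_bounded f : C0pos f -> exists b K, 0 < b /\ 0 < K /\ (forall u, b < u -> f u = 0) /\ forall u, 0 <= u -> Rabs (f u) <= K.
Proof.
case=> Hf [a [b [Ha [Hab Hs]]]].
have Hz u : b < u -> f u = 0.
  by move=> Hu; case: (Req_dec (f u) 0) => // E; have := Hs u E; lra.
have [||xM [HM _]] := continuity_ab_maj (fun u => Rabs (f u)) 0 b; first lra.
  move=> c _; apply/continuity_pt_filterlim; apply: (continuous_comp f Rabs) => //; exact: continuous_Rabs.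
exists b, (Rabs (f xM) + 1); split; first lra; split; first by have := Rabs_pos (f xM); lra.
split => // u Hu; case: (Rle_dec u b) => Hub; first by have := HM u ltac:(lra); lra.
by rewrite Hz ?Rabs_R0; [have := Rabs_pos (f xM); lra|lra].
Qed.

Lemma close_Int f g N q b K e : (0 < N)%N -> (forall u, continuous f u) -> 0 < b -> (forall u, b < u -> f u = 0) -> in_XR g ->
  (forall u, 0 <= u -> Rabs (f u) <= K) -> closeN N q g b e ->
  Rabs (Int0inf (fun u => f u * psiN N q u) - Int0inf (fun u => f u * g u)) <= b * (K * e).
Proof.
move=> HN Hf Hb Hfb Hg HK Hc; have [-> I] := Int_diff f g N q b HN Hf Hb Hfb Hg.
have {2}-> : b = b - 0 by ring.
apply: abs_RInt_le_const => //; first lra.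
move=> u Hu; rewrite -Rmult_minus_distr_l Rabs_mult.
by apply: Rmult_le_compat; [exact: Rabs_pos|exact: Rabs_pos|apply: HK; lra|exact: Hc].
Qed.

(** Distinct parts let the height drop by at most 1 per site; the extra 1/N is the lattice
    spacing. *)
Lemma psiN_lip N q u y : (0 < N)%N -> isQ q -> 0 <= u -> 0 <= y ->
  Rabs (psiN N q u - psiN N q y) <= Rabs (u - y) + / INR N.
Proof.
move=> HN HQ; have HN1 := INR_ge1 N HN; have Hi : 0 < / INR N by apply: Rinv_0_lt_compat; lra.
have Hmain s t : 0 <= s -> s <= t -> 0 <= psiN N q s - psiN N q t <= t - s + / INR N.
  move=> Hs Hst.
  have [i Hi1] := nfloor (INR N * s) ltac:(apply: Rmult_le_pos; lra).
  have [j Hj1] := nfloor (INR N * t) ltac:(apply: Rmult_le_pos; lra).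
  have Hij : (i <= j)%N.
    have : INR i < INR j.+1 by have : INR N * s <= INR N * t by [apply: Rmult_le_compat_l; lra]; lra.
    by move/INR_lt; lia.
  rewrite /psiN (psi_q_floor q _ i) // (psi_q_floor q _ j) // -Rmult_minus_distr_l.
  have Hh : forall n, (hq q (i + n) <= hq q i <= hq q (i + n) + n)%N.
    elim=> [|n IH]; first by rewrite !addn0 leqnn.
    by have := hq_step q (i + n) HQ; rewrite addnS; case: (_ \in q) => /=; lia.
  have [H1 H2] : INR (hq q j) <= INR (hq q i) /\ INR (hq q i) <= INR (hq q j) + INR (j - i).
    have := Hh (j - i)%N; have -> : (i + (j - i))%N = j by lia.
    by move=> /andP [A1 A2]; rewrite -plus_INR; split; apply: le_INR; apply/leP.
  rewrite minus_INR in H2; last by lia.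
  rewrite S_INR in Hi1 Hj1; split; first by apply: Rmult_le_pos; lra.
  apply: (Rmult_le_reg_l (INR N)); first lra.
  have -> : INR N * (/ INR N * (INR (hq q i) - INR (hq q j))) = INR (hq q i) - INR (hq q j) by field; lra.
  have -> : INR N * (t - s + / INR N) = INR N * t - INR N * s + 1 by field; lra.
  lra.
move=> Hu Hy; case: (Rle_dec u y) => H.
  have := Hmain u y Hu H; rewrite (Rabs_left1 (u - y)); last lra.
  by move=> ?; rewrite Rabs_right; lra.
have := Hmain y u Hy ltac:(lra); rewrite (Rabs_right (u - y)); last lra.
by move=> ?; rewrite Rabs_left1; lra.
Qed.

Lemma in_XR_lip g u y : in_XR g -> 0 <= u -> 0 <= y -> Rabs (g u - g y) <= Rabs (u - y).
Proof.
move=> Hg Hu Hy; have := evenpart_lip g u y Hg; rewrite !evenpart_pos // => H.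
have -> : g u - g y = (g u + u / 2 - (g y + y / 2)) + (y - u) / 2 by field.
apply: Rle_trans (Rabs_triang _ _) _.
have -> : Rabs ((y - u) / 2) = Rabs (u - y) / 2.
  by rewrite /Rdiv Rabs_mult (Rabs_minus_sym y u) (Rabs_right (/ 2)); lra.
lra.
Qed.

Definition tent (c r u : R) : R := Rmax 0 (r - Rabs (u - c)).

Lemma tent_continuous c r u : continuous (tent c r) u.
Proof.
apply: continuous_of_eps => e He; exists e; split => // s Hs; rewrite /tent.
have := Rabs_triang_inv (s - c) (u - c); have := Rabs_triang_inv (u - c) (s - c).
have -> : s - c - (u - c) = s - u by ring.
have -> : u - c - (s - c) = - (s - u) by ring.
rewrite Rabs_Ropp => H1 H2.
by rewrite /Rmax; case: Rle_dec => ?; case: Rle_dec => ?; apply: Rabs_def1; lra.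
Qed.

Lemma tent_C0pos c r : 0 < r < c -> C0pos (tent c r).
Proof.
move=> Hr; split; first exact: tent_continuous.
exists (c - r), (c + r); split; first lra; split; first lra.
move=> u; rewrite /tent /Rmax; case: Rle_dec => // H _.
by have /Rabs_le_between : Rabs (u - c) <= r by [lra]; lra.
Qed.

(** Were the error at c above e / 2, it would stay above 3 e / 8 with constant sign on the support
    of the tent, and the test integral would exceed its bound with e / 4. *)
Lemma tent_test g c r e N q : 0 < r < c -> 0 < e -> (0 < N)%N -> isQ q -> in_XR g ->
  / INR N + 4 * r <= e / 8 ->
  Rabs (Int0inf (fun u => tent c r u * psiN N q u) - Int0inf (fun u => tent c r u * g u)) <= e / 4 * RInt (tent c r) 0 (c + r) ->
  Rabs (psiN N q c - g c) <= e / 2.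
Proof.
move=> Hr He HN HQ Hg Hsm.
have Htc := tent_continuous c r.
have Ht0 u : 0 <= tent c r u by exact: Rmax_l.
have Hz u : c + r < u -> tent c r u = 0.
  by move=> Hu; rewrite /tent Rmax_left // Rabs_right; lra.
have [-> I] := Int_diff (tent c r) g N q (c + r) HN Htc ltac:(lra) Hz Hg.
have Hpos : 0 < RInt (tent c r) 0 (c + r).
  have E : RInt (tent c r) 0 (c + r) = RInt (tent c r) 0 (c - r) + RInt (tent c r) (c - r) (c + r).
    by rewrite -(RInt_Chasles (tent c r) 0 (c - r) (c + r)) //; apply: ex_RInt_cont.
  have P1 : 0 <= RInt (tent c r) 0 (c - r) by apply: RInt_ge_0; [lra|exact: ex_RInt_cont|by move=> *; exact: Ht0].
  have P2 : 0 < RInt (tent c r) (c - r) (c + r).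
    apply: RInt_gt_0 => //; first lra.
    move=> u Hu; rewrite /tent Rmax_right; have : Rabs (u - c) < r by [apply: Rabs_def1; lra]; lra.
  lra.
move=> HI; apply: Rnot_lt_le => Hbad; move: HI; apply: Rlt_not_le.
have Hloc u : 0 < u -> tent c r u <> 0 -> Rabs ((psiN N q u - g u) - (psiN N q c - g c)) <= / INR N + 2 * r.
  move=> Hu Htu.
  have Huc : Rabs (u - c) <= r.
    by apply: Rnot_lt_le => H; apply: Htu; rewrite /tent Rmax_left; lra.
  have -> : (psiN N q u - g u) - (psiN N q c - g c) = (psiN N q u - psiN N q c) - (g u - g c) by ring.
  apply: Rle_trans (Rabs_triang _ _) _; rewrite Rabs_Ropp.
  by have := psiN_lip N q u c HN HQ ltac:(lra) ltac:(lra); have := in_XR_lip g u c Hg ltac:(lra) ltac:(lra); lra.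
have Hstep F : ex_RInt F 0 (c + r) -> (forall u, 0 < u < c + r -> 3 / 8 * e * tent c r u <= F u) ->
   e / 4 * RInt (tent c r) 0 (c + r) < RInt F 0 (c + r).
  move=> HF Hle; have H1 : 3 / 8 * e * RInt (tent c r) 0 (c + r) <= RInt F 0 (c + r).
    rewrite -(RInt_scalR (tent c r)) //; apply: RInt_le => //; first lra.
    by apply: ex_RInt_cont => u; exact: (continuous_scal_r (3 / 8 * e) (tent c r)).
  have := Rmult_lt_0_compat _ _ He Hpos; lra.
case: (Rle_dec 0 (psiN N q c - g c)) => Hs.
  rewrite Rabs_right in Hbad; last lra.
  apply: Rlt_le_trans (Rle_abs _); apply: Hstep => // u Hu.
  rewrite -Rmult_minus_distr_l Rmult_comm.
  case: (Req_dec (tent c r u) 0) => [->|Hn]; first lra.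
  have /Rabs_le_between := Hloc u ltac:(lra) Hn.
  by move=> Hb; apply: Rmult_le_compat_l; [exact: Ht0|lra].
rewrite Rabs_left in Hbad; last lra.
rewrite -Rabs_Ropp; apply: Rlt_le_trans (Rle_abs _).
have <- : RInt (fun u => - (tent c r u * psiN N q u - tent c r u * g u)) 0 (c + r) =
   - RInt (fun u => tent c r u * psiN N q u - tent c r u * g u) 0 (c + r).
  exact: (RInt_opp (V := R_CompleteNormedModule)).
apply: Hstep; first exact: (ex_RInt_opp (V := R_NormedModule)).
move=> u Hu; rewrite -Rmult_minus_distr_l Rmult_comm Ropp_mult_distr_r.
case: (Req_dec (tent c r u) 0) => [->|Hn]; first lra.
have /Rabs_le_between := Hloc u ltac:(lra) Hn.
by move=> Hb; apply: Rmult_le_compat_l; [exact: Ht0|lra].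
Qed.

(** A finite net suffices by Lipschitz continuity. The centres start at s rather than 0, since test
    functions vanish near 0; the point u = 0 is reached from the first centre. *)
Lemma tests_close g M e : in_XR g -> 0 <= M -> 0 < e ->
  exists (L : seq ((R -> R) * R)) (N0 : nat), (forall fd, List.In fd L -> C0pos fd.1 /\ 0 < fd.2) /\
    forall N q, (0 < N)%N -> (N0 <= N)%N -> isQ q ->
      (forall fd, List.In fd L -> Rabs (Int0inf (fun u => fd.1 u * psiN N q u) - Int0inf (fun u => fd.1 u * g u)) <= fd.2) ->
      closeN N q g M e.
Proof.
move=> Hg HM He.
pose s := e / 32; have Hs : 0 < s by rewrite /s; lra.
pose c (i : nat) := INR i.+1 * s; pose r := s / 2.
have Hc i : 0 < r < c i.
  by rewrite /r /c S_INR; have := Rmult_le_pos _ _ (pos_INR i) (Rlt_le _ _ Hs); lra.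
have HT i : 0 < RInt (tent (c i) r) 0 (c i + r).
  have Hi := Hc i.
  have P1 : 0 <= RInt (tent (c i) r) 0 (c i - r).
    by apply: RInt_ge_0; [lra|apply: ex_RInt_cont; exact: tent_continuous|by move=> *; exact: Rmax_l].
  rewrite -(RInt_Chasles (tent (c i) r) 0 (c i - r) (c i + r)); try by apply: ex_RInt_cont; exact: tent_continuous.
  apply: (Rplus_le_lt_0_compat _ _ P1); apply: RInt_gt_0; [lra| |by move=> *; exact: tent_continuous].
  by move=> u Hu; rewrite /tent Rmax_right; have : Rabs (u - c i) < r by [apply: Rabs_def1; lra]; lra.
have [n Hn] := nfloor (M / s) ltac:(apply: Rmult_le_pos; [lra|apply: Rlt_le; exact: Rinv_0_lt_compat]).
have Hi : is_lim_seq (fun n => / INR n) 0.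
  by apply: (is_lim_seq_inv _ p_infty) => //; exact: is_lim_seq_INR.
have [N1 HN1] := proj1 (is_lim_seq_eps _ _) Hi (e / 16) ltac:(lra).
exists [seq (tent (c i) r, e / 4 * RInt (tent (c i) r) 0 (c i + r)) | i <- iota 0%N n.+1], N1; split.
  move=> fd Hfd; have [i [<- _]] := In_map _ _ _ Hfd; split; first exact: tent_C0pos.
  by apply: Rmult_lt_0_compat; [lra|exact: HT].
move=> N q HN HNN HQ Htest u Hu; have HN2 := INR_ge1 N HN.
have Hiv : 0 < / INR N by apply: Rinv_0_lt_compat; lra.
have := HN1 N HNN; rewrite Rminus_0_r Rabs_right; last lra.
move=> B1.
have [i Hiu] := nfloor (u / s) ltac:(apply: Rmult_le_pos; [lra|apply: Rlt_le; exact: Rinv_0_lt_compat]).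
have Hin : (i <= n)%N.
  have : u / s <= M / s by apply: Rmult_le_compat_r; [apply: Rlt_le; exact: Rinv_0_lt_compat|lra].
  by move=> HuM; have : INR i < INR n.+1 by [lra]; move/INR_lt; lia.
have HIn : forall k m : nat, (m <= i)%N -> (i < m + k)%N ->
    List.In (tent (c i) r, e / 4 * RInt (tent (c i) r) 0 (c i + r))
      [seq (tent (c i) r, e / 4 * RInt (tent (c i) r) 0 (c i + r)) | i <- iota m k].
  elim=> [|k IH] m H1 H2; first by lia.
  case: (ltngtP m i) => H3; [right; apply: IH; lia|lia|by left; rewrite H3].
have Ht := Htest _ (HIn n.+1 0%N ltac:(lia) ltac:(lia)).
have Hcl := tent_test g (c i) r e N q (Hc i) He HN HQ Hg ltac:(rewrite /r /s; lra) Ht.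
have Huc : Rabs (u - c i) <= s.
  have E : u = u / s * s by field; lra.
  rewrite /c S_INR; rewrite S_INR in Hiu; apply: Rabs_le.
  have := Rmult_le_compat_r _ _ _ (Rlt_le _ _ Hs) (proj1 Hiu).
  by have := Rmult_lt_compat_r _ _ _ Hs (proj2 Hiu); rewrite -E; lra.
have -> : psiN N q u - g u = (psiN N q u - psiN N q (c i)) + (psiN N q (c i) - g (c i)) + (g (c i) - g u) by ring.
have Hci := Hc i.
have L1 := psiN_lip N q u (c i) HN HQ ltac:(lra) ltac:(lra).
have L2 := in_XR_lip g (c i) u Hg ltac:(lra) ltac:(lra); rewrite Rabs_minus_sym in L2.
rewrite (Rabs_minus_sym (g u)) (Rabs_minus_sym (c i) u) in L2 *.
apply: Rle_trans (Rabs_triang _ _) _; have := Rabs_triang (psiN N q u - psiN N q (c i)) (psiN N q (c i) - g (c i)).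
rewrite /s in Huc; lra.
Qed.

(** * The probability estimate and the hydrodynamic limit *)

Lemma sumQ_scal c g : sumQ (fun x => c * g x) = c * sumQ g.
Proof.
rewrite /sumQ -Series_scal_l; apply: Series_ext => n.
by rewrite /enumQ; case: (pickle_inv n) => [x|] //; ring.
Qed.

Lemma const_supermartingale rt (good : seq nat -> bool) T : supermartingale rt good (fun _ _ => 1) T.
Proof.
split; first by move=> *; lra.
split; first by move=> *; exact: continuous_const.
move=> z s _ _; exists 0; split; first by apply: (is_derive_const (V := R_NormedModule)).
by rewrite gen_const; lra.
Qed.

Lemma ind_gt_01 d a : ind_gt d a = 0 \/ ind_gt d a = 1.
Proof. by rewrite /ind_gt; case: Rlt_dec => ?; [right|left]. Qed.

(** Initial states with F 0 <= c e contribute at most e by Markov's inequality for the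
    supermartingale. Any other state is flagged by some h of L, and the trivial bound 1 is charged
    to the nu-probability of h. *)
Lemma probT_le rt nu T F (L : seq (seq nat -> R)) g c e :
  isProbQ nu ->
  (forall x p, List.In p (rt x) -> 0 <= p.1) ->
  (forall x p, isQ x -> List.In p (rt x) -> isQ p.2) ->
  supermartingale rt isQ F T -> 0 <= T -> 0 < c -> 0 <= e ->
  (forall y, 0 <= g y <= 1) -> (forall y, isQ y -> c * g y <= F T y) ->
  (forall h, List.In h L -> forall x, 0 <= h x <= 1) ->
  (forall x, isQ x -> F 0 x <= c * e \/ exists h, List.In h L /\ h x = 1) ->
  0 <= probT rt nu T g <= e + lsum (fun h => probQ nu h) L.
Proof.
move=> [Hnu0 [Hnu1 Hnu2]] Hr0 Hrg HF HT Hc He Hg HgF HL HG.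
have Hex : ex_series (enumQ nu) by exists 1.
have Hnus : sumQ nu = 1 by apply: is_series_unique.
pose S x := sumQ (fun y => trans rt T x y * g y).
have HS1 x : isQ x -> 0 <= S x <= 1.
  move=> Hx; apply: (trans_mean_le rt isQ (fun _ _ => 1) T x g) => //; exact: const_supermartingale.
have HSF x : isQ x -> c * S x <= F 0 x.
  move=> Hx; rewrite /S -sumQ_scal.
  rewrite (sumQ_ext _ (fun y => trans rt T x y * (c * g y))); last by move=> y; ring.
  apply: (proj2 (trans_mean_le rt isQ F T x (fun y => c * g y) Hr0 Hrg HF Hx HT _)) => y Hy.
  by split; [apply: Rmult_le_pos; [lra|move: (Hg y); lra]|exact: HgF].
have Hpos x : 0 <= nu x * S x.
  case Hx: (isQ x); last by rewrite Hnu1 ?Hx //; lra.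
  by apply: Rmult_le_pos => //; exact: (HS1 x Hx).1.
have Hh h : List.In h L -> ex_series (enumQ (fun x => nu x * h x)) /\ 0 <= probQ nu h.
  move=> Hin; have H0 x : 0 <= nu x * h x <= nu x.
    by have := HL h Hin x; have := Hnu0 x; split; nra.
  have [Hex1 _] := ex_sumQ_dom _ _ H0 Hex; split => //.
  by apply: sumQ_ge0 => x; move: (H0 x); lra.
split; first exact: sumQ_ge0.
apply: (proj2 (sumQ_le _ _ Hpos _)) => l Hl.
apply: (Rle_trans _ (lsum (fun x => e * nu x + lsum (fun h => nu x * h x) L) l)).
  apply: lsum_le => x; case Hx: (isQ x); last first.
    by rewrite Hnu1 ?Hx // (_ : lsum _ L = 0) ?Rmult_0_l ?Rmult_0_r; [lra|elim: (L) => [|h l' IH] //; rewrite lsum_cons IH; ring].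
  have HL0 : 0 <= lsum (fun h => nu x * h x) L.
    by apply: lsum_ge0_In => h Hin; apply: Rmult_le_pos => //; have := HL h Hin x; lra.
  case: (HG x Hx) => [H1|[h [Hin Hhx]]].
    have H2 : S x <= e by apply: (Rmult_le_reg_l c) => //; have := HSF x Hx; lra.
    apply: Rle_trans (Rmult_le_compat_l _ _ _ (Hnu0 x) H2) _.
    by rewrite Rmult_comm -[X in X <= _]Rplus_0_r; exact: (Rplus_le_compat_l _ _ _ HL0).
  have H3 : nu x <= lsum (fun h => nu x * h x) L.
    elim: (L) HL Hin {HL0 HG Hh} => [|h' l' IH] HL //= [E|Hin]; rewrite lsum_cons.
      rewrite E Hhx Rmult_1_r -[X in X <= _]Rplus_0_r; apply: Rplus_le_compat_l.
      by apply: lsum_ge0_In => h2 Hin2; apply: Rmult_le_pos => //; have := HL h2 (or_intror Hin2) x; lra.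
    rewrite -[X in X <= _]Rplus_0_l; apply: Rplus_le_compat; last exact: (IH (fun h2 H2 => HL h2 (or_intror H2)) Hin).
    by apply: Rmult_le_pos => //; have := HL h' (or_introl (erefl _)) x; lra.
  have H4 := Rmult_le_compat_l _ _ _ (Hnu0 x) (HS1 x Hx).2.
  apply: Rle_trans H4 _; rewrite Rmult_1_r -[X in X <= _]Rplus_0_l.
  exact: (Rplus_le_compat _ _ _ _ (Rmult_le_pos _ _ He (Hnu0 x)) H3).
rewrite lsum_plus lsum_scal lsum_exchange; apply: Rplus_le_compat.
  rewrite -[X in _ <= X]Rmult_1_r; apply: Rmult_le_compat_l => //.
  by rewrite -Hnus; apply: lsum_le_sumQ.
apply: lsum_le_In => h Hin; apply: lsum_le_sumQ => //; last exact: (Hh h Hin).1.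
by move=> x; apply: Rmult_le_pos => //; have := HL h Hin x; lra.
Qed.

Lemma is_lim_seq_lsum {S : Type} (u : S -> nat -> R) (l : seq S) :
  (forall h, List.In h l -> is_lim_seq (u h) 0) -> is_lim_seq (fun n => lsum (fun h => u h n) l) 0.
Proof.
elim: l => [|h l IH] H; first exact: is_lim_seq_const.
have -> : 0 = 0 + 0 by ring.
apply: is_lim_seq_plus'; first by apply: H; left.
by apply: IH => h' Hh; apply: H; right.
Qed.

Lemma In_map_f {S T : Type} (f : S -> T) (l : seq S) (x : S) : List.In x l -> List.In (f x) (map f l).
Proof. by elim: l => [|a l IH] //= [->|/IH]; [left|right]. Qed.

Lemma beta_bounds : 0 < PI / sqrt 12 < 2.
Proof.
have H1 : 2 < sqrt 12 by rewrite -(sqrt_pow2 2); [apply: sqrt_lt_1_alt|]; lra.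
have HP := PI_RGT_0; have HP4 := PI_4; split; first by apply: Rdiv_lt_0_compat; lra.
by apply: (Rmult_lt_reg_r (sqrt 12)); [lra|rewrite /Rdiv Rmult_assoc Rinv_l; lra].
Qed.

Theorem theorem2p2 (nu : nat -> seq nat -> R) (psi0 : R -> R) (eps : nat -> R) :
  (forall N : nat, (1 <= N)%N -> 0 < eps N < 1 /\ ExpN (eps N) = INR N ^ 2) ->
  (forall N : nat, (1 <= N)%N -> isProbQ (nu N)) ->
  in_XR psi0 ->
  (forall (delta : R) (f : R -> R), 0 < delta -> C0pos f ->
     is_lim_seq (fun N => probQ (nu N) (fun q =>
        ind_gt delta (Int0inf (fun u => f u * psiN N q u) - Int0inf (fun u => f u * psi0 u)))) 0) ->
  exists psi : R -> R -> R,
    classical_sol psi0 (PI / sqrt 12) psi /\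
    (forall phi : R -> R -> R, classical_sol psi0 (PI / sqrt 12) phi ->
       forall t u, 0 <= t -> 0 <= u -> phi t u = psi t u) /\
    (forall (t delta : R) (f : R -> R), 0 < t -> 0 < delta -> C0pos f ->
       is_lim_seq (fun N => probT (ratesN N (eps N)) (nu N) t (fun q =>
          ind_gt delta (Int0inf (fun u => f u * psiN N q u) - Int0inf (fun u => f u * psi t u)))) 0).
Proof.
move=> Heps Hnu Hpsi0 Hinit.
set beta := PI / sqrt 12.
have Hbeta : 0 < beta < 2 by exact: beta_bounds.
have [w [vx [vxx HP]]] := heat_pkg_exists beta psi0 ltac:(lra) Hpsi0.
set v := hv beta psi0 in HP.
have Hsol := psi_classical beta psi0 w v vx vxx (proj1 Hbeta) HP.
set psi := (fun t u => ln (v t u) / beta - beta * t / 4 - u / 2) in Hsol.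
exists psi; split => //; split.
  by move=> phi Hphi; apply: (classical_sol_unique psi0 beta) => //; lra.
move=> T delta f HT Hdelta Hf.
(* N b_N <= 2 holds only eventually; the finitely many other N get a dummy value. *)
pose b N := if Rle_dec (INR N * - ln (eps N)) 2 then - ln (eps N) else / INR N.
have Hlim := eps_asymptotics eps Heps; rewrite -/beta in Hlim.
have [Nb HNb] := proj1 (is_lim_seq_eps _ _) Hlim (2 - beta) ltac:(lra).
have HbE N : (Nb <= N)%N -> b N = - ln (eps N).
  by move=> HN; have /Rabs_def2 := HNb N HN; rewrite /b; case: Rle_dec => // ?; lra.
have Hb0 N : (0 < N)%N -> 0 < b N.
  move=> HN; have HN1 := INR_ge1 N HN; rewrite /b; case: Rle_dec => [?|?] /=; last by apply: Rinv_0_lt_compat; lra.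
  by have [[H1 H2] _] := Heps N HN; have := ln_increasing (eps N) 1 H1 H2; rewrite ln_1; lra.
have Hb2 N : (0 < N)%N -> INR N * b N <= 2.
  by move=> HN; have HN1 := INR_ge1 N HN; rewrite /b; case: Rle_dec => [//|?] /=; rewrite Rinv_r; lra.
have Hblim : is_lim_seq (fun N => INR N * b N) beta.
  apply: is_lim_seq_ext_loc Hlim; exists Nb => N HN; rewrite HbE //; exact/leP.
have HXT : in_XR (psi T) by case: Hsol => _ [HX _]; apply: HX; lra.
have [B [K [HB [HK [HfB HfK]]]]] := C0pos_bounded f Hf.
(* With f supported in [0, B] and bounded by K, heights within e0 change the integral by at most
   delta. *)
pose e0 := Rmin 1 (delta / (B * K)).
have HBK : 0 < B * K by apply: Rmult_lt_0_compat.
have He0 : 0 < e0 <= 1 by split; [apply: Rmin_glb_lt; [lra|exact: Rdiv_lt_0_compat]|exact: Rmin_l].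
have He0d : B * (K * e0) <= delta.
  have : e0 <= delta / (B * K) by exact: Rmin_r.
  move=> H; have := Rmult_le_compat_l _ _ _ (Rlt_le _ _ HBK) H.
  by have -> : B * K * (delta / (B * K)) = delta by [field; lra]; lra.
have Htheta x : 0 <= x -> exp (- ((beta / 2) ^ 2 * T)) * v T x = exp (beta * evenpart (psi T) x).
  move=> Hx; have Hv := hp_v_gt0 _ _ _ _ _ _ T x HP (Rlt_le _ _ HT).
  rewrite evenpart_pos // /psi -{1}(exp_ln (v T x)) // -exp_plus; congr exp; field; lra.
have [c [N1 [Hc HN1]]] := energy_close beta psi0 w v vx vxx b T (psi T) HP HXT ltac:(lra) Hb0 Hblim Hb2 Htheta B e0 (Rlt_le _ _ HB) He0.
apply/is_lim_seq_eps => e He.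
pose Q := exp ((cE + cH) * T); have HQ0 : 0 < Q by exact: exp_pos.
have HHb : 0 <= Hbound psi0.
  by apply: Rmult_le_pos; [have := exp_pos 2; lra|exact: pow2_ge_0].
(* At time 0 energy and kappa term are each at most e1, so the Lyapunov function is at most 2 Q e1 =
   c e / 2; [kappa] is chosen accordingly. *)
pose e1 := c * e / (4 * Q).
have He1 : 0 < e1 by apply: Rdiv_lt_0_compat; [exact: Rmult_lt_0_compat|lra].
pose kappa := e1 / (T * (1 + Hbound psi0)).
have HTH : 0 < T * (1 + Hbound psi0) by apply: Rmult_lt_0_compat; lra.
have Hkappa : 0 < kappa by exact: Rdiv_lt_0_compat.
have [M [d [N2 [HM [Hd HN2]]]]] := init_small beta psi0 w v vx vxx b HP Hpsi0 ltac:(lra) Hb0 Hblim Hb2 e1 He1.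
have [L [N3 [HL HN3]]] := tests_close psi0 M d Hpsi0 HM Hd.
have [N4 HN4] := lyap_supermartingale beta psi0 w v vx vxx b T HP ltac:(lra) HT Hb0 Hblim Hb2 kappa Hkappa.
(* The flags of bad initial states: finitely many test integrals, each with vanishing probability by
   assumption. *)
pose h (fd : (R -> R) * R) N q := ind_gt fd.2 (Int0inf (fun u => fd.1 u * psiN N q u) - Int0inf (fun u => fd.1 u * psi0 u)).
have HLlim : is_lim_seq (fun N => lsum (fun fd => probQ (nu N) (h fd N)) L) 0.
  by apply: (is_lim_seq_lsum (fun fd N => probQ (nu N) (h fd N))) => fd Hin; have [H1 H2] := HL fd Hin; apply: Hinit.
have [N5 HN5] := proj1 (is_lim_seq_eps _ _) HLlim (e / 2) ltac:(lra).
exists (maxn 1 (maxn Nb (maxn N1 (maxn N2 (maxn N3 (maxn N4 N5)))))) => N HNN.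
have HN : (0 < N)%N by lia.
have Heq : eps N = exp (- b N).
  by rewrite HbE; [rewrite Ropp_involutive exp_ln //; exact: (Heps N HN).1.1|lia].
set g := (fun q => ind_gt delta _).
have Hg01 y : 0 <= g y <= 1.
  by rewrite /g; case: (ind_gt_01 delta (Int0inf (fun u => f u * psiN N y u) - Int0inf (fun u => f u * psi T u))) => ->; lra.
have HgF y : isQ y -> c * g y <= lyap beta w (b N) N kappa T T y.
  move=> Hy; have -> : lyap beta w (b N) N kappa T T y = energy (b N) N (usol beta w N T) y.
    by rewrite /lyap Rminus_diag !Rmult_0_r exp_0 Rmult_0_l; ring.
  have HE0 := energy_ge0 (b N) N (usol beta w N T) y HN.
  case: (Rlt_dec (energy (b N) N (usol beta w N T) y) c) => HE; last by have := Hg01 y; nra.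
  have Hcl := HN1 N y HN ltac:(lia) Hy HE.
  have := close_Int f (psi T) N y B K e0 HN Hf.1 HB HfB HXT HfK Hcl => HI.
  by rewrite /g /ind_gt; case: Rlt_dec => H /=; lra.
have HF0 x : isQ x -> lyap beta w (b N) N kappa T 0 x <= c * (e / 2) \/
    exists hh, List.In hh (map (fun fd => h fd N) L) /\ hh x = 1.
  move=> Hx.
  case: (excluded_middle_informative (exists fd, List.In fd L /\ h fd N x = 1)) => [[fd [Hin Hfd]]|Hno].
    right; exists (h fd N); split => //; exact: (In_map_f (fun fd => h fd N)).
  left.
  have Hcl : closeN N x psi0 M d.
    apply: (HN3 N x HN) => // [|fd Hin]; first by lia.
    apply: Rnot_lt_le => Hlt; apply: Hno; exists fd; split => //.
    by rewrite /h /ind_gt; case: Rlt_dec.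
  have [HE HH] := HN2 N x HN ltac:(lia) Hx Hcl.
  rewrite /lyap Rminus_0_r -/Q.
  have HX : kappa * T * (1 + Hfun (b N) N x) <= e1.
    have -> : e1 = kappa * T * (1 + Hbound psi0) by rewrite /kappa; field; lra.
    by apply: Rmult_le_compat_l; [apply: Rmult_le_pos; lra|lra].
  have -> : c * (e / 2) = Q * (e1 + e1) by rewrite /e1; field; lra.
  by apply: Rmult_le_compat_l; lra.
have Hh01 hh : List.In hh (map (fun fd => h fd N) L) -> forall x, 0 <= hh x <= 1.
  move=> Hin x; have [fd [<- _]] := In_map _ _ _ Hin.
  by rewrite /h; case: (ind_gt_01 fd.2 (Int0inf (fun u => fd.1 u * psiN N x u) - Int0inf (fun u => fd.1 u * psi0 u))) => ->; lra.
have Hsup := HN4 N HN ltac:(lia).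
have He2 : 0 <= e / 2 by lra.
have := probT_le _ (nu N) T _ _ g c (e / 2) (Hnu N HN)
  (fun x p => ratesN_ge0 N (exp (- b N)) x p (Rlt_le _ _ (exp_pos _)))
  (fun x p => isQ_ratesN N (exp (- b N)) x p) Hsup (Rlt_le _ _ HT) Hc He2 Hg01 HgF Hh01 HF0.
rewrite -Heq lsum_map Rminus_0_r => -[P0 P1].
have := HN5 N ltac:(lia); rewrite Rminus_0_r => /Rabs_def2 P2.
by rewrite Rabs_right; lra.
Qed.
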